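(* Let $N\ge 1$ and let $\Omega\subset\mathbb{R}^N$, $X$, $Y$ and $\mathcal{E}_2$ be as in the context, for either one of the two boundary conditions (Dirichlet or Navier). Then for any $\omega\in\mathbb{R}$ there exists a sufficiently large $\kappa>0$ such that $\mathcal{E}_2$ possesses a nonzero global minimizer $u$ (over $Y$) with $\mathcal{E}_2(u)<0$.
   Context: $\Omega\subset\mathbb{R}^N$ is a bounded domain with boundary of class $C^{4,\eta}$ for some $\eta\in(0,1)$. Two boundary conditions are considered. Dirichlet: $u=\partial u/\partial\nu=0$ on $\partial\Omega$, with $X:=W^{2,2}_0(\Omega)$. Navier: $u=\Delta u=0$ on $\partial\Omega$, with $X:=W^{2,2}(\Omega)\cap W^{1,2}_0(\Omega)$ and the additional assumption that $\partial\Omega$ satisfies a uniform outer ball condition (there is $r>0$ such that every boundary point lies on the boundary of an open ball of radius $r$ contained in $\mathbb{R}^N\setminus\overline{\Omega}$). Set $Y:=X$ if $N\le 3$ and $Y:=X\cap W^{1,6}(\Omega)$ if $N\ge 4$. For $\omega\in\mathbb{R}$ and $\kappa>0$ the functional $\mathcal{E}_2:Y\to\mathbb{R}$ is $$\mathcal{E}_2(u)=\frac12\int_\Omega|\Delta u|^2dx+\frac{\omega^2}{2}\int_\Omega|\nabla u|^2dx-\frac{\kappa}{4}\int_\Omega|\nabla u|^4dx+\frac{\kappa}{12}\int_\Omega|\nabla u|^6dx ,$$ the energy functional associated with the equation $\Delta^2u-\omega^2\Delta u+\kappa\,\mathrm{div}(|\nabla u|^2\nabla u)-\frac{\kappa}{2}\mathrm{div}(|\nabla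 u|^4\nabla u)=0$ in $\Omega$ under the chosen boundary condition. *)

(* Defs.v *)
From HB Require Import structures.
From mathcomp Require Import all_boot all_order all_algebra.
From mathcomp Require Import all_classical all_reals all_analysis.

Set Implicit Arguments.
Unset Strict Implicit.
Unset Printing Implicit Defensive.

Import Order.TTheory GRing.Theory Num.Theory.
Import numFieldNormedType.Exports.

Local Open Scope classical_set_scope.
Local Open Scope ring_scope.

(** * Lebesgue measure on R^n

    R^n is ['rV[R]_n] with the library's topology and (sup) norm. It gets the
    product sigma-algebra, i.e. the one generated by the coordinates, and the
    n-fold product of the one-dimensional Lebesgue measure. *)

Definition rV_display : measure_display -> measure_display.
Proof. exact. Qed.

Section measurable_rV.
Context {R : realType}.
Variable n : nat.

Let coors : 'I_n -> 'rV[R]_n -> R := fun i x => x ord0 i.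

Let rV_set0 : g_sigma_preimage coors set0.
Proof. exact: sigma_algebra0. Qed.

Let rV_setC A : g_sigma_preimage coors A -> g_sigma_preimage coors (~` A).
Proof. exact: sigma_algebraC. Qed.

Let rV_bigcup (F : _^nat) : (forall i, g_sigma_preimage coors (F i)) ->
  g_sigma_preimage coors (\bigcup_i (F i)).
Proof. exact: sigma_algebra_bigcup. Qed.

HB.instance Definition _ := @isMeasurable.Build (rV_display default_measure_display)
  'rV[R]_n (g_sigma_preimage coors) rV_set0 rV_setC rV_bigcup.

End measurable_rV.

Lemma measurable_coord (R : realType) n (i : 'I_n) :
  measurable_fun [set: 'rV[R]_n] (fun x : 'rV[R]_n => x ord0 i).
Proof.
move=> _ Y mY; rewrite setTI; apply: sub_sigma_algebra => /=.
rewrite -bigcup_seq/=; exists i => /=; first by rewrite mem_index_enum.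
by exists Y => //; rewrite setTI.
Qed.

Lemma measurable_fun_rVP (R : realType) d (T : measurableType d) n
    (f : T -> 'rV[R]_n) :
  (forall i, measurable_fun [set: T] (fun x => f x ord0 i)) ->
  measurable_fun [set: T] f.
Proof.
move=> mf.
suff H : g_sigma_preimage (fun (i : 'I_n) (x : T) => f x ord0 i) `<=` measurable.
  move=> _ A mA; rewrite setTI; apply: H.
  have -> : (fun (i : 'I_n) (x : T) => f x ord0 i) =
    (fun i : 'I_n => (fun y : 'rV[R]_n => y ord0 i) \o f) by [].
  by rewrite g_sigma_preimage_comp; exists A => //; rewrite setTI.
apply: smallest_sub; first exact: sigma_algebra_measurable.
rewrite -bigcup_seq; apply: bigcup_sub => i _.
by move=> A [B mB <-]; exact: mf.
Qed.

Section lebesgue_rV.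
Context {R : realType}.

Definition rV_cons n (p : measurableTypeR R * 'rV[R]_n) : 'rV[R]_n.+1 :=
  row_mx p.1%:M p.2 : 'rV[R]_(1 + n).

Definition rV_uncons n (x : 'rV[R]_n.+1) : measurableTypeR R * 'rV[R]_n :=
  (x ord0 ord0, rsubmx (x : 'rV[R]_(1 + n))).

Lemma rV_cons0 n (p : measurableTypeR R * 'rV[R]_n) : rV_cons p ord0 ord0 = p.1.
Proof.
rewrite /rV_cons (_ : ord0 = lshift n (ord0 : 'I_1)); last exact/val_inj.
by rewrite (@row_mxEl _ 1 1 n) mxE eqxx mulr1n.
Qed.

Lemma rV_consS n (p : measurableTypeR R * 'rV[R]_n) (i : 'I_n) :
  rV_cons p ord0 (rshift 1 i) = p.2 ord0 i.
Proof. by rewrite /rV_cons (@row_mxEr _ 1 1 n). Qed.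

Lemma rV_consK n : cancel (@rV_cons n) (@rV_uncons n).
Proof.
move=> [a x]; rewrite /rV_uncons rV_cons0; congr pair.
by rewrite /rV_cons/= row_mxKr.
Qed.

Lemma rV_unconsK n : cancel (@rV_uncons n) (@rV_cons n).
Proof.
move=> x; apply/rowP => i.
case: (@split_ordP 1 n i) => j ->.
  rewrite (_ : lshift n j = ord0); last by rewrite ord1; exact/val_inj.
  by rewrite rV_cons0.
by rewrite rV_consS /rV_uncons/= mxE.
Qed.

Lemma measurable_rV_cons n : measurable_fun [set: measurableTypeR R * 'rV[R]_n] (@rV_cons n).
Proof.
apply: measurable_fun_rVP => i.
case: (@split_ordP 1 n i) => j ->.
  rewrite (_ : (fun _ => _) = fst); first exact: measurable_fst.
  apply/funext => p; rewrite (_ : lshift n j = ord0) ?rV_cons0//.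
  by rewrite ord1; exact/val_inj.
rewrite (_ : (fun _ => _) = (fun x : 'rV[R]_n => x ord0 j) \o snd).
  by apply: measurableT_comp => //; exact: measurable_coord.
by apply/funext => p; rewrite rV_consS.
Qed.

Lemma measurable_rV_uncons n : measurable_fun [set: 'rV[R]_n.+1] (@rV_uncons n).
Proof.
apply/measurable_fun_pairP; split; first exact: measurable_coord.
apply: measurable_fun_rVP => i.
rewrite (_ : (fun _ => _) = (fun x : 'rV[R]_n.+1 => x ord0 (rshift 1 i))).
  exact: measurable_coord.
by apply/funext => x; rewrite /rV_uncons/= !mxE.
Qed.

Section lebesgue_rVS.
Variables (n : nat) (m : {sigma_finite_measure set 'rV[R]_n -> \bar R}).

Definition lebesgue_rVS : set 'rV[R]_n.+1 -> \bar R :=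
  pushforward (product_measure1 (@lebesgue_measure R) m) (@rV_cons n).

Let mpre A : measurable A -> measurable (@rV_cons n @^-1` A).
Proof.
by move=> mA; rewrite -[X in measurable X]setTI; exact: measurable_rV_cons.
Qed.

Let lebesgue_rVS0 : lebesgue_rVS set0 = 0%E.
Proof. by rewrite /lebesgue_rVS /pushforward preimage_set0 measure0. Qed.

Let lebesgue_rVS_ge0 A : (0 <= lebesgue_rVS A)%E.
Proof. exact: integral_ge0. Qed.

Let lebesgue_rVS_sigma_additive : semi_sigma_additive lebesgue_rVS.
Proof.
move=> F mF tF mUF; rewrite /lebesgue_rVS /pushforward preimage_bigcup.
apply: measure_semi_sigma_additive => [i||].
- exact: mpre.
- apply/trivIsetP => /= i j _ _ ij; rewrite -preimage_setI.
  by move/trivIsetP : tF => /(_ _ _ _ _ ij) ->//; rewrite preimage_set0.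
- by rewrite -preimage_bigcup; exact: mpre.
Qed.

HB.instance Definition _ := isMeasure.Build _ _ _ lebesgue_rVS
  lebesgue_rVS0 lebesgue_rVS_ge0 lebesgue_rVS_sigma_additive.

Let lebesgue_rVS_sigma_finite : sigma_finite setT lebesgue_rVS.
Proof.
have /sigma_finiteP[G [GT ndG Goo]] := sigma_finiteT m.
have /sigma_finiteP[F [FT ndF Foo]] := sigma_finiteT (@lebesgue_measure R).
exists (fun k => @rV_uncons n @^-1` (F k `*` G k)).
  apply/esym; rewrite -subTset => x _.
  have [i _ Fi] : (\bigcup_i F i) (rV_uncons x).1 by rewrite -FT.
  have [j _ Gj] : (\bigcup_i G i) (rV_uncons x).2 by rewrite -GT.
  exists (maxn i j) => //; split.
    by move: Fi; exact/subsetPset/ndF/leq_maxl.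
  by move: Gj; exact/subsetPset/ndG/leq_maxr.
move=> k; have [mF Fk] := Foo k; have [mG Gk] := Goo k; split.
  rewrite -[X in measurable X]setTI; apply: measurable_rV_uncons => //.
  exact: measurableX.
rewrite /lebesgue_rVS /pushforward -comp_preimage.
rewrite (_ : _ \o _ = id) ?preimage_id; last first.
  by apply/funext => p /=; rewrite rV_consK.
by rewrite product_measure1E// lte_mul_pinfty// ge0_fin_numE.
Qed.

HB.instance Definition _ :=
  Measure_isSigmaFinite.Build _ _ _ lebesgue_rVS lebesgue_rVS_sigma_finite.
End lebesgue_rVS.

Fixpoint lebesgue_rV n : {sigma_finite_measure set 'rV[R]_n -> \bar R} :=
  match n with
  | 0 => \d_(0 : 'rV[R]_0)
  | n'.+1 => lebesgue_rVS (lebesgue_rV n')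
  end.
End lebesgue_rV.

Section calculus.
Context {R : realType}.

Definition basis n (i : 'I_n) : 'rV[R]_n := delta_mx ord0 i.

(** The norm [`|x|] of the library is the sup norm; [enorm] is the Euclidean
    one. *)
Definition enorm n (x : 'rV[R]_n) : R := Num.sqrt (\sum_i x ord0 i ^+ 2).

Definition boundary n (A : set 'rV[R]_n) : set 'rV[R]_n :=
  closure A `\` interior A.

(** [pderiv [:: i1; ..; ik] f] is the classical iterated partial derivative
    d_i1 ... d_ik f. A multi-index is represented by the list of its
    directions, its order being the size of the list. *)
Definition pderiv n (s : seq 'I_n) (f : 'rV[R]_n -> R) : 'rV[R]_n -> R :=
  foldr (fun i g => 'D_(basis i) g) f s.

(** [f] is of class C^k on the open set [A]. *)
Definition Ck n (A : set 'rV[R]_n) (k : nat) (f : 'rV[R]_n -> R) : Prop :=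
  forall s : seq 'I_n, (size s <= k)%N -> forall x, A x ->
    {for x, continuous (pderiv s f)} /\
    ((size s < k)%N -> forall i, derivable (pderiv s f) x (basis i)).

Definition Cketa n (A : set 'rV[R]_n) (k : nat) (eta : R) (f : 'rV[R]_n -> R)
    : Prop :=
  Ck A k f /\
  forall s : seq 'I_n, size s = k -> exists C : R,
    forall x y, A x -> A y ->
      `|pderiv s f x - pderiv s f y| <= C * `|x - y| `^ eta.

Definition test_function n (Omega : set 'rV[R]_n) (phi : 'rV[R]_n -> R) : Prop :=
  [/\ forall k, Ck setT k phi,
      compact (closure [set x | phi x != 0]) &
      closure [set x | phi x != 0] `<=` Omega].

End calculus.

Section domains.
Context {R : realType}.

Definition bounded_domain n (Omega : set 'rV[R]_n) : Prop :=
  [/\ open Omega, connected Omega, Omega !=set0 & bounded_set Omega].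

(** The boundary is of class C^{k,eta}: near each boundary point, up to
    relabelling the axes (the axis [i] plays the role of the last one, and
    [col' i x] is [x] with its [i]-th coordinate removed) and reorienting them
    (the sign [(-1) ^+ b]), [Omega] is the set of points lying above the graph
    of a C^{k,eta} function of the other n-1 variables. The balls are
    sup-norm balls, i.e. cubes. *)
Definition boundary_of_class n (Omega : set 'rV[R]_n) (k : nat) (eta : R)
    : Prop :=
  forall x0, boundary Omega x0 ->
  exists (r : R) (i : 'I_n) (b : bool) (gamma : 'rV[R]_n.-1 -> R),
    [/\ 0 < r,
        Cketa (ball (col' i x0) r) k eta gamma &
        forall x, ball x0 r x ->
          (Omega x <-> 0 < (-1) ^+ b * (x ord0 i - gamma (col' i x)))].

Definition uniform_outer_ball n (Omega : set 'rV[R]_n) : Prop :=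
  exists r : R, 0 < r /\
    forall x, boundary Omega x -> exists c : 'rV[R]_n,
      enorm (x - c) = r /\
      [set y | enorm (y - c) < r] `<=` ~` closure Omega.

End domains.

(** * Sobolev spaces

    A function on [Omega] is represented by a function on the whole space whose
    values outside [Omega] are irrelevant; equality is almost everywhere. *)
Section sobolev.
Context {R : realType} {n : nat}.
Variable Omega : set 'rV[R]_n.
Implicit Types (u v g phi : 'rV[R]_n -> R) (s : seq 'I_n).

Local Notation leb := (@lebesgue_rV R n).

Definition loc_integrable u : Prop :=
  measurable_fun Omega u /\
  forall K : set 'rV[R]_n, compact K -> K `<=` Omega ->
    leb.-integrable K (EFin \o u).

Definition Lp_norm (p : R) u : \bar R := ('N[leb]_p%:E[EFin \o (u \_ Omega)])%E.

Definition Lp_fun (p : R) u : Prop :=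
  measurable_fun Omega u /\ (Lp_norm p u < +oo)%E.

Definition is_weak_deriv s u g : Prop :=
  [/\ loc_integrable u, loc_integrable g &
      forall phi, test_function Omega phi ->
        \int[leb]_(x in Omega) (u x * pderiv s phi x) =
        (-1) ^+ size s * \int[leb]_(x in Omega) (g x * phi x)].

(** Some weak derivative (unique up to a null set) if there is one. *)
Definition weak_deriv s u : 'rV[R]_n -> R := get (is_weak_deriv s u).

(** W^{k,p}(Omega) *)
Definition sobolev (k : nat) (p : R) u : Prop :=
  Lp_fun p u /\
  forall s, (size s <= k)%N -> exists g, is_weak_deriv s u g /\ Lp_fun p g.

(** Mixed derivatives are counted with multiplicity, which gives a norm
    equivalent to the usual one. *)
Definition sobolev_norm (k : nat) (p : R) u : \bar R :=
  (\sum_(j < k.+1) \sum_(s : j.-tuple 'I_n) Lp_norm p (weak_deriv s u))%E.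

(** W^{k,p}_0(Omega) *)
Definition sobolev0 (k : nat) (p : R) u : Prop :=
  sobolev k p u /\
  forall e : R, 0 < e -> exists phi,
    test_function Omega phi /\ (sobolev_norm k p (u \- phi)%R < e%:E)%E.

Definition weak_grad u (x : 'rV[R]_n) : 'rV[R]_n :=
  \row_i weak_deriv [:: i] u x.

Definition weak_laplacian u (x : 'rV[R]_n) : R :=
  \sum_i weak_deriv [:: i; i] u x.

End sobolev.

Inductive boundary_condition := Dirichlet | Navier.

Section energy.
Context {R : realType} {n : nat}.
Variable Omega : set 'rV[R]_n.

Definition Xspace (bc : boundary_condition) (u : 'rV[R]_n -> R) : Prop :=
  match bc with
  | Dirichlet => sobolev0 Omega 2 2 u
  | Navier => sobolev Omega 2 2 u /\ sobolev0 Omega 1 2 u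
  end.

Definition Yspace (bc : boundary_condition) (u : 'rV[R]_n -> R) : Prop :=
  if (n <= 3)%N then Xspace bc u else Xspace bc u /\ sobolev Omega 1 6 u.

(** All four integrals are finite for [u] in [Yspace bc]. *)
Definition energy2 (omega kappa : R) (u : 'rV[R]_n -> R) : R :=
  let mu := @lebesgue_rV R n in
  2^-1 * \int[mu]_(x in Omega) (weak_laplacian Omega u x ^+ 2)
  + omega ^+ 2 / 2 * \int[mu]_(x in Omega) (enorm (weak_grad Omega u x) ^+ 2)
  - kappa / 4 * \int[mu]_(x in Omega) (enorm (weak_grad Omega u x) ^+ 4)
  + kappa / 12 * \int[mu]_(x in Omega) (enorm (weak_grad Omega u x) ^+ 6).

End energy.

(* Main.v *)
(** Every competitor is encoded by its jet (the function, its first and its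
    second weak derivatives), extended by zero outside the domain. A minimizing
    sequence is bounded in H^1_0, hence by Rellich converges in L^2. The double
    well [s^3/12 - s^2/4] of [s = |grad u|^2] is convex up to [2 s], so the
    parallelogram identity together with [int |grad w|^2 = - int w lap w] shows
    that the Laplacians, and then the gradients, are Cauchy in L^2. The H^2
    estimate [int |D^2 u|^2 <= C (int (lap u)^2 + int |grad u|^2 + int u^2)],
    proved in boundary charts with tangential derivatives along
    [D_j + (D_j G) D_n], makes the whole jet converge, and Fatou's lemma passes
    to the limit in the energy. In dimension at most three the gradient lies in
    L^6: functions are extended across the boundary by the reflection
    [x_n |-> 2 G - x_n] and the Gagliardo-Nirenberg-Sobolev inequality is applied.
    For large [kappa] a small multiple of a bump function has negative energy. *)
Require Import Defs.
From HB Require Import structures.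
From mathcomp Require Import all_boot all_order all_algebra.
From mathcomp Require Import all_classical all_reals all_analysis.
From mathcomp Require Import measurable_realfun ring lra.

(* Again, since the [basis] of a topology would otherwise hide the unit vectors. *)
Import Defs.

Set Implicit Arguments.
Unset Strict Implicit.
Unset Printing Implicit Defensive.

Import Order.TTheory GRing.Theory Num.Theory.
Import numFieldNormedType.Exports.

Local Open Scope classical_set_scope.
Local Open Scope ring_scope.

(** The energy controls only the Laplacian and the gradient, while [X] asks for all second
    derivatives. A Navier function is a limit of test functions in H^1 only, so
    [int |D^2 u|^2 = int (lap u)^2] cannot be reached by density; this forces the boundary charts.
    Zero trace is encoded by testing the gradient of [u] on the whole space and is inherited by
    tangential derivatives. The fields [D_j + (D_j G) D_n] annihilate the function defining the
    boundary, so cutoffs built from it commute with them and no boundary integral is ever written.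
    The convexity defect of the double well costs [2 kappa int |grad w|^2], where [w] is half the
    difference of two almost minimizers. Young's inequality in Green's identity pays for it with
    half of the gain [2^-1 int (lap w)^2] and a multiple of [kappa^2 int w^2], which Rellich makes
    small. The scale [t] of the bump makes the sextic term cancel at most a third of the quartic
    one; a large [kappa] then beats the quadratic part. A negative minimum is not attained at zero:
    by Green's identity a vanishing [u] has vanishing gradient, hence nonnegative energy. *)

Lemma norm_rV_ltP (R : realType) n (x : 'rV[R]_n) (e : R) : 0 < e ->
  (`|x| < e) <-> (forall i, `|x ord0 i| < e).
Proof.
move=> e0; split.
- move=> xe i; have : ball x e (0 : 'rV[R]_n).
    by rewrite -ball_normE /= subr0.
  by case => _ /(_ ord0 i); rewrite -ball_normE /= mxE subr0.
- move=> H; have : ball x e (0 : 'rV[R]_n).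
    by split=> // i j; rewrite -ball_normE /= mxE subr0 ord1.
  by rewrite -ball_normE /= subr0.
Qed.

Lemma norm_rV_leP (R : realType) n (x : 'rV[R]_n) (e : R) : 0 <= e ->
  (`|x| <= e) <-> (forall i, `|x ord0 i| <= e).
Proof.
move=> e0; split.
- move=> xe i; apply/ler_addgt0Pr => d d0.
  apply/ltW; move: i; apply/norm_rV_ltP; first by rewrite addrC ltr_pwDl.
  by rewrite (le_lt_trans xe)// ltrDl.
- move=> H; apply/ler_addgt0Pr => d d0; apply/ltW.
  apply/norm_rV_ltP; first by rewrite addrC ltr_pwDl.
  by move=> i; rewrite (le_lt_trans (H i))// ltrDl.
Qed.

Lemma coord_le_norm (R : realType) n (x : 'rV[R]_n) i : `|x ord0 i| <= `|x|.
Proof. by have [+ _] := norm_rV_leP x (normr_ge0 x); apply. Qed.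

Lemma measurable_cube (R : realType) n (x : 'rV[R]_n) (e : R) :
  measurable (ball x e).
Proof.
have [e0|e0] := ltP 0 e; last first.
  rewrite (_ : ball x e = set0)//; apply/seteqP; split=> // y.
  by rewrite -ball_normE /= => /(le_lt_trans (normr_ge0 _)); rewrite ltNge e0.
rewrite (_ : ball x e = \bigcap_(i in [set: 'I_n])
   (fun y : 'rV[R]_n => y ord0 i) @^-1` (ball (x ord0 i) e)); last first.
  apply/seteqP; split=> y.
    by case=> _ H i _; exact: H.
  by move=> H; split=> // i j; rewrite ord1; exact: H.
apply: fin_bigcap_measurable => // i _.
rewrite -[X in measurable X]setTI; apply: measurable_coord => //.
by apply: open_measurable; exact: ball_open.
Qed.

(** The sigma-algebra is generated by the coordinates, so an open set has to be written with
    countably many cubes: those with rational centre and radius [1/(k+1)] that it contains. *)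
Lemma open_measurable_rV (R : realType) n (A : set 'rV[R]_n) :
  open A -> measurable A.
Proof.
move=> oA.
pose F (p : 'rV[rat]_n * nat) : set 'rV[R]_n :=
  let B := ball (map_mx (@ratr R) p.1) (p.2.+1%:R^-1) in
  if `[< B `<=` A >] then B else set0.
rewrite (_ : A = \bigcup_p F p).
  apply: countable_bigcupT_measurable => // p.
  by rewrite /F; case: asboolP => _; [exact: measurable_cube|exact: measurable0].
apply/seteqP; split=> x; last first.
  by case=> p _; rewrite /F; case: asboolP => // BA; exact: BA.
move=> Ax; have [e /= e0 xeA] : nbhs_ball x A.
  by rewrite nbhs_ballE; exact: open_nbhs_nbhs.
(* With a radius below [e / 2], a cube that contains [x] stays in the ball of radius [e] around
   [x]. *)
have [k k0 ke] : exists2 k : nat, (0 < k)%N & k.+1%:R^-1 < e / 2.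
  exists (Num.truncn (2 / e)).+1 => //.
  rewrite invf_plt ?posrE ?divr_gt0// invf_div (lt_le_trans (truncnS_gt _))//.
  by rewrite ler_nat.
have He i : exists q : rat, `|x ord0 i - ratr q| < k.+1%:R^-1.
  have [q] := @rat_in_itvoo R (x ord0 i - k.+1%:R^-1) (x ord0 i + k.+1%:R^-1)
     ltac:(by rewrite ltrBlDr -addrA ltrDl addr_gt0 ?invr_gt0).
  rewrite in_itv/= => qx; exists q; rewrite distrC ltr_distl.
  by [].
pose q := \row_i (projT1 (cid (He i))).
exists (q, k) => //; rewrite /F /=; case: asboolP => [_|].
  split; first by rewrite invr_gt0.
  move=> i j; rewrite ord1 !mxE -ball_normE /= distrC.
  by case: (cid (He j)).
case=> y qy; apply: xeA.
rewrite (splitr e); apply: (@ball_triangle _ _ (map_mx (@ratr R) q)).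
  split; first by rewrite divr_gt0.
  move=> i j; rewrite ord1 !mxE -ball_normE /=.
  by case: (cid (He j)) => r /= /lt_trans; apply.
by apply: le_ball qy; exact: ltW.
Qed.

Lemma closed_measurable_rV (R : realType) n (A : set 'rV[R]_n) :
  closed A -> measurable A.
Proof.
by move=> cA; rewrite -(setCK A); apply: measurableC; apply: open_measurable_rV;
  rewrite openC.
Qed.

Lemma continuous_measurable_rV (R : realType) n (f : 'rV[R]_n -> R) :
  continuous f -> measurable_fun setT f.
Proof.
move=> /continuousP cf; apply: (measurability _ (RGenOpens.measurableE R)).
move=> _ [_ [a [b ->] <-]]; rewrite setTI.
by apply: open_measurable_rV; apply: cf; exact: interval_open.
Qed.

Notation leb1 R := (@lebesgue_measure R).

(** * Invariance of the Lebesgue measure on the line *)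

Section leb1_invariance.
Context {R : realType}.
Local Notation T := (measurableTypeR R).

Lemma measurable_shift (a : R) : measurable_fun [set: T] ((fun x => x + a) : T -> T).
Proof. exact: measurable_funD. Qed.

Lemma measurable_oppT : measurable_fun [set: T] (-%R : T -> T).
Proof. exact: oppr_measurable. Qed.

(** The Lebesgue measure is characterized by its values on the intervals []b, c]], so only the
    preimages of these have to be measured. *)
Lemma leb1_pushforward_shift (a : R) A : measurable A ->
  leb1 R A = pushforward (leb1 R) ((fun x => x + a) : T -> T) A.
Proof.
have := measurable_shift a; set phi : T -> T := (fun x => x + a) => mphi.
pose m : {measure set T -> \bar R} := pushforward (leb1 R) phi.
move: A; apply: (@lebesgue_measure_unique R (m mphi)) => _ [[b c] /= _ <-].
rewrite /pushforward.
have -> : phi @^-1` `]b, c]%classic = `]b - a, c - a]%classic.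
  by apply/seteqP; split=> x /=; rewrite /phi !in_itv/= lerBrDr ltrBlDr.
rewrite !lebesgue_measure_itv/= !lte_fin ltrD2r.
by case: ifP => // _; rewrite -!EFinB; congr EFin; ring.
Qed.

Lemma leb1_pushforward_opp A : measurable A ->
  leb1 R A = pushforward (leb1 R) (-%R : T -> T) A.
Proof.
have := measurable_oppT; set phi : T -> T := -%R => mphi.
pose m : {measure set T -> \bar R} := pushforward (leb1 R) phi.
move: A; apply: (@lebesgue_measure_unique R (m mphi)) => _ [[b c] /= _ <-].
rewrite /pushforward.
(* The preimage is closed at the other end, which leaves its length unchanged. *)
have -> : phi @^-1` `]b, c]%classic = `[- c, - b[%classic.
  by apply/seteqP; split=> x /=; rewrite /phi !in_itv/= lerNl ltrNr andbC.
rewrite !lebesgue_measure_itv/= !lte_fin ltrN2.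
by case: ifP => // _; rewrite -!EFinB; congr EFin; ring.
Qed.

Local Open Scope ereal_scope.

Let ge0_integral_leb1_map (phi : T -> T) (mphi : measurable_fun [set: T] phi)
    (f : T -> \bar R) :
  (forall A, measurable A -> leb1 R A = pushforward (leb1 R) phi A) ->
  measurable_fun setT f -> (forall x, 0 <= f x) ->
  \int[leb1 R]_x f (phi x) = \int[leb1 R]_x f x.
Proof.
move=> H mf f0.
pose m : {measure set T -> \bar R} := pushforward (leb1 R) phi.
transitivity (\int[m mphi]_x f x); last first.
  by apply: eq_measure_integral => A mA _; exact/esym/H.
by rewrite ge0_integral_pushforward// preimage_setT.
Qed.

Lemma ge0_integral_leb1_shift (a : R) (f : T -> \bar R) :
  measurable_fun setT f -> (forall x, 0 <= f x) ->
  \int[leb1 R]_x f (x + a)%R = \int[leb1 R]_x f x.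
Proof.
by apply: (ge0_integral_leb1_map (measurable_shift a)); exact: leb1_pushforward_shift.
Qed.

Lemma ge0_integral_leb1_opp (f : T -> \bar R) :
  measurable_fun setT f -> (forall x, 0 <= f x) ->
  \int[leb1 R]_x f (- x)%R = \int[leb1 R]_x f x.
Proof.
by apply: (ge0_integral_leb1_map measurable_oppT); exact: leb1_pushforward_opp.
Qed.

End leb1_invariance.

(** * Integration along a coordinate axis *)
Section axis_fubini.
Context {R : realType}.
Local Notation T := (measurableTypeR R).

(** Inverse of the splitting of a point into its coordinate [i] and its image under [col' i]. The
    measure is built by splitting off coordinate 0, whereas a boundary chart singles out an
    arbitrary axis. *)
Definition ins n (i : 'I_n.+1) (s : R) (x : 'rV[R]_n) : 'rV[R]_n.+1 :=
  \row_j (if unlift i j is Some k then x ord0 k else s).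

Lemma ins_at n (i : 'I_n.+1) s x : ins i s x ord0 i = s.
Proof. by rewrite mxE unlift_none. Qed.

Lemma ins_lift n (i : 'I_n.+1) s x k : ins i s x ord0 (lift i k) = x ord0 k.
Proof. by rewrite mxE liftK. Qed.

Lemma ins0 n s (x : 'rV[R]_n) : ins ord0 s x = rV_cons (s, x).
Proof.
apply/rowP => j; case: (unliftP ord0 j) => [k ->|->].
  rewrite ins_lift (_ : lift ord0 k = rshift 1 k) ?rV_consS//.
  exact/val_inj.
by rewrite ins_at rV_cons0.
Qed.

Lemma insS n (k : 'I_n.+1) s (t : R) (x : 'rV[R]_n) :
  ins (lift ord0 k) s (rV_cons (t, x)) = rV_cons (t, ins k s x).
Proof.
have consS m (z : 'rV[R]_m) (a : R) l : rV_cons (a, z) ord0 (lift ord0 l) = z ord0 l.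
  by rewrite (_ : lift ord0 l = rshift 1 l) ?rV_consS//; exact/val_inj.
apply/rowP => j; case: (unliftP ord0 j) => [l ->|->].
  rewrite consS; case: (unliftP k l) => [m ->|->]; last by rewrite !ins_at.
  rewrite ins_lift (_ : lift ord0 (lift k m) = lift (lift ord0 k) (lift ord0 m)).
    by rewrite ins_lift consS.
  apply/val_inj => /=; rewrite /bump /= !add1n !ltnS.
  by case: leqP; rewrite ?addn0 ?addn1 ?add1n ?add0n.
rewrite rV_cons0 (_ : ins _ _ _ _ _ = ins (lift ord0 k) s (rV_cons (t, x)) ord0 (lift (lift ord0 k) ord0)).
  by rewrite ins_lift rV_cons0.
by congr (ins _ _ _ _ _); apply/val_inj => /=; rewrite /bump.
Qed.

Lemma measurable_ins n (i : 'I_n.+1) :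
  measurable_fun [set: T * 'rV[R]_n] (fun p : T * 'rV[R]_n => ins i p.1 p.2).
Proof.
apply: measurable_fun_rVP => j.
case: (unliftP i j) => [k ->|->].
  under eq_fun do rewrite ins_lift.
  by apply: (measurableT_comp (measurable_coord k)); exact: measurable_snd.
by under eq_fun do rewrite ins_at; exact: measurable_fst.
Qed.

Local Open Scope ereal_scope.

Lemma ge0_integral_rV_cons n (f : 'rV[R]_n.+1 -> \bar R) :
  measurable_fun setT f -> (forall x, 0 <= f x) ->
  \int[lebesgue_rV n.+1]_x f x =
  \int[leb1 R]_s \int[lebesgue_rV n]_x f (rV_cons (s, x)).
Proof.
move=> mf f0.
transitivity (\int[product_measure1 (leb1 R) (lebesgue_rV n)]_p f (rV_cons p)).
  rewrite ge0_integral_pushforward ?preimage_setT//; exact: measurable_rV_cons.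
by rewrite fubini_tonelli1//; apply: measurableT_comp => //; exact: measurable_rV_cons.
Qed.

Lemma measurable_box n (M : R) :
  measurable [set x : 'rV[R]_n | forall i, (`|x ord0 i| <= M)%R].
Proof.
rewrite (_ : [set x | _] = \bigcap_(i in [set: 'I_n])
   (fun y : 'rV[R]_n => y ord0 i) @^-1` [set s | `|s| <= M]%R); last first.
  by apply/seteqP; split=> x /= H i; [move=> _|]; exact: H.
apply: fin_bigcap_measurable => // i _.
rewrite -[X in measurable X]setTI; apply: measurable_coord => //.
rewrite (_ : [set _ | _] = `[(- M)%R, M]%classic)//.
by apply/seteqP; split=> s /=; rewrite in_itv/= ler_norml.
Qed.

Lemma lebesgue_rV_box n (M : R) :
  lebesgue_rV n [set x : 'rV[R]_n | forall i, (`|x ord0 i| <= M)%R] < +oo.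
Proof.
elim: n => [|n IH].
  apply: (@le_lt_trans _ _ 1); last exact: ltry.
  rewrite (_ : [set x | _] = setT) /= ?diracT//.
  by apply/seteqP; split=> // x _ [].
rewrite /= /lebesgue_rVS /pushforward.
rewrite (_ : _ @^-1` _ = `[(- M)%R, M]%classic `*`
  [set x : 'rV[R]_n | forall i, (`|x ord0 i| <= M)%R]); last first.
  apply/seteqP; split=> -[s x] /=; rewrite in_itv/= -ler_norml.
    move=> H; split; first by have := H ord0; rewrite rV_cons0.
    by move=> i; have := H (lift ord0 i); rewrite -ins0 ins_lift.
  move=> [sM xM] i; case: (unliftP ord0 i) => [k ->|->].
    by rewrite -ins0 ins_lift.
  by rewrite rV_cons0.
rewrite product_measure1E//; last exact: measurable_box.
have lM : leb1 R `[(- M)%R, M]%classic < +oo.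
  by rewrite lebesgue_measure_itv/=; case: ifP => // _; rewrite -EFinB ltry.
by apply: lte_mul_pinfty => //; rewrite ge0_fin_numE.
Qed.

Lemma lebesgue_rV_box_gt0 n (M : R) : (0 < M)%R ->
  0 < lebesgue_rV n [set x : 'rV[R]_n | forall i, (`|x ord0 i| <= M)%R].
Proof.
move=> M0; elim: n => [|n IH].
  rewrite (_ : [set x | _] = setT) /= ?diracT ?lte_fin ?ltr01//.
  by apply/seteqP; split=> // x _ [].
rewrite /= /lebesgue_rVS /pushforward.
rewrite (_ : _ @^-1` _ = `[(- M)%R, M]%classic `*`
  [set x : 'rV[R]_n | forall i, (`|x ord0 i| <= M)%R]); last first.
  apply/seteqP; split=> -[s x] /=; rewrite in_itv/= -ler_norml.
    move=> H; split; first by have := H ord0; rewrite rV_cons0.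
    by move=> i; have := H (lift ord0 i); rewrite -ins0 ins_lift.
  move=> [sM xM] i; case: (unliftP ord0 i) => [k ->|->].
    by rewrite -ins0 ins_lift.
  by rewrite rV_cons0.
rewrite product_measure1E//; last exact: measurable_box.
have lM : 0 < leb1 R `[(- M)%R, M]%classic.
  by rewrite lebesgue_measure_itv/= lte_fin gtrN// -EFinB lte_fin opprK addr_gt0.
exact: mule_gt0.
Qed.

End axis_fubini.

Opaque lebesgue_rV.

Section axis_fubini2.
Context {R : realType}.
Local Notation T := (measurableTypeR R).
Local Open Scope ereal_scope.

Lemma measurable_ins_comp d (S : measurableType d) n (i : 'I_n.+1)
    (s : S -> R) (x : S -> 'rV[R]_n) :
  measurable_fun setT s -> measurable_fun setT x ->
  measurable_fun setT (fun p => ins i (s p) (x p)).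
Proof.
move=> ms mx; exact: (measurableT_comp (measurable_ins i)
  (measurable_fun_pair (ms : measurable_fun setT (s : S -> T)) mx)).
Qed.

(** Induction on the dimension: coordinate 0 is split off by definition of the measure, the
    induction hypothesis splits off axis [k] of the rest, Tonelli exchanges the two line integrals,
    and the outer two factors are reassembled. *)
Lemma ge0_integral_axis n (i : 'I_n.+1) (f : 'rV[R]_n.+1 -> \bar R) :
  measurable_fun setT f -> (forall x, 0 <= f x) ->
  \int[lebesgue_rV n.+1]_x f x =
  \int[leb1 R]_s \int[lebesgue_rV n]_x f (ins i s x).
Proof.
elim: n i f => [|n IH] i f mf f0.
  rewrite (ge0_integral_rV_cons mf f0).
  apply: eq_integral => s _; apply: eq_integral => x _.
  by rewrite (ord1 i) ins0.
rewrite (ge0_integral_rV_cons mf f0).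
case: (unliftP ord0 i) => [k ->|->]; last first.
  by apply: eq_integral => s _; apply: eq_integral => x _; rewrite ins0.
transitivity (\int[leb1 R]_t \int[leb1 R]_s \int[lebesgue_rV n]_x
    f (rV_cons (t, ins k s x))).
  apply: eq_integral => t _; apply: (IH k (fun x => f (rV_cons (t, x)))) => //.
  by apply: (measurableT_comp mf); under eq_fun do rewrite -ins0; exact: measurable_ins_comp.
pose g (p : T * T) := \int[lebesgue_rV n]_x f (rV_cons (p.1, ins k p.2 x)).
have mg : measurable_fun setT g.
  apply: (@measurable_fun_fubini_tonelli_F _ _ _ _ _ (lebesgue_rV n)
    (fun q : (T * T) * 'rV[R]_n => f (rV_cons (q.1.1, ins k q.1.2 q.2)))) => //.
  apply: (measurableT_comp mf); under eq_fun do rewrite -ins0.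
  apply: measurable_ins_comp.
    exact: (measurableT_comp measurable_fst measurable_fst).
  apply: measurable_ins_comp; last exact: measurable_snd.
  exact: (measurableT_comp measurable_snd measurable_fst).
have g0 p : 0 <= g p by apply: integral_ge0.
transitivity (\int[leb1 R]_s \int[leb1 R]_t g (t, s)).
  exact: (@fubini_tonelli _ _ T T R (leb1 R) (leb1 R) g mg g0).
apply: eq_integral => s _.
transitivity (\int[leb1 R]_t \int[lebesgue_rV n]_x f (ins (lift ord0 k) s (rV_cons (t, x)))).
  by apply: eq_integral => t _; apply: eq_integral => x _; rewrite insS.
apply/esym; apply: (ge0_integral_rV_cons (f := fun x => f (ins (lift ord0 k) s x))) => //.
by apply: (measurableT_comp mf); exact: measurable_ins_comp.
Qed.

Lemma ge0_integral_axis_swap n (i : 'I_n.+1) (f : 'rV[R]_n.+1 -> \bar R) :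
  measurable_fun setT f -> (forall x, 0 <= f x) ->
  \int[lebesgue_rV n.+1]_x f x =
  \int[lebesgue_rV n]_x \int[leb1 R]_s f (ins i s x).
Proof.
move=> mf f0; rewrite (ge0_integral_axis i mf f0).
apply: (@fubini_tonelli _ _ T _ R (leb1 R) (lebesgue_rV n)
  (fun p => f (ins i p.1 p.2))) => //.
exact: (measurableT_comp mf (measurable_ins i)).
Qed.

Lemma measurable_col' n (i : 'I_n.+1) :
  measurable_fun [set: 'rV[R]_n.+1] (fun x : 'rV[R]_n.+1 => col' i x : 'rV[R]_n).
Proof.
apply: measurable_fun_rVP => j.
by under eq_fun do rewrite mxE; exact: measurable_coord.
Qed.

Lemma col'_ins n (i : 'I_n.+1) s (x : 'rV[R]_n) : col' i (ins i s x) = x.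
Proof. by apply/rowP => k; rewrite mxE ins_lift. Qed.

Lemma ins_col' n (i : 'I_n.+1) (x : 'rV[R]_n.+1) : ins i (x ord0 i) (col' i x) = x.
Proof.
apply/rowP => j; case: (unliftP i j) => [k ->|->]; rewrite ?ins_at//.
by rewrite ins_lift mxE.
Qed.

(** On each line parallel to axis [i] the map is a translation, possibly followed by a change of
    sign. With [b := true] and [l] equal to [-2 G] this is the reflection across the graph of
    [G]. *)
Lemma ge0_integral_axis_map n (i : 'I_n.+1) (b : bool) (l : 'rV[R]_n -> R)
    (f : 'rV[R]_n.+1 -> \bar R) :
  measurable_fun setT l -> measurable_fun setT f -> (forall x, 0 <= f x) ->
  \int[lebesgue_rV n.+1]_x f (ins i ((-1) ^+ b * (x ord0 i + l (col' i x)))%R (col' i x))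
  = \int[lebesgue_rV n.+1]_x f x.
Proof.
move=> ml mf f0.
rewrite (ge0_integral_axis_swap i mf f0).
pose h (x : 'rV[R]_n.+1) := f (ins i ((-1) ^+ b * (x ord0 i + l (col' i x)))%R (col' i x)).
transitivity (\int[lebesgue_rV n]_x \int[leb1 R]_s h (ins i s x)).
  apply: ge0_integral_axis_swap => //; rewrite /h.
  apply: (measurableT_comp mf); apply: measurable_ins_comp; last exact: measurable_col'.
  apply: measurable_funM => //; apply: measurable_funD; first exact: measurable_coord.
  exact: (measurableT_comp ml (measurable_col' i)).
apply: eq_integral => x _.
rewrite /h; under eq_integral do rewrite col'_ins ins_at.
pose g (s : T) := f (ins i s x).
have mg : measurable_fun setT g.
  by apply: (measurableT_comp mf); exact: measurable_ins_comp.
have g0 s : 0 <= g s by exact: f0.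
case: b {h}.
  transitivity (\int[leb1 R]_s g (- s)%R); last exact: ge0_integral_leb1_opp.
  rewrite -(ge0_integral_leb1_shift (l x) (f := fun s => g (- s)%R))//.
    by apply: eq_integral => s _; rewrite expr1 mulN1r.
  exact: (measurableT_comp mg measurable_oppT).
rewrite -[RHS](ge0_integral_leb1_shift (l x) mg g0).
by apply: eq_integral => s _; rewrite expr0 mul1r.
Qed.

Lemma ins_add n (i : 'I_n.+1) s (x : 'rV[R]_n) (a : 'rV[R]_n.+1) :
  (ins i s x + a)%R = ins i (s + a ord0 i)%R (x + col' i a)%R.
Proof.
apply/rowP => j; rewrite mxE; case: (unliftP i j) => [k ->|->].
  by rewrite !ins_lift !mxE.
by rewrite !ins_at.
Qed.

Lemma ins_opp n (i : 'I_n.+1) s (x : 'rV[R]_n) : (- ins i s x)%R = ins i (- s)%R (- x)%R.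
Proof.
apply/rowP => j; rewrite mxE; case: (unliftP i j) => [k ->|->].
  by rewrite !ins_lift !mxE.
by rewrite !ins_at.
Qed.

Lemma measurable_addrV n (a : 'rV[R]_n) :
  measurable_fun [set: 'rV[R]_n] (fun x : 'rV[R]_n => (x + a)%R).
Proof.
apply: measurable_fun_rVP => j; under eq_fun do rewrite mxE.
by apply: measurable_funD => //; exact: measurable_coord.
Qed.

Lemma measurable_opprV n :
  measurable_fun [set: 'rV[R]_n] (fun x : 'rV[R]_n => (- x)%R).
Proof.
apply: measurable_fun_rVP => j; under eq_fun do rewrite mxE.
by apply: measurable_funN; exact: measurable_coord.
Qed.

Lemma ge0_integral_shift n (a : 'rV[R]_n) (f : 'rV[R]_n -> \bar R) :
  measurable_fun setT f -> (forall x, 0 <= f x) ->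
  \int[lebesgue_rV n]_x f (x + a)%R = \int[lebesgue_rV n]_x f x.
Proof.
elim: n a f => [|n IH] a f mf f0.
  by apply: eq_integral => x _; congr f; apply/rowP; case.
rewrite (ge0_integral_axis ord0 mf f0).
pose h x := f (x + a)%R.
have mh : measurable_fun setT h by apply: (measurableT_comp mf); exact: measurable_addrV.
transitivity (\int[leb1 R]_s \int[lebesgue_rV n]_x h (ins ord0 s x)).
  by apply: ge0_integral_axis => // x; exact: f0.
pose G s := \int[lebesgue_rV n]_x f (ins ord0 s x).
transitivity (\int[leb1 R]_s G (s + a ord0 ord0)%R).
  apply: eq_integral => s _; rewrite /h /G.
  under eq_integral do rewrite ins_add.
  apply: (IH (col' ord0 a) (fun x => f (ins ord0 (s + a ord0 ord0)%R x))) => //.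
  by apply: (measurableT_comp mf); exact: measurable_ins_comp.
apply: ge0_integral_leb1_shift; last by move=> s; exact: integral_ge0.
apply: (@measurable_fun_fubini_tonelli_F _ _ T _ _ (lebesgue_rV n)
    (fun q : T * 'rV[R]_n => f (ins ord0 q.1 q.2))) => //.
by apply: (measurableT_comp mf); exact: measurable_ins.
Qed.

Lemma ge0_integral_opp n (f : 'rV[R]_n -> \bar R) :
  measurable_fun setT f -> (forall x, 0 <= f x) ->
  \int[lebesgue_rV n]_x f (- x)%R = \int[lebesgue_rV n]_x f x.
Proof.
elim: n f => [|n IH] f mf f0.
  by apply: eq_integral => x _; congr f; apply/rowP; case.
rewrite (ge0_integral_axis ord0 mf f0).
pose h x := f (- x)%R.
have mh : measurable_fun setT h by apply: (measurableT_comp mf); exact: measurable_opprV.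
transitivity (\int[leb1 R]_s \int[lebesgue_rV n]_x h (ins ord0 s x)).
  by apply: ge0_integral_axis => // x; exact: f0.
pose G s := \int[lebesgue_rV n]_x f (ins ord0 s x).
transitivity (\int[leb1 R]_s G (- s)%R).
  apply: eq_integral => s _; rewrite /h /G.
  under eq_integral do rewrite ins_opp.
  apply: (IH (fun x => f (ins ord0 (- s)%R x))) => //.
  by apply: (measurableT_comp mf); exact: measurable_ins_comp.
apply: ge0_integral_leb1_opp; last by move=> s; exact: integral_ge0.
apply: (@measurable_fun_fubini_tonelli_F _ _ T _ _ (lebesgue_rV n)
    (fun q : T * 'rV[R]_n => f (ins ord0 q.1 q.2))) => //.
by apply: (measurableT_comp mf); exact: measurable_ins.
Qed.

Lemma integral_shift n (a : 'rV[R]_n) (f : 'rV[R]_n -> \bar R) :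
  measurable_fun setT f ->
  \int[lebesgue_rV n]_x f (x + a)%R = \int[lebesgue_rV n]_x f x.
Proof.
move=> mf; rewrite [LHS]integralE [RHS]integralE; congr (_ - _).
  rewrite -(@ge0_integral_shift n a f^\+ (measurable_funepos mf) (funepos_ge0 f)).
  by apply: eq_integral => x _; rewrite !funeposE.
rewrite -(@ge0_integral_shift n a f^\- (measurable_funeneg mf) (funeneg_ge0 f)).
  by apply: eq_integral => x _; rewrite !funenegE.
Qed.

Lemma integral_opp n (f : 'rV[R]_n -> \bar R) :
  measurable_fun setT f ->
  \int[lebesgue_rV n]_x f (- x)%R = \int[lebesgue_rV n]_x f x.
Proof.
move=> mf; rewrite [LHS]integralE [RHS]integralE; congr (_ - _).
  rewrite -(@ge0_integral_opp n f^\+ (measurable_funepos mf) (funepos_ge0 f)).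
  by apply: eq_integral => x _; rewrite !funeposE.
rewrite -(@ge0_integral_opp n f^\- (measurable_funeneg mf) (funeneg_ge0 f)).
  by apply: eq_integral => x _; rewrite !funenegE.
Qed.

End axis_fubini2.

(** * Square integrable functions *)
Section integration_toolkit.
Context d (T : measurableType d) (R : realType) (mu : {measure set T -> \bar R}).
Implicit Types (f g h : T -> R).

(** Integration is over the whole space throughout: functions on the domain are extended by zero, so
    no integration domain has to be carried along. *)
Definition integ f := mu.-integrable setT (EFin \o f).

Lemma integ_meas f : integ f -> measurable_fun setT f.
Proof. by move=> /measurable_int /measurable_EFinP. Qed.

Lemma integ_eq f g : f =1 g -> integ f -> integ g.
Proof. by move=> /funext ->. Qed.

Lemma integ_le f g : measurable_fun setT f -> (forall x, `|f x| <= g x) ->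
  integ g -> integ f.
Proof.
move=> mf fg; apply: le_integrable => //; first exact/measurable_EFinP.
by move=> x _ /=; rewrite lee_fin (le_trans (fg x))// ler_norm.
Qed.

Lemma integD f g : integ f -> integ g -> integ (fun x => f x + g x).
Proof. exact: (@integrableD _ _ _ mu setT measurableT (EFin \o f) (EFin \o g)). Qed.

Lemma integB f g : integ f -> integ g -> integ (fun x => f x - g x).
Proof. exact: (@integrableB _ _ _ mu setT measurableT (EFin \o f) (EFin \o g)). Qed.

Lemma integZ r f : integ f -> integ (fun x => r * f x).
Proof. exact: (@integrableZl _ _ _ mu setT measurableT r (EFin \o f)). Qed.

Lemma integN f : integ f -> integ (fun x => - f x).
Proof. exact: (@integrableN _ _ _ mu setT (EFin \o f)). Qed.

Lemma integ0 : integ (fun=> 0).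
Proof. exact: integrable0. Qed.

Lemma integ_abs f : integ f -> integ (fun x => `|f x|).
Proof. exact: integrable_norm. Qed.

Lemma integ_sum (J : Type) (r : seq J) (F : J -> T -> R) :
  (forall j, integ (F j)) -> integ (fun x => \sum_(j <- r) F j x).
Proof.
move=> iF; elim: r => [|j r IH].
  by apply: integ_eq integ0 => x; rewrite big_nil.
by apply: integ_eq (integD (iF j) IH) => x; rewrite big_cons.
Qed.

Lemma IntD f g : integ f -> integ g ->
  \int[mu]_x (f x + g x) = \int[mu]_x f x + \int[mu]_x g x.
Proof. by move=> ? ?; rewrite RintegralD. Qed.

Lemma IntB f g : integ f -> integ g ->
  \int[mu]_x (f x - g x) = \int[mu]_x f x - \int[mu]_x g x.
Proof. by move=> ? ?; rewrite RintegralB. Qed.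

Lemma IntZ r f : integ f -> \int[mu]_x (r * f x) = r * \int[mu]_x f x.
Proof. by move=> ?; rewrite RintegralZl. Qed.

Lemma IntN f : integ f -> \int[mu]_x (- f x) = - \int[mu]_x f x.
Proof.
move=> fi; rewrite -mulN1r -IntZ//.
by apply: eq_Rintegral => x _; rewrite mulN1r.
Qed.

Lemma Int0 : \int[mu]_x (0 : R) = 0.
Proof. by rewrite /Rintegral integral0. Qed.

Lemma Int_sum (J : Type) (r : seq J) (F : J -> T -> R) :
  (forall j, integ (F j)) ->
  \int[mu]_x (\sum_(j <- r) F j x) = \sum_(j <- r) \int[mu]_x F j x.
Proof.
move=> iF; elim: r => [|j r IH].
  by rewrite big_nil -[RHS]Int0; apply: eq_Rintegral => x _; rewrite big_nil.
rewrite big_cons -IH -IntD//; last exact: integ_sum.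
by apply: eq_Rintegral => x _; rewrite big_cons.
Qed.

Lemma Int_le f g : integ f -> integ g -> (forall x, f x <= g x) ->
  \int[mu]_x f x <= \int[mu]_x g x.
Proof. by move=> ? ? fg; apply: le_Rintegral => // x _. Qed.

Lemma Int_ge0 f : (forall x, 0 <= f x) -> 0 <= \int[mu]_x f x.
Proof. by move=> f0; apply: Rintegral_ge0. Qed.

Lemma Int_abs f : integ f -> `|\int[mu]_x f x| <= \int[mu]_x `|f x|.
Proof. by move=> ?; apply: le_normr_Rintegral. Qed.

Lemma Int_EFin f : integ f -> (\int[mu]_x (f x)%:E = (\int[mu]_x f x)%:E)%E.
Proof. by move=> fi; rewrite fineK//; exact: integrable_fin_num. Qed.

Lemma integ_ge0P f : measurable_fun setT f -> (forall x, 0 <= f x) ->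
  integ f <-> (\int[mu]_x (f x)%:E < +oo)%E.
Proof.
move=> mf f0; split=> [fi|fi].
  exact: integrable_lty fi.
apply/integrableP; split; first exact/measurable_EFinP.
by under eq_integral do rewrite /= ger0_norm//.
Qed.

Lemma integ_ae f g : measurable_fun setT g ->
  {ae mu, forall x, f x = g x} -> integ f -> integ g.
Proof.
move=> mg fg fi.
have /integrableP[_ H] := fi.
apply/integrableP; split; first exact/measurable_EFinP.
rewrite (_ : (\int[mu]_x `|(EFin \o g) x|)%E = (\int[mu]_x `|(EFin \o f) x|)%E)//.
apply: ae_eq_integral => //.
- by do 2 apply: measurableT_comp => //.
- by do 2 apply: measurableT_comp => //; exact: integ_meas.
- by apply: filterS fg => x /= ->.
Qed.

Lemma Int_ae f g : measurable_fun setT f -> measurable_fun setT g ->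
  {ae mu, forall x, f x = g x} -> \int[mu]_x f x = \int[mu]_x g x.
Proof.
move=> mf mg fg; congr fine; apply: ae_eq_integral => //; try exact/measurable_EFinP.
by apply: filterS fg => x /= ->.
Qed.

Lemma Int_eq0_ae f : integ f -> (forall x, 0 <= f x) ->
  \int[mu]_x f x = 0 -> {ae mu, forall x, f x = 0}.
Proof.
move=> fi f0 If0.
have mf := integ_meas fi.
have : (\int[mu]_x `|(EFin \o f) x| = 0)%E.
  by under eq_integral do rewrite /= ger0_norm//; rewrite Int_EFin// If0.
move/(ae_eq_integral_abs mu measurableT ((measurable_EFinP _ _).2 mf)).
by apply: filterS => x /(_ Logic.I) [].
Qed.

Lemma Int_dominated (F : nat -> T -> R) f g :
  (forall n, measurable_fun setT (F n)) -> measurable_fun setT f ->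
  integ g -> (forall n x, `|F n x| <= g x) ->
  {ae mu, forall x, F ^~ x @ \oo --> f x} ->
  \int[mu]_x F n x @[n --> \oo] --> \int[mu]_x f x.
Proof.
move=> mF mf gi Fg Ff.
have Ff' : {ae mu, forall x, setT x -> (EFin \o F n) x @[n --> \oo] --> (EFin \o f) x}.
  by apply: filterS Ff => x Hx _; apply: cvg_EFin => //; exact: nearW.
have Fg' : {ae mu, forall x n, setT x -> (`|(EFin \o F n) x| <= (EFin \o g) x)%E}.
  by apply: aeW => x n _ /=; rewrite lee_fin.
have [fi _ H] := @dominated_convergence _ _ _ mu setT measurableT
   (fun n => EFin \o F n) (EFin \o f) (EFin \o g)
   (fun n => (measurable_EFinP _ _).2 (mF n)) ((measurable_EFinP _ _).2 mf) Ff' gi Fg'.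
apply: fine_cvg; rewrite fineK//.
exact: integrable_fin_num.
Qed.

(** Fatou's lemma for real integrals and almost everywhere limits. The conclusion is about [|f|]
    because [f] may be negative on the null set where convergence fails. *)
Lemma Int_fatou (F : nat -> T -> R) f C :
  (forall n, integ (F n)) -> measurable_fun setT f ->
  (forall n x, 0 <= F n x) ->
  (forall n, \int[mu]_x F n x <= C) ->
  {ae mu, forall x, F ^~ x @ \oo --> f x} ->
  integ (fun x => `|f x|) /\ \int[mu]_x `|f x| <= C.
Proof.
move=> iF mf F0 FC Ff.
have H : (\int[mu]_x (`|f x|)%:E <= C%:E)%E.
  have [N [mN N0 FN]] := Ff.
  have cF x : ~ N x -> (F n x)%:E @[n --> \oo] --> (f x)%:E.
    by move=> /(subsetCl FN) Hx; apply: cvg_EFin => //; exact: nearW.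
  have eqN g : measurable_fun setT g ->
      (\int[mu]_x (g x)%:E = \int[mu]_x (g x * \1_(~` N) x)%:E)%E.
    move=> mg; apply: ae_eq_integral => //; first exact/measurable_EFinP.
      by apply/measurable_EFinP/measurable_funM => //; exact/measurable_indic/measurableC.
    exists N; split=> // x /= Hx; apply: contrapT => xN; apply: Hx => _.
    by rewrite indicE mem_set ?mulr1.
  rewrite eqN; last exact: measurableT_comp.
  (* Killing the exceptional null set [N] makes the convergence hold at every point. *)
  pose G n x := (F n x * \1_(~` N) x)%:E.
  have eG x : (`|f x| * \1_(~` N) x)%:E = limn_einf (G ^~ x).
    have [xN|xN] := pselect (N x).
      rewrite /G indicE memNset ?mulr0; last by move=> /(_ xN).
      under eq_fun do rewrite mulr0.
      by rewrite is_cvg_limn_einfE; [rewrite lim_cst|exact: is_cvg_cst].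
    rewrite /G indicE mem_set// mulr1.
    under eq_fun do rewrite mulr1.
    rewrite is_cvg_limn_einfE; last by apply/cvg_ex; exists (f x)%:E; exact: cF.
    rewrite (cvg_lim _ (cF x xN))// ger0_norm// -lee_fin.
    rewrite -(cvg_lim _ (cF x xN))//; apply: lime_ge.
      by apply/cvg_ex; exists (f x)%:E; exact: cF.
    by apply: nearW => n; rewrite lee_fin.
  under eq_integral do rewrite eG.
  apply: le_trans (fatou mu measurableT _ _) _.
  - move=> n; apply/measurable_EFinP/measurable_funM; first exact: integ_meas.
    exact/measurable_indic/measurableC.
  - by move=> n x _; rewrite lee_fin mulr_ge0// indicE.
  rewrite limn_einf_lim; apply: lime_le; first exact: is_cvg_einfs.
  apply: nearW => n; apply: (@le_trans _ _ (\int[mu]_x G n x)%E).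
    by apply: ereal_inf_lbound; exists n => /=.
  by rewrite -eqN ?Int_EFin ?lee_fin//; exact: integ_meas.
have fi : integ (fun x => `|f x|).
  apply/integ_ge0P => //; first exact: measurableT_comp.
  by apply: le_lt_trans H _; rewrite ltry.
by split=> //; rewrite -lee_fin -Int_EFin.
Qed.


Definition L2 f := measurable_fun setT f /\ integ (fun x => f x ^+ 2).

Lemma L2_integM f g : L2 f -> L2 g -> integ (fun x => f x * g x).
Proof.
move=> [mf f2] [mg g2].
apply: integ_le (integD f2 g2); first exact: measurable_funM.
move=> x; rewrite normrM -[X in _ <= X + _]real_normK ?num_real//
  -[X in _ <= _ + X]real_normK ?num_real//.
by have := sqr_ge0 (`|f x| - `|g x|); have := normr_ge0 (f x);
  have := normr_ge0 (g x); nra.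
Qed.

Lemma L2Z r f : L2 f -> L2 (fun x => r * f x).
Proof.
move=> [mf f2]; split; first exact: measurable_funM.
by apply: integ_eq (integZ (r ^+ 2) f2) => x; rewrite exprMn.
Qed.

Lemma L2D f g : L2 f -> L2 g -> L2 (fun x => f x + g x).
Proof.
move=> Lf Lg; split; first by apply: measurable_funD; [case: Lf|case: Lg].
apply: integ_eq (integD (integD Lf.2 Lg.2) (integZ 2 (L2_integM Lf Lg))) => x.
ring.
Qed.

Lemma L2N f : L2 f -> L2 (fun x => - f x).
Proof. by move=> /(L2Z (-1)); congr L2; apply/funext => x; rewrite mulN1r. Qed.

Lemma L2B f g : L2 f -> L2 g -> L2 (fun x => f x - g x).
Proof. by move=> Lf /L2N; exact: L2D. Qed.

Lemma L2_0 : L2 (fun=> 0).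
Proof.
by split=> //; apply: integ_eq integ0 => x; rewrite expr0n.
Qed.

Lemma L2_sum (J : Type) (r : seq J) (F : J -> T -> R) :
  (forall j, L2 (F j)) -> L2 (fun x => \sum_(j <- r) F j x).
Proof.
move=> iF; elim: r => [|j r IH].
  by rewrite (_ : (fun _ => _) = fun=> 0); [exact: L2_0|apply/funext => x; rewrite big_nil].
rewrite (_ : (fun _ => _) = fun x => F j x + \sum_(j <- r) F j x); first exact: L2D.
by apply/funext => x; rewrite big_cons.
Qed.

(** The polynomial [s |-> int (f + s g)^2] is nonnegative; Cauchy-Schwarz is its discriminant
    inequality. *)
Lemma Int_CS f g : L2 f -> L2 g ->
  (\int[mu]_x (f x * g x)) ^+ 2 <= \int[mu]_x (f x ^+ 2) * \int[mu]_x (g x ^+ 2).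
Proof.
move=> Lf Lg.
set a := \int[mu]_x (f x ^+ 2); set b := \int[mu]_x (g x ^+ 2).
set c := \int[mu]_x (f x * g x).
have H s : 0 <= a + s * (2 * c) + s ^+ 2 * b.
  rewrite (_ : _ + _ = \int[mu]_x ((f x + s * g x) ^+ 2)).
    by apply: Int_ge0 => x; exact: sqr_ge0.
  rewrite (@eq_Rintegral _ _ _ mu setT (fun x => (f x ^+ 2 + (s * 2) * (f x * g x)) + s ^+ 2 * (g x ^+ 2))).
    have f2 := Lf.2; have g2 := Lg.2; have fg := L2_integM Lf Lg.
    rewrite IntD; [|by apply: integD => //; exact: integZ|exact: integZ].
    rewrite IntD; [|by []|exact: integZ].
    by rewrite !IntZ// -/a -/b -/c; ring.
  by move=> x _; ring.
have a0 : 0 <= a by apply: Int_ge0 => x; exact: sqr_ge0.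
have b0 : 0 <= b by apply: Int_ge0 => x; exact: sqr_ge0.
have [b00|bn0] := eqVneq b 0.
  rewrite b00 mulr0; have := H; rewrite b00 => H'.
  have [->|cn0] := eqVneq c 0; first by rewrite expr0n.
  (* The polynomial is affine here and takes the value -1 at this point. *)
  have := H' (- (a + 1) / (2 * c)).
  rewrite mulr0 addr0 mulfVK ?mulf_neq0//; lra.
have bp : 0 < b by rewrite lt_def bn0.
(* The point where the polynomial is minimal. *)
have := H (- c / b).
rewrite (_ : _ + _ = (a * b - c ^+ 2) / b); last by field.
by rewrite pmulr_lge0 ?invr_gt0// subr_ge0.
Qed.

Lemma Int_sqrD f g : L2 f -> L2 g ->
  \int[mu]_x ((f x + g x) ^+ 2) <=
  2 * \int[mu]_x (f x ^+ 2) + 2 * \int[mu]_x (g x ^+ 2).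
Proof.
move=> Lf Lg; have [[_ f2] [_ g2]] := (Lf, Lg).
rewrite -!IntZ// -IntD; [|exact: integZ|exact: integZ].
apply: Int_le; [by case: (L2D Lf Lg)|by apply: integD; exact: integZ|].
by move=> x; have := sqr_ge0 (f x - g x); nra.
Qed.

Lemma Int_sqrB f g : L2 f -> L2 g ->
  \int[mu]_x ((f x - g x) ^+ 2) <=
  2 * \int[mu]_x (f x ^+ 2) + 2 * \int[mu]_x (g x ^+ 2).
Proof.
move=> Lf Lg; apply: le_trans (Int_sqrD Lf (L2N Lg)) _.
by rewrite lerD2l ler_pM2l// le_eqVlt; apply/orP; left; apply/eqP;
  apply: eq_Rintegral => x _; rewrite sqrrN.
Qed.

Lemma L2_ae f g : measurable_fun setT g -> {ae mu, forall x, f x = g x} ->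
  L2 f -> L2 g.
Proof.
move=> mg fg [mf f2]; split=> //.
by apply: integ_ae f2; [exact: measurable_funX|apply: filterS fg => x ->].
Qed.

Lemma Int_sqrBC f g : \int[mu]_x ((f x - g x) ^+ 2) = \int[mu]_x ((g x - f x) ^+ 2).
Proof. by apply: eq_Rintegral => x _; rewrite -sqrrN opprB. Qed.

Lemma Int_L2_lim (F : nat -> T -> R) f g :
  (forall n, L2 (F n)) -> L2 f -> L2 g ->
  \int[mu]_x ((F n x - f x) ^+ 2) @[n --> \oo] --> 0 ->
  \int[mu]_x (F n x * g x) @[n --> \oo] --> \int[mu]_x (f x * g x).
Proof.
move=> LF Lf Lg F0.
apply/cvgrPdist_le => e e0.
set B := 1 + \int[mu]_x (g x ^+ 2).
have B0 : 0 < B by rewrite ltr_wpDr// Int_ge0// => x; exact: sqr_ge0.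
have /cvgrPdist_le /(_ (e ^+ 2 / B) (divr_gt0 (exprn_gt0 _ e0) B0)) := F0.
apply: filterS => n; rewrite sub0r normrN => Hn.
rewrite -IntB; [|exact: L2_integM|exact: L2_integM].
rewrite (@eq_Rintegral _ _ _ mu setT (fun x => (f x - F n x) * g x)); last first.
  by move=> x _; rewrite mulrBl.
rewrite -(@ler_pXn2r _ 2) ?nnegrE//; last exact: ltW.
rewrite real_normK ?num_real//; apply: le_trans (Int_CS (L2B Lf (LF n)) Lg) _.
rewrite (_ : e ^+ 2 = e ^+ 2 / B * B); last by rewrite mulfVK// gt_eqF.
apply: ler_pM => //; try by apply: Int_ge0 => x; exact: sqr_ge0.
  apply: le_trans Hn; apply: le_trans (ler_norm _).
  by rewrite Int_sqrBC.
by rewrite /B lerDr.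
Qed.

End integration_toolkit.

(** * Completeness of L^2 along fast sequences *)

Section L2_completeness.
Context d (T : measurableType d) (R : realType) (mu : {measure set T -> \bar R}).
Implicit Types (f g h : T -> R).

Lemma integ_le_ae f g : measurable_fun setT f -> (forall x, 0 <= f x) ->
  {ae mu, forall x, f x <= g x} -> integ mu g -> integ mu f.
Proof.
move=> mf f0 fg ig.
have mg := integ_meas ig.
apply: (@integ_ae _ _ _ mu (fun x => Num.min (f x) `|g x|)) => //.
  by apply: filterS fg => x fgx; rewrite min_l// (le_trans fgx)// ler_norm.
apply: integ_le (integ_abs ig).
  by apply: measurable_minr => //; exact: measurableT_comp.
by move=> x; rewrite ger0_norm ?le_min ?f0 ?normr_ge0// ge_min lexx orbT.
Qed.

Lemma Int_le_ae f g : integ mu f -> integ mu g -> {ae mu, forall x, f x <= g x} ->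
  \int[mu]_x f x <= \int[mu]_x g x.
Proof.
move=> ifi ig fg.
have mf := integ_meas ifi; have mg := integ_meas ig.
have mm : measurable_fun setT (fun x => Num.min (f x) (g x)) by exact: measurable_minr.
have H : {ae mu, forall x, f x = Num.min (f x) (g x)}.
  by apply: filterS fg => x fgx; rewrite min_l.
rewrite (Int_ae mf mm H); apply: Int_le => //; first exact: integ_ae H ifi.
by move=> x; rewrite ge_min lexx orbT.
Qed.

(** [W] is the series of the [4^n D_n^2], whose integrals are at most [4^-n]. Half of the decay
    [16^-n] makes the series integrable and the other half is left as a pointwise rate. *)
Lemma L2_fast_dominated (D : nat -> T -> R) : (forall n, L2 mu (D n)) ->
  (forall n, \int[mu]_x (D n x ^+ 2) <= 16^-1 ^+ n) ->
  exists W : T -> R, [/\ integ mu W, forall x, 0 <= W x &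
    {ae mu, forall x n, D n x ^+ 2 <= 4^-1 ^+ n * W x}].
Proof.
move=> LD HD.
pose a n x := (4 ^+ n * D n x ^+ 2)%:E.
have a0 n x : (0 <= a n x)%E by rewrite lee_fin; apply: mulr_ge0; [exact: exprn_ge0|exact: sqr_ge0].
have ia n : integ mu (fun x => 4 ^+ n * D n x ^+ 2) by apply: integZ; case: (LD n).
have ma n : measurable_fun setT (a n) by apply/measurable_EFinP/integ_meas/ia.
pose w x := (\sum_(n <oo) a n x)%E.
have mw : measurable_fun setT w by apply: (ge0_emeasurable_sum (P := xpredT)).
have w0 x : (0 <= w x)%E by apply: nneseries_ge0.
have iw : (\int[mu]_x w x <= 2%:E)%E.
  rewrite integral_nneseries//.
  apply: lime_le; first by apply: is_cvg_nneseries => n _ _; exact: integral_ge0.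
  apply: nearW => n.
  apply: (@le_trans _ _ (\sum_(0 <= k < n) (4^-1 ^+ k)%:E)%E).
    apply: lee_sum => k _; rewrite Int_EFin// lee_fin IntZ; last by case: (LD k).
    rewrite -ler_pdivlMl ?exprn_gt0//; apply: le_trans (HD k) _.
    by rewrite -exprVn -exprMn -invfM -natrM.
  rewrite sumEFin lee_fin.
  have -> : \sum_(0 <= k < n) (4^-1 : R) ^+ k = 4 / 3 * (1 - 4^-1 ^+ n).
    elim: n => [|n IH]; first by rewrite big_geq// expr0; ring.
    by rewrite big_nat_recr//= IH exprS; field.
  have : 0 <= (4^-1 : R) ^+ n by rewrite exprn_ge0.
  lra.
have iw2 : mu.-integrable setT w.
  apply/integrableP; split => //.
  rewrite (_ : (\int[mu]_x `|w x|)%E = (\int[mu]_x w x)%E); first by rewrite (le_lt_trans iw)// ltry.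
  by apply: eq_integral => x _; rewrite gee0_abs.
have wfin : {ae mu, forall x, w x \is a fin_num}.
  by have := integrable_ae measurableT iw2; apply: filterS => x /(_ Logic.I).
exists (fine \o w); split.
- apply/integ_ge0P; first exact: measurableT_comp.
    by move=> x; exact: fine_ge0.
  rewrite (_ : (\int[mu]_x _)%E = (\int[mu]_x w x)%E); first by rewrite (le_lt_trans iw)// ltry.
  apply: ae_eq_integral => //; first exact/measurable_EFinP/measurableT_comp.
  by apply: filterS wfin => x wx _ /=; rewrite fineK.
- by move=> x; exact: fine_ge0.
- apply: filterS wfin => x wx n.
  rewrite exprVn -ler_pdivrMl ?invr_gt0 ?exprn_gt0// invrK -lee_fin fineK//.
  apply: le_trans (nneseries_lim_ge n.+1 _) => //.
  rewrite big_nat_recr//= -[X in (X <= _)%E]add0e leeD2r//.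
  by apply: sume_ge0.
Qed.

Lemma fast_cvg (D : nat -> R) W : (forall n, D n ^+ 2 <= 4^-1 ^+ n * W) ->
  D @ \oo --> 0.
Proof.
move=> H.
have W0 : 0 <= W by have := H 0; rewrite expr0 mul1r; exact: le_trans (sqr_ge0 _).
have H1 n : `|D n| <= Num.sqrt W * 2^-1 ^+ n.
  rewrite -(@ler_pXn2r _ 2) ?nnegrE ?mulr_ge0 ?exprn_ge0 ?sqrtr_ge0//.
  rewrite real_normK ?num_real// exprMn sqr_sqrtr// -exprM mulnC exprM mulrC.
  by rewrite (_ : 2^-1 ^+ 2 = 4^-1 :> R)//; field.
apply/norm_cvg0P.
apply: (@squeeze_cvgr _ _ _ _ (cst 0) (geometric (Num.sqrt W) 2^-1)).
- by apply: nearW => n; rewrite normr_ge0 /=; exact: H1.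
- exact: cvg_cst.
- by apply: cvg_geometric; rewrite ger0_norm ?invr_ge0// invf_lt1// ltr1n.
Qed.

(** Increments are at most [sqrt W 2^-n], so tails are bounded by a geometric series of sum
    [2 sqrt W 2^-n], whose square is the stated bound. *)
Lemma fast_cauchy (a : nat -> R) W : (forall n, (a n.+1 - a n) ^+ 2 <= 4^-1 ^+ n * W) ->
  cvgn a /\ forall n, (limn a - a n) ^+ 2 <= 4 * (4^-1 ^+ n * W).
Proof.
move=> H.
have W0 : 0 <= W by have := H 0; rewrite expr0 mul1r; exact: le_trans (sqr_ge0 _).
set s := Num.sqrt W.
have s0 : 0 <= s by rewrite sqrtr_ge0.
have H1 n : `|a n.+1 - a n| <= s * 2^-1 ^+ n.
  rewrite -(@ler_pXn2r _ 2) ?nnegrE ?mulr_ge0 ?exprn_ge0//.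
  rewrite real_normK ?num_real// exprMn sqr_sqrtr// -exprM mulnC exprM mulrC.
  by rewrite (_ : 2^-1 ^+ 2 = 4^-1 :> R)//; field.
have H2 n k : `|a (n + k)%N - a n| <= 2 * s * 2^-1 ^+ n - 2 * s * 2^-1 ^+ (n + k)%N.
  elim: k => [|k IH]; first by rewrite addn0 !subrr normr0.
  rewrite addnS (_ : _ - a n = (a (n + k).+1 - a (n + k)%N) + (a (n + k)%N - a n)); last by ring.
  apply: le_trans (ler_normD _ _) _; apply: le_trans (lerD (H1 _) IH) _.
  by rewrite exprS; set e := 2^-1 ^+ (n + k); rewrite le_eqVlt; apply/orP; left; apply/eqP; field.
have H3 n k : `|a (n + k)%N - a n| <= 2 * s * 2^-1 ^+ n.
  by apply: le_trans (H2 n k) _; rewrite gerBl mulr_ge0 ?exprn_ge0 ?mulr_ge0.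
have geo : (fun n => 2 * s * 2^-1 ^+ n) @ \oo --> (0 : R).
  by apply: (@cvg_geometric R (2 * s) 2^-1); rewrite ger0_norm ?invr_ge0// invf_lt1// ltr1n.
have ca : cvgn a.
  apply/cauchy_cvgP/cauchyP => e e0.
  have /cvgrPdist_lt /(_ e e0) [N _ HN] := geo.
  exists (a N); exists N => // m /= Nm.
  rewrite -(subnKC Nm) -ball_normE /= distrC (le_lt_trans (H3 _ _))//.
  by have := HN N (leqnn N); rewrite /= sub0r normrN ger0_norm// mulr_ge0 ?exprn_ge0 ?mulr_ge0.
split=> // n.
have -> : 4 * (4^-1 ^+ n * W) = (2 * s * 2^-1 ^+ n) ^+ 2.
  rewrite !exprMn sqr_sqrtr// -exprM (mulnC n) exprM (_ : 2^-1 ^+ 2 = 4^-1 :> R); last by field.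
  by rewrite (_ : 2 ^+ 2 = 4 :> R); [rewrite -mulrA; congr (_ * _); exact: mulrC|ring].
rewrite -[X in X <= _]real_normK ?num_real// ler_pXn2r ?nnegrE ?mulr_ge0 ?exprn_ge0 ?mulr_ge0//.
have cn : (fun m => `|a m - a n|) @ \oo --> `|limn a - a n|.
  by apply: cvg_norm; apply: cvgB; [exact: ca|exact: cvg_cst].
rewrite -(cvg_lim _ cn)//; apply: limr_le; first by apply/cvg_ex; eexists; exact: cn.
by exists n => // m /= nm; rewrite -(subnKC nm).
Qed.

(** The prescribed speed gives convergence almost everywhere without passing to a subsequence. The
    last clause preserves vanishing outside the domain, pointwise and not only almost everywhere. *)
Lemma L2_complete (F : nat -> T -> R) : (forall n, L2 mu (F n)) ->
  (forall n, \int[mu]_x ((F n.+1 x - F n x) ^+ 2) <= 16^-1 ^+ n) ->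
  exists f, [/\ L2 mu f, \int[mu]_x ((F n x - f x) ^+ 2) @[n --> \oo] --> 0,
    {ae mu, forall x, F ^~ x @ \oo --> f x} &
    forall x, (forall n, F n x = 0) -> f x = 0].
Proof.
move=> LF HF.
have [W [iW W0 HW]] := @L2_fast_dominated (fun n x => F n.+1 x - F n x)
  (fun n => L2B (LF n.+1) (LF n)) HF.
have mF n : measurable_fun setT (F n) by case: (LF n).
(* The measurable set of full measure on which the rate holds. Multiplying by its indicator makes
   the limit exist everywhere, hence measurable. *)
pose G := \bigcap_n [set x | (F n.+1 x - F n x) ^+ 2 <= 4^-1 ^+ n * W x].
have mG : measurable G.
  apply: bigcapT_measurable => n.
  rewrite (_ : [set _ | _] = (fun x => 4^-1 ^+ n * W x - (F n.+1 x - F n x) ^+ 2) @^-1` `[0, +oo[%classic).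
    rewrite -[X in measurable X]setTI.
    apply: (measurable_funB _ _) => //; last exact/measurable_funX/measurable_funB.
    by apply: measurable_funM => //; exact: integ_meas iW.
  by apply/seteqP; split=> x /=; rewrite in_itv/= andbT subr_ge0.
have GP x : G x -> forall n, (F n.+1 x - F n x) ^+ 2 <= 4^-1 ^+ n * W x.
  by move=> Gx n; exact: Gx.
pose f x := limn (fun n => F n x * \1_G x).
have Ff1 x : (fun n => F n x * \1_G x) @ \oo --> f x.
  rewrite /f; have [Gx|Gx] := pselect (G x).
    rewrite indicE mem_set//; under eq_fun do rewrite mulr1.
    by have [] := fast_cauchy (GP x Gx).
  by rewrite indicE memNset//; under eq_fun do rewrite mulr0; exact: is_cvg_cst.
have fE x : G x -> f x = limn (F ^~ x).
  by move=> Gx; rewrite /f indicE mem_set//; under eq_fun do rewrite mulr1.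
have mf : measurable_fun setT f.
  apply: (@measurable_fun_cvg _ _ _ _ (fun n x => F n x * \1_G x)) => // n.
  by apply: measurable_funM => //; exact: measurable_indic.
have aeG : {ae mu, forall x, G x} by apply: filterS HW => x Hx n _; exact: Hx.
have Hn n : {ae mu, forall x, (F n x - f x) ^+ 2 <= 4 * (4^-1 ^+ n * W x)}.
  apply: filterS aeG => x Gx; rewrite fE// -sqrrN opprB.
  by have [_] := fast_cauchy (GP x Gx); exact.
have iD n : integ mu (fun x => (F n x - f x) ^+ 2).
  apply: integ_le_ae (Hn n) _; first exact/measurable_funX/measurable_funB.
    by move=> x; exact: sqr_ge0.
  exact/integZ/integZ.
exists f; split.
- have LDf : L2 mu (fun x => F 0 x - f x) by split => //; exact: measurable_funB.
  rewrite (_ : f = fun x => F 0 x - (F 0 x - f x)); first exact: L2B.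
  by apply/funext => x; ring.
- apply: (@squeeze_cvgr _ _ _ _ (cst 0) (geometric (4 * \int[mu]_x W x) 4^-1)).
  + apply: nearW => n; rewrite Int_ge0/=; last by move=> x; exact: sqr_ge0.
    rewrite [X in _ <= X](_ : _ = \int[mu]_x (4 * (4^-1 ^+ n * W x))).
      by apply: Int_le_ae (Hn n) => //; exact/integZ/integZ.
    by rewrite IntZ ?IntZ//; [ring|exact: integZ].
  + exact: cvg_cst.
  + by apply: cvg_geometric; rewrite ger0_norm ?invr_ge0// invf_lt1// ltr1n.
- apply: filterS aeG => x Gx.
  by rewrite fE//; have [] := fast_cauchy (GP x Gx).
- move=> x F0; rewrite /f (_ : (fun _ => _) = cst 0) ?lim_cst//.
  by apply/funext => n; rewrite F0 mul0r.
Qed.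

Lemma L2_fast_ae (F : nat -> T -> R) f : (forall n, L2 mu (F n)) -> L2 mu f ->
  (forall n, \int[mu]_x ((F n x - f x) ^+ 2) <= 16^-1 ^+ n) ->
  {ae mu, forall x, F ^~ x @ \oo --> f x}.
Proof.
move=> LF Lf HF.
have [W [iW W0]] := @L2_fast_dominated (fun n x => F n x - f x) (fun n => L2B (LF n) Lf) HF.
by apply: filterS => x /fast_cvg /subr_cvg0.
Qed.

End L2_completeness.

(** * Functions of class C^k *)
Section line_calculus.
Context (R : realType) (V : normedModType R).
Implicit Types (f g : V -> R) (x v : V).

Lemma is_derive_line f x v (t : R) : derivable f (x + t *: v) v ->
  is_derive t (1 : R) (fun s : R => f (x + s *: v)) ('D_v f (x + t *: v)).
Proof.
move=> df.
have E : (fun h : R => h^-1 *: ((fun s : R => f (x + s *: v)) (h *: 1 + t) - f (x + t *: v)))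
   = (fun h : R => h^-1 *: (f (h *: v + (x + t *: v)) - f (x + t *: v))).
  apply/funext => h; rewrite [h *: 1]mulr1 scalerDl.
  by congr (_ *: (f _ - _)); rewrite addrCA.
by apply: DeriveDef; [rewrite /derivable E|rewrite /derive E].
Qed.

Lemma derivable_line f x v (t : R) : derivable f (x + t *: v) v ->
  derivable (fun s : R => f (x + s *: v)) t 1.
Proof. by move=> /is_derive_line []. Qed.

Lemma continuous_line f x v : (forall t : R, derivable f (x + t *: v) v) ->
  continuous (fun s : R => f (x + s *: v)).
Proof.
move=> df t; apply: differentiable_continuous; apply/derivable1_diffP.
exact: derivable_line.
Qed.

(** The increment [s] has any sign, so the intermediate point is located by [|c| <= |s|] only; this
    suffices to send it to [x] in limits. *)
Lemma MVT_line f x v (s : R) : (forall t : R, derivable f (x + t *: v) v) ->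
  exists c : R, `|c| <= `|s| /\ f (x + s *: v) - f x = s * 'D_v f (x + c *: v).
Proof.
move=> df; pose g (t : R) := f (x + t *: v).
have dg (t : R) : is_derive t (1 : R) g ('D_v f (x + t *: v)) by exact: is_derive_line.
have cg (a b : R) : {within `[a, b], continuous g}.
  by apply: continuous_subspaceT; exact: continuous_line.
have g0 : g 0 = f x by rewrite /g scale0r addr0.
have [s0|s0] := leP 0 s.
  have [c] := MVT_segment s0 (fun t _ => dg t) (@cg 0 s).
  rewrite in_itv/= => /andP[c0 cs] H; exists c; split; first by rewrite !ger0_norm.
  by rewrite -g0 -/(g s) H subr0 mulrC.
have [c] := MVT_segment (ltW s0) (fun t _ => dg t) (@cg s 0).
rewrite in_itv/= => /andP[c0 cs] H; exists c; split.
  by rewrite !ler0_norm ?lerN2// ltW.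
by rewrite -g0 -/(g s) -opprB H; ring.
Qed.

Lemma derive_line0 f x v : 'D_v f x = 'D_1 (fun h : R => f (h *: v + x)) 0.
Proof.
rewrite /derive; set g1 := fun h => h^-1 *: _; set g2 := fun h => h^-1 *: _.
suff -> : g1 = g2 by [].
by rewrite funeqE /g1 /g2 => h /=; rewrite addr0 scale0r add0r [_%:A]mulr1.
Qed.

Lemma derivable_dirZ f x v (c : R) : derivable f x v ->
  derivable f x (c *: v) /\ 'D_(c *: v) f x = c * 'D_v f x.
Proof.
move=> /derivable1P df.
pose g (h : R) := f (h *: v + x).
have E : (fun h : R => f (h *: (c *: v) + x)) = g \o ( *%R c).
  by apply/funext => h /=; rewrite /g scalerA mulrC.
have dc : is_derive (0 : R) (1 : R) ( *%R c : R -> R) c.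
  have := is_deriveZ (f := id) c (is_derive_id (0 : R) (1 : R)).
  by case=> d1 e1; apply: DeriveDef; [exact: d1|rewrite e1; exact: mulr1].
have dg : derivable g (c * 0) 1 by rewrite mulr0.
split.
  apply/derivable1P; rewrite E; apply/derivable1_diffP/differentiable_comp.
    by apply/derivable1_diffP; case: dc.
  exact/derivable1_diffP.
have [d1 e1] := dc.
rewrite derive_line0 E -derive1E (derive1_comp d1 dg) !derive1E e1 mulr0.
by rewrite /g -derive_line0 mulrC.
Qed.

(** The increment is taken along [u] first and then along [v]. The mean value theorem turns the
    second part into a value of ['D_v f] at a point tending to [x], so continuity of that one
    derivative is enough. *)
Lemma derivable_dirD f x u v :
  (forall y, derivable f y v) -> derivable f x u ->
  {for x, continuous ('D_v f)} ->
  derivable f x (u + v) /\ 'D_(u + v) f x = 'D_u f x + 'D_v f x.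
Proof.
move=> dv du cv.
suff : (fun h : R => h^-1 *: (f (h *: (u + v) + x) - f x)) @ 0^' --> 'D_u f x + 'D_v f x.
  by move=> H; split; [apply/cvg_ex; eexists; exact: H|exact: cvg_lim].
rewrite (_ : (fun h : R => _) = (fun h : R => h^-1 *: (f (h *: u + x) - f x) +
    h^-1 *: (f (h *: u + x + h *: v) - f (h *: u + x)))); last first.
  apply/funext => h; rewrite -scalerDr; congr (_ *: _).
  by rewrite scalerDr (addrAC (h *: u)); ring.
apply: cvgD; first exact: du.
have [C HC] := choice (fun h : R => MVT_line h (x := h *: u + x) (fun t => dv _)).
have E : (fun h : R => 'D_v f (h *: u + x + C h *: v)) @ 0^' --> 'D_v f x.
  apply: (@cvg_comp _ _ _ (fun h : R => h *: u + x + C h *: v) ('D_v f) _ (nbhs x)); last exact: cv.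
  have id0 : (fun h : R => h) @ 0^' --> (0 : R) by exact: nbhs_dnbhs.
  have C0 : C @ 0^' --> (0 : R).
    apply/norm_cvg0P.
    apply: (@squeeze_cvgr _ _ _ _ (cst 0) (fun h : R => `|h|)).
    - by apply: nearW => h; rewrite normr_ge0 /=; have [] := HC h.
    - exact: cvg_cst.
    - have H := cvg_norm id0; rewrite normr0 in H; exact: H.
  have H := cvgD (cvgD (cvgZr_tmp (a := u) id0) (cvg_cst x)) (cvgZr_tmp (a := v) C0).
  by move: H; rewrite !scale0r add0r addr0; exact.
apply: cvg_trans E; apply: near_eq_cvg; near=> h.
have [_ ->] := HC h.
rewrite -[RHS]/(h^-1 * (h * _)) mulrA mulVf ?mul1r//; near: h; exact: nbhs_dnbhs_neq.
Unshelve. all: by end_near. Qed.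

Lemma is_derive_comp1 (h h' : R -> R) f x v :
  (forall t : R, is_derive t (1 : R) h (h' t)) -> derivable f x v ->
  is_derive x v (fun y => h (f y)) (h' (f x) * 'D_v f x).
Proof.
move=> dh /derivable1P df.
pose g (s : R) := f (s *: v + x).
have f0 : g 0 = f x by rewrite /g scale0r add0r.
have dhg : derivable h (g 0) 1 by have [] := dh (g 0).
apply: DeriveDef.
  apply/derivable1P; apply/derivable1_diffP.
  apply: (@differentiable_comp _ _ _ _ g h); exact/derivable1_diffP.
have H := derive1_comp (df : derivable g 0 1) dhg.
rewrite derive_line0 -derive1E; apply: (etrans H); rewrite !derive1E f0.
by have [_ ->] := dh (f x); rewrite /g -derive_line0.
Qed.

End line_calculus.

Section Ck_algebra.
Context (R : realType) (n : nat).
Local Notation V := 'rV[R]_n.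
Implicit Types (f g : V -> R) (A B : set V) (k : nat).

Lemma pderiv_rcons s i f : pderiv (rcons s i) f = pderiv s ('D_(basis i) f).
Proof. by rewrite /pderiv -cats1 foldr_cat. Qed.

Lemma Ck0P A f : Ck A 0 f <-> forall x, A x -> {for x, continuous f}.
Proof.
split=> [H x Ax|H [|//] _ x Ax]; first by have [] := H [::] isT x Ax.
by split; [exact: H|].
Qed.

(** The derivative split off is the innermost one, which is the last entry of the list in [pderiv].
    This is the form in which inductions on [k] proceed. *)
Lemma CkSP A k f : Ck A k.+1 f <->
  [/\ forall x, A x -> {for x, continuous f},
      forall i x, A x -> derivable f x (basis i) &
      forall i, Ck A k ('D_(basis i) f)].
Proof.
split=> [H|[cf df Cf] s].
  split=> [x Ax|i x Ax|i s sk x Ax].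
  - by have [] := H [::] isT x Ax.
  - by have [_ /(_ isT i)] := H [::] isT x Ax.
  - have := H (rcons s i); rewrite size_rcons ltnS => /(_ sk x Ax).
    by rewrite pderiv_rcons.
case/lastP: s => [_ x Ax|s i]; first by split=> [|_ i]; [exact: cf|exact: df].
by rewrite size_rcons pderiv_rcons !ltnS => sk x Ax; exact: Cf.
Qed.

Lemma CkW A k f : Ck A k.+1 f -> Ck A k f.
Proof.
move=> H s sk x Ax; have [c d] := H s (leqW sk) x Ax; split=> // sk' i.
exact/d/leqW.
Qed.

Lemma Ck_le A k m f : (m <= k)%N -> Ck A k f -> Ck A m f.
Proof.
move=> mk H s sm x Ax; have [c d] := H s (leq_trans sm mk) x Ax; split=> // sm' i.
exact/d/(leq_trans sm').
Qed.

Lemma Ck_sub A B k f : A `<=` B -> Ck B k f -> Ck A k f.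
Proof. by move=> AB H s sk x /AB; exact: H. Qed.

Lemma Ck_setU A B k f : Ck A k f -> Ck B k f -> Ck (A `|` B) k f.
Proof. by move=> HA HB s sk x [Ax|Bx]; [exact: HA|exact: HB]. Qed.

Lemma eq_in_Ck A k f g : open A -> (forall x, A x -> f x = g x) ->
  Ck A k f -> Ck A k g.
Proof.
move=> oA; have nA x : A x -> forall h1 h2 : V -> R, (forall x, A x -> h1 x = h2 x) ->
    {near x, h1 =1 h2}.
  by move=> Ax h1 h2 h12; near=> y; apply: h12; near: y; exact: open_nbhs_nbhs.
have cE (h1 h2 : V -> R) : (forall x, A x -> h1 x = h2 x) -> forall x, A x ->
    {for x, continuous h1} -> {for x, continuous h2}.
  move=> h12 x Ax; rewrite /prop_for /continuous_at -h12//.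
  exact: (cvg_trans (near_eq_cvg (nA x Ax h1 h2 h12))).
elim: k f g => [|k IH] f g fg.
  by rewrite !Ck0P => H x Ax; apply: (cE f) => //; exact: H.
rewrite !CkSP => -[cf df Cf]; split=> [x Ax|i x Ax|i].
- by apply: (cE f) => //; exact: cf.
- by apply: near_eq_derivable (df i x Ax); exact: nA.
- by apply: IH (Cf i) => x Ax; apply: near_eq_derive; exact: nA.
Unshelve. all: by end_near. Qed.

Lemma Ck_derivable A k f i x : Ck A k.+1 f -> A x -> derivable f x (basis i).
Proof. by move=> /CkSP[_ + _] Ax; apply. Qed.

Lemma Ck_D A k f i : Ck A k.+1 f -> Ck A k ('D_(basis i) f).
Proof. by move=> /CkSP[]. Qed.

Lemma Ck_cont A k f x : Ck A k f -> A x -> {for x, continuous f}.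
Proof. by move=> H Ax; exact: ((Ck0P A f).1 (Ck_le (leq0n k) H) x Ax). Qed.

Lemma Ck_cst A k (c : R) : Ck A k (fun=> c).
Proof.
elim: k c => [|k IH] c; first by apply/Ck0P => x _; exact: cst_continuous.
apply/CkSP; split=> [x _|i x _|i]; [exact: cst_continuous|exact: derivable_cst|].
by rewrite (_ : 'D_(basis i) _ = fun=> 0) //; apply/funext => x; rewrite derive_cst.
Qed.

Lemma CkD A k f g : open A -> Ck A k f -> Ck A k g -> Ck A k (fun x => f x + g x).
Proof.
move=> oA; elim: k f g => [|k IH] f g.
  by rewrite !Ck0P => cf cg x Ax; apply: (@continuousD _ _ _ f g); [exact: cf|exact: cg].
rewrite !CkSP => -[cf df Cf] [cg dg Cg]; split=> [x Ax|i x Ax|i].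
- by apply: (@continuousD _ _ _ f g); [exact: cf|exact: cg].
- by apply: derivableD; [exact: df|exact: dg].
- apply: eq_in_Ck (IH _ _ (Cf i) (Cg i)) => // x Ax.
  by rewrite -deriveD//; [exact: df|exact: dg].
Qed.

Lemma CkM A k f g : open A -> Ck A k f -> Ck A k g -> Ck A k (fun x => f x * g x).
Proof.
move=> oA; elim: k f g => [|k IH] f g.
  by rewrite !Ck0P => cf cg x Ax; apply: (@continuousM _ _ f g); [exact: cf|exact: cg].
move=> /[dup] /CkW Wf + /[dup] /CkW Wg.
rewrite !CkSP => -[cf df Cf] [cg dg Cg]; split=> [x Ax|i x Ax|i].
- by apply: (@continuousM _ _ f g); [exact: cf|exact: cg].
- by apply: derivableM; [exact: df|exact: dg].
- apply: eq_in_Ck (CkD oA (IH _ _ Wf (Cg i)) (IH _ _ Wg (Cf i))) => // x Ax.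
  by rewrite -[LHS]/(f x *: 'D_(basis i) g x + g x *: 'D_(basis i) f x) -deriveM//;
    [exact: df|exact: dg].
Qed.

Lemma CkZ A k (c : R) f : open A -> Ck A k f -> Ck A k (fun x => c * f x).
Proof. by move=> oA; apply: CkM => //; exact: Ck_cst. Qed.

Lemma CkN A k f : open A -> Ck A k f -> Ck A k (fun x => - f x).
Proof.
move=> oA /(CkZ (-1) oA); apply: eq_in_Ck => // x _; by rewrite mulN1r.
Qed.

Lemma CkB A k f g : open A -> Ck A k f -> Ck A k g -> Ck A k (fun x => f x - g x).
Proof. by move=> oA Cf Cg; exact: (CkD oA Cf (CkN oA Cg)). Qed.

Lemma Ck_prod A k (J : Type) (r : seq J) (F : J -> V -> R) : open A ->
  (forall j, Ck A k (F j)) -> Ck A k (fun x => \prod_(j <- r) F j x).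
Proof.
move=> oA CF; elim: r => [|j r IH].
  by apply: eq_in_Ck (Ck_cst (k := k) 1) => // x _; rewrite big_nil.
by apply: eq_in_Ck (CkM oA (CF j) IH) => // x _; rewrite big_cons.
Qed.

Lemma derive_coord (i : 'I_n) x v :
  is_derive x v (fun y : V => y ord0 i) (v ord0 i).
Proof.
have E : (fun h : R => h^-1 *: ((h *: v + x) ord0 i - x ord0 i)) @ 0^' --> v ord0 i.
  apply: (@cvg_trans _ ((fun _ : R => v ord0 i) @ 0^')); last exact: cvg_cst.
  apply: near_eq_cvg; near=> h.
  rewrite !mxE addrK -[RHS]/(h^-1 * (h * _)) mulrA mulVf ?mul1r//.
  by near: h; exact: nbhs_dnbhs_neq.
apply: DeriveDef; first by apply/cvg_ex; eexists; exact: E.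
exact: cvg_lim E.
Unshelve. all: by end_near. Qed.

Lemma Ck_coord A k i : Ck A k (fun x : V => x ord0 i).
Proof.
case: k => [|k]; first by apply/Ck0P => x _; exact: coord_continuous.
apply/CkSP; split=> [x _|j x _|j]; first exact: coord_continuous.
  by have [] := derive_coord i x (basis j).
rewrite (_ : 'D_(basis j) _ = fun=> (basis j : V) ord0 i); first exact: Ck_cst.
by apply/funext => x; have [_ ->] := derive_coord i x (basis j).
Qed.

Lemma is_derive_shiftV f (a x v : V) : derivable f (x + a) v ->
  is_derive x v (fun y => f (y + a)) ('D_v f (x + a)).
Proof.
have E : (fun h : R => h^-1 *: (f (h *: v + x + a) - f (x + a)))
   = (fun h : R => h^-1 *: (f (h *: v + (x + a)) - f (x + a))).
  by apply/funext => h; rewrite addrA.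
by move=> df; apply: DeriveDef; [rewrite /derivable E|rewrite /derive E].
Qed.

Lemma is_derive_reflV f (a x v : V) : derivable f (a - x) v ->
  is_derive x v (fun y => f (a - y)) (- 'D_v f (a - x)).
Proof.
move=> /(derivable_dirZ (-1)); rewrite scaleN1r mulN1r => -[d1 d2].
have E : (fun h : R => h^-1 *: (f (a - (h *: v + x)) - f (a - x)))
   = (fun h : R => h^-1 *: (f (h *: (- v) + (a - x)) - f (a - x))).
  apply/funext => h; rewrite opprD scalerN.
  by congr (_ *: (f _ - _)); rewrite addrCA.
by rewrite -d2; apply: DeriveDef; [rewrite /derivable E|rewrite /derive E].
Qed.

Lemma Ck_shiftV k f (a : V) : Ck setT k f -> Ck setT k (fun y => f (y + a)).
Proof.
have cs g : continuous g -> continuous (fun y : V => g (y + a)).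
  by move=> cg x; apply: (@continuous_comp _ _ _ (fun y : V => y + a) g);
     [apply: (@continuousD _ _ _ id (cst a)) => //; exact: cst_continuous|exact: cg].
elim: k f => [|k IH] f.
  by rewrite !Ck0P => cf x _; apply: cs => y; exact: cf.
move=> /CkSP[cf df Cf]; apply/CkSP; split=> [x _|i x _|i].
- by apply: cs => y; exact: cf.
- by have [] := is_derive_shiftV (df i (x + a) Logic.I).
- apply: eq_in_Ck (IH _ (Cf i)) => //; first exact: openT.
  by move=> x _; have [_ ->] := is_derive_shiftV (df i (x + a) Logic.I).
Qed.

Lemma Ck_reflV k f (a : V) : Ck setT k f -> Ck setT k (fun y => f (a - y)).
Proof.
have cs g : continuous g -> continuous (fun y : V => g (a - y)).
  by move=> cg x; apply: (@continuous_comp _ _ _ (fun y : V => a - y) g);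
     [apply: (@continuousB _ _ _ (cst a) id) => //; exact: cst_continuous|exact: cg].
elim: k f => [|k IH] f.
  by rewrite !Ck0P => cf x _; apply: cs => y; exact: cf.
move=> /CkSP[cf df Cf]; apply/CkSP; split=> [x _|i x _|i].
- by apply: cs => y; exact: cf.
- by have [] := is_derive_reflV (df i (a - x) Logic.I).
- apply: eq_in_Ck (CkN openT (IH _ (Cf i))) => //; first exact: openT.
  by move=> x _; have [_ ->] := is_derive_reflV (df i (a - x) Logic.I).
Qed.

(** Schwarz's theorem. The second difference of [f] is symmetric in the two directions, and two
    applications of the mean value theorem write it as [h^2] times either mixed derivative at a
    point tending to [x]. *)
Lemma derive2C f (i j : 'I_n) x : Ck setT 2 f ->
  'D_(basis i) ('D_(basis j) f) x = 'D_(basis j) ('D_(basis i) f) x.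
Proof.
move=> Cf.
pose h (k : nat) : R := k.+1%:R^-1.
suff H (a b : 'I_n) : exists Y : nat -> V, Y @ \oo --> x /\
    forall k, f (x + h k *: basis a + h k *: basis b) - f (x + h k *: basis a)
     - (f (x + h k *: basis b) - f x) = h k ^+ 2 * 'D_(basis b) ('D_(basis a) f) (Y k).
  have [Y [Yx HY]] := H i j; have [Z [Zx HZ]] := H j i.
  have c1 : 'D_(basis j) ('D_(basis i) f) (Y k) @[k --> \oo] --> 'D_(basis j) ('D_(basis i) f) x.
    exact: (cvg_comp Y _ Yx (Ck_cont (Ck_D j (Ck_D i Cf)) (Logic.I : setT x))).
  have c2 : 'D_(basis i) ('D_(basis j) f) (Z k) @[k --> \oo] --> 'D_(basis i) ('D_(basis j) f) x.
    exact: (cvg_comp Z _ Zx (Ck_cont (Ck_D i (Ck_D j Cf)) (Logic.I : setT x))).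
  have E : (fun k => 'D_(basis i) ('D_(basis j) f) (Z k)) = (fun k => 'D_(basis j) ('D_(basis i) f) (Y k)).
    apply/funext => k.
    have h0 : h k ^+ 2 != 0 by rewrite expf_neq0// invr_eq0.
    have aux : f (x + h k *: basis j + h k *: basis i) - f (x + h k *: basis j)
      - (f (x + h k *: basis i) - f x) = f (x + h k *: basis i + h k *: basis j)
      - f (x + h k *: basis i) - (f (x + h k *: basis j) - f x).
      by rewrite (addrAC x); ring.
    exact: (mulfI h0 (etrans (esym (HZ k)) (etrans aux (HY k)))).
  by move: c2; rewrite E => c2; exact: (cvg_unique _ c2 c1).
have d1 (l : 'I_n) (y : V) : derivable f y (basis l) by exact: (Ck_derivable Cf Logic.I).
have d2 (y : V) : derivable ('D_(basis a) f) y (basis b).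
  exact: (Ck_derivable (Ck_D a Cf) Logic.I).
have step k : exists y, `|x - y| <= h k * (`|basis a : V| + `|basis b : V|) /\
    f (x + h k *: basis a + h k *: basis b) - f (x + h k *: basis a)
     - (f (x + h k *: basis b) - f x) = h k ^+ 2 * 'D_(basis b) ('D_(basis a) f) y.
  pose g y := f (y + h k *: basis b) - f y.
  have dg y : is_derive y (basis a) g
      ('D_(basis a) f (y + h k *: basis b) - 'D_(basis a) f y).
    apply: is_deriveB; first exact: is_derive_shiftV.
    exact/derivableP.
  have dga y : derivable g y (basis a) by case: (dg y).
  have [c [ch Hc]] := @MVT_line _ _ g x (basis a) (h k) (fun t => dga _).
  have [e [eh He]] := @MVT_line _ _ ('D_(basis a) f) (x + c *: basis a) (basis b) (h k) (fun t => d2 _).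
  exists (x + c *: basis a + e *: basis b); split.
    rewrite -addrA opprD addNKr normrN; apply: le_trans (ler_normD _ _) _.
    have h0 : 0 <= h k by rewrite invr_ge0.
    rewrite mulrDr !normrZ; rewrite (ger0_norm h0) in ch eh.
    by apply: lerD; apply: ler_wpM2r.
  transitivity (g (x + h k *: basis a) - g x); first by rewrite /g.
  rewrite Hc; have [_ ->] := dg (x + c *: basis a).
  by rewrite He expr2 mulrA.
have [Y HY] := choice step.
exists Y; split; last by move=> k; have [_] := HY k.
apply/cvgrPdist_le => e e0.
set M := `|basis a : V| + `|basis b : V|.
have H0 : (fun k : nat => h k * M) @ \oo --> 0 * M.
  by apply: cvgMr_tmp; exact: cvg_harmonic.
rewrite mul0r in H0; move/cvgrPdist_le : H0 => /(_ e e0).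
apply: filterS => k; rewrite sub0r normrN => Hk; have [Hy _] := HY k.
exact: le_trans Hy (le_trans (ler_norm _) Hk).
Qed.

End Ck_algebra.

(** * Compactly supported functions and integration by parts *)

Section compact_support.
Context (R : realType) (n : nat).
Local Notation V := 'rV[R]_n.
Local Notation mu := (@lebesgue_rV R n).
Implicit Types (f g : V -> R) (A B K : set V) (k : nat).

Lemma rV_hausdorff : hausdorff_space V.
Proof. exact: norm_hausdorff. Qed.

Lemma compact_measurable_rV K : compact K -> measurable K.
Proof. by move=> /(compact_closed rV_hausdorff); exact: closed_measurable_rV. Qed.

Lemma compact_norm_bounded K : compact K -> exists2 M : R, 0 < M & forall x, K x -> `|x| <= M.
Proof.
move=> /compact_bounded [M [_ HM]]; exists (`|M| + 1); first by rewrite ltr_wpDl.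
by move=> x Kx; apply: HM => //; rewrite (le_lt_trans (ler_norm M))// ltrDl.
Qed.

Definition box (M : R) : set V := [set x | `|x| <= M].

Lemma boxE M : 0 <= M -> box M = [set x | forall i, `|x ord0 i| <= M].
Proof. by move=> M0; apply/seteqP; split=> x /=; [move/(norm_rV_leP x M0)|move=> ?; apply/(norm_rV_leP x M0)]. Qed.

Lemma box_meas M : measurable (box M).
Proof.
have [M0|M0] := leP 0 M; first by rewrite boxE//; exact: measurable_box.
rewrite (_ : box M = set0)//; apply/seteqP; split=> // x /= /(le_trans (normr_ge0 x)).
by rewrite leNgt M0.
Qed.

Lemma box_finite M : (mu (box M) < +oo)%E.
Proof.
have [M0|M0] := leP 0 M; first by rewrite boxE//; exact: lebesgue_rV_box.
rewrite (_ : box M = set0) ?measure0//; apply/seteqP; split=> // x /= /(le_trans (normr_ge0 x)).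
by rewrite leNgt M0.
Qed.

Lemma integ_box M : integ mu (\1_(box M) : V -> R).
Proof.
apply/integ_ge0P.
- by apply: measurable_indic; exact: box_meas.
- by move=> x; rewrite indicE.
- by rewrite integral_indic ?setIT; [exact: box_finite|exact: measurableT|exact: box_meas].
Qed.

Lemma box_closed M : closed (box M).
Proof.
rewrite (_ : box M = (fun x : V => `|x|) @^-1` [set r | r <= M])//.
by apply: closed_comp; [move=> x _; exact: norm_continuous|exact: closed_le].
Qed.

Lemma box_compact M : compact (box M).
Proof.
apply: bounded_closed_compact; last exact: box_closed.
exists M; split; first exact: num_real.
by move=> r Mr x /= xM; exact: le_trans xM (ltW Mr).
Qed.

Definition cptin A f := exists K, [/\ compact K, K `<=` A & forall x, ~ K x -> f x = 0].

Lemma cptinS A B f : A `<=` B -> cptin A f -> cptin B f.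
Proof. by move=> AB [K [cK KA f0]]; exists K; split=> // x /KA /AB. Qed.

Lemma cptinMl A f g : cptin A f -> cptin A (fun x => f x * g x).
Proof. by move=> [K [cK KA f0]]; exists K; split=> // x /f0 ->; rewrite mul0r. Qed.

Lemma cptinMr A f g : cptin A f -> cptin A (fun x => g x * f x).
Proof. by move=> [K [cK KA f0]]; exists K; split=> // x /f0 ->; rewrite mulr0. Qed.

Lemma cptinD A f g : cptin A f -> cptin A g -> cptin A (fun x => f x + g x).
Proof.
move=> [K [cK KA f0]] [L [cL LA g0]]; exists (K `|` L); split.
- exact: compactU.
- by move=> x [/KA|/LA].
- by move=> x KLx; rewrite f0 ?g0 ?addr0//; move=> ?; apply: KLx; [right|left].
Qed.

Lemma cptin_box A f : cptin A f -> exists2 M : R, 0 < M & forall x, M < `|x| -> f x = 0.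
Proof.
move=> [K [cK _ f0]]; have [M M0 HM] := compact_norm_bounded cK.
by exists M => // x Mx; apply: f0 => /HM; rewrite leNgt Mx.
Qed.

Lemma box_cptin f M : (forall x, M < `|x| -> f x = 0) -> cptin setT f.
Proof.
move=> f0; exists (box M); split=> //; first exact: box_compact.
by move=> x /= /negP; rewrite -ltNge; exact: f0.
Qed.

Lemma cptin_bounded A f : continuous f -> cptin A f ->
  exists2 M : R, 0 <= M & forall x, `|f x| <= M.
Proof.
move=> cf [K [cK _ f0]].
have [[y Ky]|K0] := pselect (K !=set0); last first.
  by exists 0 => // x; rewrite f0 ?normr0// => Kx; apply: K0; exists x.
have cnf : {within K, continuous (fun x => `|f x|)}.
  apply: continuous_subspaceT => x.
  by apply: (@continuous_comp _ _ _ f Num.norm); [exact: cf|exact: norm_continuous].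
have [c _ Hc] := EVT_max_rV (ex_intro _ y Ky) cK cnf.
exists `|f c| => // x; have [Kx|Kx] := pselect (K x); first by apply: Hc; rewrite inE.
by rewrite f0// normr0.
Qed.

Lemma integ_bounded_box f M C : measurable_fun setT f ->
  (forall x, M < `|x| -> f x = 0) -> (forall x, `|f x| <= C) -> integ mu f.
Proof.
move=> mf f0 fC; apply: integ_le (integZ C (integ_box M)) => // x.
rewrite indicE; have [xM|xM] := boolP (x \in box M); first by rewrite mulr1.
by rewrite mulr0 f0 ?normr0//; move: xM; rewrite notin_setE /box/= => /negP; rewrite -ltNge.
Qed.

Lemma integ_cpt A f : continuous f -> cptin A f -> integ mu f.
Proof.
move=> cf cpf; have [M _ HM] := cptin_bounded cf cpf.
have [C _ HC] := cptin_box cpf.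
exact: (integ_bounded_box (continuous_measurable_rV cf) HC HM).
Qed.

Lemma L2_cpt A f : continuous f -> cptin A f -> L2 mu f.
Proof.
move=> cf cpf; split; first exact: continuous_measurable_rV.
apply: (@integ_cpt A); last by under eq_fun do rewrite expr2; exact: cptinMl.
by move=> x; under eq_fun do rewrite expr2; apply: (@continuousM _ _ f f); exact: cf.
Qed.

Lemma CkT_cont k f : Ck setT k f -> continuous f.
Proof. by move=> H x; exact: (Ck_cont H). Qed.

(** Regularity is required on the whole space and [A] only constrains the support, so translations
    and integration by parts never see the boundary of [A]. *)
Definition TC k A f := Ck setT k f /\ cptin A f.

Lemma TC_cont k A f : TC k A f -> continuous f.
Proof. by move=> [/CkT_cont]. Qed.

Lemma TC_integ k A f : TC k A f -> integ mu f.
Proof. by move=> [/CkT_cont cf]; exact: integ_cpt. Qed.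

Lemma TC_L2 k A f : TC k A f -> L2 mu f.
Proof. by move=> [/CkT_cont cf]; exact: L2_cpt. Qed.

Lemma TC_bounded k A f : TC k A f -> exists2 M : R, 0 <= M & forall x, `|f x| <= M.
Proof. by move=> [/CkT_cont cf]; exact: cptin_bounded. Qed.

Lemma TC_W k A f : TC k.+1 A f -> TC k A f.
Proof. by move=> [/CkW]. Qed.

Lemma TC_le k m A f : (m <= k)%N -> TC k A f -> TC m A f.
Proof. by move=> mk [Cf cf]; split=> //; exact: Ck_le Cf. Qed.

Lemma TC_S k A B f : A `<=` B -> TC k A f -> TC k B f.
Proof. by move=> AB [? cf]; split=> //; exact: cptinS cf. Qed.

Lemma derive_locally0 f K i x : closed K -> (forall y, ~ K y -> f y = 0) -> ~ K x ->
  'D_(basis i) f x = 0.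
Proof.
move=> cK f0 Kx; rewrite (@near_eq_derive _ _ _ f (cst 0)) ?derive_cst//.
near=> y; apply: f0; near: y; apply: (@open_nbhs_nbhs _ x (~` K)).
by split=> //; rewrite openC.
Unshelve. all: by end_near. Qed.

Lemma TC_D k A f i : TC k.+1 A f -> TC k A ('D_(basis i) f).
Proof.
move=> [/(Ck_D i) Cf [K [cK KA f0]]]; split=> //; exists K; split=> //.
by move=> x; apply: derive_locally0 => //; exact: compact_closed.
Qed.

Lemma TC_Ml k A f g : TC k A f -> Ck setT k g -> TC k A (fun x => g x * f x).
Proof. by move=> [Cf cf] Cg; split; [exact: CkM openT Cg Cf|exact: cptinMr]. Qed.

Lemma TC_add k A f g : TC k A f -> TC k A g -> TC k A (fun x => f x + g x).
Proof. by move=> [Cf cf] [Cg cg]; split; [exact: CkD openT Cf Cg|exact: cptinD]. Qed.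

Lemma TC_Z k A f c : TC k A f -> TC k A (fun x => c * f x).
Proof. by move=> Tf; apply: TC_Ml => //; exact: Ck_cst. Qed.

Lemma TC_derivable k A f i x : TC k.+1 A f -> derivable f x (basis i).
Proof. by move=> [Cf _]; exact: (Ck_derivable Cf Logic.I). Qed.

Lemma Int_shift f (a : V) : measurable_fun setT f ->
  \int[mu]_x f (x + a) = \int[mu]_x f x.
Proof.
move=> mf; rewrite /Rintegral; congr fine.
by apply: (integral_shift a (f := EFin \o f)); exact/measurable_EFinP.
Qed.

Lemma integ_shift f (a : V) : integ mu f -> integ mu (fun x => f (x + a)).
Proof.
move=> fi; have mf := integ_meas fi.
have mfa : measurable_fun setT (fun x : V => f (x + a)).
  exact: measurableT_comp (measurable_addrV a).
apply/integrableP; split; first exact/measurable_EFinP.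
have /integrableP[_] := fi; rewrite -(integral_shift a)//.
by apply: measurableT_comp => //; exact/measurable_EFinP.
Qed.

Lemma basis_norm i : `|basis i : V| <= 1.
Proof.
apply/norm_rV_leP => // j; rewrite !mxE/=.
by case: (_ == _); rewrite ?normr1 ?normr0.
Qed.

(** Difference quotients have integral zero by translation invariance, and they converge boundedly
    to the derivative on a fixed box. *)
Lemma Int_D0 f i : TC 1 setT f -> \int[mu]_x 'D_(basis i) f x = 0.
Proof.
move=> Tf; pose e k : R := k.+1%:R^-1.
have df x : derivable f x (basis i) by exact: TC_derivable Tf.
have [M M0 HM] := TC_bounded (TC_D i Tf).
have [B B0 HB] := cptin_box Tf.2.
have mf : measurable_fun setT f by exact: continuous_measurable_rV (TC_cont Tf).
have e0 k : 0 < e k by rewrite invr_gt0.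
have e1 k : e k <= 1 by rewrite invf_le1 ?ler1n.
pose F k x := (e k)^-1 * (f (x + e k *: basis i) - f x).
have mF k : measurable_fun setT (F k).
  apply: measurable_funM => //; apply: measurable_funB => //.
  exact: measurableT_comp (measurable_addrV _).
have IF k : \int[mu]_x F k x = 0.
  have fi := TC_integ Tf.
  rewrite IntZ; last by apply: integB => //; exact: integ_shift.
  by rewrite IntB ?Int_shift// ?subrr ?mulr0//; exact: integ_shift.
(* The steps are at most 1 and the unit vectors have norm at most 1, so the quotients vanish outside
   the box enlarged by 1. *)
have FM k x : `|F k x| <= M * \1_(box (B + 1)) x.
  rewrite indicE; have [xB|xB] := boolP (x \in box (B + 1)).
    have [c [_ Hc]] := MVT_line (x := x) (e k) (fun t => df _).
    by rewrite /F Hc mulrA mulVf ?gt_eqF// mul1r mulr1.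
  move: xB; rewrite notin_setE /box/= => /negP; rewrite -ltNge => xB.
  rewrite /F !HB ?subrr ?mulr0 ?normr0//.
    by apply: lt_trans xB; rewrite ltrDl.
  rewrite -(ltrD2r 1); apply: lt_le_trans xB _.
  rewrite -[x in X in X <= _](addrK (e k *: basis i)); apply: le_trans (ler_normB _ _) _.
  rewrite lerD2l normrZ gtr0_norm//.
  by rewrite -[X in _ <= X]mulr1; apply: ler_pM => //; [exact: ltW|exact: basis_norm].
have : \int[mu]_x F k x @[k --> \oo] --> \int[mu]_x 'D_(basis i) f x.
  apply: (Int_dominated mF _ (integZ M (integ_box (B + 1))) FM).
    exact: continuous_measurable_rV (TC_cont (TC_D i Tf)).
  apply: aeW => x.
  pose g (h : R) := h^-1 *: (f (h *: basis i + x) - f x).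
  have gx : g @ 0^' --> 'D_(basis i) f x by exact: df.
  rewrite (_ : (fun k => F k x) = g \o e).
    by apply: (@cvgr_dnbhsP R g _ _).1 gx _ _; split; [move=> k; rewrite gt_eqF|exact: cvg_harmonic].
  by apply/funext => k; rewrite /F /g /= (addrC x).
rewrite (_ : (fun k => _) = fun=> 0); last by apply/funext => k; exact: IF.
by move=> H; rewrite -(cvg_lim _ H)// lim_cst.
Qed.

Lemma Int_IBP f g i : TC 1 setT f -> Ck setT 1 g ->
  \int[mu]_x (g x * 'D_(basis i) f x) = - \int[mu]_x ('D_(basis i) g x * f x).
Proof.
move=> Tf Cg; have Tfg := TC_Ml Tf Cg.
have dfx x : derivable f x (basis i) by exact: TC_derivable Tf.
have dgx x : derivable g x (basis i) by exact: (Ck_derivable Cg Logic.I).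
have E x : 'D_(basis i) (fun x => g x * f x) x = g x * 'D_(basis i) f x + 'D_(basis i) g x * f x.
  by rewrite [LHS](deriveM (dgx x) (dfx x)) [X in _ = _ + X](mulrC ('D_(basis i) g x)).
have := Int_D0 i Tfg.
under eq_Rintegral do rewrite E.
rewrite IntD.
- by move/eqP; rewrite addr_eq0 => /eqP.
- by apply: TC_integ (TC_Ml (TC_D i Tf) (CkW Cg)).
- by apply: TC_integ (TC_Ml (TC_W Tf) (Ck_D i Cg)).
Qed.

End compact_support.

(** * Bump functions and mollifying kernels *)

Section bump.
Context (R : realType).

(* [flat m x = x^(-m) exp(-1/x)] for [x > 0]; the derivative of [flat m] is
   [flat (m+2) - m flat (m+1)]. *)
Definition flat (m : nat) (x : R) : R :=
  if 0 < x then x^-1 ^+ m * expR (- x^-1) else 0.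

Lemma flat_ge0 m x : 0 <= flat m x.
Proof.
rewrite /flat; case: ifP => // x0.
by rewrite mulr_ge0 ?expR_ge0// exprn_ge0// invr_ge0 ltW.
Qed.

Lemma flat_le0 m x : x <= 0 -> flat m x = 0.
Proof. by rewrite /flat leNgt; case: ifP. Qed.

Lemma flat0_gt0 x : 0 < x -> 0 < flat 0 x.
Proof. by rewrite /flat => ->; rewrite expr0 mul1r expR_gt0. Qed.

Lemma flat0_le1 x : flat 0 x <= 1.
Proof.
rewrite /flat; case: ifP => // x0.
by rewrite expr0 mul1r -expR0 ler_expR oppr_le0 invr_ge0 ltW.
Qed.

(** From [t <= exp t] at [t = y / m], raised to the power [m]: [y^m <= m^m exp y]. *)
Lemma expRN_bound (m : nat) : exists2 C : R, 0 <= C & forall y, 0 < y -> y ^+ m * expR (- y) <= C.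
Proof.
exists (m%:R ^+ m); first exact: exprn_ge0.
move=> y y0; case: m => [|m].
  by rewrite !expr0 mul1r -expR0 ler_expR oppr_le0 ltW.
rewrite expRN ler_pdivrMr ?expR_gt0//.
have m0 : (0 : R) < m.+1%:R by rewrite ltr0n.
rewrite (_ : expR y = expR (y / m.+1%:R) ^+ m.+1); last first.
  by rewrite -expRM_natl mulrCA mulfV ?gt_eqF// mulr1.
rewrite -exprMn lerXn2r ?nnegrE ?mulr_ge0 ?expR_ge0//; first exact: ltW.
rewrite -(@ler_pM2l _ m.+1%:R^-1) ?invr_gt0// mulrA mulVf ?gt_eqF// mul1r mulrC.
by apply: le_trans (expR_ge1Dx _); rewrite lerDr.
Qed.

Lemma is_derive_flat m (x : R) :
  is_derive x (1 : R) (flat m) (flat m.+2 x - m%:R * flat m.+1 x).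
Proof.
have [x0|x0|->] := ltgtP x 0.
- rewrite !flat_le0 ?ltW// mulr0 subr0.
  apply: (near_eq_is_derive _ (is_derive_cst (0 : R) x (1 : R))).
  near=> y; rewrite flat_le0//=; apply: ltW; near: y; exact: lt_nbhsl.
- have xn0 : x != 0 by rewrite gt_eqF.
  apply: (@near_eq_is_derive _ _ _ (fun y : R => y^-1 ^+ m * expR (- y^-1))).
    near=> y; rewrite /flat ifT//; near: y; exact: lt_nbhsr.
  rewrite /flat x0.
  have d1 : is_derive x (1 : R) (fun y : R => y^-1) (- x^-1 ^+ 2).
    have := is_deriveV (f := id) xn0 (is_derive_id x (1 : R)).
    by case=> d e; apply: DeriveDef; [exact: d|rewrite e exprVn; exact: mulr1].
  have dG (t : R) : is_derive t (1 : R) (fun t => t ^+ m * expR (- t))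
     (m%:R * t ^+ m.-1 * expR (- t) - t ^+ m * expR (- t)).
    have d2 := is_derive1_comp (is_derive_expR (- t)) (is_deriveNid t (1 : R)).
    have d3 : is_derive t (1 : R) (fun t : R => t ^+ m) (m%:R * t ^+ m.-1).
      apply: DeriveDef; first exact: exprn_derivable.
      by rewrite exp_derive; exact: mulr1.
    have [d e] := is_deriveM d3 d2.
    apply: DeriveDef; first exact: d.
    apply: (etrans e); rewrite /GRing.scale /=; ring.
  have [d e] := is_derive_comp1 dG (let: DeriveDef d _ := d1 in d).
  apply: DeriveDef; first exact: d.
  rewrite e; have [_ ->] := d1; set t := x^-1; set E := expR (- t).
  case: m {dG d e} => [|m] /=; first by rewrite !mul0r !expr0; ring.
  rewrite !exprS; ring.
- rewrite !flat_le0// mulr0 subr0.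
  (* At 0 the quotient is [h^-(m+1) exp(-1/h)] for positive [h]. Putting [y = 1/h], the bound on
     [y^(m+2) exp(-y)] makes it at most [C h]. *)
  have [C C0 HC] := expRN_bound m.+2.
  have H : (fun h : R => h^-1 *: (flat m (h *: 1 + 0) - flat m 0)) @ 0^' --> (0 : R).
    apply/norm_cvg0P.
    apply: (@squeeze_cvgr _ _ _ _ (cst 0) (fun h : R => C * `|h|)).
    + near=> h; rewrite normr_ge0/= addr0 [h *: 1]mulr1 (flat_le0 m (lexx 0)) subr0.
      have [h0|h0] := leP h 0; first by rewrite flat_le0// scaler0 normr0 mulr_ge0.
      rewrite /flat h0 (ger0_norm (ltW h0)) -[_ *: _]/(_ * _) mulrA -exprS.
      rewrite ger0_norm; last by rewrite mulr_ge0 ?expR_ge0// exprn_ge0// invr_ge0 ltW.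
      rewrite -ler_pdivrMr// mulrC mulrA -exprS.
      by apply: HC; rewrite invr_gt0.
    + exact: cvg_cst.
    + have id0 : (fun h : R => h) @ 0^' --> (0 : R) by exact: nbhs_dnbhs.
      have H := cvgMl_tmp (a := C) (cvg_norm id0); rewrite normr0 mulr0 in H; exact: H.
  apply: DeriveDef; first by apply/cvg_ex; eexists; exact: H.
  exact: cvg_lim H.
Unshelve. all: by end_near. Qed.

Context (n : nat).
Local Notation V := 'rV[R]_n.
Local Notation mu := (@lebesgue_rV R n).

Lemma Ck_flat (A : set V) k m f : open A -> Ck A k f -> Ck A k (fun x => flat m (f x)).
Proof.
move=> oA; elim: k m f => [|k IH] m f.
  rewrite !Ck0P => cf x Ax; apply: (@continuous_comp _ _ _ f (flat m)); first exact: cf.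
  by apply: differentiable_continuous; apply/derivable1_diffP; have [] := is_derive_flat m (f x).
move=> /[dup] /CkW Wf /CkSP[cf df Cf]; apply/CkSP; split=> [x Ax|i x Ax|i].
- apply: (@continuous_comp _ _ _ f (flat m)); first exact: cf.
  by apply: differentiable_continuous; apply/derivable1_diffP; have [] := is_derive_flat m (f x).
- by have [] := is_derive_comp1 (is_derive_flat m) (df i x Ax).
- apply: eq_in_Ck (CkM oA (CkB oA (IH m.+2 f Wf) (CkZ m%:R oA (IH m.+1 f Wf))) (Cf i)) => // x Ax.
  by have [_ ->] := is_derive_comp1 (is_derive_flat m) (df i x Ax).
Qed.

(** A product over the coordinates, adapted to the sup norm: it is positive exactly on the open cube
    of radius [e]. *)
Definition bump (e : R) (x : V) : R :=
  \prod_(i < n) (flat 0 (e - x ord0 i) * flat 0 (e + x ord0 i)).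

Lemma bump_Ck e k : Ck setT k (bump e).
Proof.
apply: Ck_prod; first exact: openT.
move=> i; apply: CkM; first exact: openT.
  by apply: Ck_flat; [exact: openT|apply: CkB; [exact: openT|exact: Ck_cst|exact: Ck_coord]].
by apply: Ck_flat; [exact: openT|apply: CkD; [exact: openT|exact: Ck_cst|exact: Ck_coord]].
Qed.

Lemma bump_ge0 e x : 0 <= bump e x.
Proof. by apply: prodr_ge0 => i _; rewrite mulr_ge0 ?flat_ge0. Qed.

Lemma bump_gt0 e (x : V) : (forall i, `|x ord0 i| < e) -> 0 < bump e x.
Proof.
move=> H; apply: prodr_gt0 => i _; have := H i; rewrite ltr_norml => /andP[a b].
by rewrite mulr_gt0// flat0_gt0 ?subr_gt0// -ltrBlDl sub0r.
Qed.

Lemma bump_eq0 e x : 0 < e -> e <= `|x| -> bump e x = 0.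
Proof.
move=> e0 ex; have [i Hi] : exists i, e <= `|x ord0 i|.
  apply: contrapT => /forallNP H; move: ex; rewrite leNgt => /negP; apply.
  by apply/(norm_rV_ltP x e0) => i; rewrite ltNge; apply/negP; exact: H.
rewrite /bump (bigD1 i)//=.
suff -> : flat 0 (e - x ord0 i) * flat 0 (e + x ord0 i) = 0 by rewrite mul0r.
move: Hi; rewrite ler_normr; case/orP => H.
  by rewrite (flat_le0 _ (_ : e - _ <= 0)) ?mul0r// subr_le0.
by rewrite (flat_le0 _ (_ : e + x ord0 i <= 0)) ?mulr0// -lerBrDr sub0r.
Qed.

Lemma bump_cptin e : 0 < e -> cptin setT (bump e).
Proof. by move=> e0; apply: (@box_cptin _ _ _ e) => x /ltW; exact: bump_eq0. Qed.

(** Otherwise the bump would vanish almost everywhere, although it is positive on the cube of radius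
    [e / 2], whose measure is positive. *)
Lemma Int_bump_gt0 e : 0 < e -> 0 < \int[mu]_x bump e x.
Proof.
move=> e0; rewrite lt_def Int_ge0 ?andbT; last exact: bump_ge0.
apply/eqP => I0.
have bi : integ mu (bump e).
  by apply: (@integ_cpt _ _ setT); [exact: CkT_cont (@bump_Ck e 0)|exact: bump_cptin].
have [N [mN N0 HN]] := Int_eq0_ae bi (bump_ge0 e) I0.
pose S : set V := [set x | forall i, `|x ord0 i| <= e / 2].
have SN : S `<=` N.
  move=> x Sx; apply: HN => /=; apply/eqP; rewrite gt_eqF//; apply: bump_gt0 => i.
  by rewrite (le_lt_trans (Sx i))// ltr_pdivrMr// ltr_pMr// ltr1n.
have e2 : 0 < e / 2 by rewrite divr_gt0.
have := lebesgue_rV_box_gt0 n e2; rewrite ltNge => /negP; apply.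
rewrite -[leRHS]N0; apply: le_measure; rewrite ?inE//; exact: measurable_box.
Qed.

Definition ker e x := (\int[mu]_y bump e y)^-1 * bump e x.

Lemma ker_Ck e k : Ck setT k (ker e).
Proof. by apply: CkZ; [exact: openT|exact: bump_Ck]. Qed.

Lemma ker_ge0 e x : 0 < e -> 0 <= ker e x.
Proof. by move=> e0; rewrite mulr_ge0 ?bump_ge0// invr_ge0 ltW ?Int_bump_gt0. Qed.

Lemma ker_eq0 e x : 0 < e -> e <= `|x| -> ker e x = 0.
Proof. by move=> e0 ex; rewrite /ker bump_eq0// mulr0. Qed.

Lemma ker_TC e k : 0 < e -> TC k setT (ker e).
Proof.
move=> e0; split; first exact: ker_Ck.
by apply: (@box_cptin _ _ _ e) => x /ltW; exact: ker_eq0.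
Qed.

Lemma Int_ker e : 0 < e -> \int[mu]_x ker e x = 1.
Proof.
move=> e0; rewrite IntZ; first by rewrite mulVf// gt_eqF// Int_bump_gt0.
by apply: (@integ_cpt _ _ setT); [exact: CkT_cont (@bump_Ck e 0)|exact: bump_cptin].
Qed.

End bump.

Lemma lipschitz_continuous (R : realType) (W : normedModType R) (f : W -> R) (L : R) :
  0 <= L -> (forall x y, `|f x - f y| <= L * `|x - y|) -> continuous f.
Proof.
move=> L0 fL x; have L1 : 0 < L + 1 by rewrite ltr_wpDl.
apply/cvgrPdist_le => e e0; near=> y.
apply: le_trans (fL x y) _.
apply: (@le_trans _ _ ((L + 1) * `|x - y|)); first by rewrite ler_wpM2r// lerDl.
rewrite -ler_pdivlMl// mulrC; apply: ltW.
have : ball x (e / (L + 1)) y by near: y; apply: nbhsx_ballx; rewrite divr_gt0.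
by rewrite -ball_normE.
Unshelve. all: by end_near. Qed.

Section lipschitz.
Context (R : realType) (n : nat).
Local Notation V := 'rV[R]_n.
Implicit Types (f : V -> R) (x h : V).

Lemma rV_sum_basis h : h = \sum_i h ord0 i *: basis i.
Proof. by rewrite [LHS]row_sum_delta. Qed.

(** The path from [x] to [x + h] changes one coordinate at a time; each of the [n] moves costs at
    most [M |h|]. *)
Lemma C1_lipschitz f (M : R) : (forall i x, derivable f x (basis i)) ->
  (forall i x, `|'D_(basis i) f x| <= M) ->
  forall x h, `|f (x + h) - f x| <= n%:R * M * `|h|.
Proof.
move=> df fM x h.
have H (s : seq 'I_n) : `|f (x + \sum_(i <- s) h ord0 i *: basis i) - f x| <= (size s)%:R * (M * `|h|).
  elim: s x => [|i s IH] x.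
    by rewrite big_nil addr0 subrr normr0 mul0r.
  rewrite big_cons addrA (_ : _ - f x = (f (x + h ord0 i *: basis i + \sum_(j <- s) h ord0 j *: basis j)
     - f (x + h ord0 i *: basis i)) + (f (x + h ord0 i *: basis i) - f x)); last by ring.
  apply: le_trans (ler_normD _ _) _.
  rewrite [X in _ <= X * _](_ : _ = (size s)%:R + 1); last by rewrite /= -natr1.
  rewrite mulrDl mul1r; apply: lerD; first exact: IH.
  have [c [_ ->]] := MVT_line (x := x) (h ord0 i) (fun t => df i _).
  rewrite normrM mulrC; apply: ler_pM => //; exact: coord_le_norm.
have := H (index_enum 'I_n).
by rewrite -rV_sum_basis -mulrA {1}/index_enum -enumT size_enum_ord.
Qed.

Lemma TC1_lipschitz f A : TC 1 A f ->
  exists2 L : R, 0 <= L & forall x y, `|f x - f y| <= L * `|x - y|.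
Proof.
move=> Tf.
have [M HM] := choice (fun i => let: ex_intro2 M _ H := TC_bounded (TC_D i Tf) in ex_intro _ M H).
pose N := \sum_i `|M i|.
have N0 : 0 <= N by apply: sumr_ge0.
exists (n%:R * N); first by rewrite mulr_ge0.
have dfx i z : derivable f z (basis i) by exact: TC_derivable Tf.
have fN i z : `|'D_(basis i) f z| <= N.
  apply: le_trans (HM i z) _; apply: le_trans (ler_norm _) _.
  by rewrite /N (bigD1 i)//= lerDl sumr_ge0.
by move=> x y; have := C1_lipschitz dfx fN y (x - y); rewrite subrKC.
Qed.

End lipschitz.

(** * Convolution and mollification *)
Section convolution.
Context (R : realType) (n : nat).
Local Notation V := 'rV[R]_n.
Local Notation mu := (@lebesgue_rV R n).
Implicit Types (f g rho : V -> R).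

Definition conv f rho x := \int[mu]_y (f y * rho (x - y)).

Lemma measurable_subrV (x : V) : measurable_fun setT (fun y : V => x - y).
Proof.
apply: measurable_fun_rVP => j; under eq_fun do rewrite !mxE.
by apply: measurable_funB => //; exact: measurable_coord.
Qed.

Lemma Int_refl f (x : V) : measurable_fun setT f ->
  \int[mu]_y f (x - y) = \int[mu]_y f y.
Proof.
move=> mf; rewrite -(Int_shift x mf) /Rintegral; congr fine.
have mg : measurable_fun setT (fun y : V => (f (y + x))%:E).
  by apply/measurable_EFinP; exact: measurableT_comp (measurable_addrV x).
by rewrite -(integral_opp mg); apply: eq_integral => y _; rewrite addrC.
Qed.

Lemma integ_refl f (x : V) : integ mu f -> integ mu (fun y => f (x - y)).
Proof.
move=> /(integ_shift x) fi; have mf := integ_meas fi.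
apply/integrableP; split.
  apply/measurable_EFinP; rewrite (_ : (fun _ => _) = (fun y => f (y + x)) \o -%R).
    exact: (measurableT_comp mf (@measurable_opprV _ n)).
  by apply/funext => y /=; rewrite addrC.
have /integrableP[mf2] := fi.
rewrite -[X in (X < _)%E -> _]integral_opp; last exact: measurableT_comp.
by under eq_integral do rewrite /= addrC.
Qed.

Lemma conv_integ f rho x : integ mu f -> continuous rho -> cptin setT rho ->
  integ mu (fun y => f y * rho (x - y)).
Proof.
move=> fi crho srho; have [M M0 HM] := cptin_bounded crho srho.
apply: integ_le (integZ M (integ_abs fi)).
  apply: measurable_funM; first exact: (integ_meas fi).
  exact: (measurableT_comp (continuous_measurable_rV crho) (measurable_subrV x)).
by move=> y; rewrite normrM mulrC ler_wpM2r.
Qed.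

Lemma conv_lipschitz f rho (L : R) x x' : integ mu f -> continuous rho -> cptin setT rho ->
  (forall x y, `|rho x - rho y| <= L * `|x - y|) ->
  `|conv f rho x - conv f rho x'| <= L * `|x - x'| * \int[mu]_y `|f y|.
Proof.
move=> fi crho srho rhoL.
have ix := conv_integ x fi crho srho; have ix' := conv_integ x' fi crho srho.
rewrite /conv -IntB//; apply: le_trans (Int_abs (integB ix ix')) _.
rewrite -IntZ; last exact: integ_abs.
apply: Int_le; [exact/integ_abs/integB|exact/integZ/integ_abs|].
move=> y; rewrite -mulrBr normrM mulrC ler_wpM2r//.
by apply: le_trans (rhoL _ _) _; rewrite opprB addrA subrK.
Qed.

(** The derivative falls on [rho], as [f] is merely integrable. The difference quotients of [rho]
    are values of its derivative, so [M |f|] dominates. *)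
Lemma is_derive_conv f rho x i : integ mu f -> TC 1 setT rho ->
  is_derive x (basis i) (conv f rho) (conv f ('D_(basis i) rho) x).
Proof.
move=> fi Tr.
have cr := TC_cont Tr; have TDr := TC_D i Tr.
have [M M0 HM] := TC_bounded TDr.
have dr y : derivable rho y (basis i) by exact: TC_derivable Tr.
suff H : (fun h : R => h^-1 *: (conv f rho (h *: basis i + x) - conv f rho x)) @ 0^'
    --> conv f ('D_(basis i) rho) x.
  by apply: DeriveDef; [apply/cvg_ex; eexists; exact: H|exact: cvg_lim H].
apply/cvgr_dnbhsP => u [un0 u0].
pose F k y := f y * ((u k)^-1 * (rho (x - y + u k *: basis i) - rho (x - y))).
have EF k : (u k)^-1 *: (conv f rho (u k *: basis i + x) - conv f rho x) = \int[mu]_y F k y.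
  rewrite /conv -IntB; [|exact: (conv_integ _ fi cr Tr.2)..].
  rewrite -[LHS]/(_ * _) -IntZ; last by apply: integB; exact: (conv_integ _ fi cr Tr.2).
  apply: eq_Rintegral => y _; rewrite /F -mulrBr mulrCA.
  by congr (_ * (_ * (rho _ - _))); rewrite (addrC (_ *: _)) addrAC.
under eq_cvg do rewrite EF.
have mr : measurable_fun setT rho by exact: continuous_measurable_rV.
apply: (Int_dominated (g := fun y => M * `|f y|)).
- move=> k; apply: measurable_funM; first exact: (integ_meas fi).
  apply: measurable_funM => //; apply: measurable_funB.
    apply: (measurableT_comp mr); rewrite (_ : (fun _ => _) = (fun y : V => (x + u k *: basis i) - y)).
      exact: measurable_subrV.
    by apply/funext => y; rewrite addrAC.
  exact: (measurableT_comp mr (measurable_subrV x)).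
- apply: measurable_funM; first exact: (integ_meas fi).
  exact: (measurableT_comp (continuous_measurable_rV (TC_cont TDr)) (measurable_subrV x)).
- exact/integZ/integ_abs.
- move=> k y; rewrite /F normrM mulrC ler_wpM2r//.
  have [c [_ ->]] := MVT_line (x := x - y) (u k) (fun t => dr _).
  by rewrite mulrA mulVf ?mul1r.
- apply: aeW => y; apply: cvgMl_tmp.
  pose g (h : R) := h^-1 *: (rho (h *: basis i + (x - y)) - rho (x - y)).
  have gx : g @ 0^' --> 'D_(basis i) rho (x - y) by exact: dr.
  have := (@cvgr_dnbhsP R g _ _).1 gx u (conj un0 u0).
  by apply: cvg_trans; apply: near_eq_cvg; apply: nearW => k; rewrite /g (addrC (x - y)).
Qed.

Lemma conv_Ck f rho : integ mu f -> (forall k, TC k setT rho) ->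
  forall k, Ck setT k (conv f rho).
Proof.
move=> fi Tr k; elim: k rho Tr => [|k IH] rho Tr.
  apply/Ck0P => x _.
  have [L L0 HL] := TC1_lipschitz (Tr 1).
  apply: (@lipschitz_continuous _ _ _ (L * \int[mu]_y `|f y|)); first by rewrite mulr_ge0// Int_ge0.
  by move=> y z; rewrite mulrAC; exact: (conv_lipschitz y z fi (TC_cont (Tr 1)) (Tr 1).2 HL).
apply/CkSP; split=> [x _|i x _|i].
- exact: (Ck_cont (IH rho Tr)).
- by have [] := is_derive_conv x i fi (Tr 1).
- have := IH _ (fun k => TC_D i (Tr k.+1)); apply: eq_in_Ck; first exact: openT.
  by move=> x _; have [_ ->] := is_derive_conv x i fi (Tr 1).
Qed.

(* Tested with [rho (x - _)]. *)
Lemma conv_weak_D f g rho i x : integ mu f -> TC 1 setT rho ->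
  (\int[mu]_y (f y * 'D_(basis i) (fun y => rho (x - y)) y) =
    - \int[mu]_y (g y * rho (x - y))) ->
  'D_(basis i) (conv f rho) x = conv g rho x.
Proof.
move=> fi Tr H; have [_ ->] := is_derive_conv x i fi Tr.
rewrite /conv -[RHS]opprK -H.
have dr y : derivable rho y (basis i) by exact: TC_derivable Tr.
have E y : f y * 'D_(basis i) (fun y => rho (x - y)) y = - (f y * 'D_(basis i) rho (x - y)).
  by have [_ ->] := is_derive_reflV (dr (x - y)); rewrite mulrN.
under [in RHS]eq_Rintegral do rewrite E.
by rewrite IntN ?opprK//; exact: (conv_integ _ fi (TC_cont (TC_D i Tr)) (TC_D i Tr).2).
Qed.

Lemma convE f rho x : measurable_fun setT f -> continuous rho ->
  conv f rho x = \int[mu]_y (f (x - y) * rho y).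
Proof.
move=> mf cr; rewrite -[RHS](@Int_refl _ x).
  by apply: eq_Rintegral => y _; rewrite opprB addrCA subrr addr0.
apply: measurable_funM; last exact: continuous_measurable_rV.
exact: (measurableT_comp mf (measurable_subrV x)).
Qed.

Lemma conv_eq0 f rho (K : set V) e x : (forall y, ~ K y -> f y = 0) ->
  (forall y, e <= `|y| -> rho y = 0) -> (forall y, K y -> e <= `|x - y|) ->
  conv f rho x = 0.
Proof.
move=> f0 r0 Kx; rewrite /conv -[RHS](@Int0 _ _ _ mu); apply: eq_Rintegral => y _.
have [/Kx/r0 ->|/f0 ->] := pselect (K y); by rewrite ?mulr0 ?mul0r.
Qed.

End convolution.

(** * Jensen's inequality and L^p bounds for mollification *)

Section jensen.
Context (R : realType).

(* Powers for which the tangent line inequality is available: enough for the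
   exponents 2 and 6. *)
Record convex_power (p : nat) : Prop := ConvexPower {
  cp_tangent : forall m t : R, m ^+ p + p%:R * m ^+ p.-1 * (t - m) <= t ^+ p;
  cp_ge0 : forall t : R, 0 <= t ^+ p;
  cp_norm : forall t : R, `|t| <= 1 + t ^+ p }.

Lemma convex_power2 : convex_power 2.
Proof.
split=> [m t|t|t].
- by rewrite /= expr1 -subr_ge0 (_ : _ - _ = (t - m) ^+ 2) ?sqr_ge0//; ring.
- exact: sqr_ge0.
- rewrite -real_normK ?num_real//; have := sqr_ge0 (`|t| - 1); have := normr_ge0 t; nra.
Qed.

Lemma convex_power6 : convex_power 6.
Proof.
split=> [m t|t|t].
(* Divided by [(t - m)^2], the remainder is [t^4 + 2 t^3 m + 3 t^2 m^2 + 4 t m^3 + 5 m^4], written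
   as a sum of squares. *)
- rewrite /= -subr_ge0 (_ : _ - _ = (t - m) ^+ 2 * ((t ^+ 2 + t * m) ^+ 2
    + 2 * (t * m + m ^+ 2) ^+ 2 + 3 * m ^+ 4)); last by ring.
  rewrite mulr_ge0 ?sqr_ge0// !addr_ge0 ?sqr_ge0// mulr_ge0 ?sqr_ge0//.
  by rewrite (_ : m ^+ 4 = (m ^+ 2) ^+ 2) ?sqr_ge0//; ring.
- by rewrite (_ : t ^+ 6 = (t ^+ 3) ^+ 2) ?sqr_ge0//; ring.
- have [t1|t1] := leP `|t| 1.
    rewrite (le_trans t1)// lerDl (_ : t ^+ 6 = (t ^+ 3) ^+ 2) ?sqr_ge0//; ring.
  rewrite (_ : t ^+ 6 = `|t| ^+ 6); last first.
    by rewrite -normrX ger0_norm// (_ : t ^+ 6 = (t ^+ 3) ^+ 2) ?sqr_ge0//; ring.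
  rewrite (le_trans (_ : `|t| <= `|t| ^+ 6))// ?lerDr//.
  by rewrite -[X in X <= _]expr1 ler_eXn2l// ltW.
Qed.

Context d (T : measurableType d) (mu : {measure set T -> \bar R}).

(** The tangent line inequality at the mean [m] of [g] is integrated against the probability density
    [rho]. When the right-hand side is infinite there is nothing to prove. *)
Lemma jensen_power p (rho g : T -> R) : convex_power p -> integ mu rho ->
  (forall x, 0 <= rho x) -> \int[mu]_x rho x = 1 -> measurable_fun setT g ->
  (((\int[mu]_x (g x * rho x)) ^+ p)%:E <= \int[mu]_x (g x ^+ p * rho x)%:E)%E.
Proof.
move=> cp ri r0 r1 mg.
have mr := integ_meas ri.
have mgp : measurable_fun setT (fun x => g x ^+ p * rho x).
  by apply: measurable_funM => //; exact: measurable_funX.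
have gp0 x : 0 <= g x ^+ p * rho x by rewrite mulr_ge0// (cp_ge0 cp).
have [oo|] := pselect (\int[mu]_x (g x ^+ p * rho x)%:E < +oo)%E; last first.
  by move=> /negP; rewrite -leNgt leye_eq => /eqP ->; rewrite leey.
have igp : integ mu (fun x => g x ^+ p * rho x) by apply/integ_ge0P.
have ig : integ mu (fun x => g x * rho x).
  apply: integ_le (integD ri igp); first exact: measurable_funM.
  by move=> x; rewrite normrM (ger0_norm (r0 x)) -[X in X + _]mul1r -mulrDl ler_wpM2r// (cp_norm cp).
rewrite Int_EFin// lee_fin.
set m := \int[mu]_x (g x * rho x).
have -> : m ^+ p = \int[mu]_x ((m ^+ p - p%:R * m ^+ p.-1 * m) * rho x + p%:R * m ^+ p.-1 * (g x * rho x)).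
  rewrite IntD ?IntZ//; [|exact: integZ..].
  rewrite r1 -/m; ring.
apply: Int_le => //; first by apply: integD; exact: integZ.
move=> x; apply: le_trans (ler_wpM2r (r0 x) (cp_tangent cp m (g x))).
rewrite le_eqVlt; apply/orP; left; apply/eqP; ring.
Qed.

End jensen.

Section mollification.
Context (R : realType) (n : nat).
Local Notation V := 'rV[R]_n.
Local Notation mu := (@lebesgue_rV R n).
Implicit Types (f g : V -> R) (e : R).

Lemma measurable_subV2 : measurable_fun setT (fun z : V * V => z.1 - z.2).
Proof.
apply: measurable_fun_rVP => j; under eq_fun do rewrite !mxE.
apply: measurable_funB.
  exact: (measurableT_comp (measurable_coord j) measurable_fst).
exact: (measurableT_comp (measurable_coord j) measurable_snd).
Qed.

(** Jensen in [y], then Tonelli. The two-variable [G] covers both uses: [f (x - y)] for norm bounds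
    and [f (x - y) - f x] for the approximation error. Only shifts with [|y| <= e] count, as the
    kernel vanishes beyond. *)
Lemma ker_avg_le p (G : V -> V -> R) e (C : R) : convex_power R p -> 0 < e -> 0 <= C ->
  measurable_fun setT (fun z : V * V => G z.1 z.2) ->
  measurable_fun setT (fun x => \int[mu]_y (G x y * ker e y)) ->
  (forall y, `|y| <= e -> (\int[mu]_x (G x y ^+ p)%:E <= C%:E)%E) ->
  (\int[mu]_x ((\int[mu]_y (G x y * ker e y)) ^+ p)%:E <= C%:E)%E.
Proof.
move=> cp e0 C0 mG mI GC.
have kc : continuous (@ker R n e) by exact: TC_cont (ker_TC n 0 e0).
have mk : measurable_fun setT (@ker R n e) by exact: continuous_measurable_rV.
have ki : integ mu (@ker R n e) by exact: TC_integ (ker_TC n 0 e0).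
have k0 y : 0 <= ker e y by exact: ker_ge0.
have mGp : measurable_fun setT (fun z : V * V => (G z.1 z.2 ^+ p * ker e z.2)%:E).
  apply/measurable_EFinP/measurable_funM; first exact: measurable_funX.
  exact: (measurableT_comp mk measurable_snd).
have Gp0 z : (0 <= (G z.1 z.2 ^+ p * ker e z.2)%:E)%E.
  by rewrite lee_fin mulr_ge0// (cp_ge0 cp).
apply: (@le_trans _ _ (\int[mu]_x \int[mu]_y (G x y ^+ p * ker e y)%:E)%E).
  apply: ge0_le_integral => //.
  - by move=> x _; rewrite lee_fin (cp_ge0 cp).
  - by apply/measurable_EFinP/measurable_funX.
  - exact: (@measurable_fun_fubini_tonelli_F _ _ _ _ _ mu _ mGp Gp0).
  - move=> x _; apply: jensen_power => //; first exact: Int_ker.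
    exact: (measurableT_comp mG (measurable_pair1 x)).
rewrite (@fubini_tonelli _ _ _ _ _ mu mu (fun z => (G z.1 z.2 ^+ p * ker e z.2)%:E) mGp Gp0).
apply: (@le_trans _ _ (\int[mu]_y (C * ker e y)%:E)%E); last first.
  by rewrite (Int_EFin (integZ C ki)) (IntZ C ki) Int_ker// mulr1.
apply: ge0_le_integral => //.
- by move=> y _; apply: integral_ge0 => x _; exact: Gp0.
- exact: (@measurable_fun_fubini_tonelli_G _ _ _ _ _ mu _ mGp Gp0).
- by apply/measurable_EFinP/measurable_funM.
- move=> y _ /=; have [ye|ye] := leP `|y| e; last first.
    rewrite (@ker_eq0 _ _ e y e0 (ltW ye)) mulr0 integral0_eq// => x _; by rewrite mulr0.
  under eq_integral do rewrite mulrC EFinM.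
  rewrite ge0_integralZl//.
  + rewrite (mulrC C) (EFinM (ker e y) C); apply: lee_wpmul2l; first by rewrite lee_fin.
    exact: GC.
  + apply/measurable_EFinP/measurable_funX.
    exact: (measurableT_comp mG (measurable_pair2 y)).
  + by move=> x _; rewrite lee_fin (cp_ge0 cp).
  + by rewrite lee_fin.
Qed.

Lemma conv_cont f e : 0 < e -> integ mu f -> continuous (conv f (ker e)).
Proof.
by move=> e0 fi; apply: (@CkT_cont _ _ 0); apply: conv_Ck => // k; exact: ker_TC.
Qed.

Lemma conv_power_le p f e : convex_power R p -> 0 < e -> integ mu f ->
  integ mu (fun x => f x ^+ p) ->
  integ mu (fun x => conv f (ker e) x ^+ p) /\
  \int[mu]_x (conv f (ker e) x ^+ p) <= \int[mu]_x (f x ^+ p).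
Proof.
move=> cp e0 fi fpi.
have mf := integ_meas fi.
have kc : continuous (@ker R n e) by exact: TC_cont (ker_TC n 0 e0).
have cc := conv_cont e0 fi.
have E x : conv f (ker e) x = \int[mu]_y (f (x - y) * ker e y) by exact: convE.
have H : (\int[mu]_x (conv f (ker e) x ^+ p)%:E <= (\int[mu]_x (f x ^+ p))%:E)%E.
  under eq_integral do rewrite E.
  apply: ker_avg_le => //.
  - by apply: Int_ge0 => x; exact: (cp_ge0 cp).
  - exact: (measurableT_comp mf measurable_subV2).
  - by under eq_fun do rewrite -E; exact: continuous_measurable_rV.
  - move=> y _; rewrite -Int_EFin//.
    by rewrite (integral_shift (- y) (f := fun x => (f x ^+ p)%:E)); last exact/measurable_EFinP/measurable_funX.
have i1 : integ mu (fun x => conv f (ker e) x ^+ p).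
  apply/integ_ge0P.
  - by apply: measurable_funX; exact: continuous_measurable_rV.
  - by move=> x; exact: (cp_ge0 cp).
  - by apply: le_lt_trans H _; rewrite ltry.
by split=> //; rewrite -lee_fin -Int_EFin.
Qed.

(** The kernel has integral 1, so [f x] can be pulled into the average; the error of mollification
    is then at most the L^2 modulus of continuity of translations. *)
Lemma conv_sub_le f e C : 0 < e -> 0 <= C -> integ mu f -> L2 mu f ->
  (forall h, `|h| <= e -> \int[mu]_x ((f (x - h) - f x) ^+ 2) <= C) ->
  L2 mu (conv f (ker e)) /\ \int[mu]_x ((conv f (ker e) x - f x) ^+ 2) <= C.
Proof.
move=> e0 C0 fi Lf fC.
have [mf f2] := Lf.
have kc : continuous (@ker R n e) by exact: TC_cont (ker_TC n 0 e0).
have cc := conv_cont e0 fi.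
have Lc : L2 mu (conv f (ker e)).
  split; first exact: continuous_measurable_rV.
  by have [] := conv_power_le (convex_power2 R) e0 fi f2.
split=> //.
have mk : measurable_fun setT (@ker R n e) by exact: continuous_measurable_rV.
have ki : integ mu (@ker R n e) by exact: TC_integ (ker_TC n 0 e0).
have ifk x : integ mu (fun y => f (x - y) * ker e y).
  have := integ_refl x (conv_integ x fi kc (ker_TC n 0 e0).2).
  by apply: integ_eq => y; rewrite subKr.
have E x : conv f (ker e) x - f x = \int[mu]_y ((f (x - y) - f x) * ker e y).
  under eq_Rintegral do rewrite mulrBl.
  rewrite (IntB (ifk x) (integZ (f x) ki)) (IntZ (f x) ki) Int_ker// mulr1.
  by rewrite -convE.
rewrite -lee_fin -Int_EFin; last by case: (L2B Lc Lf).
under eq_integral do rewrite E.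
apply: (ker_avg_le (convex_power2 R)) => //.
- apply: measurable_funB; first exact: (measurableT_comp mf measurable_subV2).
  exact: (measurableT_comp mf measurable_fst).
- by under eq_fun do rewrite -E; apply: measurable_funB => //; exact: continuous_measurable_rV.
- move=> h he; rewrite Int_EFin ?lee_fin ?fC//.
  have Ls : L2 mu (fun x => f (x - h)).
    split; first exact: measurableT_comp (measurable_addrV _).
    exact: (integ_shift (- h) f2).
  by case: (L2B Ls Lf).
Qed.

End mollification.

(** * Continuity of translations in L^2 *)

Section translation_continuity.
Context (R : realType) (n : nat).
Local Notation V := 'rV[R]_n.
Local Notation mu := (@lebesgue_rV R n).
Implicit Types (f g : V -> R) (A B : set V).

(** Presents the measurable sets as generated by the open sets, a family stable under intersection,
    as Dynkin's induction requires. *)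
Lemma measurable_rV_open : @measurable _ V = <<s @open V >>.
Proof.
apply/seteqP; split; last first.
  apply: smallest_sub; first exact: sigma_algebra_measurable.
  exact: open_measurable_rV.
apply: smallest_sub; first exact: smallest_sigma_algebra.
rewrite -bigcup_seq; apply: bigcup_sub => i _.
suff mc : measurable_fun setT (fun x : g_sigma_algebraType (@open V) => (x : V) ord0 i).
  by move=> A [B mB <-]; exact: mc.
apply: (measurability _ (RGenOpens.measurableE R)).
move=> _ [_ [a [b ->] <-]]; rewrite setTI; apply: sub_sigma_algebra.
apply: open_comp; last exact: interval_open.
by move=> x _; exact: coord_continuous.
Qed.

Lemma L2_shift f (a : V) : L2 mu f -> L2 mu (fun x => f (x + a)).
Proof.
move=> [mf f2]; split; first exact: (measurableT_comp mf (measurable_addrV a)).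
exact: (integ_shift a f2).
Qed.

Lemma Int_sqr_shift f g (a : V) : L2 mu f -> L2 mu g ->
  \int[mu]_x ((f (x + a) - g (x + a)) ^+ 2) = \int[mu]_x ((f x - g x) ^+ 2).
Proof.
move=> [mf _] [mg _].
rewrite -(@Int_shift R n (fun x => (f x - g x) ^+ 2) a)//.
by apply: measurable_funX; exact: measurable_funB.
Qed.

Definition L2cont f := forall d : R, 0 < d ->
  exists2 e : R, 0 < e & forall h, `|h| <= e -> \int[mu]_x ((f (x - h) - f x) ^+ 2) <= d.

Lemma L2cont_Z c f : L2 mu f -> L2cont f -> L2cont (fun x => c * f x).
Proof.
move=> Lf fc d d0.
have [e e0 he] := fc (d / (c ^+ 2 + 1)) ltac:(by rewrite divr_gt0// ltr_wpDl// sqr_ge0).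
exists e => // h /he H.
under eq_Rintegral do rewrite -mulrBr exprMn.
rewrite IntZ; last by case: (L2B (L2_shift (- h) Lf) Lf).
apply: le_trans (ler_wpM2l (sqr_ge0 c) H) _.
rewrite mulrA ler_pdivrMr ?ltr_wpDl ?sqr_ge0// mulrC ler_pM2l// lerDl//.
Qed.

Lemma L2cont_D f g : L2 mu f -> L2 mu g -> L2cont f -> L2cont g ->
  L2cont (fun x => f x + g x).
Proof.
move=> Lf Lg fc gc d d0.
have d4 : 0 < d / 4 by rewrite divr_gt0.
have [e e0 he] := fc _ d4; have [e' e0' he'] := gc _ d4.
exists (Num.min e e'); first by rewrite lt_min e0.
move=> h; rewrite le_min => /andP[/he H /he' H'].
under eq_Rintegral do rewrite opprD addrACA.
apply: le_trans (Int_sqrD (L2B (L2_shift (- h) Lf) Lf) (L2B (L2_shift (- h) Lg) Lg)) _.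
by move: H H'; lra.
Qed.

Lemma L2cont_0 : L2cont (fun=> 0).
Proof.
move=> d d0; exists 1 => // h _; under eq_Rintegral do rewrite subrr expr0n.
by rewrite Int0 ltW.
Qed.

Lemma L2cont_sum (J : Type) (r : seq J) (F : J -> V -> R) :
  (forall j, L2 mu (F j)) -> (forall j, L2cont (F j)) ->
  L2cont (fun x => \sum_(j <- r) F j x).
Proof.
move=> LF cF; elim: r => [|j r IH].
  rewrite (_ : (fun _ => _) = fun=> 0); first exact: L2cont_0.
  by apply/funext => x; rewrite big_nil.
rewrite (_ : (fun _ => _) = fun x => F j x + \sum_(j <- r) F j x); last first.
  by apply/funext => x; rewrite big_cons.
by apply: L2cont_D => //; exact: L2_sum.
Qed.

Lemma L2cont_lim (F : nat -> V -> R) f : (forall k, L2 mu (F k)) -> L2 mu f ->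
  (forall k, L2cont (F k)) ->
  \int[mu]_x ((F k x - f x) ^+ 2) @[k --> \oo] --> 0 -> L2cont f.
Proof.
move=> LF Lf cF Ff d d0.
have d12 : 0 < d / 12 by rewrite divr_gt0.
have /cvgrPdist_lt/(_ _ d12)[k _ /(_ k (leqnn k))/=] := Ff.
rewrite sub0r normrN => /(le_lt_trans (ler_norm _)) kd.
have [e e0 he] := cF k _ d12; exists e => // h /he H.
have L1 := L2_shift (- h) Lf; have L2' := L2_shift (- h) (LF k).
have E x : f (x - h) - f x = (f (x - h) - F k (x - h)) + ((F k (x - h) - F k x) + (F k x - f x)).
  by ring.
under eq_Rintegral do rewrite E.
have La := L2B L1 L2'; have Lb := L2B L2' (LF k); have Lc := L2B (LF k) Lf.
apply: le_trans (Int_sqrD La (L2D Lb Lc)) _.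
have := Int_sqrD Lb Lc.
have := Int_sqr_shift (- h) Lf (LF k).
rewrite (Int_sqrBC mu f (F k)).
by move: H kd; lra.
Qed.

(** Sequences of translations give access to dominated convergence. *)
Lemma L2cont_seq f : L2 mu f ->
  (forall h : nat -> V, h @ \oo --> (0 : V) ->
    \int[mu]_x ((f (x - h k) - f x) ^+ 2) @[k --> \oo] --> 0) ->
  L2cont f.
Proof.
move=> Lf H d d0; apply: contrapT => nH.
have Hk (k : nat) : exists h : V, `|h| <= k.+1%:R^-1 /\
    d < \int[mu]_x ((f (x - h) - f x) ^+ 2).
  apply: contrapT => nk; apply: nH; exists k.+1%:R^-1 => // h hk.
  by rewrite leNgt; apply/negP => hd; apply: nk; exists h.
pose h k := projT1 (cid (Hk k)).
have hP k := projT2 (cid (Hk k)).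
have h0 : h @ \oo --> (0 : V).
  apply/norm_cvg0P.
  apply: (@squeeze_cvgr _ _ _ _ (fun=> 0) (@harmonic R)); last 2 first.
  - exact: cvg_cst.
  - exact: cvg_harmonic.
  by near=> k; rewrite normr_ge0/=; exact: (hP k).1.
have /cvgrPdist_lt/(_ _ d0)[k _ /(_ k (leqnn k))/=] := H h h0.
rewrite sub0r normrN => /(le_lt_trans (ler_norm _)) kd.
by have := lt_trans kd (hP k).2; rewrite ltxx.
Unshelve. all: by end_near.
Qed.

Lemma L2_indic A : measurable A -> (mu A < +oo)%E -> L2 mu (\1_A : V -> R).
Proof.
move=> mA Afin; split; first exact: measurable_indic.
rewrite (_ : (fun x => _) = (\1_A : V -> R)).
  apply/integ_ge0P; [exact: measurable_indic|by []|].
  by rewrite integral_indic// setIT.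
by apply/funext => x; rewrite indicE; case: (x \in A); rewrite ?expr1n ?expr0n.
Qed.

Lemma indic_sqr A x : (\1_A x : R) ^+ 2 = \1_A x.
Proof. by rewrite indicE; case: (x \in A); rewrite ?expr1n ?expr0n. Qed.

(** The squared difference integrates to [2 |U|] minus twice the measure of the overlap of [U] with
    its translate; for open [U] every point of [U] eventually lies in the translate, so the overlap
    fills [U]. *)
Lemma L2cont_indic_open (U : set V) : open U -> (mu U < +oo)%E -> L2cont (\1_U : V -> R).
Proof.
move=> oU Ufin.
have mU := open_measurable_rV oU.
have LU := L2_indic mU Ufin.
have iU : integ mu (\1_U : V -> R).
  by have := LU.2; under eq_fun do rewrite indic_sqr.
apply: L2cont_seq => // h h0.
have mUh k : measurable_fun setT (fun x : V => \1_U (x - h k) : R).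
  exact: (L2_shift (- h k) LU).1.
have iUh k : integ mu (fun x : V => \1_U (x - h k) : R) := integ_shift (- h k) iU.
have iP k : integ mu (fun x : V => \1_U (x - h k) * \1_U x : R).
  by apply: L2_integM => //; exact: (L2_shift (- h k) LU).
have E k : \int[mu]_x ((\1_U (x - h k) - \1_U x : R) ^+ 2) =
    2 * \int[mu]_x (\1_U x : R) - 2 * \int[mu]_x (\1_U (x - h k) * \1_U x).
  under eq_Rintegral => x _.
    rewrite (_ : _ ^+ 2 = (\1_U (x - h k) + \1_U x) - 2 * (\1_U (x - h k) * \1_U x)).
      over.
    rewrite sqrrB !indic_sqr -mulr_natl; ring.
  rewrite (IntB (integD (iUh k) iU) (integZ 2 (iP k))) (IntZ 2 (iP k)).
  rewrite (IntD (iUh k) iU) (Int_shift (- h k) (f := \1_U : V -> R) LU.1).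
  by ring.
suff C : \int[mu]_x (\1_U (x - h k) * \1_U x : R) @[k --> \oo] --> \int[mu]_x (\1_U x : R).
  have H : (fun k => 2 * \int[mu]_x (\1_U x : R) - 2 * \int[mu]_x (\1_U (x - h k) * \1_U x : R))
      @ \oo --> 2 * \int[mu]_x (\1_U x : R) - 2 * \int[mu]_x (\1_U x : R).
    by apply: cvgB; [exact: cvg_cst|exact: cvgMl_tmp].
  rewrite subrr in H; under eq_fun do rewrite E; exact: H.
apply: (Int_dominated (g := \1_U : V -> R)) => //.
- by move=> k; exact: integ_meas (iP k).
- move=> k x; rewrite !indicE; case: (x \in U); rewrite ?mulr0 ?normr0//.
  by case: (x - h k \in U); rewrite ?mul1r ?mul0r ?normr0 ?normr1.
apply: aeW => x; have [Ux|nUx] := pselect (U x); last first.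
  rewrite (_ : (fun k => _) = fun=> 0) ?indicE ?memNset//; first exact: cvg_cst.
  by apply/funext => k; rewrite mulr0.
apply: (@cvg_trans _ ((fun k : nat => 1 : R) @ \oo)); last first.
  by rewrite indicE mem_set//; exact: cvg_cst.
apply: near_eq_cvg.
have xh : (fun k => x - h k) @ \oo --> x.
  have H : (fun k => x - h k) @ \oo --> x - 0 by apply: cvgB => //; exact: cvg_cst.
  by rewrite subr0 in H.
have /xh : nbhs x U by move: oU; rewrite openE; apply.
move=> [k0 _ H]; exists k0 => // k /H/= Uk.
by rewrite !indicE !mem_set// mulr1.
Qed.

(** Dynkin induction from the open sets. Intersecting with a ball keeps measures finite when passing
    to complements, and the claim is carried for all radii at once. *)
Lemma L2cont_indic A M : measurable A -> L2cont (\1_(A `&` ball (0 : V) M) : V -> R).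
Proof.
pose P A := forall M, L2cont (\1_(A `&` ball (0 : V) M) : V -> R).
move=> mA; suff : P A by [].
have bfin (M' : R) : (mu (ball (0%R : V) M') < +oo)%E.
  apply: le_lt_trans (box_finite n M'); apply: le_measure; rewrite ?inE.
  - by apply: open_measurable_rV; exact: ball_open.
  - exact: box_meas.
  - by move=> x; rewrite -ball_normE/= /box/= sub0r normrN => /ltW.
have mb (M' : R) : measurable (ball (0 : V) M') by exact: measurable_cube.
have fin (B : set V) M' : measurable B -> (mu (B `&` ball (0%R : V) M') < +oo)%E.
  move=> mB; apply: le_lt_trans (bfin M').
  by apply: le_measure; rewrite ?inE//; exact: measurableI.
have L B M' : measurable B -> L2 mu (\1_(B `&` ball (0 : V) M') : V -> R).
  by move=> mB; apply: L2_indic; [exact: measurableI|exact: fin].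
move: mA; rewrite measurable_rV_open.
apply: dynkin_induction.
- exact: measurable_rV_open.
- by move=> B C; exact: openI.
- by move=> M'; rewrite setTI; apply: L2cont_indic_open => //; exact: ball_open.
- move=> B oB M'; apply: L2cont_indic_open; first by apply: openI => //; exact: ball_open.
  by apply: fin; exact: open_measurable_rV.
- move=> S mS PS M'.
  rewrite (_ : \1__ = fun x => \1_(setT `&` ball (0 : V) M') x + (-1) * \1_(S `&` ball (0 : V) M') x); last first.
    apply/funext => x; rewrite setTI; move: (ball _ _) => Q; rewrite !indicE !in_setI in_setC.
    by do 2 case: (_ \in _); rewrite /= ?mulr1 ?mulr0 ?addr0 ?subrr.
  apply: L2cont_D; [exact: L|by apply: L2Z; exact: L| |by apply: L2cont_Z; [exact: L|exact: PS]].
  by rewrite setTI; apply: L2cont_indic_open => //; exact: ball_open.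
(* By disjointness the partial sums take values 0 and 1 and are eventually constant at each point;
   the indicator of the ball dominates the squared errors. *)
- move=> F mF tF PF M'.
  have mU := bigcup_measurable (fun k _ => mF k).
  pose s k (x : V) : R := \sum_(j < k) \1_(F j `&` ball (0 : V) M') x.
  have Ls k : L2 mu (s k) by apply: L2_sum => j; exact: L.
  have sE k x m : (F m `&` ball (0 : V) M') x -> s k x = (m < k)%:R.
    move=> Fm; case: ltnP => mk.
      rewrite /s (bigD1 (Ordinal mk))//= indicE mem_set// big1 ?addr0// => j /eqP jm.
      rewrite indicE memNset// => -[Fj _]; apply: jm; apply/val_inj => /=.
      by apply: (tF j m I I); exists x; split => //; case: Fm.
    rewrite /s big1// => j _; rewrite indicE memNset// => -[Fj _].
    have jm : nat_of_ord j = m by apply: (tF j m I I); exists x; split => //; case: Fm.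
    by have := ltn_ord j; rewrite jm ltnNge mk.
  have s0 k x : ~ (\bigcup_k F k `&` ball (0 : V) M') x -> s k x = 0.
    move=> nx; rewrite /s big1// => j _; rewrite indicE memNset// => -[Fj xM].
    by apply: nx; split => //; exists j.
  have LU := L _ M' (mU setT).
  have s01 k x : (s k x - \1_(\bigcup_k F k `&` ball (0 : V) M') x) ^+ 2 <= \1_(setT `&` ball (0 : V) M') x.
    have [[[m _ Fm] xM]|nx] := pselect ((\bigcup_k F k `&` ball (0 : V) M') x); last first.
      by rewrite s0// indicE memNset// subrr expr0n indicE.
    rewrite (sE _ _ m)// !indicE !mem_set//; last by split => //; exists m.
    by case: ltnP; rewrite ?subrr ?sub0r ?expr0n ?sqrrN ?expr1n.
  apply: (@L2cont_lim s) => //.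
    by move=> k; apply: L2cont_sum => j; [exact: L|exact: PF].
  suff H : \int[mu]_x ((s k x - \1_(\bigcup_k F k `&` ball (0 : V) M') x) ^+ 2) @[k --> \oo]
      --> \int[mu]_x (0 : R) by rewrite Int0 in H.
  apply: (Int_dominated (g := \1_(setT `&` ball (0 : V) M') : V -> R)) => //.
  + by move=> k; case: (L2B (Ls k) LU) => mm _; apply: measurable_funX.
  + by have := (L setT M' measurableT).2; under eq_fun do rewrite indic_sqr.
  + by move=> k x; rewrite ger0_norm ?sqr_ge0//; exact: s01.
  apply: aeW => x; have [[[m _ Fm] xM]|nx] := pselect ((\bigcup_k F k `&` ball (0 : V) M') x); last first.
    rewrite (_ : (fun k => _) = fun=> 0); first exact: cvg_cst.
    by apply/funext => k; rewrite s0// indicE memNset// subrr expr0n.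
  apply: (@cvg_trans _ ((fun k : nat => 0 : R) @ \oo)); last exact: cvg_cst.
  apply: near_eq_cvg; exists m.+1 => // k /= mk.
  rewrite (sE _ _ m)// mk indicE mem_set ?subrr ?expr0n//; by split => //; exists m.
Qed.

Import HBNNSimple.

(** Positive and negative parts reduce the claim to [f >= 0], approximated from below by simple
    functions cut off to balls of growing radius; their level sets are handled by [L2cont_indic]. *)
Lemma L2_cont f : L2 mu f -> L2cont f.
Proof.
suff pos f' : (forall x, 0 <= f' x) -> L2 mu f' -> L2cont f'.
  move=> Lf; have [mf _] := Lf.
  have ma : measurable_fun setT (fun x => `|f x|).
    by apply: measurableT_comp.
  have La : L2 mu (fun x => `|f x|).
    by split => //; apply: integ_eq Lf.2 => x; rewrite real_normK// num_real.
  have L1 := L2Z 2^-1 (L2D La Lf); have L2' := L2Z 2^-1 (L2B La Lf).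
  rewrite (_ : f = fun x => 2^-1 * (`|f x| + f x) + (-1) * (2^-1 * (`|f x| - f x))); last first.
    by apply/funext => x; field.
  apply: (L2cont_D L1 (L2Z (-1) L2')).
    apply: pos => // x; rewrite mulr_ge0 ?invr_ge0//.
    by rewrite addrC -lerBlDr sub0r; exact: lerNnormlW.
  apply: L2cont_Z => //; apply: pos => // x; rewrite mulr_ge0 ?invr_ge0// subr_ge0; exact: ler_norm.
move=> f0 Lf; have [mf f2] := Lf.
have mfE : measurable_fun setT (EFin \o f') by exact/measurable_EFinP.
pose g := nnsfun_approx measurableT mfE.
have gle k (x : V) : 0 <= g k x <= f' x.
  rewrite fun_ge0/= -lee_fin /g nnsfun_approxE; apply: le_approx => // y _.
  by rewrite lee_fin.
pose F k (x : V) : R := g k x * \1_(ball (0 : V) k%:R) x.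
have mF k : measurable_fun setT (F k).
  apply: measurable_funM; first exact: measurable_funP.
  by apply: measurable_indic; exact: measurable_cube.
have Fle k x : 0 <= F k x <= f' x.
  have /andP[g0 gf] := gle k x; rewrite /F indicE.
  by case: (_ \in _); rewrite ?mulr1 ?mulr0 ?g0 ?gf ?lexx ?f0.
have LF k : L2 mu (F k).
  split => //; apply: integ_le f2; first exact: measurable_funX.
  move=> x; rewrite ger0_norm ?sqr_ge0//; have /andP[F0 Ff] := Fle k x.
  by rewrite lerXn2r ?nnegrE.
apply: (L2cont_lim LF Lf).
  move=> k; rewrite /F; rewrite (_ : (fun _ => _) = fun x : V =>
    \sum_(y <- finmap.enum_fset (fset_set (range (g k)))) (y *
      \1_((g k @^-1` [set y]) `&` ball (0 : V) k%:R) x)); last first.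
    apply/funext => x; rewrite fimfunE fsbig_finite//= mulr_suml; apply: eq_bigr => y _.
    by rewrite -mulrA indicI.
  have ml y : measurable (g k @^-1` [set y]).
    by rewrite -[X in measurable X]setTI; apply: measurable_funP.
  have li y : L2 mu (\1_((g k @^-1` [set y]) `&` ball (0 : V) k%:R) : V -> R).
    apply: L2_indic; first by apply: measurableI => //; exact: measurable_cube.
    apply: le_lt_trans (box_finite n k%:R); apply: le_measure; rewrite ?inE.
    - by apply: measurableI => //; exact: measurable_cube.
    - exact: box_meas.
    - by move=> x [_]; rewrite -ball_normE/= /box/= sub0r normrN => /ltW.
  apply: L2cont_sum => i; first by apply: L2Z; exact: li.
  by apply: L2cont_Z; [exact: li|exact: L2cont_indic].
suff H : \int[mu]_x ((F k x - f' x) ^+ 2) @[k --> \oo] --> \int[mu]_x (0 : R).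
  by rewrite Int0 in H.
apply: (Int_dominated (g := fun x => f' x ^+ 2)) => //.
- by move=> k; case: (L2B (LF k) Lf) => mm _; apply: measurable_funX.
- move=> k x; rewrite ger0_norm ?sqr_ge0// -sqrrN opprB.
  have /andP[F0 Ff] := Fle k x.
  by rewrite lerXn2r ?nnegrE ?subr_ge0// lerBlDr lerDl.
apply: aeW => x.
have gx : (fun k => g k x) @ \oo --> f' x.
  have H : (fun k => (g k x)%:E) @ \oo --> (f' x)%:E.
    apply: (@cvg_nnsfun_approx _ _ _ _ measurableT _ mfE) => // y _.
    by rewrite /= lee_fin.
  exact: (fine_cvg H).
have Fx : (fun k => F k x) @ \oo --> f' x.
  apply: cvg_trans gx; apply: near_eq_cvg.
  exists (Num.truncn `|x|).+1 => // k /= xk; rewrite /F indicE mem_set ?mulr1//.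
  rewrite -ball_normE/= sub0r normrN; apply: lt_le_trans (truncnS_gt _) _.
  by rewrite ler_nat.
have H : (fun k => (F k x - f' x) ^+ 2) @ \oo --> (f' x - f' x) ^+ 2.
  have H0 : (fun k => F k x - f' x) @ \oo --> f' x - f' x by apply: cvgB => //; exact: cvg_cst.
  exact: (cvgM H0 H0).
by rewrite subrr expr0n in H.
Qed.

End translation_continuity.

(** * Test functions and the fundamental lemma of the calculus of variations *)

Section test_functions.
Context (R : realType) (n : nat).
Local Notation V := 'rV[R]_n.
Local Notation mu := (@lebesgue_rV R n).
Implicit Types (f g phi : V -> R) (A K : set V).

Lemma test_functionE A phi : test_function A phi <-> forall k, TC k A phi.
Proof.
split=> [[Cphi cK KA] k|H].
  split; first exact: Cphi.
  exists (closure [set x | phi x != 0]); split => // x nx.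
  apply/eqP/negP => /negP xn; apply: nx; exact: subset_closure.
have [K [cK KA K0]] := (H 0).2.
have sK : closure [set x | phi x != 0] `<=` K.
  rewrite [X in _ `<=` X](closure_id K).1; last by apply: compact_closed cK; exact: rV_hausdorff.
  apply: closure_subset => x /= /eqP xn; apply: contrapT => nK; exact/xn/K0.
split.
- by move=> k; exact: (H k).1.
- by apply: subclosed_compact cK sK; exact: closed_closure.
- exact: subset_trans sK KA.
Qed.

(** If no radius worked, points outside [A] would approach [K] at distance [1/(k+1)]; their
    neighbours in [K] cluster at a point of [K], around which a ball lies in [A]. The enlarged set
    is the compact sum of [K] and a closed cube. *)
Lemma compact_enlarge A K : open A -> compact K -> K `<=` A ->
  exists e0 : R, [/\ 0 < e0 & exists K', [/\ compact K', K' `<=` A &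
    forall x y, K y -> `|x - y| <= e0 -> K' x]].
Proof.
move=> oA cK KA.
have [e e0 eA] : exists2 e : R, 0 < e & forall x y, K y -> `|x - y| <= e -> A x.
  apply: contrapT => nE.
  have Hk (k : nat) : exists p : V * V, [/\ K p.2, `|p.1 - p.2| <= k.+1%:R^-1 & ~ A p.1].
    apply: contrapT => nk; apply: nE; exists k.+1%:R^-1 => // x y Ky xy.
    by apply: contrapT => nA; apply: nk; exists (x, y).
  pose p k := projT1 (cid (Hk k)); have pP k := projT2 (cid (Hk k)).
  have : K `&` cluster ((fun k => (p k).2) @ \oo) !=set0.
    by apply: cK; exists 0%N => // k _; case: (pP k).
  move=> [z [Kz cz]].
  have /nbhs_ballP[d /= d0 dA] : nbhs z A by move: oA; rewrite openE; apply; exact: KA.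
  have d2 : 0 < d / 2 by rewrite divr_gt0.
  have := cz [set (p k).2 | k in [set k | k.+1%:R^-1 < d / 2 :> R]] (ball z (d / 2)).
  have [N _ HN] := near_infty_natSinv_lt (PosNum d2).
  case=> [||y [[k /= kd <-] zy]].
  - by exists N => // k Nk; exists k => //; exact: HN.
  - exact: nbhsx_ballx.
  have [Kp ple nA] := pP k; apply: nA; apply: dA.
  move: zy; rewrite -!ball_normE/= => zy.
  rewrite (_ : z - (p k).1 = (z - (p k).2) - ((p k).1 - (p k).2)); last first.
    by rewrite opprB addrA subrK.
  apply: le_lt_trans (ler_normB _ _) _; rewrite (splitr d).
  by apply: ltrD => //; exact: le_lt_trans ple _.
exists e; split => //.
exists [set x | exists2 y, K y & `|x - y| <= e]; split.
- rewrite (_ : [set x | _] = (fun p : V * V => p.1 + p.2) @` (K `*` box e)); last first.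
    apply/seteqP; split => [x [y Ky xy]|x [[y h]/= [Ky hh] <-]].
      by exists (y, x - y); [split|rewrite /= addrC subrK].
    by exists y => //; rewrite (addrC y) addrK.
  apply: continuous_compact; last first.
    by apply: compact_setX => //; exact: box_compact.
  apply: continuous_subspaceT => x; exact: (@add_continuous V x).
- by move=> x [y Ky xy]; exact: (eA x y).
- by move=> x y Ky xy; exists y.
Qed.

Lemma conv_ker_supp K K' e0 e f : 0 < e -> e <= e0 ->
  (forall x y, K y -> `|x - y| <= e0 -> K' x) -> (forall x, ~ K x -> f x = 0) ->
  forall x, ~ K' x -> conv f (ker e) x = 0.
Proof.
move=> ep ee0 H fK x nK'; apply: (@conv_eq0 _ _ f (ker e) K e) => //.
- by move=> y; exact: ker_eq0.
- move=> y Ky; rewrite leNgt; apply/negP => xy; apply: nK'; apply: (H x y) => //.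
  exact: le_trans (ltW xy) ee0.
Qed.

Lemma conv_ker_TC A f : open A -> cptin A f -> integ mu f ->
  exists2 e0 : R, 0 < e0 & forall e, 0 < e <= e0 -> forall k, TC k A (conv f (ker e)).
Proof.
move=> oA [K [cK KA K0]] fi.
have [e0 [e00 [K' [cK' KA' KK']]]] := compact_enlarge oA cK KA.
exists e0 => // e /andP[ep ee0] k; split.
  by apply: conv_Ck => // m; exact: ker_TC.
exists K'; split => //; exact: (conv_ker_supp ep ee0 KK' K0).
Qed.

Lemma integ_L2_cpt f A : L2 mu f -> cptin A f -> integ mu f.
Proof.
move=> [mf f2] /cptin_box[M M0 fM].
apply: (integ_le mf) (integD (integ_box n M) f2) => x.
have [xM|xM] := leP `|x| M; last by rewrite fM// normr0 expr0n addr0 indicE.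
rewrite indicE mem_set//; have := cp_norm (convex_power2 R) (f x).
by [].
Qed.

Lemma mollify f A d : L2 mu f -> cptin A f -> 0 < d ->
  exists2 e0 : R, 0 < e0 & forall e, 0 < e <= e0 ->
    L2 mu (conv f (ker e)) /\ \int[mu]_x ((conv f (ker e) x - f x) ^+ 2) <= d.
Proof.
move=> Lf cf d0; have [e0 e00 He] := L2_cont Lf d0.
exists e0 => // e /andP[ep ee0]; apply: conv_sub_le => //; first exact: ltW.
  exact: (integ_L2_cpt Lf cf).
by move=> h he; apply: He; exact: le_trans he ee0.
Qed.

Lemma fast_mollify f A e0 : L2 mu f -> cptin A f -> 0 < e0 ->
  exists e : nat -> R, [/\ forall k, 0 < e k <= e0,
    forall k, L2 mu (conv f (ker (e k))),
    forall k, \int[mu]_x ((conv f (ker (e k)) x - f x) ^+ 2) <= 16^-1 ^+ k &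
    {ae mu, forall x, (fun k => conv f (ker (e k)) x) @ \oo --> f x}].
Proof.
move=> Lf cf e00.
have Hk (k : nat) : exists e : R, 0 < e <= e0 /\ (L2 mu (conv f (ker e)) /\
    \int[mu]_x ((conv f (ker e) x - f x) ^+ 2) <= 16^-1 ^+ k).
  have [e1 e10 H] := mollify Lf cf (exprn_gt0 k (ltac:(by rewrite invr_gt0) : 0 < 16^-1 :> R)).
  exists (Num.min e0 e1); rewrite lt_min e00 e10 ge_min lexx; split => //; apply: H.
  by rewrite lt_min e00 e10 ge_min lexx orbT.
pose e k := projT1 (cid (Hk k)).
have eP k : 0 < e k <= e0 /\ (L2 mu (conv f (ker (e k))) /\
    \int[mu]_x ((conv f (ker (e k)) x - f x) ^+ 2) <= 16^-1 ^+ k) := projT2 (cid (Hk k)).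
exists e; split => [k|k|k|]; [exact: (eP k).1|exact: (eP k).2.1|exact: (eP k).2.2|].
by apply: L2_fast_ae => // k; case: (eP k).2.
Qed.

Lemma conv_ker_01 f e : 0 < e -> measurable_fun setT f -> (forall x, 0 <= f x <= 1) ->
  forall x, 0 <= conv f (ker e) x <= 1.
Proof.
move=> e0 mf f01 x.
have ki : integ mu (@ker R n e) by exact: TC_integ (ker_TC n 0 e0).
have kc : continuous (@ker R n e) by exact: TC_cont (ker_TC n 0 e0).
rewrite convE//; apply/andP; split.
  by apply: Int_ge0 => y; rewrite mulr_ge0 ?ker_ge0//; case/andP: (f01 (x - y)).
rewrite -(@Int_ker R n e)//; apply: Int_le => // [|y].
  apply: (integ_le _ _ ki) => [|y].
    apply: measurable_funM; last exact: continuous_measurable_rV.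
    exact: (measurableT_comp mf (measurable_subrV x)).
  rewrite normrM (ger0_norm (ker_ge0 y e0)); apply: ler_piMl; first exact: ker_ge0.
  by rewrite ger0_norm; case/andP: (f01 (x - y)).
by apply: ler_piMl; [exact: ker_ge0|case/andP: (f01 (x - y))].
Qed.

(** [w] is tested with mollified indicators of the part [B] of [K] where [w > 0]. Each integral
    vanishes, hence so does [int w 1_B], whose integrand is positive on [B]; thus [B] is null. *)
Lemma fundamental_le A (w : V -> R) K : open A -> measurable_fun setT w ->
  (forall K, compact K -> K `<=` A -> integ mu (fun x => w x * \1_K x)) ->
  (forall phi, test_function A phi -> \int[mu]_x (w x * phi x) = 0) ->
  compact K -> K `<=` A -> {ae mu, forall x, K x -> w x <= 0}.
Proof.
move=> oA mw iw wphi cK KA.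
pose B := K `&` [set x | 0 < w x].
have mB : measurable B.
  apply: measurableI; first exact: compact_measurable_rV.
  rewrite (_ : [set x | _] = w @^-1` `]0, +oo[%classic).
    by rewrite -[X in measurable X]setTI; apply: mw.
  by apply/seteqP; split => x /=; rewrite in_itv/= andbT.
have [M M0 KM] := compact_norm_bounded cK.
have LB : L2 mu (\1_B : V -> R).
  apply: L2_indic => //; apply: le_lt_trans (box_finite n M).
  by apply: le_measure; rewrite ?inE//; [exact: box_meas|move=> x [/KM]].
have cB : cptin A (\1_B : V -> R).
  by exists K; split => // x nK; rewrite indicE memNset// => -[].
have iB := integ_L2_cpt LB cB.
have [e1 e10 Ht] := conv_ker_TC oA cB iB.
have [e0 [e00 [K' [cK' KA' KK']]]] := compact_enlarge oA cK KA.
have [e [eP Le _ eae]] := fast_mollify LB cB (ltac:(by rewrite lt_min e10) : 0 < Num.min e1 e0).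
have phi01 k x : 0 <= conv (\1_B) (ker (e k)) x <= 1.
  apply: conv_ker_01; [by case/andP: (eP k)|exact: LB.1|].
  by move=> y; rewrite indicE; case: (_ \in _); rewrite ler01 lexx.
have C : \int[mu]_x (w x * conv (\1_B) (ker (e k)) x) @[k --> \oo] --> \int[mu]_x (w x * \1_B x).
  apply: (Int_dominated (g := fun x => `|w x * \1_K' x|)).
  - by move=> k; apply: measurable_funM => //; exact: (Le k).1.
  - by apply: measurable_funM => //; exact: LB.1.
  - by apply: integ_abs; exact: iw.
  - move=> k x; have [K'x|nK'x] := pselect (K' x); last first.
      have /andP[ep ee] := eP k.
      rewrite (@conv_ker_supp K K' e0 (e k) (\1_B : V -> R)) ?mulr0 ?normr0//.
        by apply: le_trans ee _; rewrite ge_min lexx orbT.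
      by move=> y nK; rewrite indicE memNset// => -[].
    rewrite [X in _ <= `|_ * X|]indicE mem_set// mulr1 normrM; apply: ler_piMr => //.
    by rewrite ger0_norm; case/andP: (phi01 k x).
  - apply: filterS eae => x Hx; apply: cvgMl_tmp; exact: Hx.
have C0 : \int[mu]_x (w x * \1_B x) = 0.
  suff E k : \int[mu]_x (w x * conv (\1_B) (ker (e k)) x) = 0.
    have := C; under eq_fun do rewrite E; move=> C'.
    exact: (cvg_unique _ C' (cvg_cst 0)).
  apply: wphi; apply/test_functionE; apply: Ht.
  have /andP[ep ee] := eP k; rewrite ep; apply: le_trans ee _; by rewrite ge_min lexx.
have wB : integ mu (fun x => w x * \1_B x).
  apply: (integ_le _ _ (integ_abs (iw K cK KA))); first by apply: measurable_funM => //; exact: LB.1.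
  move=> x; rewrite !normrM ler_wpM2l// !indicE in_setI.
  by case: (x \in K); case: (_ \in _); rewrite ?normr1 ?normr0.
have := Int_eq0_ae wB _ C0; move/(_ _) => H.
have wB0 x : 0 <= w x * \1_B x.
  rewrite indicE; have [Bx|nB] := pselect (B x); last by rewrite memNset// mulr0.
  by rewrite mem_set// mulr1; case: Bx => _ /ltW.
apply: filterS (H wB0) => x + Kx; rewrite indicE leNgt => wx.
by apply/negP => w0; move: wx; rewrite mem_set// mulr1 => wx; rewrite wx ltxx in w0.
Qed.

Lemma fundamental_lemma A (w : V -> R) : open A -> measurable_fun setT w ->
  (forall K, compact K -> K `<=` A -> integ mu (fun x => w x * \1_K x)) ->
  (forall phi, test_function A phi -> \int[mu]_x (w x * phi x) = 0) ->
  {ae mu, forall x, A x -> w x = 0}.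
Proof.
move=> oA mw iw wphi.
pose r (m : nat) : R := m.+1%:R^-1.
(* Exhaustion of [A] by compact sets: the points of a large cube at distance at least [1/(m+1)] from
   the complement. *)
pose K m : set V := box m%:R `&` ~` \bigcup_(y in ~` A) ball y (r m).
have cK m : compact (K m).
  apply: (@subclosed_compact _ _ (box m%:R)); [|exact: box_compact|by move=> x []].
  apply: closedI; first exact: box_closed.
  by apply: open_closedC; apply: bigcup_open => y _; exact: ball_open.
have KA m : K m `<=` A.
  move=> x [_ nx]; apply: contrapT => nA; apply: nx; exists x => //.
  by apply: ballxx; rewrite /r.
have KE x : A x -> exists m, K m x.
  move=> Ax; have /nbhs_ballP[d /= d0 dA] : nbhs x A by move: oA; rewrite openE; apply.
  have [N _ HN] := near_infty_natSinv_lt (PosNum d0).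
  exists (maxn N (Num.truncn `|x|).+1); split.
    rewrite /box/=; apply: ltW; apply: lt_le_trans (truncnS_gt _) _.
    by rewrite ler_nat leq_maxr.
  move=> [y nAy xy]; apply: nAy; apply: dA.
  apply: ball_sym; apply: le_ball xy; apply: ltW; apply: HN; exact: leq_maxl.
have Hp m := fundamental_le oA mw iw wphi (cK m) (@KA m).
have Hn m : {ae mu, forall x, K m x -> - w x <= 0}.
  apply: (@fundamental_le A (fun x => - w x) (K m) oA _ _ _ (cK m) (@KA m)).
  - exact: measurableT_comp.
  - by move=> K' cK' KA'; apply: integ_eq (integN (iw K' cK' KA')) => x; rewrite mulNr.
  - move=> phi tphi; under eq_Rintegral do rewrite mulNr -mulrN.
    apply: wphi; apply/test_functionE => k; move/test_functionE : tphi => /(_ k).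
    by move/(TC_Z (-1)); congr TC; apply/funext => x; rewrite mulN1r.
have H : {ae mu, forall x, forall m, K m x -> w x = 0}.
  apply: ae_foralln => m; apply: filterS2 (Hp m) (Hn m) => x H1 H2 Kx.
  by apply: le_anti; rewrite H1// -oppr_le0 H2.
by apply: filterS H => x H /KE[m]; exact: H.
Qed.

End test_functions.

(** * Weak derivatives *)
Section weak_derivative.
Context (R : realType) (n : nat).
Local Notation V := 'rV[R]_n.
Local Notation mu := (@lebesgue_rV R n).
Implicit Types (f g u v phi a : V -> R) (A K : set V) (i j : 'I_n).

Definition smooth A phi := forall k, TC k A phi.

(** For functions extended by zero. With [A := setT] the test functions may cross the boundary of
    the domain, which encodes a zero trace of [u]; with a smaller [A] only the interior equation is
    expressed. *)
Definition wder A i u g := forall phi, smooth A phi ->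
  \int[mu]_x (u x * 'D_(basis i) phi x) = - \int[mu]_x (g x * phi x).

Definition L2cvg (F : nat -> V -> R) f := \int[mu]_x ((F m x - f x) ^+ 2) @[m --> \oo] --> 0.

Lemma L2cvg_le F f : (forall d, 0 < d -> exists N, forall m, (N <= m)%N ->
  \int[mu]_x ((F m x - f x) ^+ 2) <= d) -> L2cvg F f.
Proof.
move=> H; apply/cvgrPdist_le => d d0; have [N HN] := H d d0.
exists N => // m /= Nm; rewrite sub0r normrN ger0_norm; first exact: HN.
by apply: Int_ge0 => x; exact: sqr_ge0.
Qed.

Lemma L2cvgP F f : L2cvg F f -> forall d, 0 < d -> exists N, forall m, (N <= m)%N ->
  \int[mu]_x ((F m x - f x) ^+ 2) <= d.
Proof.
move=> H d d0; have /cvgrPdist_le/(_ _ d0)[N _ HN] := H.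
exists N => m Nm; have := HN m Nm; rewrite sub0r normrN; exact/le_trans/ler_norm.
Qed.

Lemma conv_cvg f A (e : nat -> R) : L2 mu f -> cptin A f -> (forall m, 0 < e m) ->
  e @ \oo --> 0 -> (forall m, L2 mu (conv f (ker (e m)))) /\ L2cvg (fun m => conv f (ker (e m))) f.
Proof.
move=> Lf cf e0 ecvg; split.
  move=> m; have fi := integ_L2_cpt Lf cf; split.
    by apply: continuous_measurable_rV; exact: conv_cont.
  exact: (conv_power_le (convex_power2 R) (e0 m) fi Lf.2).1.
apply: L2cvg_le => d d0; have [e1 e10 H] := mollify Lf cf d0.
have /cvgrPdist_le/(_ _ e10)[N _ HN] := ecvg.
exists N => m Nm; apply: (H (e m) _).2.
rewrite e0/=; have := HN m Nm; rewrite sub0r normrN; exact/le_trans/ler_norm.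
Qed.

Lemma conv_wder A f g i (e : R) x : integ mu f -> 0 < e ->
  smooth A (fun y => ker e (x - y)) -> wder A i f g ->
  'D_(basis i) (conv f (ker e)) x = conv g (ker e) x.
Proof.
move=> fi e0 sk wfg; apply: conv_weak_D => //; first exact: ker_TC.
by apply: wfg.
Qed.

Lemma smooth_ker (e : R) (x : V) : 0 < e -> smooth setT (fun y => ker e (x - y)).
Proof.
move=> e0 k; split; first by apply: Ck_reflV; exact: ker_Ck.
apply: (@box_cptin R n _ (e + `|x|)) => y xy; apply: ker_eq0 => //.
by rewrite distrC; apply: le_trans (lerB_dist _ _); rewrite lerBrDr ltW.
Qed.

(** Mollification commutes with derivatives that are weak on the whole space, and a small kernel
    keeps the support inside the open set [A]. *)
Lemma smooth_approx A z (zg : 'I_n -> V -> R) : open A -> L2 mu z -> cptin A z ->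
  (forall i, L2 mu (zg i)) -> (forall i, cptin setT (zg i)) ->
  (forall i, wder setT i z (zg i)) ->
  exists psi : nat -> V -> R, [/\ forall m, smooth A (psi m), forall m, L2 mu (psi m),
    L2cvg psi z & forall i, L2cvg (fun m => 'D_(basis i) (psi m)) (zg i)].
Proof.
move=> oA Lz cz Lg cg wz; have iz := integ_L2_cpt Lz cz.
have [e0 e00 H] := conv_ker_TC oA cz iz.
pose e m : R := e0 * m.+1%:R^-1.
have ep m : 0 < e m by rewrite mulr_gt0.
have ee0 m : e m <= e0 by apply: ler_piMr; [exact: ltW|rewrite invf_le1 ?ltr0n// ler1n].
have ec : e @ \oo --> 0.
  have := cvgMl_tmp (a := e0) (@cvg_harmonic R); rewrite mulr0; exact.
exists (fun m => conv z (ker (e m))); have [L C] := conv_cvg Lz cz ep ec; split => //.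
- by move=> m k; apply: H; rewrite ep ee0.
- move=> i; have [Li Ci] := conv_cvg (Lg i) (cg i) ep ec.
  rewrite (_ : (fun _ => _) = fun m => conv (zg i) (ker (e m)))//.
  apply/funext => m; apply/funext => x.
  by apply: (@conv_wder setT) => //; exact: smooth_ker.
Qed.

Lemma TC_wder A i f : TC 1 A f -> wder setT i f ('D_(basis i) f).
Proof.
move=> Tf phi sphi; have := Int_IBP i (sphi 1) (TC_S (@subsetT _ A) Tf).1.
by [].
Qed.

Lemma L2cvg_pair F f g : (forall m, L2 mu (F m)) -> L2 mu f -> L2 mu g -> L2cvg F f ->
  \int[mu]_x (g x * F m x) @[m --> \oo] --> \int[mu]_x (g x * f x).
Proof.
move=> LF Lf Lg C; have := Int_L2_lim LF Lf Lg C.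
under eq_fun do under eq_Rintegral do rewrite mulrC.
by under [X in _ --> X]eq_Rintegral do rewrite mulrC.
Qed.

(** Enlarges the class of test functions from smooth to C^1, by mollifying [phi]. Needed since test
    functions will be multiplied by coefficients of a chart of finite regularity. *)
Lemma wder1 A i u g phi : open A -> L2 mu u -> L2 mu g -> wder A i u g -> TC 1 A phi ->
  \int[mu]_x (u x * 'D_(basis i) phi x) = - \int[mu]_x (g x * phi x).
Proof.
move=> oA Lu Lg w Tphi.
have Tj j : TC 0 A ('D_(basis j) phi) by exact: TC_D.
have [||||||psi [spsi Lpsi C1 C2]] := @smooth_approx A phi (fun j => 'D_(basis j) phi) => //.
- exact: TC_L2 Tphi.
- exact: Tphi.2.
- by move=> j; exact: TC_L2 (Tj j).
- by move=> j; apply: cptinS (Tj j).2.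
- by move=> j; exact: TC_wder Tphi.
have LD m : L2 mu ('D_(basis i) (psi m)) by apply: (@TC_L2 _ _ 0 A); apply: TC_D; exact: spsi.
have H1 := L2cvg_pair LD (TC_L2 (Tj i)) Lu (C2 i).
have H2 := L2cvg_pair Lpsi (TC_L2 Tphi) Lg C1.
have H3 : (fun m => \int[mu]_x (u x * 'D_(basis i) (psi m) x)) @ \oo
    --> - \int[mu]_x (g x * phi x).
  by under eq_fun do rewrite w//; exact: cvgN.
exact: (cvg_unique _ H1 H3).
Qed.

Lemma L2_Mc a u A : continuous a -> L2 mu u -> cptin A u -> L2 mu (fun x => a x * u x).
Proof.
move=> ca Lu [K [cK KA K0]].
have [C C0 aC] : exists2 C, 0 <= C & forall x, K x -> `|a x| <= C.
  have : compact (a @` K) by apply: continuous_compact => //; exact: continuous_subspaceT.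
  move=> /compact_bounded[M [Mr HM]]; exists (`|M| + 1) => [|x Kx].
    by rewrite addr_ge0.
  by apply: (HM (`|M| + 1)); [rewrite ltr_pwDr// ler_norm|exists x].
have [mu' u2] := Lu; split.
  by apply: measurable_funM => //; exact: continuous_measurable_rV.
apply: (integ_le _ _ (integZ (C ^+ 2) u2)) => [|x].
  apply: measurable_funX; apply: measurable_funM => //; exact: continuous_measurable_rV.
rewrite ger0_norm ?sqr_ge0// exprMn.
have [Kx|nK] := pselect (K x); last by rewrite K0// expr0n !mulr0.
rewrite ler_wpM2r ?sqr_ge0// -[a x ^+ 2]ger0_norm ?sqr_ge0// normrX.
by rewrite lerXn2r ?nnegrE// aC.
Qed.

Lemma wderM A i u g a B : open A -> L2 mu u -> L2 mu g -> cptin B u -> cptin B g ->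
  wder A i u g -> Ck setT 1 a ->
  wder A i (fun x => a x * u x) (fun x => a x * g x + 'D_(basis i) a x * u x).
Proof.
move=> oA Lu Lg cu cg w Ca phi sphi.
have T1 : TC 1 A (fun x => a x * phi x) by apply: TC_Ml => //; exact: sphi.
have ca := CkT_cont Ca; have cDa := CkT_cont (Ck_D i Ca).
have Lau := L2_Mc ca Lu cu; have Lag := L2_Mc ca Lg cg; have LDu := L2_Mc cDa Lu cu.
have Lphi := TC_L2 (sphi 0); have LDphi := TC_L2 (TC_D i (sphi 1)).
have E x : a x * u x * 'D_(basis i) phi x =
    u x * 'D_(basis i) (fun x => a x * phi x) x - 'D_(basis i) a x * u x * phi x.
  rewrite deriveM; [|exact: (Ck_derivable Ca)|exact: TC_derivable (sphi 1)].
  rewrite /GRing.scale/=; ring.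
under eq_Rintegral do rewrite E.
have i1 : integ mu (fun x => u x * 'D_(basis i) (fun x => a x * phi x) x).
  by apply: L2_integM => //; exact: (TC_L2 (TC_D i T1)).
have i2 := L2_integM LDu Lphi; have i3 := L2_integM Lag Lphi.
rewrite (IntB i1 i2) (wder1 oA Lu Lg w T1).
under [in RHS]eq_Rintegral do rewrite mulrDl.
rewrite (IntD i3 i2) opprD; congr (- _ - _).
by apply: eq_Rintegral => x _; ring.
Qed.

Lemma wder_sub A B i u g : A `<=` B -> wder B i u g -> wder A i u g.
Proof. by move=> AB w phi sphi; apply: w => k; exact: TC_S AB (sphi k). Qed.

Lemma wderD A i u v g h : L2 mu u -> L2 mu v -> L2 mu g -> L2 mu h ->
  wder A i u g -> wder A i v h -> wder A i (fun x => u x + v x) (fun x => g x + h x).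
Proof.
move=> Lu Lv Lg Lh wu wv phi sphi.
have Lphi := TC_L2 (sphi 0); have LDphi := TC_L2 (TC_D i (sphi 1)).
under eq_Rintegral do rewrite mulrDl; under [in RHS]eq_Rintegral do rewrite mulrDl.
rewrite (IntD (L2_integM Lu LDphi) (L2_integM Lv LDphi)).
by rewrite (IntD (L2_integM Lg Lphi) (L2_integM Lh Lphi)) wu// wv// opprD.
Qed.

Lemma wderZ A i c u g : L2 mu u -> L2 mu g ->
  wder A i u g -> wder A i (fun x => c * u x) (fun x => c * g x).
Proof.
move=> Lu Lg wu phi sphi.
have Lphi := TC_L2 (sphi 0); have LDphi := TC_L2 (TC_D i (sphi 1)).
under eq_Rintegral do rewrite -mulrA; under [in RHS]eq_Rintegral do rewrite -mulrA.
by rewrite (IntZ c (L2_integM Lu LDphi)) (IntZ c (L2_integM Lg Lphi)) wu// mulrN.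
Qed.

Lemma wder_lim A i (F G : nat -> V -> R) u g :
  (forall m, L2 mu (F m)) -> (forall m, L2 mu (G m)) -> L2 mu u -> L2 mu g ->
  L2cvg F u -> L2cvg G g -> (forall m, wder A i (F m) (G m)) -> wder A i u g.
Proof.
move=> LF LG Lu Lg Fu Gg w phi sphi.
have Lphi := TC_L2 (sphi 0); have LDphi := TC_L2 (TC_D i (sphi 1)).
have H1 := Int_L2_lim LF Lu LDphi Fu.
have H2 : (fun m => \int[mu]_x (F m x * 'D_(basis i) phi x)) @ \oo --> - \int[mu]_x (g x * phi x).
  by under eq_fun do rewrite w//; apply: cvgN; exact: Int_L2_lim.
exact: (cvg_unique _ H1 H2).
Qed.

End weak_derivative.

(** * Poincare inequality and Rellich compactness *)
Section sobolev_estimates.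
Context (R : realType) (n : nat).
Local Notation V := 'rV[R]_n.
Local Notation mu := (@lebesgue_rV R n).
Implicit Types (f g u v phi a : V -> R) (A K : set V) (i j : 'I_n).

Lemma sqr_sum_le (J : Type) (r : seq J) (a : J -> R) :
  (\sum_(j <- r) a j) ^+ 2 <= (size r)%:R * \sum_(j <- r) a j ^+ 2.
Proof.
elim: r => [|j r IH]; first by rewrite !big_nil expr0n mulr0.
rewrite !big_cons /= -natr1; case: r IH => [|k r].
  by rewrite !big_nil !addr0 add0r mul1r.
set S := \sum_(_ <- _) _; set Q := \sum_(_ <- _) _; set m : R := (size _)%:R => IH.
have m0 : 0 < m by rewrite ltr0n.
suff : 2 * S * a j <= Q + m * a j ^+ 2 by move: IH; nra.
rewrite -(ler_pM2l m0); have : 0 <= (S - m * a j) ^+ 2 by exact: sqr_ge0.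
move: IH; clearbody S Q m; move: (a j) => w H1 H2; rewrite sqrrB in H2.
have -> : m * (Q + m * w ^+ 2) = m * Q + (m * w) ^+ 2 by ring.
have -> : m * (2 * S * w) = S * (m * w) *+ 2 by rewrite -mulr_natl; ring.
lra.
Qed.

Lemma L2cvg_norm (F : nat -> V -> R) f : (forall m, L2 mu (F m)) -> L2 mu f -> L2cvg F f ->
  \int[mu]_x (F m x ^+ 2) @[m --> \oo] --> \int[mu]_x (f x ^+ 2).
Proof.
move=> LF Lf C.
have H := Int_L2_lim LF Lf Lf C.
have E m : \int[mu]_x (F m x ^+ 2) = \int[mu]_x ((F m x - f x) ^+ 2) +
    (2 * \int[mu]_x (F m x * f x) - \int[mu]_x (f x * f x)).
  have i1 := (L2B (LF m) Lf).2; have i2 := L2_integM (LF m) Lf; have i3 := L2_integM Lf Lf.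
  rewrite -(IntZ 2 i2) -(IntB (integZ 2 i2) i3) -(IntD i1 (integB (integZ 2 i2) i3)).
  by apply: eq_Rintegral => x _; ring.
have H' : (fun m => \int[mu]_x (F m x ^+ 2)) @ \oo
    --> 0 + (2 * \int[mu]_x (f x * f x) - \int[mu]_x (f x * f x)).
  rewrite (funext E); apply: cvgD => //.
  by apply: cvgB; [exact: cvgMl_tmp|exact: cvg_cst].
by rewrite add0r mulrDl mul1r addrK in H'.
Qed.

(** The divergence of [x_i f^(p+1)] along axis [i] integrates to zero, so [int f^(p+1)] equals
    [-(p+1) int f^p x_i D_i f], where [|x_i| <= M] on the support. *)
Lemma poincare_smooth p f i M : convex_power R p.+1 -> 0 <= M -> TC 1 setT f ->
  (forall x, M < `|x| -> f x = 0) ->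
  \int[mu]_x (f x ^+ p.+1) <=
    2 * (2 * p.+1%:R * M) ^+ p.+1 * \int[mu]_x ('D_(basis i) f x ^+ p.+1).
Proof.
move=> cp M0 Tf fM.
have TD : TC 0 setT ('D_(basis i) f) by exact: TC_D.
have Tp k (g : V -> R) q : TC k setT g -> TC k setT (fun x => g x ^+ q.+1).
  move=> Tg; elim: q => [|q IH]; first by under eq_fun do rewrite expr1.
  by under eq_fun do rewrite exprS; apply: TC_Ml => //; exact: Tg.1.
have [Cf _] := Tf.
have Cg : Ck setT 1 (fun x => f x ^+ p * x ord0 i).
  apply: CkM; [exact: openT| |exact: Ck_coord].
  by case: p {cp} => [|q]; [under eq_fun do rewrite expr0; exact: Ck_cst|exact: (Tp 1 f q Tf).1].
have d1 x : derivable f x (basis i) by exact: (Ck_derivable Cf).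
have Dg x : 'D_(basis i) (fun x => f x ^+ p * x ord0 i) x * f x =
    f x ^+ p.+1 + p%:R * (f x ^+ p * x ord0 i * 'D_(basis i) f x).
  have dp : is_derive x (basis i) (fun x => f x ^+ p) (p%:R * f x ^+ p.-1 * 'D_(basis i) f x).
    have hp (t : R) : is_derive t (1 : R) (fun t => t ^+ p) (p%:R * t ^+ p.-1).
      by apply: DeriveDef; [exact: exprn_derivable|rewrite exp_derive /GRing.scale/= mulr1].
    exact: (is_derive_comp1 hp (d1 x)).
  have dc := @derive_coord R n i x (basis i).
  rewrite deriveM; [|exact: (@ex_derive _ _ _ _ _ _ _ dp)|exact: (@ex_derive _ _ _ _ _ _ _ dc)].
  rewrite (@derive_val _ _ _ _ _ _ _ dp) (@derive_val _ _ _ _ _ _ _ dc).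
  rewrite /basis mxE !eqxx /GRing.scale/= mulr1.
  case: p {cp Cg dp} => [|q] /=; first by rewrite !mul0r mulr0 !addr0 expr0 mul1r expr1.
  by rewrite !exprS; ring.
have iI : integ mu (fun x => f x ^+ p * x ord0 i * 'D_(basis i) f x).
  have := TC_integ (TC_Ml TD (CkW Cg)); by [].
have If := TC_integ (Tp 1 f p Tf).
have IBP : \int[mu]_x (f x ^+ p.+1) =
    - p.+1%:R * \int[mu]_x (f x ^+ p * x ord0 i * 'D_(basis i) f x).
  have := Int_IBP i Tf Cg; under [in RHS]eq_Rintegral do rewrite Dg.
  rewrite (IntD If (integZ p%:R iI)) (IntZ p%:R iI) -natr1; move=> H; lra.
set C := (2 * p.+1%:R * M) ^+ p.+1.
have tp (t : R) : `|t| ^+ p.+1 = t ^+ p.+1 by rewrite -normrX ger0_norm// (cp_ge0 cp).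
have DI : integ mu (fun x => 'D_(basis i) f x ^+ p.+1).
  by apply: (@TC_integ _ _ 0 setT); exact: Tp.
have : \int[mu]_x (f x ^+ p.+1) <= 2^-1 * \int[mu]_x (f x ^+ p.+1) +
    C * \int[mu]_x ('D_(basis i) f x ^+ p.+1).
  rewrite -(IntZ 2^-1 If) -(IntZ C DI) -(IntD (integZ 2^-1 If) (integZ C DI)) IBP.
  rewrite -(IntZ _ iI); apply: Int_le.
  - exact: integZ.
  - by apply: integD; exact: integZ.
  move=> x; have [xM|xM] := ltP M `|x|.
    rewrite fM// exprS mul0r mulr0 add0r.
    case: p @C tp {cp iI If IBP DI Tp Cg Dg} => [|q] C tp.
      rewrite (@derive_locally0 _ _ f (box M))//; first by rewrite expr1 !mulr0.
      - exact: box_closed.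
      - by move=> y /negP; rewrite -ltNge; exact: fM.
      - by rewrite /box/=; apply/negP; rewrite -ltNge.
    rewrite exprS !mul0r mulr0; apply: mulr_ge0; last by rewrite -tp exprn_ge0.
    by rewrite exprn_ge0// !mulr_ge0.
  set F := f x; set D := 'D_(basis i) f x; set y := x ord0 i.
  have yM : `|y| <= M by apply: le_trans xM; exact: coord_le_norm.
  apply: le_trans (ler_norm _) _; rewrite !normrM normrN normr_nat normrX.
  rewrite -(tp F) -(tp D).
  set P : R := p.+1%:R; have P0 : 0 <= P by [].
  apply: (@le_trans _ _ (P * M * `|D| * `|F| ^+ p)).
    rewrite [leRHS](_ : _ = P * (`|F| ^+ p * M * `|D|)); last by ring.
    by apply: ler_wpM2l => //; apply: ler_wpM2r => //; apply: ler_wpM2l.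
  (* Young's inequality by cases: either the derivative is small compared with [F] and half of
     [F^(p+1)] absorbs the product, or [F] is bounded by the derivative. Absorbing the half produces
     the leading factor 2. *)
  have [h|h] := leP (2 * P * M * `|D|) `|F|.
    rewrite -[leLHS]addr0; apply: lerD; last by rewrite mulr_ge0// ?exprn_ge0// !mulr_ge0.
    rewrite exprS mulrA; apply: ler_wpM2r; first exact: exprn_ge0.
    by move: h; lra.
  rewrite -[leLHS]add0r; apply: lerD; first by rewrite mulr_ge0// exprn_ge0.
  rewrite /C -exprMn exprS; apply: (@le_trans _ _ (P * M * `|D| * (2 * P * M * `|D|) ^+ p)).
    apply: ler_wpM2l; first by rewrite !mulr_ge0.
    by apply: lerXn2r; rewrite ?nnegrE ?(ltW h)//; exact: le_trans (ltW h).
  apply: ler_wpM2r; first by rewrite exprn_ge0// !mulr_ge0.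
  by rewrite -!mulrA ler_peMl ?ler1n// !mulr_ge0.
lra.
Qed.

Lemma derive_dir f (h : V) : Ck setT 1 f -> forall x,
  derivable f x h /\ 'D_h f x = \sum_i h ord0 i * 'D_(basis i) f x.
Proof.
move=> Cf; rewrite {1 2}[h]rV_sum_basis.
have d1 i x : derivable f x (basis i) by exact: (Ck_derivable Cf).
elim: (index_enum _) => [|i r IH] x.
  have E0 : (fun t : R => t^-1 *: ((f \o shift x) (t *: (0 : V)) - f x)) = fun=> 0.
    by apply/funext => t; rewrite /= scaler0 add0r subrr scaler0.
  rewrite !big_nil; split; first by rewrite /derivable E0; exact: is_cvg_cst.
  by rewrite /derive E0; exact: lim_cst.
have [dr Er] := IH x; rewrite !big_cons addrC.
have dz y := derivable_dirZ (h ord0 i) (d1 i y).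
have [|||d E] := @derivable_dirD _ _ f x (\sum_(j <- r) h ord0 j *: basis j) (h ord0 i *: basis i).
- by move=> y; exact: (dz y).1.
- exact: dr.
- rewrite (_ : 'D_(h ord0 i *: basis i) f = fun y => h ord0 i * 'D_(basis i) f y); last first.
    by apply/funext => y; exact: (dz y).2.
  by apply: (@Ck_cont _ _ setT 0) => //; apply: CkZ; [exact: openT|exact: Ck_D].
by split=> //; rewrite E Er (dz x).2 addrC.
Qed.

(** The bound [int (f(x + h) - f(x))^2 <= int (D_h f)^2] is obtained by cutting [h] into [m+1] equal
    steps. On one step the mean value theorem compares the increment with [D_h f] up to a Lipschitz
    error, and the total error tends to 0 as [m] grows. *)
Lemma translation_smooth f (h : V) : TC 2 setT f ->
  \int[mu]_x ((f (x + h) - f x) ^+ 2) <=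
    n%:R * `|h| ^+ 2 * \sum_i \int[mu]_x ('D_(basis i) f x ^+ 2).
Proof.
move=> Tf; have TD i : TC 1 setT ('D_(basis i) f) by exact: TC_D.
have T1 := TC_W Tf; have dd := derive_dir h T1.1.
pose Df x := \sum_i h ord0 i * 'D_(basis i) f x.
have TDf : TC 1 setT Df.
  rewrite /Df; elim: (index_enum _) => [|i r IH].
    under eq_fun do rewrite big_nil; split; first exact: Ck_cst.
    by exists set0; split => //; exact: compact0.
  by under eq_fun do rewrite big_cons; apply: TC_add => //; exact: TC_Z.
pose Q x := Df x * Df x.
have TQ : TC 1 setT Q by apply: TC_Ml => //; exact: TDf.1.
have [L L0 QL] := TC1_lipschitz TQ.
have [M M0 fM] := cptin_box Tf.2.
have iQ := TC_integ TQ; have iB := integ_box n (M + `|h|).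
pose v := \int[mu]_x (\1_(box (M + `|h|)) x : R).
have v0 : 0 <= v by apply: Int_ge0 => x; rewrite indicE.
have Lf := TC_L2 T1.
have Lh (a b : V) : L2 mu (fun x => f (x + a) - f (x + b)) by apply: L2B; exact: L2_shift.
(* [Q] is the square of the derivative along [h] and [L] its Lipschitz constant; all increments live
   in the box of radius [M + |h|], of volume [v]. *)
have step (r : R) : 0 <= r <= 1 -> \int[mu]_x ((f (x + r *: h) - f (x + 0)) ^+ 2) <=
    r ^+ 2 * (\int[mu]_x Q x + L * r * `|h| * v).
  move=> /andP[r0 r1]; rewrite -(IntZ (L * r * `|h|) iB).
  rewrite -(IntD iQ (integZ (L * r * `|h|) iB)) -(IntZ _ (integD iQ (integZ (L * r * `|h|) iB))).
  apply: Int_le; [by case: (Lh (r *: h) 0)|by apply/integZ/integD => //; exact: integZ|].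
  move=> x; rewrite addr0.
  have Q0 : 0 <= Q x by rewrite /Q -expr2 sqr_ge0.
  have Lrh : 0 <= L * r * `|h| by rewrite !mulr_ge0.
  have [xM|xM] := leP `|x| (M + `|h|); last first.
    rewrite !fM; first by rewrite subrr expr0n mulr_ge0 ?sqr_ge0// addr_ge0// mulr_ge0// indicE.
      by apply: le_lt_trans xM; rewrite lerDl.
    have : `|x| - `|r *: h| <= `|x + r *: h| by exact: lerB_normD.
    apply: lt_le_trans; rewrite ltrBrDr; apply: le_lt_trans xM; rewrite lerD2l normrZ.
    by rewrite ger0_norm// ler_piMl.
  rewrite [\1__ x]indicE mem_set// mulr1.
  have [c [cr ->]] := @MVT_line _ _ f x h r (fun t => (dd _).1).
  rewrite (dd _).2 exprMn; apply: ler_wpM2l; first exact: sqr_ge0.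
  rewrite -lerBlDl (_ : _ ^+ 2 = Q (x + c *: h))//; apply: le_trans (ler_norm _) _.
  apply: le_trans (QL _ _) _; rewrite addrAC subrr add0r normrZ mulrA.
  by rewrite ler_wpM2r// ler_wpM2l// (le_trans cr)// ger0_norm.
have main (m : nat) : \int[mu]_x ((f (x + h) - f x) ^+ 2) <=
    \int[mu]_x Q x + L * `|h| * v * m.+1%:R^-1.
  set r : R := m.+1%:R^-1.
  have r01 : 0 <= r <= 1 by rewrite invr_ge0 ler0n/= invf_le1 ?ltr0n// ler1n.
  pose g k x := f (x + (k.+1%:R * r) *: h) - f (x + (k%:R * r) *: h).
  have E x : f (x + h) - f x = \sum_(k <- index_iota 0 m.+1) g k x.
    rewrite (telescope_sumr (fun k : nat => f (x + (k%:R * r) *: h)))//.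
    by rewrite mul0r scale0r addr0 divff ?scale1r// pnatr_eq0.
  have ig k : integ mu (fun x => g k x ^+ 2) by case: (Lh ((k.+1%:R * r) *: h) ((k%:R * r) *: h)).
  (* Cauchy-Schwarz over the steps costs a factor [m+1]; translation invariance makes all terms
     equal, for another factor [m+1], and [r^2] cancels both. *)
  apply: (@le_trans _ _ (m.+1%:R * \sum_(k <- index_iota 0 m.+1) \int[mu]_x (g k x ^+ 2))).
    rewrite -Int_sum// -IntZ; last exact: integ_sum.
    apply: Int_le.
    - by have := (Lh h 0).2; apply: integ_eq => x; rewrite addr0.
    - by apply: integZ; exact: integ_sum.
    - by move=> x; rewrite E; apply: le_trans (sqr_sum_le _ _) _; rewrite size_iota subn0.
  have Eg k : \int[mu]_x (g k x ^+ 2) = \int[mu]_x ((f (x + r *: h) - f (x + 0)) ^+ 2).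
    rewrite -(@Int_shift R n (fun x => (f (x + r *: h) - f (x + 0)) ^+ 2) ((k%:R * r) *: h)); last first.
      by case: (Lh (r *: h) 0) => mm _; apply: measurable_funX.
    apply: eq_Rintegral => x _; rewrite /g addr0 -[in RHS]addrA -scalerDl.
    by rewrite (_ : k%:R * r + r = k.+1%:R * r)// -natr1 mulrDl mul1r.
  under eq_bigr do rewrite Eg.
  set X0 := \int[mu]_x _; rewrite big_const_nat subn0 iter_addr_0 -(mulr_natl X0) mulrA.
  apply: (@le_trans _ _ (m.+1%:R * m.+1%:R * (r ^+ 2 * (\int[mu]_x Q x + L * r * `|h| * v)))).
    by apply: ler_wpM2l; [rewrite mulr_ge0|exact: step].
  rewrite /r mulrA -expr2 -exprMn divff ?pnatr_eq0// expr1n mul1r.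
  by rewrite lerD2l -!mulrA ler_wpM2l// mulrC -!mulrA ler_wpM2l.
have le1 : \int[mu]_x ((f (x + h) - f x) ^+ 2) <= \int[mu]_x Q x.
  apply/ler_addgt0Pr => e e0.
  set c := L * `|h| * v; have c0 : 0 <= c by rewrite !mulr_ge0.
  apply: le_trans (main (Num.truncn (c / e))) _; rewrite lerD2l -/c.
  rewrite ler_pdivrMr// mulrC -ler_pdivrMr//; exact/ltW/truncnS_gt.
apply: le_trans le1 _.
have iD i : integ mu (fun x => 'D_(basis i) f x ^+ 2) by case: (TC_L2 (TD i)).
rewrite -Int_sum// -IntZ; last exact: integ_sum.
apply: Int_le => //; first by apply: integZ; exact: integ_sum.
move=> x; rewrite /Q -expr2; apply: le_trans (sqr_sum_le _ _) _.
rewrite (_ : size _ = n); last by rewrite -sum1_size big_const_ord iter_addn_0 mul1n.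
rewrite -mulrA ler_wpM2l// mulr_sumr; apply: ler_sum => i _.
rewrite exprMn ler_wpM2r ?sqr_ge0// -[leLHS]ger0_norm ?sqr_ge0// normrX.
by apply: lerXn2r; rewrite ?nnegrE//; exact: coord_le_norm.
Qed.

End sobolev_estimates.

(** * Weak forms of the estimates, and compactness *)

Section rellich.
Context (R : realType) (n : nat).
Local Notation V := 'rV[R]_n.
Local Notation mu := (@lebesgue_rV R n).
Implicit Types (f g u v phi a : V -> R) (A K : set V) (i j : 'I_n).

Lemma cvg_sumr (J : Type) (r : seq J) (b : J -> nat -> R) (l : J -> R) :
  (forall c, b c @ \oo --> l c) ->
  (fun m => \sum_(c <- r) b c m) @ \oo --> \sum_(c <- r) l c.
Proof.
move=> al; elim: r => [|c r IH].
  by rewrite big_nil; under eq_fun do rewrite big_nil; exact: cvg_cst.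
by rewrite big_cons; under eq_fun do rewrite big_cons; exact: cvgD.
Qed.

Lemma translation_weak u (g : 'I_n -> V -> R) (h : V) : L2 mu u -> cptin setT u ->
  (forall i, L2 mu (g i)) -> (forall i, cptin setT (g i)) -> (forall i, wder setT i u (g i)) ->
  \int[mu]_x ((u (x + h) - u x) ^+ 2) <=
    n%:R * `|h| ^+ 2 * \sum_i \int[mu]_x (g i x ^+ 2).
Proof.
move=> Lu cu Lg cg w.
have [psi [spsi Lpsi C1 C2]] := smooth_approx openT Lu cu Lg cg w.
have LD m i : L2 mu ('D_(basis i) (psi m)) by apply: (@TC_L2 _ _ 0 setT); apply: TC_D; exact: spsi.
have Cs : L2cvg (fun m x => psi m (x + h) - psi m x) (fun x => u (x + h) - u x).
  apply: L2cvg_le => d d0; have d4 : 0 < d / 4 by rewrite divr_gt0.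
  have [N HN] := L2cvgP C1 d4; exists N => m /HN H.
  have E x : psi m (x + h) - psi m x - (u (x + h) - u x) =
      (psi m (x + h) - u (x + h)) - (psi m x - u x) by ring.
  under eq_Rintegral do rewrite E.
  have La := L2B (L2_shift h (Lpsi m)) (L2_shift h Lu).
  have Lb := L2B (Lpsi m) Lu.
  apply: le_trans (Int_sqrB La Lb) _; rewrite (Int_sqr_shift h (Lpsi m) Lu).
  by move: H; lra.
have Ld m : L2 mu (fun x => psi m (x + h) - psi m x) by apply: L2B => //; exact: L2_shift.
have H1 := L2cvg_norm Ld (L2B (L2_shift h Lu) Lu) Cs.
have H2 : (fun m => n%:R * `|h| ^+ 2 * \sum_i \int[mu]_x ('D_(basis i) (psi m) x ^+ 2)) @ \oo -->
    n%:R * `|h| ^+ 2 * \sum_i \int[mu]_x (g i x ^+ 2).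
  apply: cvgMl_tmp; apply: cvg_sumr => i.
  by apply: (@L2cvg_norm _ _ (fun m => 'D_(basis i) (psi m))).
apply: (ler_cvg_to H1 H2); apply: nearW => m.
by apply: translation_smooth; exact: spsi.
Qed.

Lemma poincare_weak u (g : 'I_n -> V -> R) i M : 0 <= M -> L2 mu u -> (forall x, M < `|x| -> u x = 0) ->
  (forall j, L2 mu (g j)) -> (forall j, cptin setT (g j)) -> (forall j, wder setT j u (g j)) ->
  \int[mu]_x (u x ^+ 2) <= 2 * (4 * (M + 1)) ^+ 2 * \int[mu]_x (g i x ^+ 2).
Proof.
move=> M0 Lu uM Lg cg w.
have cu : cptin (ball (0 : V) (M + 1)) u.
  exists (box M); split; first exact: box_compact.
    move=> x; rewrite /box/= -ball_normE/= sub0r normrN => /le_lt_trans; apply.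
    by rewrite ltrDl.
  by move=> x /negP; rewrite -ltNge; exact: uM.
have [psi [spsi Lpsi C1 C2]] := smooth_approx (ball_open _ _) Lu cu Lg cg w.
have LD m j : L2 mu ('D_(basis j) (psi m)).
  by apply: (@TC_L2 _ _ 0 (ball (0 : V) (M + 1))); apply: TC_D; exact: spsi.
have H1 := L2cvg_norm Lpsi Lu C1.
have H2 : (fun m => 2 * (4 * (M + 1)) ^+ 2 * \int[mu]_x ('D_(basis i) (psi m) x ^+ 2)) @ \oo -->
    2 * (4 * (M + 1)) ^+ 2 * \int[mu]_x (g i x ^+ 2).
  by apply: cvgMl_tmp; apply: (@L2cvg_norm _ _ (fun m => 'D_(basis i) (psi m))).
apply: (ler_cvg_to H1 H2); apply: nearW => m.
rewrite (_ : 4 = 2 * 2 :> R); last by rewrite -natrM.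
apply: (@poincare_smooth R n 1) => //.
- exact: convex_power2.
- by rewrite addr_ge0.
- by apply: TC_S (spsi m 1) => x.
move=> x xM; have [_ [K [cK KA K0]]] := spsi m 0; apply: K0 => /KA.
by rewrite -ball_normE/= sub0r normrN; apply/negP; rewrite -leNgt ltW.
Qed.

(** Above dimension three [Y] also asks for [u] itself in L^6, whereas the energy controls only its
    gradient. Mollifications satisfy the Poincare inequality with exponent 6, and Fatou's lemma
    passes to the limit. *)
Lemma poincare6 u g i M : 0 <= M -> L2 mu u -> (forall x, M < `|x| -> u x = 0) ->
  L2 mu g -> (forall x, M < `|x| -> g x = 0) -> wder setT i u g ->
  integ mu (fun x => g x ^+ 6) -> integ mu (fun x => u x ^+ 6).
Proof.
move=> M0 Lu uM Lg gM w g6.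
have cu := box_cptin uM; have cg := box_cptin gM.
have iu := integ_L2_cpt Lu cu; have ig := integ_L2_cpt Lg cg.
have [e [eP Le _ eae]] := fast_mollify Lu cu (@ltr01 R).
have ep k : 0 < e k by case/andP: (eP k).
have vM k x : M + 1 < `|x| -> conv u (ker (e k)) x = 0.
  move=> xM; apply: (@conv_eq0 _ _ u (ker (e k)) (box M) (e k)).
  - by move=> y /negP; rewrite -ltNge; exact: uM.
  - by move=> y; exact: ker_eq0.
  - move=> y yM; apply: le_trans (lerB_dist _ _); rewrite lerBrDl.
    apply: ltW; apply: le_lt_trans xM; apply: lerD => //; by case/andP: (eP k).
have Tv k : TC 1 setT (conv u (ker (e k))).
  split; first by apply: conv_Ck => // m; exact: ker_TC.
  exact: box_cptin (vM k).
have DE k x : 'D_(basis i) (conv u (ker (e k))) x = conv g (ker (e k)) x.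
  by apply: (@conv_wder _ _ setT) => //; exact: smooth_ker.
have v6 k := conv_power_le (convex_power6 R) (ep k) iu.
have [g6i g6le] : (forall k, integ mu (fun x => conv g (ker (e k)) x ^+ 6)) /\
   (forall k, \int[mu]_x (conv g (ker (e k)) x ^+ 6) <= \int[mu]_x (g x ^+ 6)).
  by split=> k; case: (conv_power_le (convex_power6 R) (ep k) ig g6).
have i6 k : integ mu (fun x => conv u (ker (e k)) x ^+ 6).
  apply: (@integ_cpt _ _ setT).
    by move=> x; apply: (@continuous_comp _ _ _ (conv u (ker (e k))) (fun t => t ^+ 6));
      [exact: (TC_cont (Tv k))|exact: exprn_continuous].
  by apply: (@box_cptin _ _ _ (M + 1)) => x /vM ->; rewrite expr0n.
pose C := 2 * (2 * 6%:R * (M + 1)) ^+ 6 * \int[mu]_x (g x ^+ 6).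
have C0 k : \int[mu]_x (conv u (ker (e k)) x ^+ 6) <= C.
  apply: le_trans (@poincare_smooth R n 5 _ i (M + 1) (convex_power6 R) _ (Tv k) (vM k)) _.
    by rewrite addr_ge0.
  under eq_Rintegral do rewrite DE.
  apply: ler_wpM2l; last exact: g6le.
  by rewrite mulr_ge0// exprn_ge0// !mulr_ge0// addr_ge0.
have u6 x : 0 <= u x ^+ 6 by exact: (cp_ge0 (convex_power6 R)).
suff [H _] : integ mu (fun x => `|u x ^+ 6|) /\ \int[mu]_x `|u x ^+ 6| <= C.
  by apply: integ_eq H => x; rewrite ger0_norm.
apply: (Int_fatou i6 _ _ C0).
- by apply: measurable_funX; exact: Lu.1.
- by move=> k x; exact: (cp_ge0 (convex_power6 R)).
- apply: filterS eae => x Hx; exact: (cvg_comp _ _ Hx (@exprn_continuous _ 6 _)).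
Qed.

(** The image of [U] clusters at a point [p] of a segment. The indices within [d / 2] of [p] form a
    set of [U], for its complement in [U] would contradict clustering. *)
Lemma ultra_bounded_cauchy (U : set_system nat) (a : nat -> R) B d : UltraFilter U ->
  (forall k, `|a k| <= B) -> 0 < d ->
  \forall p \near filter_prod U U, `|a p.1 - a p.2| <= d.
Proof.
move=> UU aB d0; have FU : ProperFilter U := @ultra_proper _ _ UU.
have : `[- B, B]%classic `&` cluster (a @ U) !=set0.
  apply: (@segment_compact R (- B) B).
  change (U [set k | `[- B, B]%classic (a k)]).
  by apply: filterE => k; have := aB k; rewrite ler_norml /= in_itv.
move=> [p [_ cp]].
have d2 : 0 < d / 2 by rewrite divr_gt0.
pose S := [set k | `|p - a k| < d / 2].
have US : U S.
  case: (in_ultra_setVsetC S UU) => // nS.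
  have := cp (~` ball p (d / 2)) (ball p (d / 2)) _ (nbhsx_ballx _ _ d2).
  case=> [|x []//].
  change (U (~` (a @^-1` ball p (d / 2)))).
  by apply: filterS nS => k nk; rewrite /= -ball_normE; exact: nk.
exists (S, S) => //= -[k l] [/= Sk Sl].
have tri (b c : R) : `|p - b| < d / 2 -> `|p - c| < d / 2 -> `|b - c| <= d.
  by rewrite !ltr_norml ler_norml => /andP[? ?] /andP[? ?]; apply/andP; split; lra.
exact: tri.
Qed.

(* Working along an ultrafilter, where bounded real sequences converge, replaces
   the extraction of subsequences. *)
Lemma rellich (U : set_system nat) (u : nat -> V -> R) M C d : UltraFilter U -> 0 <= M -> 0 <= C ->
  (forall k, L2 mu (u k)) -> (forall k x, M < `|x| -> u k x = 0) ->
  (forall k, \int[mu]_x (u k x ^+ 2) <= C) ->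
  (forall k h, \int[mu]_x ((u k (x + h) - u k x) ^+ 2) <= C * `|h| ^+ 2) -> 0 < d ->
  \forall p \near filter_prod U U, \int[mu]_x ((u p.1 x - u p.2 x) ^+ 2) <= d.
Proof.
move=> UU M0 C0 Lu uM uC uh d0.
have FU : ProperFilter U := @ultra_proper _ _ UU.
have d16 : 0 < d / 16 by rewrite divr_gt0.
(* The scale of mollification: by the translation estimate it moves every [u k] by at most [d / 16]
   in squared norm. *)
have [e [e0 e1 eC]] : exists e : R, [/\ 0 < e, e <= 1 & C * e ^+ 2 <= d / 16].
  have C1 : 0 < C + 1 by rewrite ltr_wpDl.
  exists (Num.min 1 (d / 16 / (C + 1))); rewrite lt_min ltr01 divr_gt0// ge_min lexx.
  set e := Num.min _ _; have ele : e <= d / 16 / (C + 1) by rewrite ge_min lexx orbT.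
  have e1 : e <= 1 by rewrite ge_min lexx.
  have e0 : 0 <= e by rewrite le_min ler01 ltW// divr_gt0.
  split => //; rewrite ler_pdivlMr// in ele.
  have : e ^+ 2 <= e by rewrite expr2 ler_piMl.
  nra.
have cu k := box_cptin (uM k); have iu k := integ_L2_cpt (Lu k) (cu k).
pose v k := conv (u k) (ker e).
have [Lv vu] : (forall k, L2 mu (v k)) /\
    (forall k, \int[mu]_x ((v k x - u k x) ^+ 2) <= d / 16).
  suff H k : L2 mu (v k) /\ \int[mu]_x ((v k x - u k x) ^+ 2) <= d / 16.
    by split=> k; case: (H k).
  apply: conv_sub_le => // [|h he]; first exact: ltW.
  apply: le_trans (uh k (- h)) _; apply: le_trans eC; rewrite normrN.
  by apply: ler_wpM2l => //; rewrite lerXn2r ?nnegrE ?normr_ge0 ?(ltW e0).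
have Tk : TC 1 setT (@ker R n e) by exact: ker_TC.
have [L L0 kL] := TC1_lipschitz Tk.
have [S S0 kS] := TC_bounded Tk.
pose vol := \int[mu]_x (\1_(box M) x : R); pose vol1 := \int[mu]_x (\1_(box (M + 1)) x : R).
have vol0 : 0 <= vol by apply: Int_ge0 => x; rewrite indicE.
have vol10 : 0 <= vol1 by apply: Int_ge0 => x; rewrite indicE.
pose B := vol + C; have B0 : 0 <= B by rewrite addr_ge0.
have uB k : \int[mu]_x `|u k x| <= B.
  apply: (@le_trans _ _ (vol + \int[mu]_x (u k x ^+ 2))); last by rewrite lerD2l.
  rewrite -(IntD (integ_box n M) (Lu k).2); apply: Int_le.
  - exact/integ_abs.
  - by apply: integD; [exact: integ_box|exact: (Lu k).2].
  move=> x; rewrite indicE; have [xM|xM] := leP `|x| M; last first.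
    by rewrite uM// normr0 expr0n/= addr0.
  by rewrite mem_set//; exact: (cp_norm (convex_power2 R)).
have kc : continuous (@ker R n e) by exact: TC_cont Tk.
have vL k x y : `|v k x - v k y| <= L * B * `|x - y|.
  apply: le_trans (conv_lipschitz x y (iu k) kc Tk.2 kL) _.
  by rewrite mulrAC ler_wpM2r// ler_wpM2l.
have vS k x : `|v k x| <= S * B.
  have ik := conv_integ x (iu k) kc Tk.2.
  apply: le_trans (Int_abs ik) _; apply: (@le_trans _ _ (\int[mu]_y (S * `|u k y|))).
    apply: Int_le; [exact: integ_abs|by apply: integZ; exact: integ_abs|].
    by move=> y; rewrite normrM mulrC ler_wpM2r.
  by rewrite IntZ; [exact: ler_wpM2l|exact: integ_abs].
have vM k x : M + 1 < `|x| -> v k x = 0.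
  move=> xM; apply: (@conv_eq0 _ _ (u k) (ker e) (box M) e).
  - by move=> y /negP; rewrite -ltNge; exact: uM.
  - by move=> y; exact: ker_eq0.
  - move=> y yM; apply: le_trans (lerB_dist _ _); rewrite lerBrDl.
    by apply: ltW; apply: le_lt_trans xM; exact: lerD.
have [dl [dl0 dlv]] : exists dl : R, 0 < dl /\ dl ^+ 2 * vol1 <= d / 16.
  have C1 : 0 < vol1 + 1 by rewrite ltr_wpDl.
  exists (Num.min 1 (d / 16 / (vol1 + 1))); rewrite lt_min ltr01 divr_gt0//.
  set e' := Num.min _ _; have ele : e' <= d / 16 / (vol1 + 1) by rewrite ge_min lexx orbT.
  have e1' : e' <= 1 by rewrite ge_min lexx.
  have e0' : 0 <= e' by rewrite le_min ler01 ltW// divr_gt0.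
  split => //; rewrite ler_pdivlMr// in ele.
  have : e' ^+ 2 <= e' by rewrite expr2 ler_piMl.
  nra.
(* An Arzela-Ascoli argument: the mollified functions share a bound and a Lipschitz constant, so the
   Cauchy property along [U] at each point becomes uniform on the box by compactness. *)
have /compact_near_coveringP K : compact (box (M + 1) : set V) by exact: box_compact.
have := K _ (filter_prod U U) (fun p x => `|v p.1 x - v p.2 x| <= dl) _.
have LB1 : 0 < 4 * (L * B + 1) by rewrite mulr_gt0// ltr_wpDl// mulr_ge0.
have dl2 : 0 < dl / 2 by rewrite divr_gt0.
case=> [x xM|].
  have H := ultra_bounded_cauchy UU (vS ^~ x) dl2.
  exists (ball x (dl / (4 * (L * B + 1))), [set p | `|v p.1 x - v p.2 x| <= dl / 2]) => /=.
    by split; [apply: nbhsx_ballx; rewrite divr_gt0|exact: H].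
  move=> -[y p] [/= xy Hp].
  have yk k : `|v k x - v k y| <= dl / 4.
    apply: le_trans (vL k x y) _; move: xy; rewrite -ball_normE/= ltr_pdivlMr// => xy.
    have := normr_ge0 (x - y); have : 0 <= L * B by rewrite mulr_ge0.
    move: xy; nra.
  have tri (b c b' c' : R) : `|b - b'| <= dl / 4 -> `|c - c'| <= dl / 4 ->
      `|b - c| <= dl / 2 -> `|b' - c'| <= dl.
    rewrite !ler_norml => /andP[? ?] /andP[? ?] /andP[? ?]; apply/andP; split; lra.
  exact: (tri _ _ _ _ (yk p.1) (yk p.2) Hp).
move=> AB UAB H; exists AB => // p /H Hp.
have Lp := L2B (Lv p.1) (Lv p.2).
have vv : \int[mu]_x ((v p.1 x - v p.2 x) ^+ 2) <= d / 16.
  apply: le_trans dlv; rewrite -(IntZ (dl ^+ 2) (integ_box n (M + 1))).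
  apply: Int_le; [exact: Lp.2|exact: (integZ _ (integ_box n (M + 1)))|].
  move=> x; rewrite indicE; have [xM|xM] := leP `|x| (M + 1); last first.
    by rewrite !vM// subrr expr0n/= mulr_ge0// sqr_ge0.
  rewrite mem_set// mulr1 -[leLHS]ger0_norm ?sqr_ge0// normrX.
  by rewrite lerXn2r ?nnegrE ?(ltW dl0)// Hp.
(* Three errors of squared norm [d / 16] weigh [2 + 2 (2 + 2) = 10] sixteenths of [d] in all. *)
have tri (a b c f : R) : a - f = (a - b) + ((b - c) + (c - f)) by ring.
have E x := tri (u p.1 x) (v p.1 x) (v p.2 x) (u p.2 x).
under eq_Rintegral do rewrite E.
have La := L2B (Lu p.1) (Lv p.1); have Lb := L2B (Lv p.2) (Lu p.2).
have fin (I a b c f : R) : I <= 2 * a + 2 * b -> b <= 2 * c + 2 * f -> a <= d / 16 ->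
    c <= d / 16 -> f <= d / 16 -> I <= d by lra.
apply: (fin _ _ _ _ _ (Int_sqrD La (L2D Lp Lb)) (Int_sqrD Lp Lb) _ vv (vu p.2)).
rewrite Int_sqrBC; exact: vu.
Qed.

End rellich.

(** * Smooth cutoff functions *)

Section plateau.
Context (R : realType) (n : nat).
Local Notation V := 'rV[R]_n.
Local Notation mu := (@lebesgue_rV R n).

Lemma cball_compact (x0 : V) r : compact [set x : V | `|x - x0| <= r].
Proof.
apply: (@subclosed_compact _ _ (box (r + `|x0|))); [|exact: box_compact|].
  rewrite (_ : [set x : V | _] = (fun x => `|x - x0|) @^-1` [set t | t <= r])//.
  apply: closed_comp; last exact: closed_le.
  move=> x _; apply: (@lipschitz_continuous R V (fun x => `|x - x0|) 1) => // y z.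
  by rewrite mul1r; apply: le_trans (ler_dist_dist _ _) _; rewrite opprB addrA subrK.
move=> x /= xr; rewrite /box/=; rewrite -[x](subrK x0).
by apply: le_trans (ler_normD _ _) _; rewrite lerD2r.
Qed.

(** The indicator of the ball of radius [s], midway between [r1] and [r2], is mollified at a quarter
    of the gap: [r1 + e < s] and [s + e < r2]. *)
Lemma plateau (x0 : V) r1 r2 : 0 < r1 < r2 -> exists chi : V -> R,
  smooth (ball x0 r2) chi /\ forall x, `|x - x0| <= r1 -> chi x = 1.
Proof.
move=> /andP[r10 r12]; pose s := (r1 + r2) / 2; pose e := (r2 - r1) / 4.
have e0 : 0 < e by rewrite divr_gt0// subr_gt0.
pose A : set V := [set x | `|x - x0| <= s].
have cA : compact A by exact: cball_compact.
have mA : measurable A by exact: compact_measurable_rV.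
have [M M0 AM] := compact_norm_bounded cA.
have LA : L2 mu (\1_A : V -> R).
  apply: L2_indic => //; apply: le_lt_trans (box_finite n M).
  by apply: le_measure; rewrite ?inE//; try exact: box_meas; exact: AM.
have cpA : cptin setT (\1_A : V -> R).
  by exists A; split => // x nA; rewrite indicE memNset.
have iA := integ_L2_cpt LA cpA.
have kc : continuous (@ker R n e) by exact: TC_cont (ker_TC n 0 e0).
exists (conv (\1_A) (ker e)); split.
  move=> k; split; first by apply: conv_Ck => // m; exact: ker_TC.
  exists [set x | `|x - x0| <= s + e]; split; first exact: cball_compact.
    move=> x /=; rewrite -ball_normE/= distrC => /le_lt_trans; apply.
    by rewrite /s /e; lra.
  move=> x /negP; rewrite -ltNge => xs; apply: (@conv_eq0 _ _ _ (ker e) A e).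
  - by move=> y nA; rewrite indicE memNset.
  - by move=> y; exact: ker_eq0.
  - move=> y Ay; rewrite -(lerD2l s); apply: le_trans (ltW xs) _.
    have -> : x - x0 = (x - y) + (y - x0) by rewrite addrA subrK.
    apply: le_trans (ler_normD _ _) _; rewrite addrC lerD2r//.
move=> x xr; rewrite convE//.
rewrite -(Int_ker n e0); apply: eq_Rintegral => y _.
have [ye|ye] := leP e `|y|; first by rewrite (ker_eq0 e0 ye) mulr0.
rewrite indicE mem_set ?mul1r//= /A/= addrAC.
apply: le_trans (ler_normB _ _) _.
by move: xr ye; rewrite /s /e; lra.
Qed.

End plateau.

Section flat_limit.
Context (R : realType).

Lemma flat0_cvg1 (a : nat -> R) : a @ \oo --> +oo -> (fun m => flat 0 (a m)) @ \oo --> (1 : R).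
Proof.
move=> aoo.
have H : (fun m => expR (- (a m)^-1)) @ \oo --> expR (- 0).
  apply: continuous_cvg; first exact: continuous_expR.
  apply: cvgN; apply/gtr0_cvgV0 => //.
  by move/cvgryPgt : aoo => /(_ 0); apply: filterS.
rewrite oppr0 expR0 in H; apply: cvg_trans H; apply: near_eq_cvg.
move/cvgryPgt : aoo => /(_ 0); apply: filterS => m a0.
by rewrite /flat a0 expr0 mul1r.
Qed.

End flat_limit.

(** * Boundary charts *)
Section chart.
Context (R : realType) (n : nat).
Local Notation V := 'rV[R]_n.
Local Notation mu := (@lebesgue_rV R n).
Context (Omega : set V) (oO : open Omega) (x0 : V) (r r1 : R) (r1r : 0 < r1 < r)
  (k0 : 'I_n) (b : bool) (G : V -> R) (CG : Ck setT 3 G)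
  (GI : forall x (s : R), G (x + s *: basis k0) = G x).
Local Notation sg := ((-1) ^+ b : R).
(** Signed vertical distance to the boundary, positive inside the domain. [G] lives on the whole
    space and is constant along axis [k0], so that all derivatives are taken in one space. *)
Definition height (x : V) : R := sg * (x ord0 k0 - G x).
Local Notation H := height.
Context (chartP : forall x, ball x0 r x -> (Omega x <-> 0 < H x)).
Implicit Types (f g u v w phi psi : V -> R) (i j k : 'I_n).

Local Notation c j := ('D_(basis j) G).

Lemma invariant_D f : (forall x (s : R), f (x + s *: basis k0) = f x) ->
  (forall x, 'D_(basis k0) f x = 0) /\
  (forall i x (s : R), 'D_(basis i) f (x + s *: basis k0) = 'D_(basis i) f x).
Proof.
move=> fI; split=> [x|i x s]; rewrite /derive.
  rewrite (_ : (fun h : R => _) = fun=> 0); first exact: lim_cst.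
  by apply/funext => h; rewrite /= [_ *: _ + x]addrC fI subrr scaler0.
rewrite (_ : (fun h : R => h^-1 *: (_ - f (x + _))) =
  fun h => h^-1 *: ((f \o shift x) (h *: basis i) - f x))//.
by apply/funext => h; rewrite /= addrA !fI.
Qed.

Let cI j x (s : R) : c j (x + s *: basis k0) = c j x.
Proof. exact: (invariant_D GI).2. Qed.

Let Cc j : Ck setT 2 (c j). Proof. exact: Ck_D. Qed.

Let Dc j x : 'D_(basis k0) (c j) x = 0.
Proof. exact: (invariant_D (cI j)).1. Qed.

Let DDc j k x : 'D_(basis k0) ('D_(basis k) (c j)) x = 0.
Proof. exact: (invariant_D ((invariant_D (cI j)).2 k)).1. Qed.

Lemma height_shift x s : H (x + s *: basis k0) = H x + sg * s.
Proof. by rewrite /height GI !mxE !eqxx mulr1 -mulrDr addrAC. Qed.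

Lemma height_Ck : Ck setT 3 H.
Proof.
apply: CkZ; first exact: openT.
by apply: CkB; [exact: openT|exact: Ck_coord|exact: CG].
Qed.

Lemma height_D j x : 'D_(basis j) H x = sg * ((j == k0)%:R - c j x).
Proof.
have dG : derivable G x (basis j) by exact: (Ck_derivable CG).
have dx := @derive_coord R n k0 x (basis j).
have dX := @ex_derive _ _ _ _ _ _ _ dx.
rewrite /height deriveZ; last exact: derivableB.
rewrite deriveB// (@derive_val _ _ _ _ _ _ _ dx) /basis mxE eqxx/= eq_sym.
by [].
Qed.

(* Being a function of [H], this cutoff is killed by the tangential fields
   [D_j + (D_j G) D_k0]; it vanishes where [m H <= 1]. *)
Definition eta (m : nat) (x : V) : R := flat 0 (m%:R * H x - 1).

Lemma eta_Ck m : Ck setT 3 (eta m).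
Proof.
apply: Ck_flat; first exact: openT.
apply: CkB; [exact: openT| |exact: Ck_cst].
by apply: CkZ; [exact: openT|exact: height_Ck].
Qed.

Lemma eta_cvg x : 0 < H x -> (fun m => eta m x) @ \oo --> (1 : R).
Proof.
move=> Hx; apply: flat0_cvg1; apply/cvgryPge => A.
exists (Num.truncn ((A + 1) / H x)).+1 => // m /= mA.
rewrite lerBrDr -ler_pdivrMr//; apply: ltW; apply: lt_le_trans (truncnS_gt _) _.
by rewrite ler_nat.
Qed.

Lemma eta_le1 m x : `|eta m x| <= 1.
Proof. by rewrite ger0_norm ?flat_ge0// flat0_le1. Qed.

Lemma eta_D m j x : 'D_(basis j) (eta m) x =
  flat 2 (m%:R * H x - 1) * (m%:R * 'D_(basis j) H x).
Proof.
have dH : derivable H x (basis j) by exact: (Ck_derivable height_Ck).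
have dmH : derivable (fun x => m%:R * H x - 1) x (basis j).
  by apply: derivableB; [exact: derivableZ|exact: derivable_cst].
have E := is_derive_comp1 (fun t => @is_derive_flat R 0 t) dmH.
rewrite /eta (@derive_val _ _ _ _ _ _ _ E) mul0r subr0; congr (_ * _).
rewrite deriveB; [|exact: derivableZ|exact: derivable_cst].
by rewrite derive_cst subr0 deriveZ.
Qed.

(** The support may touch the boundary of [Omega]: localization keeps away from the sphere of the
    chart only. *)
Definition lsup w := forall x, ~ (`|x - x0| <= r1 /\ Omega x) -> w x = 0.

Lemma lsup_height w x : lsup w -> w x != 0 -> 0 < H x.
Proof.
move=> sw /eqP wx; have [xr Ox] : `|x - x0| <= r1 /\ Omega x.
  by apply: contrapT => nx; exact/wx/sw.
apply/chartP => //; rewrite -ball_normE/= distrC; apply: le_lt_trans xr _.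
by case/andP: r1r.
Qed.

Lemma lsup_cpt w : lsup w -> cptin setT w.
Proof.
move=> sw; exists [set x | `|x - x0| <= r1]; split => //; first exact: cball_compact.
by move=> x nx; apply: sw => -[].
Qed.

Lemma eta_dominated w : integ mu w -> lsup w ->
  \int[mu]_x (w x * eta m x) @[m --> \oo] --> \int[mu]_x w x.
Proof.
move=> iw sw; apply: (Int_dominated (g := fun x => `|w x|)).
- move=> m; apply: measurable_funM; first exact: integ_meas iw.
  by apply: continuous_measurable_rV; exact: CkT_cont (eta_Ck m).
- exact: integ_meas iw.
- exact: integ_abs.
- by move=> m x; rewrite normrM ler_piMr// eta_le1.
apply: aeW => x; have [->|wx] := eqVneq (w x) 0.
  by under eq_fun do rewrite mul0r; exact: cvg_cst.
have H0 : (fun m => w x * eta m x) @ \oo --> w x * 1.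
  by apply: cvgMl_tmp; exact: eta_cvg (lsup_height sw wx).
by rewrite mulr1 in H0.
Qed.

(** [chi] confines a global test function to the chart; on the support of localized data neither its
    values nor its derivatives change. *)
Lemma local_test : exists2 chi : V -> R, smooth (ball x0 r) chi &
  [/\ forall x, `|x - x0| <= r1 -> chi x = 1 &
      forall psi j x, Ck setT 1 psi -> `|x - x0| <= r1 ->
        'D_(basis j) (fun x => chi x * psi x) x = 'D_(basis j) psi x].
Proof.
have /andP[r10 r1r'] := r1r.
have [|chi [schi chi1]] := @plateau R n x0 ((r1 + r) / 2) r; first by apply/andP; split; lra.
exists chi => //; split.
  by move=> x xr; apply: chi1; lra.
move=> psi j x Cpsi xr.
have dpsi y : derivable psi y (basis j) by exact: (Ck_derivable Cpsi).
have dchi y : derivable chi y (basis j) by exact: (Ck_derivable (schi 1).1).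
apply/eqP; rewrite -subr_eq0 -deriveB//; last exact: derivableM.
apply/eqP; apply: (@derive_locally0 R n _ (~` ball x0 ((r1 + r) / 2))).
- by apply: open_closedC; exact: ball_open.
- move=> y /contrapT; rewrite -ball_normE/= distrC => /ltW yr.
  by rewrite /= !fctE chi1// mul1r subrr.
- by apply; rewrite -ball_normE/= distrC; lra.
Qed.

(** The support of the product lies where [m H >= 1], at positive distance from the boundary;
    functions reaching the boundary thus become admissible tests in [Omega]. *)
Lemma eta_TC psi m : TC 1 (ball x0 r) psi -> TC 1 Omega (fun x => eta m x * psi x).
Proof.
move=> [Cpsi [K [cK KA K0]]]; split.
  by apply: CkM => //; [exact: openT|exact: Ck_le (eta_Ck m)].
exists (K `&` [set x | 1 <= m%:R * H x]); split.
- apply: (@subclosed_compact _ _ K) => //.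
  apply: closedI; first exact: (compact_closed (@rV_hausdorff R n)).
  rewrite (_ : [set x | _] = (fun x => m%:R * H x) @^-1` [set t | 1 <= t])//.
  apply: closed_comp; last exact: closed_ge.
  have cH : continuous (fun x => m%:R * H x).
    by apply: (@CkT_cont _ _ 3); apply: CkZ; [exact: openT|exact: height_Ck].
  by move=> x _; exact: cH.
- move=> x [/KA xr /= mH]; apply/chartP => //.
  by rewrite ltNge; apply/negP => /(ler_wpM2l (ler0n R m)); rewrite mulr0; lra.
- move=> x nx; have [Kx|nK] := pselect (K x); last by rewrite K0// mulr0.
  rewrite /eta flat_le0 ?mul0r// subr_le0 leNgt; apply/negP => mH; apply: nx.
  by split => //; exact: ltW.
Qed.

(** The tangential field annihilates [H] and hence the cutoff [eta m], and [c j] passes through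
    [D_k0] because it is constant along that axis. So the cutoff leaves no commutator, and dominated
    convergence removes it whatever the trace of [w]. *)
Lemma tangential_IBP w wj wn j psi : j != k0 -> L2 mu w -> L2 mu wj -> L2 mu wn ->
  lsup w -> lsup wj -> lsup wn ->
  wder Omega j w wj -> wder Omega k0 w wn -> TC 1 setT psi ->
  \int[mu]_x (w x * ('D_(basis j) psi x + c j x * 'D_(basis k0) psi x)) =
  - \int[mu]_x ((wj x + c j x * wn x) * psi x).
Proof.
move=> jk Lw Lj Ln sw sj sn dj dn Tpsi.
have [chi schi [chi1 chiD]] := local_test.
have Tcp : TC 1 (ball x0 r) (fun x => psi x * chi x).
  by apply: TC_Ml; [exact: schi|exact: Tpsi.1].
have cc : continuous (c j) by exact: CkT_cont (Cc j).
pose F x := w x * ('D_(basis j) psi x + c j x * 'D_(basis k0) psi x).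
pose F' x := (wj x + c j x * wn x) * psi x.
have TD k : TC 0 setT ('D_(basis k) psi) by exact: TC_D.
have TX : TC 0 setT (fun x => 'D_(basis j) psi x + c j x * 'D_(basis k0) psi x).
  by apply: TC_add => //; apply: TC_Ml => //; exact: Ck_le (Cc j).
have iF : integ mu F by apply: L2_integM => //; exact: TC_L2 TX.
have Lcn : L2 mu (fun x => c j x * wn x) by apply: L2_Mc (lsup_cpt sn).
have iF' : integ mu F' by apply: L2_integM (TC_L2 Tpsi); exact: L2D.
have sF : lsup F by move=> x /sw; rewrite /F => ->; rewrite mul0r.
have sF' : lsup F' by move=> x nx; rewrite /F' sj// sn// mulr0 addr0 mul0r.
have E m : \int[mu]_x (F x * eta m x) = - \int[mu]_x (F' x * eta m x).
  pose phi x := eta m x * (psi x * chi x).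
  have Tphi : TC 1 Omega phi by exact: eta_TC.
  have Tcphi : TC 1 Omega (fun x => c j x * phi x) by apply: TC_Ml => //; exact: Ck_le (Cc j).
  have dphi k x : derivable phi x (basis k) by exact: TC_derivable Tphi.
  have Dcphi x : 'D_(basis k0) (fun x => c j x * phi x) x = c j x * 'D_(basis k0) phi x.
    rewrite deriveM//; last exact: (Ck_derivable (Cc j)).
    by rewrite Dc scaler0 addr0.
  have I1 : integ mu (fun x => w x * 'D_(basis j) phi x).
    by apply: L2_integM => //; exact: TC_L2 (TC_D j Tphi).
  have I2 : integ mu (fun x => w x * 'D_(basis k0) (fun x => c j x * phi x) x).
    by apply: L2_integM => //; exact: TC_L2 (TC_D k0 Tcphi).
  have Xphi x : `|x - x0| <= r1 -> 'D_(basis j) phi x + c j x * 'D_(basis k0) phi x =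
      ('D_(basis j) psi x + c j x * 'D_(basis k0) psi x) * eta m x.
    move=> xr.
    have de k : derivable (eta m) x (basis k) by exact: (Ck_derivable (eta_Ck m)).
    have dp k : derivable (fun x => psi x * chi x) x (basis k) by exact: TC_derivable Tcp.
    have Dp k : 'D_(basis k) (fun x => psi x * chi x) x = 'D_(basis k) psi x.
      rewrite -(chiD psi k x Tpsi.1 xr); congr derive; apply/funext => y; exact: mulrC.
    rewrite /phi (deriveM (de j) (dp j)) (deriveM (de k0) (dp k0)) !Dp chi1// mulr1 !eta_D !height_D eqxx (negbTE jk).
    rewrite (invariant_D GI).1 /GRing.scale/=; ring.
  transitivity (\int[mu]_x (w x * 'D_(basis j) phi x + w x * 'D_(basis k0) (fun x => c j x * phi x) x)).
    apply: eq_Rintegral => x _; rewrite Dcphi /F.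
    have [xr|xr] := leP `|x - x0| r1; first by rewrite -mulrDr Xphi// mulrA.
    by rewrite sw ?mul0r ?addr0// => -[]; rewrite leNgt xr.
  rewrite (IntD I1 I2) (wder1 oO Lw Lj dj Tphi) (wder1 oO Lw Ln dn Tcphi) -opprD.
  have I3 : integ mu (fun x => wj x * phi x) by apply: L2_integM => //; exact: TC_L2 Tphi.
  have I4 : integ mu (fun x => wn x * (c j x * phi x)).
    by apply: L2_integM => //; exact: TC_L2 Tcphi.
  rewrite -(IntD I3 I4); congr (- _); apply: eq_Rintegral => x _; rewrite /F' /phi.
  have [xr|xr] := leP `|x - x0| r1; first by rewrite chi1// mulr1; ring.
  have nx : ~ (`|x - x0| <= r1 /\ Omega x) by move=> []; rewrite leNgt xr.
  by rewrite sj// sn// mulr0 !mul0r addr0 !mul0r.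
have C1 := eta_dominated iF sF; have C2 := cvgN (eta_dominated iF' sF').
have C3 : (fun m => \int[mu]_x (F x * eta m x)) @ \oo --> - \int[mu]_x F' x.
  by rewrite (funext E); exact: cvgN (eta_dominated iF' sF').
exact: (cvg_unique _ C1 C3).
Qed.

End chart.

Opaque derive basis.

(** Each of the three Young inequalities returns [8^-1 s]; five eighths of [s] remain on the
    left. *)
Lemma absorb (R : realType) (Gs s L w1 w2 q a e PP N c2 : R) : s = w1 + w2 + q ->
  w1 <= 2 * L + 8^-1 * a -> w2 <= 2 * PP + 8^-1 * e -> q <= 2 * N * c2 * Gs + 8^-1 * s ->
  PP <= 2 * c2 * L + 2 * N * c2 * Gs -> a <= s -> e <= s ->
  0 <= L -> 0 <= Gs -> 0 <= N -> 0 <= c2 -> s <= 4 * (1 + 3 * (N + 1) * c2) * (L + Gs).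
Proof.
move=> h1 h2 h3 h4 h5 h6 h7 L0 Gs0 N0 c0.
have P1 : 0 <= N * c2 * L by rewrite !mulr_ge0.
have P2 : 0 <= N * c2 * Gs by rewrite !mulr_ge0.
have P3 : 0 <= c2 * L by rewrite mulr_ge0.
have P4 : 0 <= c2 * Gs by rewrite mulr_ge0.
have -> : 4 * (1 + 3 * (N + 1) * c2) * (L + Gs) = 4 * L + 4 * Gs + 12 * (N * c2 * L) +
  12 * (c2 * L) + 12 * (N * c2 * Gs) + 12 * (c2 * Gs) by ring.
have E1 : 2 * N * c2 * Gs = 2 * (N * c2 * Gs) by ring.
have E2' : 2 * c2 * L = 2 * (c2 * L) by ring.
rewrite E1 in h4 h5; rewrite E2' in h5.
clear E1 E2' N0 c0; move: P1 P2 P3 P4 h4 h5.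
move: (N * c2 * L) (N * c2 * Gs) (c2 * L) (c2 * Gs) => t1 t2 t3 t4 P1 P2 P3 P4 h4 h5.
have hs : s <= 2 * L + 8^-1 * s + (2 * (2 * t3 + 2 * t2) + 8^-1 * s) + (2 * t2 + 8^-1 * s).
  by rewrite [leLHS]h1; lra.
lra.
Qed.

(** * The local H^2 estimate *)
Section local_H2.
Context (R : realType) (n : nat).
Local Notation V := 'rV[R]_n.
Local Notation mu := (@lebesgue_rV R n).
Context (Omega : set V) (oO : open Omega) (x0 : V) (r r1 : R) (r1r : 0 < r1 < r)
  (k0 : 'I_n) (b : bool) (G : V -> R) (CG : Ck setT 3 G)
  (GI : forall x (s : R), G (x + s *: basis k0) = G x).
Local Notation sg := ((-1) ^+ b : R).
Local Notation H := (height k0 b G).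
Context (chartP : forall x, ball x0 r x -> (Omega x <-> 0 < H x)).
Implicit Types (f u w phi psi : V -> R) (i j k l : 'I_n).
Local Notation lsup := (lsup Omega x0 r1).
Local Notation c j := ('D_(basis j) G).

Let cI j x (s : R) : c j (x + s *: basis k0) = c j x.
Proof. exact: (invariant_D GI).2. Qed.

Let Cc j : Ck setT 2 (c j). Proof. exact: Ck_D. Qed.

Let CDc j k : Ck setT 1 ('D_(basis k) (c j)). Proof. exact: Ck_D. Qed.

Let Dc j x : 'D_(basis k0) (c j) x = 0.
Proof. exact: (invariant_D (cI j)).1. Qed.

Let DDc j k x : 'D_(basis k0) ('D_(basis k) (c j)) x = 0.
Proof. exact: (invariant_D ((invariant_D (cI j)).2 k)).1. Qed.

Let DcM j f x : derivable f x (basis k0) ->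
  'D_(basis k0) (fun x => c j x * f x) x = c j x * 'D_(basis k0) f x.
Proof.
move=> df; rewrite (deriveM (@Ck_derivable _ _ setT 1 (c j) k0 x (Cc j) I) df).
by rewrite Dc scaler0 addr0.
Qed.

Context (v : V -> R) (g : 'I_n -> V -> R) (h : 'I_n -> 'I_n -> V -> R)
  (Lv : L2 mu v) (Lg : forall i, L2 mu (g i)) (Lh : forall i k, L2 mu (h i k))
  (sv : lsup v) (sgg : forall i, lsup (g i)) (sh : forall i k, lsup (h i k))
  (dv : forall i, wder setT i v (g i)) (dg : forall i k, wder Omega k (g i) (h i k))
  (hs : forall i k, h i k = h k i).

Let cM (a : V -> R) f : continuous a -> lsup f -> L2 mu f -> L2 mu (fun x => a x * f x).
Proof. by move=> ca sf Lf; exact: L2_Mc ca Lf (lsup_cpt sf). Qed.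

Let cc j : continuous (c j). Proof. exact: CkT_cont (Cc j). Qed.
Let cDc j k : continuous ('D_(basis k) (c j)). Proof. exact: CkT_cont (CDc j k). Qed.

Let lM (a : V -> R) f : lsup f -> lsup (fun x => a x * f x).
Proof. by move=> sf x /sf ->; rewrite mulr0. Qed.

Let lD f f' : lsup f -> lsup f' -> lsup (fun x => f x + f' x).
Proof. by move=> s1 s2 x nx; rewrite s1// s2// addr0. Qed.

Let pI f psi A : L2 mu f -> TC 0 A psi -> integ mu (fun x => f x * psi x).
Proof. by move=> Lf Tp; apply: L2_integM => //; exact: TC_L2 Tp. Qed.

(** The derivative of [v] along [D_j + (D_j G) D_k0]; [tang_grad] is its gradient computed by the
    product rule. *)
Definition tang j x := g j x + c j x * g k0 x.
Definition tang_grad j k x :=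
  h k j x + c j x * h k k0 x + 'D_(basis k) (c j) x * g k0 x.

Let L2_tang j : L2 mu (tang j).
Proof. by apply: L2D => //; exact: cM. Qed.

Let L2_tang_grad j k : L2 mu (tang_grad j k).
Proof. by apply: L2D; [apply: L2D => //; exact: cM|exact: cM]. Qed.

Let lsup_tang j : lsup (tang j).
Proof. by apply: lD => //; exact: lM. Qed.

Let lsup_tang_grad j k : lsup (tang_grad j k).
Proof. by apply: lD; [apply: lD => //; exact: lM|exact: lM]. Qed.

(** The crux at the boundary: [v] has zero trace, hence so has its tangential derivative, whose
    extension by zero is then weakly differentiable across the boundary. Derivatives are moved from
    [v] onto [phi] over the whole space, exchanged there, and brought back by [tangential_IBP]. *)
Lemma tang_wder j k : j != k0 -> wder setT k (tang j) (tang_grad j k).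
Proof.
move=> jk phi sphi.
have sD i : smooth setT ('D_(basis i) phi) by move=> m; exact: TC_D.
have TD i m : TC m setT ('D_(basis i) phi) := sD i m.
have Tc m i : (m <= 2)%N -> TC m setT (fun x => c j x * 'D_(basis i) phi x).
  by move=> m2; apply: TC_Ml => //; exact: Ck_le (Cc j).
pose X x := 'D_(basis j) phi x + c j x * 'D_(basis k0) phi x.
have TX : TC 1 setT X by apply: TC_add => //; exact: Tc.
have Tdc : TC 1 setT (fun x => 'D_(basis k) (c j) x * phi x) by apply: TC_Ml.
have d1 i x m : derivable ('D_(basis i) phi) x (basis m) by exact: TC_derivable (TD i 1).
have dc i x : derivable (c j) x (basis i) by exact: (Ck_derivable (Cc j)).
have E1 := dv j (sD k).
have E2 := wder1 openT Lv (Lg k0) (dv k0) (Tc 1 k isT).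
have E3 := wder1 openT Lv (Lg k) (dv k) TX.
have E4 := wder1 openT Lv (Lg k0) (dv k0) Tdc.
have E5 := tangential_IBP oO r1r CG GI chartP jk (Lg k) (Lh k j) (Lh k k0)
  (sgg k) (sh k j) (sh k k0) (dg k j) (dg k k0) (sphi 1).
have DE2 x : 'D_(basis k0) (fun x => c j x * 'D_(basis k) phi x) x =
    c j x * 'D_(basis k) ('D_(basis k0) phi) x.
  by rewrite (DcM j (d1 k x k0)) (derive2C k0 k x (sphi 2).1).
have DE4 x : 'D_(basis k0) (fun x => 'D_(basis k) (c j) x * phi x) x =
    'D_(basis k) (c j) x * 'D_(basis k0) phi x.
  rewrite deriveM; [|exact: (Ck_derivable (CDc j k))|exact: TC_derivable (sphi 1)].
  by rewrite DDc scaler0 addr0.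
have DE3 x : 'D_(basis k) X x = 'D_(basis j) ('D_(basis k) phi) x +
    'D_(basis k0) (fun x => c j x * 'D_(basis k) phi x) x +
    'D_(basis k0) (fun x => 'D_(basis k) (c j) x * phi x) x.
  rewrite DE2 DE4 /X (deriveD (d1 j x k) (derivableM (dc k x) (d1 k0 x k))).
  rewrite (deriveM (dc k x) (d1 k0 x k)) -addrA (derive2C k j x (sphi 2).1).
  by congr (_ + (_ + _)); exact: mulrC.
have I1 : integ mu (fun x => v x * 'D_(basis j) ('D_(basis k) phi) x).
  by apply: (@pI _ _ setT) => //; apply: TC_D; exact: TD.
have I2 : integ mu (fun x => v x * 'D_(basis k0) (fun x => c j x * 'D_(basis k) phi x) x).
  by apply: (@pI _ _ setT) => //; apply: TC_D; exact: Tc.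
have I4 : integ mu (fun x => v x * 'D_(basis k0) (fun x => 'D_(basis k) (c j) x * phi x) x).
  by apply: (@pI _ _ setT) => //; exact: TC_D.
have S3 : \int[mu]_x (v x * 'D_(basis k) X x) =
    \int[mu]_x (v x * 'D_(basis j) ('D_(basis k) phi) x) +
    \int[mu]_x (v x * 'D_(basis k0) (fun x => c j x * 'D_(basis k) phi x) x) +
    \int[mu]_x (v x * 'D_(basis k0) (fun x => 'D_(basis k) (c j) x * phi x) x).
  rewrite -(IntD I1 I2) -(IntD (integD I1 I2) I4); apply: eq_Rintegral => x _.
  by rewrite DE3 !mulrDr.
have S0 : \int[mu]_x (tang j x * 'D_(basis k) phi x) =
    \int[mu]_x (g j x * 'D_(basis k) phi x) +
    \int[mu]_x (g k0 x * (c j x * 'D_(basis k) phi x)).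
  rewrite -(IntD (pI (Lg j) (TD k 0)) (pI (Lg k0) (Tc 0 k isT))).
  by apply: eq_Rintegral => x _; rewrite /tang; ring.
have Lhc : L2 mu (fun x => h k j x + c j x * h k k0 x) by apply: L2D => //; exact: cM.
have S1 : \int[mu]_x (tang_grad j k x * phi x) =
    \int[mu]_x ((h k j x + c j x * h k k0 x) * phi x) +
    \int[mu]_x (g k0 x * ('D_(basis k) (c j) x * phi x)).
  rewrite -(IntD (pI Lhc (sphi 0)) (pI (Lg k0) (TC_W Tdc))).
  by apply: eq_Rintegral => x _; rewrite /tang_grad; ring.
rewrite S0 S1; move: E1 E2 E3 E4 E5 S3; rewrite -/X.
move=> -> -> -> -> ->; lra.
Qed.

(** Derivatives are exchanged through the test function so that second derivatives of [v] occur on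
    the right only as [h k k]. Summed over [k] they become the Laplacian, up to terms with first
    derivatives of [v]. *)
Lemma tang_weak_eq j k psi : smooth Omega psi ->
  \int[mu]_x (tang_grad j k x * 'D_(basis k) psi x) =
  \int[mu]_x (h k k x * 'D_(basis j) psi x) +
  \int[mu]_x ((c j x * h k k x + 'D_(basis k) (c j) x * g k x) * 'D_(basis k0) psi x) +
  \int[mu]_x ('D_(basis k) (c j) x * g k0 x * 'D_(basis k) psi x).
Proof.
move=> sphi.
have sD i : smooth Omega ('D_(basis i) psi) by move=> m; exact: TC_D.
have TD i m : TC m Omega ('D_(basis i) psi) := sD i m.
have Tc m i : (m <= 2)%N -> TC m Omega (fun x => c j x * 'D_(basis i) psi x).
  by move=> m2; apply: TC_Ml => //; exact: Ck_le (Cc j).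
have d1 i x m : derivable ('D_(basis i) psi) x (basis m) by exact: TC_derivable (TD i 1).
have dc i x : derivable (c j) x (basis i) by exact: (Ck_derivable (Cc j)).
have E1 := dg k j (sD k).
have E2 := dg k k (sD j).
have E3 := wder1 oO (Lg k) (Lh k k0) (dg k k0) (Tc 1 k isT).
have E4 := wder1 oO (Lg k) (Lh k k) (dg k k) (Tc 1 k0 isT).
have DE1 x : 'D_(basis k) ('D_(basis j) psi) x = 'D_(basis j) ('D_(basis k) psi) x.
  exact: (derive2C k j x (sphi 2).1).
have DE3 x : 'D_(basis k0) (fun x => c j x * 'D_(basis k) psi x) x =
    c j x * 'D_(basis k) ('D_(basis k0) psi) x.
  by rewrite (DcM j (d1 k x k0)) (derive2C k0 k x (sphi 2).1).
have DE4 x : 'D_(basis k) (fun x => c j x * 'D_(basis k0) psi x) x =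
    'D_(basis k0) (fun x => c j x * 'D_(basis k) psi x) x +
    'D_(basis k) (c j) x * 'D_(basis k0) psi x.
  by rewrite DE3 (deriveM (dc k x) (d1 k0 x k)); congr (_ + _); exact: mulrC.
have A1 : \int[mu]_x (h k j x * 'D_(basis k) psi x) = \int[mu]_x (h k k x * 'D_(basis j) psi x).
  have X : \int[mu]_x (g k x * 'D_(basis j) ('D_(basis k) psi) x) =
      \int[mu]_x (g k x * 'D_(basis k) ('D_(basis j) psi) x).
    apply: eq_Rintegral => x _; exact: (congr1 (fun t => g k x * t) (esym (DE1 x))).
  exact: oppr_inj (etrans (esym E1) (etrans X E2)).
have I3 : integ mu (fun x => g k x * 'D_(basis k0) (fun x => c j x * 'D_(basis k) psi x) x).
  exact: (pI (Lg k) (TC_D k0 (Tc 1 k isT))).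
have LDg i : L2 mu (fun x => 'D_(basis k) (c j) x * g i x) by exact: cM.
have I5 : integ mu (fun x => 'D_(basis k) (c j) x * g k x * 'D_(basis k0) psi x).
  exact: (pI (LDg k) (TD k0 0)).
have A2 : \int[mu]_x (h k k0 x * (c j x * 'D_(basis k) psi x)) =
    \int[mu]_x (h k k x * (c j x * 'D_(basis k0) psi x)) +
    \int[mu]_x ('D_(basis k) (c j) x * g k x * 'D_(basis k0) psi x).
  apply: oppr_inj; rewrite -E3 opprD -E4 -(IntN I5) -IntD.
  - apply: eq_Rintegral => x _; rewrite DE4; ring.
  - exact: (pI (Lg k) (TC_D k (Tc 1 k0 isT))).
  - exact: integN.
have S0 : \int[mu]_x (tang_grad j k x * 'D_(basis k) psi x) =
    \int[mu]_x (h k j x * 'D_(basis k) psi x) + \int[mu]_x (h k k0 x * (c j x * 'D_(basis k) psi x)) +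
    \int[mu]_x ('D_(basis k) (c j) x * g k0 x * 'D_(basis k) psi x).
  have J1 := pI (Lh k j) (TD k 0); have J2 := pI (Lh k k0) (Tc 0 k isT).
  rewrite -(IntD J1 J2) -(IntD (integD J1 J2) (pI (LDg k0) (TD k 0))).
  by apply: eq_Rintegral => x _; rewrite /tang_grad; ring.
have S1 : \int[mu]_x ((c j x * h k k x + 'D_(basis k) (c j) x * g k x) * 'D_(basis k0) psi x) =
    \int[mu]_x (h k k x * (c j x * 'D_(basis k0) psi x)) +
    \int[mu]_x ('D_(basis k) (c j) x * g k x * 'D_(basis k0) psi x).
  rewrite -(IntD (pI (Lh k k) (Tc 0 k0 isT)) I5).
  by apply: eq_Rintegral => x _; ring.
have fin (s0 s1 a1 a2 a3 b1 b2 b3 : R) : s0 = a1 + a2 + a3 -> s1 = b2 + b3 ->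
    a1 = b1 -> a2 = b2 + b3 -> s0 = b1 + s1 + a3 by move=> -> -> -> ->.
exact: (fin _ _ _ _ _ _ _ _ S0 S1 A1 A2).
Qed.

Lemma wder_shift i u w (a : V) : measurable_fun setT u -> measurable_fun setT w ->
  wder setT i u w -> wder setT i (fun x => u (x + a)) (fun x => w (x + a)).
Proof.
move=> mu' mw uw phi sphi.
have sa : smooth setT (fun x : V => phi (x - a)).
  move=> m; have [Cphi cphi] := sphi m; split; first exact: Ck_shiftV.
  have [M M0 phiM] := cptin_box cphi.
  apply: (@box_cptin _ _ _ (M + `|a|)) => x xM; apply: phiM.
  by apply: lt_le_trans (lerB_dist _ _); rewrite ltrBrDr.
have da x : derivable phi x (basis i) by exact: TC_derivable (sphi 1).
have Da x : 'D_(basis i) (fun x : V => phi (x - a)) x = 'D_(basis i) phi (x - a).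
  exact: (@derive_val _ _ _ _ _ _ _ (is_derive_shiftV (da (x - a)))).
have mD : measurable_fun setT (fun x : V => 'D_(basis i) phi (x - a)).
  apply: (measurableT_comp (f := 'D_(basis i) phi)); last exact: measurable_addrV.
  by apply: continuous_measurable_rV; exact: TC_cont (TC_D i (sphi 1)).
have mp : measurable_fun setT (fun x : V => phi (x - a)).
  by apply: continuous_measurable_rV; exact: TC_cont (sa 0).
have := uw _ sa; under eq_Rintegral do rewrite Da.
rewrite -(@Int_shift R n (fun x => u x * 'D_(basis i) phi (x - a)) a); last exact: measurable_funM.
rewrite -(@Int_shift R n (fun x => w x * phi (x - a)) a); last exact: measurable_funM.
by under eq_Rintegral do rewrite addrK; under [in RHS]eq_Rintegral do rewrite addrK.
Qed.

Lemma L2cvg_shift f (a : nat -> V) : L2 mu f ->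
  (forall e, 0 < e -> exists N, forall m, (N <= m)%N -> `|a m| <= e) ->
  L2cvg (fun m x => f (x - a m)) f.
Proof.
move=> Lf a0; apply: L2cvg_le => d d0; have [e e0 He] := L2_cont Lf d0.
by have [N HN] := a0 e e0; exists N => m /HN; exact: He.
Qed.

Let tang_id j k (F : 'I_n -> V -> R) := \int[mu]_x (tang_grad j k x * F k x) =
  \int[mu]_x (h k k x * F j x) +
  \int[mu]_x ((c j x * h k k x + 'D_(basis k) (c j) x * g k x) * F k0 x) +
  \int[mu]_x ('D_(basis k) (c j) x * g k0 x * F k x).

Let tang_id_lim j k (F : nat -> 'I_n -> V -> R) F0 : (forall m i, L2 mu (F m i)) ->
  (forall i, L2 mu (F0 i)) -> (forall i, L2cvg (fun m => F m i) (F0 i)) ->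
  (forall m, tang_id j k (F m)) -> tang_id j k F0.
Proof.
move=> LF LF0 C Fid.
have Lp : L2 mu (fun x => c j x * h k k x + 'D_(basis k) (c j) x * g k x).
  by apply: L2D; exact: cM.
have Ld : L2 mu (fun x => 'D_(basis k) (c j) x * g k0 x) by exact: cM.
have C1 := L2cvg_pair (LF ^~ k) (LF0 k) (L2_tang_grad j k) (C k).
have C2 := L2cvg_pair (LF ^~ j) (LF0 j) (Lh k k) (C j).
have C3 := L2cvg_pair (LF ^~ k0) (LF0 k0) Lp (C k0).
have C4 := L2cvg_pair (LF ^~ k) (LF0 k) Ld (C k).
have C5 := cvgD (cvgD C2 C3) C4.
have C6 : (fun m => \int[mu]_x (tang_grad j k x * F m k x)) @ \oo --> 
  \int[mu]_x (h k k x * F0 j x) +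
  \int[mu]_x ((c j x * h k k x + 'D_(basis k) (c j) x * g k x) * F0 k0 x) +
  \int[mu]_x ('D_(basis k) (c j) x * g k0 x * F0 k x).
  by rewrite (funext Fid); exact: C5.
exact: (cvg_unique _ C1 C6).
Qed.

(** Puts [tang j] itself as test function. It has zero trace but its support touches the boundary,
    so it is first translated inward along axis [k0], then mollified; both limits preserve the
    identity. *)
Lemma tang_energy j k : j != k0 -> tang_id j k (tang_grad j).
Proof.
move=> jk; have /andP[r10 r1r'] := r1r.
(* Half of the gap keeps the translated supports inside the chart ball. *)
pose s0 := (r - r1) / 2; have s00 : 0 < s0 by rewrite divr_gt0// subr_gt0.
pose s m : R := s0 * m.+1%:R^-1.
have sp m : 0 < s m by rewrite mulr_gt0.
have ss0 m : s m <= s0 by apply: ler_piMr; [exact: ltW|rewrite invf_le1 ?ltr0n// ler1n].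
pose a m : V := (sg * s m) *: basis k0.
have sgsg : sg * sg = 1 by rewrite -expr2 sqrr_sign.
have na m : `|a m| <= s m.
  rewrite /a normrZ normrM normrX normrN1 expr1n mul1r (gtr0_norm (sp m)).
  by rewrite ler_piMr ?basis_norm// ltW.
have Ls f m : L2 mu f -> L2 mu (fun x => f (x - a m)) by exact: L2_shift.
apply: (@tang_id_lim j k (fun m i x => tang_grad j i (x - a m))) => //.
- by move=> m i; exact: Ls.
- move=> i; apply: L2cvg_shift => // e e0.
  exists (Num.truncn (s0 / e)) => m Nm; apply: le_trans (na m) _.
  rewrite /s ler_pdivrMr// mulrC -ler_pdivrMr//; apply: ltW.
  by apply: lt_le_trans (truncnS_gt _) _; rewrite ler_nat.
move=> m.
(* The translation raises heights by [s m], so the support lies where the height is at least [s m],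
   a compact part of [Omega]. *)
have cs w : lsup w -> cptin Omega (fun x => w (x - a m)).
  move=> sw; exists ([set x | `|x - x0| <= r1 + s m] `&` [set x | s m <= H x]); split.
  - apply: (@subclosed_compact _ _ [set x | `|x - x0| <= r1 + s m]); [|exact: cball_compact|by move=> x []].
    apply: closedI; first by apply: (compact_closed (@rV_hausdorff R n)); exact: cball_compact.
    rewrite (_ : [set x | _] = H @^-1` [set t | s m <= t])//.
    apply: closed_comp; last exact: closed_ge.
    by move=> x _; exact: (CkT_cont (height_Ck k0 b CG)).
  - move=> x [/= xr sH]; apply/chartP; last exact: lt_le_trans (sp m) sH.
    rewrite -ball_normE/= distrC; apply: le_lt_trans xr _.
    by have := ss0 m; rewrite /s0; lra.
  - move=> x nx; apply: sw => -[xr Ox]; apply: nx; split.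
      rewrite /= -[x](subrK (a m)) -addrA (addrC (a m)) addrA.
      by apply: le_trans (ler_normD _ _) _; exact: lerD.
    have Hx : 0 < H (x - a m).
      by apply: (chartP _).1 Ox; rewrite -ball_normE/= distrC; exact: le_lt_trans xr _.
    have Es : H (x - a m) = H x - s m.
      by rewrite /a -scaleNr height_shift// mulrN (mulrA sg sg (s m)) sgsg mul1r.
    by rewrite Es subr_gt0 in Hx; exact: ltW.
have [psi [spsi Lpsi _ C2]] := @smooth_approx R n Omega (fun x => tang j (x - a m))
   (fun i x => tang_grad j i (x - a m)) oO (Ls _ m (L2_tang j)) (cs _ (lsup_tang j))
   (fun i => Ls _ m (L2_tang_grad j i)) (fun i => cptinS (@subsetT _ _) (cs _ (lsup_tang_grad j i)))
   (fun i => wder_shift (- a m) (L2_tang j).1 (L2_tang_grad j i).1 (tang_wder i jk)).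
apply: (@tang_id_lim j k (fun m i => 'D_(basis i) (psi m))) => //.
- move=> l i; apply: (@TC_L2 _ _ 0 Omega); apply: TC_D; exact: spsi.
- by move=> i; exact: Ls.
- by move=> l; exact: tang_weak_eq.
Qed.

Lemma young f f' : L2 mu f -> L2 mu f' ->
  \int[mu]_x (f x * f' x) <= 2 * \int[mu]_x (f x ^+ 2) + 8^-1 * \int[mu]_x (f' x ^+ 2).
Proof.
move=> Lf Lf'; rewrite -(IntZ 2 Lf.2) -(IntZ 8^-1 Lf'.2).
have I1 := integZ 2 Lf.2; have I2 := integZ 8^-1 Lf'.2.
rewrite -(IntD I1 I2); apply: Int_le; [exact: L2_integM|exact: integD|].
move=> x; have := sqr_ge0 (f x - 4^-1 * f' x); rewrite !expr2; lra.
Qed.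

Let lap x := \sum_l h l l x.
Let E2 := \int[mu]_x (lap x ^+ 2) + \sum_l \int[mu]_x (g l x ^+ 2).

Let Llap : L2 mu lap. Proof. exact: L2_sum. Qed.

Let sum_pair (F : 'I_n -> V -> R) f : (forall l, L2 mu (F l)) -> L2 mu f ->
  \sum_l \int[mu]_x (F l x * f x) = \int[mu]_x ((\sum_l F l x) * f x).
Proof.
move=> LF Lf; rewrite -Int_sum; last by move=> l; exact: L2_integM.
by apply: eq_Rintegral => x _; rewrite mulr_suml.
Qed.

(** The identity [tang_energy] summed over [k] has the square of the gradient of [tang j] on the
    left and the Laplacian on the right, paired with two of its components; Young's inequality
    absorbs these. *)
Lemma tang_bound C j : 0 <= C -> j != k0 ->
  (forall i x, `|x - x0| <= r1 -> `|c i x| <= C) ->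
  (forall i l x, `|x - x0| <= r1 -> `|'D_(basis l) (c i) x| <= C) ->
  \sum_k \int[mu]_x (tang_grad j k x ^+ 2) <= 4 * (1 + 3 * (n%:R + 1) * C ^+ 2) * E2.
Proof.
move=> C0 jk cC dC.
set S := \sum_k _.
pose p k x := c j x * h k k x + 'D_(basis k) (c j) x * g k x.
pose d k x := 'D_(basis k) (c j) x * g k0 x.
pose P x := \sum_k p k x.
have Lp k : L2 mu (p k) by apply: L2D; exact: cM.
have Ld k : L2 mu (d k) by exact: cM.
have LP : L2 mu P by exact: L2_sum.
have ES : S = \int[mu]_x (lap x * tang_grad j j x) + \int[mu]_x (P x * tang_grad j k0 x) +
    \sum_k \int[mu]_x (d k x * tang_grad j k x).
  have e1 := sum_pair Lp (L2_tang_grad j k0).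
  have e2 := sum_pair (fun l => Lh l l) (L2_tang_grad j j).
  pose aa k := \int[mu]_x (h k k x * tang_grad j j x).
  pose bb k := \int[mu]_x (p k x * tang_grad j k0 x).
  pose dd k := \int[mu]_x (d k x * tang_grad j k x).
  have e3 k : true -> \int[mu]_x (tang_grad j k x ^+ 2) = aa k + bb k + dd k.
    by move=> _; exact: (tang_energy k jk).
  rewrite /S (eq_bigr _ e3) !big_split /=; congr (_ + _ + _); [exact: e2|exact: e1].
have Sge k : \int[mu]_x (tang_grad j k x ^+ 2) <= S.
  rewrite /S (bigD1 k)//= lerDl; apply: sumr_ge0 => l _; apply: Int_ge0 => x; exact: sqr_ge0.
have ge0 f : 0 <= \int[mu]_x (f x ^+ 2) by apply: Int_ge0 => x; exact: sqr_ge0.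
have gl l : \int[mu]_x (g l x ^+ 2) <= \sum_l \int[mu]_x (g l x ^+ 2).
  by rewrite (bigD1 l)//= lerDl; apply: sumr_ge0.
set Gs := \sum_l _ in gl.
have Gs0 : 0 <= Gs by apply: sumr_ge0.
have C2 (t : R) : `|t| <= C -> t ^+ 2 <= C ^+ 2.
  by move=> tC; rewrite -[leLHS]ger0_norm ?sqr_ge0// normrX lerXn2r ?nnegrE.
have dle k : \int[mu]_x (d k x ^+ 2) <= C ^+ 2 * \int[mu]_x (g k0 x ^+ 2).
  rewrite -(IntZ _ (Lg k0).2); apply: Int_le; [exact: (Ld k).2|exact: integZ (Lg k0).2|].
  move=> x; rewrite /d exprMn; have [xr|xr] := leP `|x - x0| r1.
    by rewrite ler_wpM2r ?sqr_ge0// C2// dC.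
  by rewrite sgg ?expr0n ?mulr0// => -[]; rewrite leNgt xr.
have Ple : \int[mu]_x (P x ^+ 2) <= 2 * C ^+ 2 * \int[mu]_x (lap x ^+ 2) +
    2 * n%:R * C ^+ 2 * Gs.
  have Lc : L2 mu (fun x => c j x * lap x).
    by apply: cM => // x nx; rewrite /lap big1// => l _; exact: sh.
  have Ldg l : L2 mu (fun x => 'D_(basis l) (c j) x * g l x) by exact: cM.
  have LQ : L2 mu (fun x => \sum_l 'D_(basis l) (c j) x * g l x) by exact: L2_sum.
  have EP x : P x = c j x * lap x + \sum_l 'D_(basis l) (c j) x * g l x.
    by rewrite /P /p /lap big_split mulr_sumr.
  under eq_Rintegral do rewrite EP.
  apply: le_trans (Int_sqrD Lc LQ) _; rewrite -mulrA; apply: lerD.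
    rewrite ler_pM2l// -(IntZ _ Llap.2); apply: Int_le; [exact: Lc.2|exact: integZ Llap.2|].
    move=> x; rewrite exprMn; have [xr|xr] := leP `|x - x0| r1.
      by rewrite ler_wpM2r ?sqr_ge0// C2// cC.
    rewrite /lap big1 ?expr0n ?mulr0// => l _; apply: sh => -[].
    by rewrite leNgt xr.
  have -> : 2 * n%:R * C ^+ 2 * Gs = 2 * (n%:R * C ^+ 2 * Gs) by ring.
  rewrite ler_pM2l// /Gs -Int_sum; last by move=> l; exact: (Lg l).2.
  rewrite -(IntZ (n%:R * C ^+ 2)); last by apply: integ_sum => l; exact: (Lg l).2.
  apply: Int_le; [exact: LQ.2|by apply: integZ; apply: integ_sum => l; exact: (Lg l).2|].
  move=> x; apply: le_trans (sqr_sum_le _ _) _.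
  rewrite (_ : size _ = n); last by rewrite -sum1_size big_const_ord iter_addn_0 mul1n.
  rewrite -mulrA ler_wpM2l// mulr_sumr; apply: ler_sum => l _; rewrite exprMn.
  have [xr|xr] := leP `|x - x0| r1; first by rewrite ler_wpM2r ?sqr_ge0// C2// dC.
  by rewrite sgg ?expr0n ?mulr0// => -[]; rewrite leNgt xr.
have Y1 := young Llap (L2_tang_grad j j).
have Y2 := young LP (L2_tang_grad j k0).
have Y3 : \sum_k \int[mu]_x (d k x * tang_grad j k x) <= 2 * n%:R * C ^+ 2 * Gs + 8^-1 * S.
  apply: (@le_trans _ _ (\sum_(k < n) (2 * C ^+ 2 * Gs + 8^-1 * \int[mu]_x (tang_grad j k x ^+ 2)))).
    apply: ler_sum => k _; apply: le_trans (young (Ld k) (L2_tang_grad j k)) _.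
    rewrite lerD2r -mulrA ler_pM2l//; apply: le_trans (dle k) _.
    by rewrite ler_wpM2l ?sqr_ge0.
  rewrite big_split/=; apply: lerD; last by rewrite -mulr_sumr.
  rewrite sumr_const card_ord -(mulr_natl (2 * C ^+ 2 * Gs)).
  have -> : n%:R * (2 * C ^+ 2 * Gs) = 2 * n%:R * C ^+ 2 * Gs by ring.
  exact: lexx.
exact: (absorb ES Y1 Y2 Y3 Ple (Sge j) (Sge k0) (ge0 lap) Gs0 (ler0n R n) (sqr_ge0 C)).
Qed.

End local_H2.

(** * From tangential derivatives to the full Hessian *)

Section hessian_algebra.
Context (R : realType) (n : nat).

(** The rows along the tangential fields are known; the entry [m k0 k0] is then read off the trace,
    as in solving an elliptic equation for the normal second derivative. *)
Lemma hessian_algebra (k0 : 'I_n) (a : 'I_n -> R) (m : 'I_n -> 'I_n -> R) C B :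
  0 <= C -> 0 <= B -> (forall j, `|a j| <= C) -> (forall j k, m j k = m k j) ->
  `|\sum_l m l l| <= B ->
  (forall j k, j != k0 -> `|m k j + a j * m k k0| <= B) ->
  forall i k, `|m i k| <= (1 + C) ^+ 2 * (1 + n%:R * (1 + C)) * B.
Proof.
move=> C0 B0 aC ms trB bB.
set q := 1 + n%:R * (1 + C); have q0 : 1 <= q by rewrite lerDl mulr_ge0// addr_ge0.
have qB : 0 <= q * B by rewrite mulr_ge0// (le_trans _ q0).
have BqB : B <= q * B by rewrite ler_peMl.
have m00 : `|m k0 k0| <= q * B.
  pose s := \sum_(l | l != k0) a l ^+ 2.
  have s0 : 0 <= s by apply: sumr_ge0 => l _; exact: sqr_ge0.
  (* By symmetry this known combination equals [m l l - a_l^2 m k0 k0], so removing it from the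
     trace leaves [(1 + s) m k0 k0]. *)
  pose e l := (m l l + a l * m l k0) - a l * (m k0 l + a l * m k0 k0).
  have E : m k0 k0 * (1 + s) = \sum_l m l l - \sum_(l | l != k0) e l.
    rewrite (bigD1 k0)//= mulrDr mulr1 -addrA -sumrB; congr (_ + _).
    rewrite mulr_sumr; apply: eq_bigr => l _; rewrite /e (ms l k0); ring.
  have : `|m k0 k0| * (1 + s) <= q * B.
    rewrite -[1 + s]ger0_norm ?addr_ge0// -normrM E.
    apply: le_trans (ler_normB _ _) _; rewrite /q mulrDl mul1r; apply: lerD => //.
    apply: le_trans (ler_norm_sum _ _ _) _.
    apply: (@le_trans _ _ (\sum_(l < n) (1 + C) * B)).
      rewrite [leRHS](bigD1 k0)//= -[leLHS]add0r; apply: lerD; first by rewrite mulr_ge0// addr_ge0.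
      apply: ler_sum => l lk; rewrite /e mulrDl mul1r.
      apply: le_trans (ler_normB _ _) _; apply: lerD; first exact: bB.
      by rewrite normrM; apply: ler_pM => //; exact: bB.
    by rewrite sumr_const card_ord -(mulr_natl ((1 + C) * B)) mulrA.
  by apply: le_trans; rewrite ler_peMr// lerDl.
have C1 : 1 <= 1 + C by rewrite lerDl.
have m0 j : `|m j k0| <= (1 + C) * (q * B).
  have [->|jk] := eqVneq j k0; first by apply: le_trans m00 _; rewrite ler_peMl.
  rewrite (ms j k0) -[m k0 j](addrK (a j * m k0 k0)).
  apply: le_trans (ler_normB _ _) _; rewrite mulrDl mul1r; apply: lerD.
    by apply: le_trans (bB _ _ jk) _.
  by rewrite normrM ler_pM.
have K : (1 + C) * (q * B) <= (1 + C) ^+ 2 * q * B.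
  by rewrite expr2 -!mulrA ler_peMl// mulr_ge0// (le_trans ler01).
move=> i k; have [->|kk] := eqVneq k k0; first exact: le_trans (m0 i) K.
rewrite -[m i k](addrK (a k * m i k0)).
apply: le_trans (ler_normB _ _) _.
apply: (@le_trans _ _ (q * B + C * ((1 + C) * (q * B)))).
  apply: lerD; first exact: le_trans (bB _ _ kk) _.
  by rewrite normrM ler_pM.
have : 0 <= C * (q * B) by rewrite mulr_ge0.
rewrite expr2; nra.
Qed.

End hessian_algebra.

Section local_estimate.
Context (R : realType) (n : nat).
Local Notation V := 'rV[R]_n.
Local Notation mu := (@lebesgue_rV R n).
Implicit Types (f u w phi psi : V -> R) (i j k l : 'I_n).

Lemma continuous_ball_bounded f (x0 : V) r1 : continuous f ->
  exists2 C : R, 0 <= C & forall x, `|x - x0| <= r1 -> `|f x| <= C.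
Proof.
move=> cf; have : compact (f @` [set x | `|x - x0| <= r1]).
  apply: continuous_compact; last exact: cball_compact.
  exact: continuous_subspaceT.
move=> /compact_bounded[M [Mr HM]]; exists (`|M| + 1) => [|x xr].
  by rewrite addr_ge0.
by apply: (HM (`|M| + 1)); [rewrite ltr_pwDr// ler_norm|exists x].
Qed.

Lemma continuous_ball_bounded_fam (J : finType) (f : J -> V -> R) (x0 : V) r1 :
  (forall c, continuous (f c)) ->
  exists2 C : R, 0 <= C & forall c x, `|x - x0| <= r1 -> `|f c x| <= C.
Proof.
move=> cf.
have /choice[D HD] : forall c, exists D : R, 0 <= D /\ forall x, `|x - x0| <= r1 -> `|f c x| <= D.
  by move=> c; have [D D0 H] := continuous_ball_bounded x0 r1 (cf c); exists D.
exists (\sum_c D c); first by apply: sumr_ge0 => c _; case: (HD c).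
move=> c x xr; apply: le_trans ((HD c).2 x xr) _.
by rewrite (bigD1 c)//= lerDl; apply: sumr_ge0 => e _; case: (HD e).
Qed.

Lemma Int_sqr_ge0 f : 0 <= \int[mu]_x (f x ^+ 2).
Proof. by apply: Int_ge0 => x; exact: sqr_ge0. Qed.

Lemma term_le_sum2 (F : 'I_n -> 'I_n -> R) i k : (forall i k, 0 <= F i k) ->
  F i k <= \sum_j \sum_l F j l.
Proof.
move=> F0; apply: (@le_trans _ _ (\sum_l F i l)).
  by rewrite (bigD1 k)//= lerDl; apply: sumr_ge0.
by rewrite [leRHS](bigD1 i)//= lerDl; apply: sumr_ge0 => j _; apply: sumr_ge0.
Qed.

Lemma size_ord : size (index_enum 'I_n) = n.
Proof. by rewrite -sum1_size big_const_ord iter_addn_0 mul1n. Qed.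

Context (Omega : set V) (oO : open Omega) (x0 : V) (r r1 : R) (r1r : 0 < r1 < r)
  (k0 : 'I_n) (b : bool) (G : V -> R) (CG : Ck setT 3 G)
  (GI : forall x (s : R), G (x + s *: basis k0) = G x)
  (chartP : forall x, ball x0 r x -> (Omega x <-> 0 < height k0 b G x)).
Local Notation lsup := (lsup Omega x0 r1).
Local Notation c j := ('D_(basis j) G).

(** [tang_bound] controls the tangential rows of the Hessian in L^2, and [hessian_algebra], applied
    at each point, controls all entries by these rows and the Laplacian. The constant depends on the
    chart alone. *)
Theorem local_H2_estimate : exists2 CF : R, 0 <= CF &
  forall (v : V -> R) (g : 'I_n -> V -> R) (h : 'I_n -> 'I_n -> V -> R),
  L2 mu v -> (forall i, L2 mu (g i)) -> (forall i k, L2 mu (h i k)) ->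
  lsup v -> (forall i, lsup (g i)) -> (forall i k, lsup (h i k)) ->
  (forall i, wder setT i v (g i)) -> (forall i k, wder Omega k (g i) (h i k)) ->
  (forall i k, h i k = h k i) ->
  forall i k, \int[mu]_x (h i k x ^+ 2) <=
    CF * (\int[mu]_x ((\sum_l h l l x) ^+ 2) + \sum_l \int[mu]_x (g l x ^+ 2)).
Proof.
have cc i : continuous (c i) by apply: CkT_cont (Ck_D i CG).
have cDc i l : continuous ('D_(basis l) (c i)) by apply: CkT_cont (Ck_D l (Ck_D i CG)).
have [C1 C10 H1] := continuous_ball_bounded_fam x0 r1 cc.
have [C2 C20 H2] := continuous_ball_bounded_fam x0 r1
  (fun p : 'I_n * 'I_n => cDc p.1 p.2).
pose C := C1 + C2; have C0 : 0 <= C by rewrite addr_ge0.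
have cC i x : `|x - x0| <= r1 -> `|c i x| <= C.
  by move=> /H1 Hx; apply: le_trans (Hx i) _; rewrite lerDl.
have dC i l x : `|x - x0| <= r1 -> `|'D_(basis l) (c i) x| <= C.
  by move=> xr; apply: le_trans (H2 (i, l) x xr) _; rewrite lerDr.
pose K := (1 + C) ^+ 2 * (1 + n%:R * (1 + C)).
pose CT := 4 * (1 + 3 * (n%:R + 1) * C ^+ 2).
pose CF := K ^+ 2 * (2 + 2 * n%:R ^+ 2 * (n%:R * (2 * CT + 2 * n%:R * C ^+ 2))).
have CT0 : 0 <= CT by rewrite mulr_ge0// addr_ge0// !mulr_ge0// ?addr_ge0// sqr_ge0.
have K0 : 0 <= K by rewrite mulr_ge0 ?sqr_ge0// addr_ge0// mulr_ge0// addr_ge0.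
exists CF.
  by rewrite /CF !(mulr_ge0, addr_ge0, exprn_ge0).
move=> v g h Lv Lg Lh sv sg sh dv dg hs i k.
set lap := fun x => \sum_l h l l x.
have Llap : L2 mu lap by exact: L2_sum.
set E := \int[mu]_x (lap x ^+ 2) + \sum_l \int[mu]_x (g l x ^+ 2).
have gE l : \int[mu]_x (g l x ^+ 2) <= E.
  rewrite /E (bigD1 l)//= addrCA lerDl addr_ge0 ?Int_sqr_ge0//.
  by apply: sumr_ge0 => *; exact: Int_sqr_ge0.
have lE : \int[mu]_x (lap x ^+ 2) <= E.
  by rewrite lerDl; apply: sumr_ge0 => *; exact: Int_sqr_ge0.
have E0 : 0 <= E by apply: le_trans (Int_sqr_ge0 _) lE.
pose d j l x := 'D_(basis l) (c j) x * g k0 x.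
have Ld j l : L2 mu (d j l) by apply: L2_Mc (Lg k0) (lsup_cpt (sg k0)); exact: cDc.
pose tg := tang_grad k0 G g h.
have Ltg j l : L2 mu (tg j l).
  apply: L2D; last exact: Ld.
  by apply: L2D => //; apply: L2_Mc (cc j) (Lh l k0) (lsup_cpt (sh l k0)).
(* The part of [tang_grad] of second order in [v], obtained by removing the term with a derivative
   of [c j]. *)
pose bb j l x := if j == k0 then 0 else tg j l x - d j l x.
have Lbb j l : L2 mu (bb j l).
  by rewrite /bb; case: eqP => _; [exact: L2_0|exact: L2B].
have bbE j l x : j != k0 -> bb j l x = h l j x + c j x * h l k0 x.
  by move=> /negbTE jk; rewrite /bb jk /tg /tang_grad /d addrK.
have dle j l : \int[mu]_x (d j l x ^+ 2) <= C ^+ 2 * E.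
  apply: le_trans (ler_wpM2l (sqr_ge0 C) (gE k0)).
  rewrite -(IntZ _ (Lg k0).2); apply: Int_le; [exact: (Ld j l).2|exact: integZ (Lg k0).2|].
  move=> x; rewrite /d exprMn; have [xr|xr] := leP `|x - x0| r1.
    rewrite ler_wpM2r ?sqr_ge0// -[leLHS]ger0_norm ?sqr_ge0// normrX.
    by rewrite lerXn2r ?nnegrE// dC.
  by rewrite sg ?expr0n ?mulr0// => -[]; rewrite leNgt xr.
have bble j : \sum_l \int[mu]_x (bb j l x ^+ 2) <= (2 * CT + 2 * n%:R * C ^+ 2) * E.
  have [jk|jk] := eqVneq j k0.
    rewrite big1; last first.
      move=> l _; rewrite /bb jk eqxx; under eq_Rintegral do rewrite expr0n.
      exact: Int0.
    by apply: mulr_ge0 => //; apply: addr_ge0; [exact: mulr_ge0|rewrite !(mulr_ge0, exprn_ge0)].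
  have Tb := tang_bound oO r1r CG GI chartP Lv Lg Lh sg sh dv dg C0 jk cC dC.
  apply: (@le_trans _ _ (\sum_l (2 * \int[mu]_x (tg j l x ^+ 2) + 2 * (C ^+ 2 * E)))).
    apply: ler_sum => l _; rewrite /bb (negbTE jk).
    apply: le_trans (Int_sqrB (Ltg j l) (Ld j l)) _.
    by rewrite lerD2l ler_pM2l// dle.
  rewrite big_split/= -mulr_sumr sumr_const card_ord -(mulr_natl (2 * (C ^+ 2 * E))).
  have -> : (2 * CT + 2 * n%:R * C ^+ 2) * E = 2 * (CT * E) + n%:R * (2 * (C ^+ 2 * E)) by ring.
  by rewrite lerD2r ler_pM2l//; exact: Tb.
pose B x := `|lap x| + \sum_j \sum_l `|bb j l x|.
have hB x : `|h i k x| <= K * B x.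
  have B0 : 0 <= B x by rewrite addr_ge0//; do 2 (apply: sumr_ge0 => ? _).
  have [xr|xr] := leP `|x - x0| r1; last first.
    by rewrite sh; [rewrite normr0; exact: mulr_ge0|move=> []; rewrite leNgt xr].
  apply: (@hessian_algebra _ _ k0 (fun j => c j x) (fun i k => h i k x)) => //.
  - by move=> j; exact: cC.
  - by move=> j l; rewrite hs.
  - rewrite -/(lap x) /B lerDl; by do 2 (apply: sumr_ge0 => ? _).
  - move=> j l jk; rewrite -(bbE j l x jk) /B.
    apply: (@le_trans _ _ (\sum_j \sum_l `|bb j l x|)); last by rewrite lerDr.
    exact: (@term_le_sum2 (fun j l => `|bb j l x|)).
pose S x := 2 * lap x ^+ 2 + 2 * n%:R ^+ 2 * \sum_j \sum_l bb j l x ^+ 2.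
have iS1 : integ mu (fun x => \sum_j \sum_l bb j l x ^+ 2).
  by apply: integ_sum => j; apply: integ_sum => l; exact: (Lbb j l).2.
have iS : integ mu S by apply: integD; apply: integZ => //; exact: Llap.2.
have BS x : B x ^+ 2 <= S x.
  set s := \sum_j \sum_l `|bb j l x|.
  have s2 : s ^+ 2 <= n%:R ^+ 2 * \sum_j \sum_l bb j l x ^+ 2.
    apply: le_trans (sqr_sum_le _ _) _; rewrite size_ord expr2 -mulrA ler_wpM2l//.
    rewrite mulr_sumr; apply: ler_sum => j _.
    apply: le_trans (sqr_sum_le _ _) _; rewrite size_ord ler_wpM2l//.
    by apply: ler_sum => l _; rewrite real_normK// num_real.
  have := sqr_ge0 (`|lap x| - s); have := real_normK (num_real (lap x)).
  rewrite /B /S -/s -mulrA => e1; rewrite -e1 => e2.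
  apply: (@le_trans _ _ (2 * `|lap x| ^+ 2 + 2 * s ^+ 2)).
    by move: e2; rewrite !expr2; lra.
  by rewrite lerD2l ler_pM2l.
apply: (@le_trans _ _ (K ^+ 2 * \int[mu]_x S x)).
  rewrite -(IntZ _ iS); apply: Int_le; [exact: (Lh i k).2|exact: integZ|].
  move=> x; apply: le_trans (ler_wpM2l (sqr_ge0 K) (BS x)); rewrite -exprMn.
  rewrite -[leLHS]ger0_norm ?sqr_ge0// normrX lerXn2r ?nnegrE//.
  by apply: le_trans (hB x).
rewrite /CF -mulrA ler_wpM2l ?sqr_ge0//.
rewrite (IntD (integZ 2 Llap.2) (integZ _ iS1)) (IntZ _ Llap.2) (IntZ _ iS1).
set Q := 2 * CT + _.
have -> : (2 + 2 * n%:R ^+ 2 * (n%:R * Q)) * E = 2 * E + 2 * n%:R ^+ 2 * (n%:R * Q * E) by ring.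
apply: lerD; first by rewrite ler_pM2l.
apply: ler_wpM2l; first by rewrite mulr_ge0// sqr_ge0.
rewrite Int_sum; last by move=> j; apply: integ_sum => l; exact: (Lbb j l).2.
apply: (@le_trans _ _ (\sum_(j < n) Q * E)).
  apply: ler_sum => j _; rewrite Int_sum; last by move=> l; exact: (Lbb j l).2.
  exact: bble.
by rewrite sumr_const card_ord -(mulr_natl (Q * E)) mulrA.
Qed.

End local_estimate.

Transparent derive basis.

(** * The Gagliardo-Nirenberg-Sobolev inequality *)
Section axis_inequality.
Context (R : realType).

(** Fundamental theorem of calculus from a point [a] to the left of the support and of [t]. *)
Lemma line_abs_le (f df : R -> R) L : (forall t, is_derive t (1 : R) f (df t)) ->
  continuous df -> (forall t, L < `|t| -> f t = 0) ->
  forall t, (`|f t|%:E <= \int[leb1 R]_s `|df s|%:E)%E.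
Proof.
move=> fd cdf fL t; pose a := - (`|t| + `|L| + 1).
have at' : a < t.
  rewrite /a; have := ler_norm (- t); rewrite normrN; have := normr_ge0 L; lra.
have fa : f a = 0.
  apply: fL; rewrite /a normrN ger0_norm; last by rewrite !addr_ge0.
  by have := ler_norm L; have := normr_ge0 t; lra.
have cf : continuous f.
  by move=> x; apply: differentiable_continuous; apply/derivable1_diffP; exact: (@ex_derive _ _ _ _ _ _ _ (fd x)).
have E : (\int[leb1 R]_(x in `[a, t]) (df x)%:E = (f t)%:E - (f a)%:E)%E.
  apply: continuous_FTC2 => //.
  - exact: continuous_subspaceT.
  - split; first by move=> x _; exact: (@ex_derive _ _ _ _ _ _ _ (fd x)).
      by apply: cvg_at_right_filter; exact: cf.
    by apply: cvg_at_left_filter; exact: cf.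
  - by move=> x _; rewrite derive1E; exact: (@derive_val _ _ _ _ _ _ _ (fd x)).
have mdf : measurable_fun (setT : set (measurableTypeR R)) df.
  exact: continuous_measurable_fun.
rewrite fa sube0 in E; rewrite -abse_EFin -E.
apply: le_trans (le_abse_integral _ _ _) _ => //.
  by apply/measurable_EFinP; exact: measurable_funS mdf.
apply: ge0_subset_integral => //.
by apply/measurable_EFinP; exact: measurableT_comp.
Qed.

Lemma ins_line n (i : 'I_n.+1) (s t : R) (y : 'rV[R]_n) :
  ins i (s + t) y = ins i s y + t *: basis i.
Proof.
rewrite ins_add !mxE !eqxx mulr1; congr ins; rewrite -[LHS]addr0; congr (_ + _).
by apply/rowP => j; rewrite !mxE [_ == i]eq_sym (negbTE (neq_lift i j)) andbF mulr0.
Qed.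

Lemma axis_le n (i : 'I_n.+1) (f : 'rV[R]_n.+1 -> R) s (y : 'rV[R]_n) : TC 1 setT f ->
  (`|f (ins i s y)|%:E <= \int[leb1 R]_t `|'D_(basis i) f (ins i t y)|%:E)%E.
Proof.
move=> Tf; have [M M0 fM] := cptin_box Tf.2.
have E t : ins i t y = ins i 0 y + t *: basis i by rewrite -ins_line add0r.
have d x : derivable f x (basis i) by exact: TC_derivable Tf.
apply: (@line_abs_le (fun t => f (ins i t y)) (fun t => 'D_(basis i) f (ins i t y)) M).
- move=> t; have -> : (fun t => f (ins i t y)) = (fun t => f (ins i 0 y + t *: basis i)).
    by apply/funext => z; rewrite E.
  by rewrite (E t); exact: (@is_derive_line R _ f (ins i 0 y) (basis i) t (d _)).
- have cD := TC_cont (TC_D i Tf).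
  move=> t; apply: (@continuous_comp _ _ _ (fun t => ins i t y) ('D_(basis i) f)); last exact: cD.
  have -> : (fun t => ins i t y) = (fun t => ins i 0 y + t *: basis i).
    by apply/funext => z; rewrite E.
  apply: cvgD; first exact: cvg_cst.
  by apply: cvgZr_tmp; exact: cvg_id.
- move=> t tM; apply: fM; apply: lt_le_trans tM _.
  by have := coord_le_norm (ins i t y) i; rewrite ins_at.
Qed.

Lemma ins_lipschitz n (i : 'I_n.+1) s (y z : 'rV[R]_n) :
  `|ins i s y - ins i s z| <= `|y - z|.
Proof.
apply/norm_rV_leP => // j; rewrite mxE [X in _ + X]mxE.
case: (unliftP i j) => [k|] ->; last by rewrite !ins_at subrr normr0.
rewrite !ins_lift; by have := coord_le_norm (y - z) k; rewrite !mxE.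
Qed.

Lemma ins_norm n (i : 'I_n.+1) s (y : 'rV[R]_n) : `|y| <= `|ins i s y|.
Proof.
by apply/norm_rV_leP => // j; rewrite -(ins_lift i s y j); exact: coord_le_norm.
Qed.

Lemma slice_quot n (i : 'I_n.+1) s (f : 'rV[R]_n.+1 -> R) (y : 'rV[R]_n) j :
  (fun h : R => h^-1 *: (((fun y => f (ins i s y)) \o shift y) (h *: basis j) - f (ins i s y))) =
  (fun h : R => h^-1 *: ((f \o shift (ins i s y)) (h *: basis (lift i j)) - f (ins i s y))).
Proof.
apply/funext => h; congr (_ *: (f _ - _)).
rewrite /= [RHS]addrC ins_add addrC; congr ins.
  by rewrite !mxE [i == _]eq_sym ?[_ == i]eq_sym ?(negbTE (neq_lift i j)) andbF mulr0 addr0.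
by congr (_ + _); apply/rowP => k; rewrite !mxE (inj_eq lift_inj).
Qed.

Lemma slice_derive n (i : 'I_n.+1) s (f : 'rV[R]_n.+1 -> R) (y : 'rV[R]_n) j :
  'D_(basis j) (fun y => f (ins i s y)) y = 'D_(basis (lift i j)) f (ins i s y).
Proof. by rewrite /derive slice_quot. Qed.

Lemma slice_TC n k (i : 'I_n.+1) s (f : 'rV[R]_n.+1 -> R) : TC k.+1 setT f ->
  TC k setT (fun y : 'rV[R]_n => f (ins i s y)).
Proof.
move=> Tf; split; last first.
  have [M M0 fM] := cptin_box Tf.2.
  apply: (@box_cptin _ _ _ M) => y yM; apply: fM; apply: lt_le_trans yM _.
  exact: ins_norm.
have cs (h : 'rV[R]_n.+1 -> R) : TC 1 setT h -> continuous (fun y : 'rV[R]_n => h (ins i s y)).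
  move=> Th; have [L L0 hL] := TC1_lipschitz Th.
  apply: (@lipschitz_continuous _ _ _ L) => // y z; apply: le_trans (hL _ _) _.
  by rewrite ler_wpM2l// ins_lipschitz.
elim: k f Tf => [|k IH] f Tf; first by apply/Ck0P => y _; exact: cs.
apply/CkSP; split.
- by move=> y _; apply: cs; exact: TC_le Tf.
- move=> j y _; rewrite /derivable slice_quot; exact: TC_derivable Tf.
- move=> j; rewrite (_ : 'D_(basis j) _ = fun y => 'D_(basis (lift i j)) f (ins i s y)).
    exact: (IH _ (TC_D (lift i j) Tf)).
  by apply/funext => z; rewrite slice_derive.
Qed.

#[local] Transparent lebesgue_rV.

Lemma Int_rV0 (F : 'rV[R]_0 -> \bar R) : (\int[lebesgue_rV 0]_z F z = F 0%R)%E.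
Proof. rewrite (_ : F = cst (F 0%R)); last first.
  by apply/funext => z; congr F; apply/rowP => -[].
have M1 : lebesgue_rV 0 [set: 'rV[R]_0] = 1%E by exact: diracT.
have H := @integral_cst _ _ R (lebesgue_rV 0) setT measurableT (F 0%R).
by rewrite -[RHS]mule1; exact: (etrans H (congr1 (mule (F 0%R)) M1)). Qed.

#[local] Opaque lebesgue_rV.

Lemma line_le (f : 'rV[R]_1 -> R) y : TC 1 setT f ->
  (`|f y|%:E <= \int[lebesgue_rV 1]_x `|'D_(basis ord0) f x|%:E)%E.
Proof.
move=> Tf; have mD : measurable_fun setT (fun x => `|'D_(basis ord0) f x|%:E).
  apply/measurable_EFinP; apply: measurableT_comp => //.
  exact: continuous_measurable_rV (TC_cont (TC_D ord0 Tf)).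
rewrite (ge0_integral_axis ord0 mD)//.
under eq_integral do rewrite Int_rV0.
rewrite -[y](ins_col' ord0) (_ : col' ord0 y = 0); first exact: axis_le.
by apply/rowP => -[].
Qed.

(** Gagliardo's argument: each of the two factors [|f x|] is bounded by a line integral along a
    different axis, and the resulting product of functions of separate variables integrates to a
    product. *)
Lemma product_le (f : 'rV[R]_2 -> R) : TC 2 setT f ->
  (\int[lebesgue_rV 2]_x (f x ^+ 2)%:E <=
   (\int[lebesgue_rV 2]_x `|'D_(basis ord0) f x|%:E) *
   (\int[lebesgue_rV 2]_x `|'D_(basis (lift ord0 ord0)) f x|%:E))%E.
Proof.
move=> Tf; have T1 := TC_W Tf.
have cm (h : 'rV[R]_2 -> R) : continuous h -> measurable_fun setT (fun x => (h x)%:E).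
  by move=> ch; apply/measurable_EFinP; exact: continuous_measurable_rV.
have cn (h : 'rV[R]_2 -> R) : continuous h -> measurable_fun setT (fun x => `|h x|%:E).
  move=> ch; apply/measurable_EFinP; apply: measurableT_comp => //.
  exact: continuous_measurable_rV.
have c0 := TC_cont (TC_D ord0 T1); have c1 := TC_cont (TC_D (lift ord0 ord0) T1).
have m0 := cn _ c0; have m1 := cn _ c1.
have mf2 : measurable_fun setT (fun x => (f x ^+ 2)%:E).
  apply/measurable_EFinP; apply: measurable_funX; exact: continuous_measurable_rV (TC_cont T1).
pose A s := (\int[lebesgue_rV 1]_y `|'D_(basis (lift ord0 ord0)) f (ins ord0 s y)|%:E)%E.
pose B y := (\int[leb1 R]_t `|'D_(basis ord0) f (ins ord0 t y)|%:E)%E.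
have A0 s : (0 <= A s)%E by exact: integral_ge0.
have B0 y : (0 <= B y)%E by exact: integral_ge0.
have mins : measurable_fun setT (fun p : measurableTypeR R * 'rV[R]_1 => ins ord0 p.1 p.2).
  exact: measurable_ins.
have mA : measurable_fun setT A.
  apply: (@measurable_fun_fubini_tonelli_F _ _ _ _ _ (lebesgue_rV 1) (fun p => `|'D_(basis (lift ord0 ord0)) f (ins ord0 p.1 p.2)|%:E)) => //.
  exact: (measurableT_comp m1 mins).
have mB : measurable_fun setT B.
  apply: (@measurable_fun_fubini_tonelli_G _ _ _ _ _ (leb1 R) (fun p => `|'D_(basis ord0) f (ins ord0 p.1 p.2)|%:E)) => //.
  exact: (measurableT_comp m0 mins).
rewrite (ge0_integral_axis ord0 mf2); last by move=> x; rewrite lee_fin sqr_ge0.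
rewrite (ge0_integral_axis ord0 m1)//.
rewrite (ge0_integral_axis_swap ord0 m0)//.
apply: (@le_trans _ _ ((\int[leb1 R]_s A s) * (\int[lebesgue_rV 1]_y B y))%E); last first.
  by rewrite muleC.
have B0' : (0 <= \int[lebesgue_rV 1]_y B y)%E by exact: integral_ge0.
rewrite -(@ge0_integralZr _ _ _ (leb1 R) setT measurableT A mA _ (fun s _ => A0 s) B0').
apply: ge0_le_integral => //.
- by move=> s _; apply: integral_ge0 => y _; rewrite lee_fin sqr_ge0.
- apply: (@measurable_fun_fubini_tonelli_F _ _ _ _ _ (lebesgue_rV 1) (fun p => (f (ins ord0 p.1 p.2) ^+ 2)%:E)).
    exact: (measurableT_comp mf2 mins).
  by move=> p; rewrite lee_fin sqr_ge0.
- by apply: emeasurable_funM => //; exact: measurable_cst.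
move=> s _; rewrite -ge0_integralZl//.
apply: ge0_le_integral => //.
- by move=> y _; rewrite lee_fin sqr_ge0.
- apply/measurable_EFinP; apply: measurable_funX.
  exact: continuous_measurable_rV (TC_cont (slice_TC ord0 s Tf)).
- exact: (measurable_funeM (A s) mB).
move=> y _; rewrite -real_normK ?num_real// expr2 EFinM.
apply: lee_pmul => //; last exact: axis_le.
have := @line_le (fun y => f (ins ord0 s y)) y (slice_TC ord0 s Tf).
by under eq_integral do rewrite slice_derive.
Qed.

Lemma TC_sqr n k (f : 'rV[R]_n -> R) : TC k setT f -> TC k setT (fun x => f x ^+ 2).
Proof. by move=> Tf; apply: TC_Ml => //; exact: Tf.1. Qed.

Lemma derive_sqr n (f : 'rV[R]_n -> R) x i : derivable f x (basis i) ->
  'D_(basis i) (fun x => f x ^+ 2) x = 2 * f x * 'D_(basis i) f x.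
Proof.
move=> df; have := deriveM df df; rewrite /GRing.scale/= => E.
by rewrite [LHS]E -mulrDr; ring.
Qed.

Lemma TC_cube n k (f : 'rV[R]_n -> R) : TC k setT f -> TC k setT (fun x => f x ^+ 3).
Proof. by move=> Tf; apply: (TC_Ml (TC_sqr Tf)); exact: Tf.1. Qed.

Lemma derive_cube n (f : 'rV[R]_n -> R) x i : derivable f x (basis i) ->
  'D_(basis i) (fun x => f x ^+ 3) x = 3 * f x ^+ 2 * 'D_(basis i) f x.
Proof.
move=> df; have d2 : derivable (fun x => f x ^+ 2) x (basis i) by exact: (derivableM df df).
have := deriveM df d2; rewrite derive_sqr// /GRing.scale/= => E.
by rewrite [LHS]E; ring.
Qed.

Lemma Int_TC_EFin n (f : 'rV[R]_n -> R) : TC 0 setT f ->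
  (\int[lebesgue_rV n]_x `|f x|%:E = (\int[lebesgue_rV n]_x `|f x|)%:E)%E.
Proof. by move=> Tf; apply: Int_EFin; apply: integ_abs; exact: TC_integ Tf. Qed.

Lemma integ_TC_M n (f g : 'rV[R]_n -> R) : TC 0 setT f -> TC 0 setT g ->
  integ (lebesgue_rV n) (fun x => f x * g x).
Proof. by move=> Tf Tg; apply: L2_integM; [exact: TC_L2 Tf|exact: TC_L2 Tg]. Qed.

Lemma mulr_le_half (a b u w : R) : b ^+ 2 <= w -> a ^+ 2 <= u -> b * a <= 2^-1 * (w + u).
Proof. by move=> h1 h2; have := sqr_ge0 (a - b); move: h1 h2; rewrite sqrrB -mulr_natl; lra. Qed.

(** Meant for a power [g] of [f], whose derivatives have the form [c u D_i f]; Cauchy-Schwarz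
    separates [u] from the gradient. The cases [g = f^3] and [g = f^2] give [sobolev_2d]. *)
Lemma product_le_sq (f g u : 'rV[R]_2 -> R) (c : R) : TC 1 setT f -> TC 2 setT g ->
  TC 0 setT u -> 0 <= c -> (forall i x, 'D_(basis i) g x = c * u x * 'D_(basis i) f x) ->
  \int[lebesgue_rV 2]_x (g x ^+ 2) <= 2^-1 * c ^+ 2 * \int[lebesgue_rV 2]_x (u x ^+ 2) *
    (\int[lebesgue_rV 2]_x ('D_(basis ord0) f x ^+ 2) +
     \int[lebesgue_rV 2]_x ('D_(basis (lift ord0 ord0)) f x ^+ 2)).
Proof.
move=> Tf Tg T0 c0 Dg; have := product_le Tg.
have TDg i : TC 0 setT ('D_(basis i) g) by apply: TC_D; exact: TC_W.
have TDf i : TC 0 setT ('D_(basis i) f) by exact: TC_D.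
rewrite !Int_TC_EFin// Int_EFin; last exact: (TC_L2 Tg).2.
rewrite -EFinM lee_fin => /le_trans; apply.
have CS i : (\int[lebesgue_rV 2]_x `|'D_(basis i) g x|) ^+ 2 <=
    c ^+ 2 * (\int[lebesgue_rV 2]_x (u x ^+ 2) * \int[lebesgue_rV 2]_x ('D_(basis i) f x ^+ 2)).
  under eq_Rintegral do rewrite Dg -mulrA normrM (ger0_norm c0).
  rewrite IntZ; last by apply: integ_abs; exact: integ_TC_M.
  rewrite exprMn ler_wpM2l ?sqr_ge0//.
  have La (h : 'rV[R]_2 -> R) : TC 0 setT h -> L2 (lebesgue_rV 2) (fun x => `|h x|).
    move=> Th; split; first by apply: measurableT_comp => //; exact: (TC_L2 Th).1.
    by apply: integ_eq (TC_L2 Th).2 => x; rewrite real_normK// num_real.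
  have := Int_CS (La _ T0) (La _ (TDf i)).
  under eq_Rintegral do rewrite -normrM.
  under [X in _ <= X * _]eq_Rintegral do rewrite real_normK ?num_real//.
  by under [X in _ <= _ * X]eq_Rintegral do rewrite real_normK ?num_real//.
have := CS ord0; have := CS (lift ord0 ord0).
set a := \int[_]_x `|_|; set b := \int[_]_x `|_|; set F := \int[_]_x (u x ^+ 2).
set P := \int[_]_x _; set Q := \int[_]_x _ => h1 h2.
have -> : 2^-1 * c ^+ 2 * F * (Q + P) = 2^-1 * (c ^+ 2 * (F * Q) + c ^+ 2 * (F * P)) by field.
exact: mulr_le_half h2 h1.
Qed.

Lemma sobolev_2d (f : 'rV[R]_2 -> R) : TC 2 setT f ->
  \int[lebesgue_rV 2]_x (f x ^+ 6) <= 2^-1 * 9 * \int[lebesgue_rV 2]_x (f x ^+ 4) *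
    (\int[lebesgue_rV 2]_x ('D_(basis ord0) f x ^+ 2) +
     \int[lebesgue_rV 2]_x ('D_(basis (lift ord0 ord0)) f x ^+ 2)) /\
  \int[lebesgue_rV 2]_x (f x ^+ 4) <= 2 * \int[lebesgue_rV 2]_x (f x ^+ 2) *
    (\int[lebesgue_rV 2]_x ('D_(basis ord0) f x ^+ 2) +
     \int[lebesgue_rV 2]_x ('D_(basis (lift ord0 ord0)) f x ^+ 2)).
Proof.
move=> Tf; have T1 := TC_W Tf; have T0 := TC_W T1.
have d i x : derivable f x (basis i) by exact: TC_derivable T1.
have := @product_le_sq f _ (fun x => f x ^+ 2) 3 T1 (TC_cube Tf) (TC_sqr T0) (ler0n _ _)
  (fun i x => derive_cube (d i x)).
have := @product_le_sq f _ f 2 T1 (TC_sqr Tf) T0 (ler0n _ _) (fun i x => derive_sqr (d i x)).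
rewrite (_ : 2^-1 * 3 ^+ 2 = 2^-1 * 9); last by congr (_ * _); rewrite -natrX.
rewrite (_ : 2^-1 * 2 ^+ 2 = 2); last by rewrite expr2 mulKf// pnatr_eq0.
have e6 (x : R) : (x ^+ 3) ^+ 2 = x ^+ 6 by rewrite -exprM.
have e4 (x : R) : (x ^+ 2) ^+ 2 = x ^+ 4 by rewrite -exprM.
move=> h2 h6; split.
  have := h6; under eq_Rintegral do rewrite e6.
  by under [X in _ <= _ * X * _ -> _]eq_Rintegral do rewrite e4.
by have := h2; under eq_Rintegral do rewrite e4.
Qed.

Lemma Int_TC_X n (f : 'rV[R]_n -> R) q : TC 0 setT f ->
  integ (lebesgue_rV n) (fun x => f x ^+ q.+1).
Proof.
move=> Tf; apply: (@TC_integ _ _ 0 setT); elim: q => [|q IH].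
  by under eq_fun do rewrite expr1.
by under eq_fun do rewrite exprS; apply: TC_Ml => //; exact: Tf.1.
Qed.

(** Squaring the first bound and inserting the second leaves a factor [P] on both sides; [324] is
    [16] times [(9 / 2)^2]. *)
Lemma sobolev_3d_arith (P T D0 S : R) : 0 <= P -> 0 <= T -> 0 <= D0 -> 0 <= S ->
  P <= 2^-1 * 9 * T * S -> T ^+ 2 <= 16 * (P * D0) -> P <= 324 * D0 * S ^+ 2.
Proof.
move=> P0 T0 D0' S0 h1 h2.
have [->|Pn] := eqVneq P 0; first by rewrite !mulr_ge0// sqr_ge0.
have Pp : 0 < P by rewrite lt0r Pn.
rewrite -(ler_pM2l Pp).
have h3 : P * P <= (2^-1 * 9 * T * S) * (2^-1 * 9 * T * S) by apply: ler_pM.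
apply: le_trans h3 _.
have -> : (2^-1 * 9 * T * S) * (2^-1 * 9 * T * S) = T ^+ 2 * (2^-1 * 9 * S) ^+ 2 by ring.
apply: (@le_trans _ _ (16 * (P * D0) * (2^-1 * 9 * S) ^+ 2)).
  by rewrite ler_wpM2r// sqr_ge0.
by rewrite le_eqVlt; apply/orP; left; apply/eqP; field.
Qed.

Lemma slice_arith (A T X Y X' Y' : R) : X = X' -> Y = Y' -> 0 <= X' -> 0 <= Y' -> A <= T ->
  2^-1 * 9 * A * (X + Y) <= 2^-1 * 9 * T * (X' + Y').
Proof.
move=> -> -> X0 Y0 AT; apply: ler_wpM2r; first exact: addr_ge0.
by apply: ler_wpM2l AT.
Qed.

(** The planar inequality is applied on the slices orthogonal to the first axis. The slice integrals
    of [f^4] are bounded uniformly by [T], and [T^2] is bounded in turn by [int f^6] times an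
    integral of the gradient, so that the power of [int f^6] can be divided out. *)
Lemma sobolev_3d (f : 'rV[R]_3 -> R) : TC 3 setT f ->
  \int[lebesgue_rV 3]_x (f x ^+ 6) <= 324 * \int[lebesgue_rV 3]_x ('D_(basis ord0) f x ^+ 2) *
    (\int[lebesgue_rV 3]_x ('D_(basis (lift ord0 ord0)) f x ^+ 2) +
     \int[lebesgue_rV 3]_x ('D_(basis (lift ord0 (lift ord0 ord0))) f x ^+ 2)) ^+ 2.
Proof.
move=> T3; have T2 := TC_W T3; have T1 := TC_W T2; have T0 := TC_W T1.
have d i x : derivable f x (basis i) by exact: TC_derivable T1.
have TD i : TC 1 setT ('D_(basis i) f) by exact: TC_D.
pose f4 x := f x ^+ 4.
have T4 : TC 1 setT f4.
  have := TC_sqr (TC_sqr T1); congr TC; apply/funext => x; by rewrite -exprM.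
have D4 x : 'D_(basis ord0) f4 x = 4 * (f x ^+ 3 * 'D_(basis ord0) f x).
  rewrite /f4 (_ : (fun x => f x ^+ 4) = fun x => (f x ^+ 2) ^+ 2); last first.
    by apply/funext => z; rewrite -exprM.
  rewrite derive_sqr; last exact: derivableM.
  by rewrite derive_sqr//; ring.
set D0 := \int[_]_x ('D_(basis ord0) f x ^+ 2).
set D1 := \int[_]_x ('D_(basis (lift ord0 ord0)) f x ^+ 2).
set D2 := \int[_]_x ('D_(basis _) f x ^+ 2).
pose T := \int[lebesgue_rV 3]_x `|'D_(basis ord0) f4 x|.
have i4 : integ (lebesgue_rV 3) (fun x => `|'D_(basis ord0) f4 x|).
  by apply: integ_abs; apply: TC_integ (TC_D ord0 T4).
have T0' : 0 <= T by apply: Int_ge0.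
(* On each line along the first axis [f^4] is at most the integral of [|D_0 f^4|]; integrating over
   the slice gives a bound free of [s]. *)
have slice4 s : \int[lebesgue_rV 2]_y (f (ins ord0 s y) ^+ 4) <= T.
  rewrite -lee_fin -Int_EFin; last exact: (Int_TC_X 3 (slice_TC ord0 s T1)).
  rewrite -Int_EFin//.
  have m4 : measurable_fun setT (fun x => (`|'D_(basis ord0) f4 x|)%:E).
    by apply/measurable_EFinP; exact: integ_meas i4.
  rewrite (ge0_integral_axis_swap ord0 m4)//; apply: ge0_le_integral => //.
  - by move=> y _; rewrite lee_fin (exprM _ 2 2) sqr_ge0.
  - by apply/measurable_EFinP; exact: integ_meas (Int_TC_X 3 (slice_TC ord0 s T1)).
  - apply: (@measurable_fun_fubini_tonelli_G _ _ _ _ _ (leb1 R)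
      (fun p => `|'D_(basis ord0) f4 (ins ord0 p.1 p.2)|%:E)) => //.
    exact: (measurableT_comp m4 (measurable_ins ord0)).
  - move=> y _; apply: le_trans (axis_le ord0 s y T4); rewrite lee_fin; exact: ler_norm.
have i6 := Int_TC_X 5 T0.
set P := \int[_]_x _.
have P0 : 0 <= P by apply: Int_ge0 => x; rewrite (exprM _ 3 2) sqr_ge0.
have m6 : measurable_fun setT (fun x => (f x ^+ 6)%:E).
  by apply/measurable_EFinP; exact: integ_meas i6.
have D_ge0 i : 0 <= \int[lebesgue_rV 3]_x ('D_(basis i) f x ^+ 2).
  by apply: Int_ge0 => x; exact: sqr_ge0.
have iD i : integ (lebesgue_rV 3) (fun x => 'D_(basis i) f x ^+ 2).
  exact: (TC_L2 (TC_W (TD i))).2.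
have main : P <= 2^-1 * 9 * T * (D1 + D2).
  have iS : integ (lebesgue_rV 3) (fun x => 'D_(basis (lift ord0 ord0)) f x ^+ 2 +
      'D_(basis (lift ord0 (lift ord0 ord0))) f x ^+ 2) by exact: integD.
  have mS : measurable_fun setT (fun x => ('D_(basis (lift ord0 ord0)) f x ^+ 2 +
      'D_(basis (lift ord0 (lift ord0 ord0))) f x ^+ 2)%:E).
    by apply/measurable_EFinP; exact: integ_meas iS.
  rewrite /D1 /D2 -IntD// -lee_fin EFinM -Int_EFin// -Int_EFin//.
  rewrite (ge0_integral_axis ord0 m6); last by move=> x; rewrite lee_fin (exprM _ 3 2) sqr_ge0.
  have S0 (x : 'rV[R]_3) : (0 <= ('D_(basis (lift ord0 ord0)) f x ^+ 2 +
      'D_(basis (lift ord0 (lift ord0 ord0))) f x ^+ 2)%:E)%E.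
    by rewrite lee_fin addr_ge0// sqr_ge0.
  rewrite (ge0_integral_axis ord0 mS)//.
  have mF : measurable_fun setT (fun s => (\int[lebesgue_rV 2]_y
      ('D_(basis (lift ord0 ord0)) f (ins ord0 s y) ^+ 2 +
      'D_(basis (lift ord0 (lift ord0 ord0))) f (ins ord0 s y) ^+ 2)%:E)%E).
    apply: (@measurable_fun_fubini_tonelli_F _ _ _ _ _ (lebesgue_rV 2)
      (fun p => ('D_(basis (lift ord0 ord0)) f (ins ord0 p.1 p.2) ^+ 2 +
      'D_(basis (lift ord0 (lift ord0 ord0))) f (ins ord0 p.1 p.2) ^+ 2)%:E)) => //.
    exact: (measurableT_comp mS (measurable_ins ord0)).
  rewrite -ge0_integralZl//; last 2 first.
  - by move=> s _; apply: integral_ge0.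
  - by rewrite lee_fin !mulr_ge0.
  apply: ge0_le_integral => //.
  - by move=> s _; apply: integral_ge0 => y _; rewrite lee_fin (exprM _ 3 2) sqr_ge0.
  - apply: (@measurable_fun_fubini_tonelli_F _ _ _ _ _ (lebesgue_rV 2)
      (fun p => (f (ins ord0 p.1 p.2) ^+ 6)%:E)).
      exact: (measurableT_comp m6 (measurable_ins ord0)).
    by move=> p; rewrite lee_fin (exprM _ 3 2) sqr_ge0.
  - exact: measurable_funeM.
  move=> s _; have Ts := slice_TC ord0 s T3.
  have Ts0 : TC 0 setT (fun y : 'rV[R]_2 => f (ins ord0 s y)) by exact: TC_W (TC_W Ts).
  have isl j : integ (lebesgue_rV 2) (fun y => 'D_(basis (lift ord0 j)) f (ins ord0 s y) ^+ 2).
    by exact: (TC_L2 (slice_TC ord0 s (TD (lift ord0 j)))).2.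
  rewrite Int_EFin; last exact: (Int_TC_X 5 Ts0).
  rewrite Int_EFin; last by apply: integD; exact: isl.
  rewrite -EFinM lee_fin IntD//; try exact: isl.
  have [H _] := sobolev_2d Ts.
  have E j : \int[lebesgue_rV 2]_y ('D_(basis j) (fun y => f (ins ord0 s y)) y ^+ 2) =
      \int[lebesgue_rV 2]_y ('D_(basis (lift ord0 j)) f (ins ord0 s y) ^+ 2).
    by apply: eq_Rintegral => y _; rewrite slice_derive.
  have pos j : 0 <= \int[lebesgue_rV 2]_y ('D_(basis (lift ord0 j)) f (ins ord0 s y) ^+ 2).
    by apply: Int_ge0 => y; exact: sqr_ge0.
  exact: (le_trans H (slice_arith (E ord0) (E (lift ord0 ord0)) (pos _) (pos _) (slice4 s))).
have CS : T ^+ 2 <= 16 * (P * D0).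
  rewrite /T; under eq_Rintegral do rewrite D4 normrM (ger0_norm (ler0n _ 4)).
  have TM : TC 0 setT (fun x => f x ^+ 3 * 'D_(basis ord0) f x).
    exact: (TC_Ml (TC_W (TD ord0)) (TC_cube T0).1).
  rewrite IntZ; last by apply: integ_abs; exact: TC_integ TM.
  rewrite exprMn (_ : 4 ^+ 2 = 16); last by rewrite -natrX.
  rewrite ler_wpM2l//.
  have La (h : 'rV[R]_3 -> R) : TC 0 setT h -> L2 (lebesgue_rV 3) (fun x => `|h x|).
    move=> Th; split; first by apply: measurableT_comp => //; exact: (TC_L2 Th).1.
    by apply: integ_eq (TC_L2 Th).2 => x; rewrite real_normK// num_real.
  have := Int_CS (La _ (TC_cube T0)) (La _ (TC_W (TD ord0))).
  under eq_Rintegral do rewrite -normrM.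
  under [X in _ <= X * _]eq_Rintegral do rewrite real_normK ?num_real// -exprM.
  by under [X in _ <= _ * X]eq_Rintegral do rewrite real_normK ?num_real//.
apply: sobolev_3d_arith main CS => //; first exact: D_ge0.
by rewrite addr_ge0// D_ge0.
Qed.

Lemma power_le_cube (a b q : R) : 0 <= a <= q -> 0 <= b <= q -> b ^+ 2 * a <= q ^+ 3.
Proof.
move=> /andP[a0 aq] /andP[b0 bq]; rewrite [q ^+ 3]exprSr; apply: ler_pM => //; first exact: sqr_ge0.
by rewrite lerXn2r// nnegrE (le_trans b0 bq).
Qed.

(** The supremum of [f^2] is at most [int 2 |f f'| <= q], whence [f^6 <= q^2 f^2]. *)
Lemma sobolev_1d (f : 'rV[R]_1 -> R) : TC 2 setT f ->
  \int[lebesgue_rV 1]_x (f x ^+ 6) <=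
    (\int[lebesgue_rV 1]_x (f x ^+ 2) + \int[lebesgue_rV 1]_x ('D_(basis ord0) f x ^+ 2)) ^+ 3.
Proof.
move=> T2; have T1 := TC_W T2; have T0 := TC_W T1; have TD := TC_D ord0 T2.
have d x : derivable f x (basis ord0) by exact: TC_derivable T1.
have i2 := (TC_L2 T0).2; have iD := (TC_L2 (TC_W TD)).2.
set q := _ + _.
have q0 : 0 <= \int[lebesgue_rV 1]_x (f x ^+ 2) by apply: Int_ge0 => x; exact: sqr_ge0.
have q1 : 0 <= \int[lebesgue_rV 1]_x ('D_(basis ord0) f x ^+ 2).
  by apply: Int_ge0 => x; exact: sqr_ge0.
have sup y : f y ^+ 2 <= q.
  have T4 := TC_sqr T1; have := line_le y T4.
  rewrite (Int_TC_EFin (TC_D ord0 T4)) lee_fin ger0_norm ?sqr_ge0// => /le_trans; apply.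
  rewrite /q -IntD//; apply: Int_le.
  - by apply: integ_abs; apply: TC_integ (TC_D ord0 T4).
  - exact: integD.
  - move=> x; rewrite derive_sqr// -[_ + _]ger0_norm ?addr_ge0 ?sqr_ge0//.
    rewrite [leRHS]ger0_norm ?addr_ge0 ?sqr_ge0// ler_norml.
    by move: (f x) ('D_(basis ord0) f x) => a b; have := sqr_ge0 (a - b); have := sqr_ge0 (a + b); move=> *; apply/andP; split; nra.
apply: (@le_trans _ _ (\int[lebesgue_rV 1]_x (q ^+ 2 * f x ^+ 2))).
  apply: Int_le; first exact: Int_TC_X 5 T0.
    exact: integZ.
  move=> x; rewrite (exprD _ 4 2) (exprM _ 2 2) ler_wpM2r ?sqr_ge0// lerXn2r// ?nnegrE ?sqr_ge0//.
  by rewrite /q addr_ge0.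
rewrite IntZ//; apply: power_le_cube; rewrite ?q0 /q /= ?lerDl ?addr_ge0// ?lexx//.
Qed.

Lemma sobolev_arith2 (P F a S : R) : 0 <= a -> 0 <= S -> P <= 2^-1 * 9 * F * S ->
  F <= 2 * a * S -> P <= 324 * (a + S) ^+ 3.
Proof.
move=> a0 S0 h1 h2; apply: (le_trans h1).
have h3 : 2^-1 * 9 * F * S <= 2^-1 * 9 * (2 * a * S) * S.
  by apply: ler_wpM2r => //; apply: ler_wpM2l.
apply: (le_trans h3).
have h4 : S ^+ 2 * a <= (a + S) ^+ 3.
  by apply: power_le_cube; rewrite ?a0 ?S0 ?lerDl ?lerDr.
have h5 : 0 <= S ^+ 2 * a by rewrite mulr_ge0// sqr_ge0.
have -> : 2^-1 * 9 * (2 * a * S) * S = 9 * (S ^+ 2 * a) by field.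
move: h4 h5; move: (S ^+ 2 * a) ((a + S) ^+ 3) => u w; lra.
Qed.

Lemma sobolev_arith3 (P a D S : R) : 0 <= a -> 0 <= D -> 0 <= S -> P <= 324 * D * S ^+ 2 ->
  P <= 324 * (a + (D + S)) ^+ 3.
Proof.
move=> a0 D0 S0 h1; apply: (le_trans h1); rewrite -mulrA ler_wpM2l// mulrC.
apply: power_le_cube; first by rewrite D0 addrCA lerDl addr_ge0.
by rewrite S0 addrA lerDr addr_ge0.
Qed.

Lemma sum2 (F : 'I_2 -> R) : \sum_i F i = F ord0 + F (lift ord0 ord0).
Proof. by rewrite !big_ord_recl big_ord0 addr0. Qed.

Lemma sum3 (F : 'I_3 -> R) :
  \sum_i F i = F ord0 + (F (lift ord0 ord0) + F (lift ord0 (lift ord0 ord0))).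
Proof. by rewrite !big_ord_recl big_ord0 addr0. Qed.

Lemma sobolev_smooth n (f : 'rV[R]_n.+1 -> R) : (n < 3)%N -> TC 3 setT f ->
  \int[lebesgue_rV n.+1]_x (f x ^+ 6) <= 324 * (\int[lebesgue_rV n.+1]_x (f x ^+ 2) +
    \sum_i \int[lebesgue_rV n.+1]_x ('D_(basis i) f x ^+ 2)) ^+ 3.
Proof.
have pos (m : nat) (h : 'rV[R]_m -> R) : 0 <= \int[lebesgue_rV m]_x (h x ^+ 2).
  by apply: Int_ge0 => x; exact: sqr_ge0.
case: n f => [|[|[|//]]] f _ T3.
- rewrite big_ord1; apply: (le_trans (sobolev_1d (TC_W T3))); rewrite ler_peMl ?ler1n//.
  by rewrite exprn_ge0// addr_ge0.
- rewrite (sum2 (fun i => \int[lebesgue_rV 2]_x ('D_(basis i) f x ^+ 2))).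
  have [h1 h2] := sobolev_2d (TC_W T3).
  by apply: sobolev_arith2 h1 h2; rewrite ?addr_ge0.
- rewrite (sum3 (fun i => \int[lebesgue_rV 3]_x ('D_(basis i) f x ^+ 2))).
  by apply: sobolev_arith3 (sobolev_3d T3); rewrite ?addr_ge0.
Qed.

Lemma sobolev6 n (u : 'rV[R]_n.+1 -> R) (g : 'I_n.+1 -> 'rV[R]_n.+1 -> R) : (n < 3)%N ->
  L2 (lebesgue_rV n.+1) u -> cptin setT u -> (forall i, L2 (lebesgue_rV n.+1) (g i)) ->
  (forall i, cptin setT (g i)) -> (forall i, wder setT i u (g i)) ->
  integ (lebesgue_rV n.+1) (fun x => u x ^+ 6).
Proof.
move=> n3 Lu cu Lg cg w; pose mu := @lebesgue_rV R n.+1.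
have iu := integ_L2_cpt Lu cu; have ig i := integ_L2_cpt (Lg i) (cg i).
have [e [eP Le _ eae]] := fast_mollify Lu cu (@ltr01 R).
have ep k : 0 < e k by case/andP: (eP k).
have [M M0 uM] := cptin_box cu.
have vM k x : M + 1 < `|x| -> conv u (ker (e k)) x = 0.
  move=> xM; apply: (@conv_eq0 _ _ u (ker (e k)) (box M) (e k)).
  - by move=> y /negP; rewrite -ltNge; exact: uM.
  - by move=> y; exact: ker_eq0.
  - move=> y yM; apply: le_trans (lerB_dist _ _); rewrite lerBrDl.
    apply: ltW; apply: le_lt_trans xM; apply: lerD => //; by case/andP: (eP k).
have Tv k : TC 3 setT (conv u (ker (e k))).
  split; first by apply: conv_Ck => // m; exact: ker_TC.
  exact: box_cptin (vM k).
have DE i k x : 'D_(basis i) (conv u (ker (e k))) x = conv (g i) (ker (e k)) x.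
  by apply: (@conv_wder _ _ setT) => //; exact: smooth_ker.
have u2 k : \int[mu]_x (conv u (ker (e k)) x ^+ 2) <= \int[mu]_x (u x ^+ 2).
  by case: (conv_power_le (convex_power2 R) (ep k) iu Lu.2).
have g2 i k : \int[mu]_x (conv (g i) (ker (e k)) x ^+ 2) <= \int[mu]_x (g i x ^+ 2).
  by case: (conv_power_le (convex_power2 R) (ep k) (ig i) (Lg i).2).
have i6 k : integ mu (fun x => conv u (ker (e k)) x ^+ 6).
  exact: (Int_TC_X 5 (TC_W (TC_W (TC_W (Tv k))))).
pose C := 324 * (\int[mu]_x (u x ^+ 2) + \sum_i \int[mu]_x (g i x ^+ 2)) ^+ 3.
have pos (h : 'rV[R]_n.+1 -> R) : 0 <= \int[mu]_x (h x ^+ 2).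
  by apply: Int_ge0 => x; exact: sqr_ge0.
have C0 k : \int[mu]_x (conv u (ker (e k)) x ^+ 6) <= C.
  apply: le_trans (sobolev_smooth n3 (Tv k)) _; rewrite ler_wpM2l//.
  have pS (h : 'I_n.+1 -> 'rV[R]_n.+1 -> R) : 0 <= \sum_i \int[mu]_x (h i x ^+ 2).
    by apply: sumr_ge0 => i _; exact: pos.
  apply: lerXn2r; rewrite ?nnegrE.
  - exact: (addr_ge0 (pos _) (pS (fun i x => 'D_(basis i) _ x))).
  - exact: (addr_ge0 (pos _) (pS g)).
  apply: lerD => //; apply: ler_sum => i _.
  by under eq_Rintegral do rewrite DE.
have u6 x : 0 <= u x ^+ 6 by exact: (cp_ge0 (convex_power6 R)).
suff [H _] : integ mu (fun x => `|u x ^+ 6|) /\ \int[mu]_x `|u x ^+ 6| <= C.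
  by apply: integ_eq H => x; rewrite ger0_norm.
apply: (Int_fatou i6 _ _ C0).
- by apply: measurable_funX; exact: Lu.1.
- by move=> k x; exact: (cp_ge0 (convex_power6 R)).
- apply: filterS eae => x Hx; exact: (cvg_comp _ _ Hx (@exprn_continuous _ 6 _)).
Qed.

End axis_inequality.

(** * Decay of the derivative of the boundary cutoff *)

Section flat_bounds.
Context (R : realType).

Lemma flat_bound m : exists2 C : R, 0 <= C & forall s, flat m s <= C.
Proof.
have [C C0 HC] := @expRN_bound R m; exists C => // s; rewrite /flat; case: ifP => // s0.
by apply: HC; rewrite invr_gt0.
Qed.

(** With [s = m H - 1] the factor [s + 1] is [m H], the size of the derivative of the cutoff times a
    function vanishing linearly on the boundary. The bound [2 / s] tends to 0 as [m] grows. *)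
Lemma flat2_decay (s : R) : 1 <= s -> (s + 1) * flat 2 s <= 2 * s^-1.
Proof.
move=> s1; have s0 : 0 < s by lra.
have E1 : expR (- s^-1) <= 1 by rewrite -expR0 ler_expR oppr_le0 invr_ge0 ltW.
have E0 : 0 <= expR (- s^-1) by exact: expR_ge0.
have i0 : 0 <= s^-1 by rewrite invr_ge0 ltW.
have i1 : s^-1 <= 1 by rewrite invf_le1.
rewrite /flat s0.
have -> : (s + 1) * (s^-1 ^+ 2 * expR (- s^-1)) = (1 + s^-1) * (s^-1 * expR (- s^-1)).
  by field; rewrite gt_eqF.
apply: ler_pM; rewrite ?addr_ge0 ?mulr_ge0//; first by lra.
by rewrite ler_piMr.
Qed.

Lemma flat2_bound : exists2 C : R, 0 <= C & forall s, (s + 1) * flat 2 s <= C.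
Proof.
have [C C0 HC] := flat_bound 2; exists (2 * C + 2); first by rewrite addr_ge0 ?mulr_ge0.
move=> s; have [s1|s1] := leP 1 s.
  apply: le_trans (flat2_decay s1) _.
  have i1 : s^-1 <= 1 by rewrite invf_le1//; lra.
  by move: i1 C0; set i := s^-1; lra.
have F0 := flat_ge0 2 s; have FC := HC s.
apply: (@le_trans _ _ (2 * flat 2 s)); last by lra.
by apply: ler_wpM2r => //; lra.
Qed.

End flat_bounds.

Section abstract_continuity.
Context (R : realType).

Lemma nonexpansive_continuous (W W' : normedModType R) (f : W -> W') :
  (forall x y, `|f x - f y| <= `|x - y|) -> continuous f.
Proof.
move=> fL x; apply/cvgrPdist_le => e e0; near=> y; apply: le_trans (fL x y) _.
have : ball x e y by near: y; exact: nbhsx_ballx.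
by rewrite -ball_normE => /ltW.
Unshelve. all: by end_near. Qed.

Lemma shear_continuous (W : normedModType R) (q : W -> R) (v : W) : continuous q ->
  continuous (fun y => y + q y *: v).
Proof. by move=> cq x; apply: cvgD; [exact: cvg_id|apply: cvgZr_tmp; exact: cq]. Qed.

Lemma continuousT_comp (W W' W'' : topologicalType) (f : W -> W') (g : W' -> W'') :
  continuous f -> continuous g -> continuous (fun x => g (f x)).
Proof. by move=> cf cg x; apply: continuous_comp; [exact: cf|exact: cg]. Qed.

Lemma addr_subK (W : zmodType) (a x e1 e2 : W) : a + (x + e1) + (e2 - e1) = a + x + e2.
Proof. by rewrite -!addrA; congr (_ + (_ + _)); rewrite addrC subrK. Qed.

Lemma opp_arith (a b : R) : 0 = - a - b -> b = - a.
Proof. lra. Qed.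

End abstract_continuity.

Lemma ins_continuous (R : realType) n (i : 'I_n.+1) (s : R) : continuous (@ins R n i s).
Proof. by apply: nonexpansive_continuous => x y; exact: ins_lipschitz. Qed.

Lemma integralE_comp d (T : measurableType d) (R : realType) (mu : {measure set T -> \bar R})
    (f : T -> R) (phi : T -> T) :
  (\int[mu]_x (f (phi x))%:E =
   \int[mu]_x (EFin \o f)^\+ (phi x) - \int[mu]_x (EFin \o f)^\- (phi x))%E.
Proof.
by rewrite integralE; congr (_ - _)%E; apply: eq_integral => x _; rewrite ?funeposE ?funenegE.
Qed.

(** * Reflection across the boundary *)
Section shear.
Context (R : realType) (n : nat).
Local Notation V := 'rV[R]_n.
Implicit Types (f : V -> R) (x u v : V).

(** Chain rule for [y |-> y + q(y) v] from directional derivatives only: [f] is moved along [u]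
    first, then along [v] by the increment of [q], where the mean value theorem applies. *)
Lemma derive_shear f (q : V -> R) x u v :
  (forall y, derivable f y v) -> derivable f (x + q x *: v) u ->
  {for x + q x *: v, continuous ('D_v f)} -> derivable q x u ->
  derivable (fun y => f (y + q y *: v)) x u /\
  'D_u (fun y => f (y + q y *: v)) x =
    'D_u f (x + q x *: v) + 'D_u q x * 'D_v f (x + q x *: v).
Proof.
move=> dv du cv dq; set p := x + q x *: v.
suff : (fun h : R => h^-1 *: (f (h *: u + x + q (h *: u + x) *: v) - f p)) @ 0^' -->
    'D_u f p + 'D_u q x * 'D_v f p.
  by move=> H; split; [apply/cvg_ex; eexists; exact: H|exact: cvg_lim].
pose s h := q (h *: u + x) - q x.
rewrite (_ : (fun h : R => _) = (fun h : R => h^-1 *: (f (h *: u + p) - f p) +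
    h^-1 *: (f (h *: u + p + s h *: v) - f (h *: u + p)))); last first.
  apply/funext => h; rewrite -scalerDr; congr (_ *: _).
  have -> : h *: u + p + s h *: v = h *: u + x + q (h *: u + x) *: v.
    rewrite /p /s scalerBl; exact: addr_subK.
  ring.
apply: cvgD; first exact: du.
have [C HC] := choice (fun h : R => MVT_line (s h) (x := h *: u + p) (fun t => dv _)).
have id0 : (fun h : R => h) @ 0^' --> (0 : R) by exact: nbhs_dnbhs.
have qc : (fun h : R => h^-1 * s h) @ 0^' --> 'D_u q x by exact: dq.
have s0 : s @ 0^' --> (0 : R).
  have H : (fun h : R => h * (h^-1 * s h)) @ 0^' --> 0 * 'D_u q x by exact: cvgM id0 qc.
  rewrite mul0r in H; apply: cvg_trans H; apply: near_eq_cvg; near=> h.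
  rewrite /= mulrA divff ?mul1r//; near: h; exact: nbhs_dnbhs_neq.
have E : (fun h : R => 'D_v f (h *: u + p + C h *: v)) @ 0^' --> 'D_v f p.
  apply: (@cvg_comp _ _ _ (fun h : R => h *: u + p + C h *: v) ('D_v f) _ (nbhs p)); last exact: cv.
  have C0 : C @ 0^' --> (0 : R).
    apply/norm_cvg0P.
    apply: (@squeeze_cvgr _ _ _ _ (cst 0) (fun h : R => `|s h|)).
    - by apply: nearW => h; rewrite normr_ge0 /=; have [] := HC h.
    - exact: cvg_cst.
    - have H := cvg_norm s0; rewrite normr0 in H; exact: H.
  have H := cvgD (cvgD (cvgZr_tmp (a := u) id0) (cvg_cst p)) (cvgZr_tmp (a := v) C0).
  by move: H; rewrite !scale0r add0r addr0; exact.
apply: cvg_trans (cvgM qc E); apply: near_eq_cvg; near=> h.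
have [_ ->] := HC h.
by rewrite -[RHS]/(h^-1 * (s h * _)) mulrA.
Unshelve. all: by end_near. Qed.

End shear.

Opaque derive basis.

Section reflection.
Context (R : realType) (m : nat).
Local Notation n := m.+1.
Local Notation V := 'rV[R]_n.
Local Notation mu := (@lebesgue_rV R n).
Context (Omega : set V) (oO : open Omega) (x0 : V) (r r1 : R) (r1r : 0 < r1 < r)
  (k0 : 'I_n) (b : bool) (G : V -> R) (CG : Ck setT 3 G)
  (GI : forall x (s : R), G (x + s *: basis k0) = G x).
Local Notation sg := ((-1) ^+ b : R).
Local Notation H := (height k0 b G).
Context (chartP : forall x, ball x0 r x -> (Omega x <-> 0 < H x)).
Implicit Types (f g u v w phi psi : V -> R) (i j k : 'I_n).

Local Notation c j := ('D_(basis j) G).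
Local Notation lsup := (lsup Omega x0 r1).
Local Notation eta := (eta k0 b G).
Let tipp := @tangential_IBP R n Omega oO x0 r r1 r1r k0 b G CG GI chartP.
Let etaD := @eta_dominated R n Omega x0 r r1 r1r k0 b G CG chartP.
Let etaTC := @eta_TC R n Omega x0 r k0 b G CG chartP.
Let hgt := @lsup_height R n Omega x0 r r1 r1r k0 b G chartP.

Let invD0 := (invariant_D GI).1.
Let Cc j : Ck setT 2 (c j) := Ck_D j CG.

(** The displacement along axis [k0] from a point to its mirror image. It makes the reflection a
    shear, to which [derive_shear] applies. *)
Definition q x := 2 * (G x - x ord0 k0).
Definition refl x : V := x + q x *: basis k0.

Lemma refl_height x : H (refl x) = - H x.
Proof.
rewrite /refl (height_shift b GI) /q /height -mulrDr -mulrN; congr (_ * _).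
by move: (G x) (x ord0 k0) => a e; ring.
Qed.

Lemma reflK x : refl (refl x) = x.
Proof.
rewrite /refl /q GI !mxE !eqxx mulr1 -addrA -scalerDl.
rewrite [X in X *: _](_ : _ = 0) ?scale0r ?addr0//.
by move: (G x) (x ord0 k0) => a e; ring.
Qed.

Lemma q_Ck : Ck setT 3 q.
Proof. by apply: CkZ; [exact: openT|apply: CkB; [exact: openT| |exact: Ck_coord]]. Qed.

Lemma q_D j x : 'D_(basis j) q x = 2 * (c j x - (j == k0)%:R).
Proof.
have dG : derivable G x (basis j) by exact: (Ck_derivable CG).
have dx := @derive_coord R n k0 x (basis j).
have dX := @ex_derive _ _ _ _ _ _ _ dx.
rewrite /q (deriveZ _ (derivableB dG dX)) (deriveB dG dX).
by rewrite (@derive_val _ _ _ _ _ _ _ dx) [basis j _ _]mxE eqxx/= eq_sym.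
Qed.

Lemma refl_cont : continuous refl.
Proof. by apply: shear_continuous; exact: CkT_cont q_Ck. Qed.

Lemma refl_meas : measurable_fun setT refl.
Proof.
apply: measurable_fun_rVP => j; apply: continuous_measurable_rV.
exact: continuousT_comp refl_cont (CkT_cont (@Ck_coord R n setT 0 j)).
Qed.

(** On a line along axis [k0] the reflection is [s |-> 2 G - s], with [G] constant on that line. *)
Lemma integral_refl (f : V -> \bar R) : measurable_fun setT f -> (forall x, (0 <= f x)%E) ->
  (\int[mu]_x f (refl x) = \int[mu]_x f x)%E.
Proof.
move=> mf f0; pose l (y : 'rV[R]_m) := - 2 * G (ins k0 0 y).
have ml : measurable_fun setT l.
  apply: measurable_funM; first exact: measurable_cst.
  by apply: continuous_measurable_rV; apply: continuousT_comp (@ins_continuous R m k0 0) _; exact: CkT_cont CG.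
rewrite -(@ge0_integral_axis_map R m k0 true l f)//; apply: eq_integral => x _; congr f.
rewrite expr1 /refl -{1}(ins_col' k0 x) -ins_line; congr ins.
have GE : G (ins k0 0 (col' k0 x)) = G x.
  by rewrite -(GI _ (x ord0 k0)) -ins_line add0r ins_col'.
by rewrite /q /l GE; move: (G x) (x ord0 k0) => a e; ring.
Qed.

Lemma Int_reflect f : measurable_fun setT f -> \int[mu]_x f (refl x) = \int[mu]_x f x.
Proof.
move=> mf; rewrite /Rintegral; congr fine.
have mf' : measurable_fun setT (EFin \o f) by exact/measurable_EFinP.
have P := integral_refl (measurable_funepos mf') (fun x => funepos_ge0 (EFin \o f) x).
have N := integral_refl (measurable_funeneg mf') (fun x => funeneg_ge0 (EFin \o f) x).
have E1 := integralE mu setT (EFin \o f).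
exact: (etrans (integralE_comp mu f refl) (etrans (congr2 (fun a e => (a - e)%E) P N) (esym E1))).
Qed.

Lemma integ_reflect f : integ mu f -> integ mu (fun x => f (refl x)).
Proof.
move=> fi; have mf := integ_meas fi.
apply/integrableP; split.
  by apply/measurable_EFinP; exact: (measurableT_comp mf refl_meas).
have /integrableP[mf2] := fi.
rewrite -[X in (X < _)%E -> _]integral_refl//; last exact: measurableT_comp.
Qed.

Lemma L2_reflect f : L2 mu f -> L2 mu (fun x => f (refl x)).
Proof.
move=> [mf f2]; split; last exact: (integ_reflect f2).
exact: (measurableT_comp mf refl_meas).
Qed.

Lemma cptin_reflect f : cptin setT f -> cptin setT (fun x => f (refl x)).
Proof.
move=> [K [cK _ K0]]; exists (refl @` K); split => //.
  apply: continuous_compact => //; apply: continuous_subspaceT; exact: refl_cont.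
by move=> x nx; apply: K0 => Kx; apply: nx; exists (refl x) => //; exact: reflK.
Qed.

Lemma derive_reflect phi j x : Ck setT 1 phi -> derivable (fun x => phi (refl x)) x (basis j) /\
  'D_(basis j) (fun x => phi (refl x)) x =
   'D_(basis j) phi (refl x) + 2 * (c j x - (j == k0)%:R) * 'D_(basis k0) phi (refl x).
Proof.
move=> Cp; have dp i y : derivable phi y (basis i) by exact: (Ck_derivable Cp).
have dq : derivable q x (basis j) by exact: (Ck_derivable q_Ck).
have [|d E] := @derive_shear R n phi q x (basis j) (basis k0) (dp k0) (dp j _) _ dq.
  exact: (CkT_cont (Ck_D k0 Cp)).
by split => //; rewrite -q_D.
Qed.

Lemma TC_reflect phi : TC 1 setT phi -> TC 1 setT (fun x => phi (refl x)).
Proof.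
move=> [Cp cp]; split; last exact: cptin_reflect.
have cr f : continuous f -> continuous (fun x => f (refl x)).
  by move=> cf; exact: continuousT_comp refl_cont cf.
apply/CkSP; split.
- by move=> x _; apply: cr; exact: CkT_cont Cp.
- by move=> j x _; exact: (derive_reflect j x Cp).1.
- move=> j; rewrite (_ : 'D_(basis j) _ = fun x => 'D_(basis j) phi (refl x) +
    2 * (c j x - (j == k0)%:R) * 'D_(basis k0) phi (refl x)); last first.
    by apply/funext => x; exact: (derive_reflect j x Cp).2.
  apply/Ck0P => x _.
  have h1 : (fun x => 'D_(basis j) phi (refl x)) @ x --> 'D_(basis j) phi (refl x).
    exact: (cr _ (CkT_cont (Ck_D j Cp))).
  have h2 : (fun x => 'D_(basis k0) phi (refl x)) @ x --> 'D_(basis k0) phi (refl x).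
    exact: (cr _ (CkT_cont (Ck_D k0 Cp))).
  have h3 : (fun x => 2 * (c j x - (j == k0)%:R)) @ x --> 2 * (c j x - (j == k0)%:R).
    rewrite (_ : (fun x => _) = 'D_(basis j) q); last by apply/funext => z; rewrite q_D.
    by rewrite -q_D; exact: (CkT_cont (Ck_D j q_Ck)).
  exact: (cvgD h1 (cvgM h3 h2)).
Qed.

(* No boundary term appears because [theta] vanishes on [H = 0]: the extra term
   [theta * D eta m] stays bounded and tends to 0. *)
Lemma normal_IBP w wn theta B : L2 mu w -> L2 mu wn -> lsup w -> lsup wn ->
  wder Omega k0 w wn -> TC 1 setT theta -> 0 <= B -> (forall x, `|theta x| <= B * `|H x|) ->
  \int[mu]_x (w x * 'D_(basis k0) theta x) = - \int[mu]_x (wn x * theta x).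
Proof.
move=> Lw Ln sw sn dn Tt B0 tB.
have [chi schi [chi1 chiD]] := @local_test R n x0 r r1 r1r.
have Tcp : TC 1 (ball x0 r) (fun x => theta x * chi x).
  by apply: TC_Ml; [exact: schi|exact: Tt.1].
pose F x := w x * 'D_(basis k0) theta x.
pose F' x := wn x * theta x.
pose e' (i : nat) x := w x * (theta x * 'D_(basis k0) (eta i) x).
have iF : integ mu F by apply: L2_integM => //; exact: TC_L2 (TC_D k0 Tt).
have iF' : integ mu F' by apply: L2_integM => //; exact: TC_L2 Tt.
have sF : lsup F by move=> x /sw; rewrite /F => ->; rewrite mul0r.
have sF' : lsup F' by move=> x /sn; rewrite /F' => ->; rewrite mul0r.
have De (i : nat) : Ck setT 2 ('D_(basis k0) (eta i)) by apply: Ck_D; exact: eta_Ck.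
have ie' (i : nat) : integ mu (e' i).
  apply: L2_integM => //; apply: (@TC_L2 _ _ 0 setT).
  under eq_fun do rewrite mulrC.
  apply: TC_Ml; first exact: TC_W Tt.
  exact: Ck_le (De i).
(* The test function is [theta] with both cutoffs; [e' i] is what the product rule leaves when the
   derivative hits [eta i]. *)
have E (i : nat) : \int[mu]_x e' i x =
    - (\int[mu]_x (F' x * eta i x)) - (\int[mu]_x (F x * eta i x)).
  pose phi x := eta i x * (theta x * chi x).
  have Tphi : TC 1 Omega phi by exact: etaTC.
  have Dphi x : `|x - x0| <= r1 -> 'D_(basis k0) phi x =
      'D_(basis k0) theta x * eta i x + theta x * 'D_(basis k0) (eta i) x.
    move=> xr.
    have de : derivable (eta i) x (basis k0) by exact: (Ck_derivable (eta_Ck k0 b CG i)).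
    have dp : derivable (fun x => theta x * chi x) x (basis k0) by exact: TC_derivable Tcp.
    have Dp : 'D_(basis k0) (fun x => theta x * chi x) x = 'D_(basis k0) theta x.
      rewrite -(chiD theta k0 x Tt.1 xr); congr derive; apply/funext => y; exact: mulrC.
    rewrite /phi (deriveM de dp) Dp chi1// mulr1.
    by congr (_ + _); exact: mulrC.
  have h1 := wder1 oO Lw Ln dn Tphi.
  have iFe : integ mu (fun x => F x * eta i x).
    have Te : TC 0 setT (fun x => eta i x * 'D_(basis k0) theta x).
      apply: TC_Ml; first exact: TC_D.
      exact: Ck_le (eta_Ck k0 b CG i).
    by apply: integ_eq (L2_integM Lw (TC_L2 Te)) => x; rewrite /F mulrA mulrAC.
  have h2 : \int[mu]_x (w x * 'D_(basis k0) phi x) = \int[mu]_x (F x * eta i x + e' i x).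
    apply: eq_Rintegral => x _; rewrite /F /e'.
    have [xr|xr] := leP `|x - x0| r1; first by rewrite (Dphi x xr) mulrDr; congr (_ + _); exact: mulrA.
    by rewrite sw ?mul0r ?addr0// => -[]; rewrite leNgt xr.
  have h3 : \int[mu]_x (wn x * phi x) = \int[mu]_x (F' x * eta i x).
    apply: eq_Rintegral => x _; rewrite /F' /phi.
    have [xr|xr] := leP `|x - x0| r1; first by rewrite chi1// mulr1 mulrA mulrAC.
    by rewrite sn ?mul0r// => -[]; rewrite leNgt xr.
  rewrite h2 h3 (IntD iFe (ie' i)) in h1.
  by rewrite -h1 addrC addKr.
have [C C0 HC] := flat2_bound R.
(* The linear vanishing of [theta] compensates the factor [i] produced by the derivative of [eta i];
   what remains has the form bounded in [flat2_bound]. *)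
have e'E (i : nat) x : 0 < H x -> `|e' i x| <= B * `|w x| * (i%:R * H x * flat 2 (i%:R * H x - 1)).
  move=> Hx; rewrite /e' eta_D// height_D// eqxx invD0 subr0 mulr1 !normrM normr_sign mulr1.
  rewrite [`|flat _ _|]ger0_norm ?flat_ge0// normr_nat.
  rewrite mulrCA [leRHS](_ : _ = (`|w x| * (flat 2 (i%:R * H x - 1) * i%:R)) * (B * H x)); last by ring.
  rewrite mulrCA [leLHS](_ : _ = (`|w x| * (flat 2 (i%:R * H x - 1) * i%:R)) * `|theta x|); last by ring.
  apply: ler_wpM2l; first by rewrite !mulr_ge0// flat_ge0.
  by have := tB x; rewrite (gtr0_norm Hx).
have hx x : w x != 0 -> 0 < H x by exact: hgt.
have C1 : \int[mu]_x e' i x @[i --> \oo] --> \int[mu]_x (0 : R).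
  apply: (Int_dominated (g := fun x => B * C * `|w x|)).
  - by move=> i; exact: integ_meas (ie' i).
  - exact: measurable_cst.
  - by apply: integZ; apply: integ_abs; exact: integ_L2_cpt Lw (lsup_cpt sw).
  - move=> i x; have [w0|wx] := eqVneq (w x) 0; first by rewrite /e' w0 !mul0r normr0 mulr0.
    apply: le_trans (e'E i x (hx x wx)) _; rewrite [leRHS]mulrAC.
    apply: ler_wpM2l; first by rewrite mulr_ge0.
    by have := HC (i%:R * H x - 1); rewrite subrK.
  apply: aeW => x; have [w0|wx] := eqVneq (w x) 0.
    by rewrite /e'; under eq_fun do rewrite w0 mul0r; exact: cvg_cst.
  have Hx := hx x wx.
  have goo : (fun i : nat => i%:R * H x - 1) @ \oo --> +oo.
    apply/cvgryPge => A; exists (Num.truncn ((A + 1) / H x)).+1 => // i /= iA.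
    rewrite lerBrDr -ler_pdivrMr//; apply: ltW; apply: lt_le_trans (truncnS_gt _) _.
    by rewrite ler_nat.
  apply/norm_cvg0P.
  apply: (@squeeze_cvgr _ _ _ _ (cst 0)
    (fun i : nat => B * `|w x| * (2 * (i%:R * H x - 1)^-1))); last 2 first.
  - exact: cvg_cst.
  - have h1 : (fun i : nat => (i%:R * H x - 1)^-1) @ \oo --> (0 : R).
      apply/gtr0_cvgV0 => //; move/cvgryPgt : goo => /(_ 0); exact: filterS.
    have h2 : (fun i : nat => B * `|w x| * (2 * (i%:R * H x - 1)^-1)) @ \oo --> B * `|w x| * (2 * 0).
      by apply: cvgMl_tmp; apply: cvgMl_tmp.
    rewrite !mulr0 in h2; exact: h2.
  move/cvgryPge : goo => /(_ 1); apply: filterS => i h1; rewrite normr_ge0/=.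
  apply: le_trans (e'E i x Hx) _; apply: ler_wpM2l; first by rewrite mulr_ge0.
  by have := flat2_decay h1; rewrite subrK.
rewrite Int0 in C1.
have C3 : (fun i : nat => \int[mu]_x e' i x) @ \oo --> - (\int[mu]_x F' x) - (\int[mu]_x F x).
  rewrite (funext E); apply: cvgB; last exact: etaD iF sF.
  by apply: cvgN; exact: etaD iF' sF'.
apply: opp_arith; exact: cvg_unique C1 C3.
Qed.

(** The even extension of [w] has a weak gradient on the whole space whatever the trace of [w]. By
    change of variables all derivatives are tested on [w] itself, with the odd combination [theta]
    of [phi] and its reflection, which vanishes on the boundary, and the even one [sigma], to which
    tangential integration by parts applies. *)
Lemma reflect_wder w (wk : 'I_n -> V -> R) : L2 mu w -> (forall k, L2 mu (wk k)) ->
  lsup w -> (forall k, lsup (wk k)) -> (forall k, wder Omega k w (wk k)) ->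
  exists gk : 'I_n -> V -> R, [/\ forall k, L2 mu (gk k), forall k, cptin setT (gk k) &
    forall k, wder setT k (fun x => w x + w (refl x)) (gk k)].
Proof.
move=> Lw Lk sw sk dw.
pose cw k x := c k x * wk k0 x.
have Lcw k : L2 mu (cw k).
  by apply: (L2_Mc _ (Lk k0) (lsup_cpt (sk k0))); exact: CkT_cont (Cc k).
(* Chain rule for [w o refl]: the normal derivative changes sign, and a tangential one gains twice
   [c k] times the normal derivative. *)
pose gk k := if k == k0 then fun x => wk k0 x - wk k0 (refl x)
  else fun x => wk k x + (wk k (refl x) + 2 * cw k (refl x)).
have cc k : cptin setT (cw k) by apply: cptinMr; exact: lsup_cpt (sk k0).
exists gk; split=> k; rewrite /gk.
- case: ifP => _; first by apply: L2B => //; exact: L2_reflect.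
  apply: L2D => //; apply: L2D; first exact: L2_reflect.
  by apply: L2Z; exact: (L2_reflect (Lcw k)).
- have h := fun k => lsup_cpt (sk k); case: ifP => _.
    rewrite (_ : (fun _ => _) = fun x => wk k0 x + (-1) * wk k0 (refl x)); last first.
      by apply/funext => x; rewrite mulN1r.
    apply: cptinD => //; apply: cptinMr; exact: cptin_reflect.
  apply: cptinD => //; apply: cptinD; first exact: cptin_reflect.
  by apply: cptinMr; exact: (cptin_reflect (cc k)).
move=> phi sphi; have T1 := sphi 1.
pose psi x := phi (refl x); have Tpsi : TC 1 setT psi by exact: TC_reflect.
pose theta x := phi x - psi x.
have Tt : TC 1 setT theta.
  have := TC_add T1 (TC_Z (-1) Tpsi); congr TC; apply/funext => x; by rewrite mulN1r.
have [L L0 phiL] := TC1_lipschitz T1.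
(* The distance from [x] to its mirror image is at most [2 |H x|]. *)
have tB x : `|theta x| <= 2 * L * `|H x|.
  apply: le_trans (phiL _ _) _; rewrite /refl opprD addrA subrr add0r normrN normrZ.
  rewrite /q /height !normrM normr_nat normr_sign mul1r distrC [leRHS]mulrAC [leRHS]mulrC.
  apply: ler_wpM2l => //; rewrite ler_piMr ?mulr_ge0//; exact: basis_norm.
have L20 : 0 <= 2 * L by rewrite mulr_ge0.
have TD j f : TC 1 setT f -> L2 mu ('D_(basis j) f) by move=> Tf; exact: TC_L2 (TC_D j Tf).
have Dpsi j x : 'D_(basis j) psi x =
   'D_(basis j) phi (refl x) + 2 * (c j x - (j == k0)%:R) * 'D_(basis k0) phi (refl x).
  exact: (derive_reflect j x T1.1).2.
have dphi j x : derivable phi x (basis j) by exact: TC_derivable T1.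
have dpsi j x : derivable psi x (basis j) by exact: TC_derivable Tpsi.
have Dt j x : 'D_(basis j) theta x = 'D_(basis j) phi x - 'D_(basis j) psi x.
  exact: (deriveB (dphi j x) (dpsi j x)).
have iwD j f : TC 1 setT f -> integ mu (fun x => w x * 'D_(basis j) f x).
  by move=> Tf; apply: L2_integM => //; exact: TD.
have reflw f g : L2 mu f -> L2 mu g -> \int[mu]_x (f (refl x) * g x) = \int[mu]_x (f x * g (refl x)).
  move=> Lf Lg; rewrite -[RHS]Int_reflect; last first.
    by apply: measurable_funM; [exact: Lf.1|exact: (L2_reflect Lg).1].
  by apply: eq_Rintegral => x _; rewrite reflK.
have L2phi := TC_L2 T1; have L2psi := TC_L2 Tpsi.
have DL := TD k _ T1.
have lhs : \int[mu]_x ((w x + w (refl x)) * 'D_(basis k) phi x) =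
    \int[mu]_x (w x * ('D_(basis k) phi x + 'D_(basis k) phi (refl x))).
  transitivity (\int[mu]_x (w x * 'D_(basis k) phi x + w (refl x) * 'D_(basis k) phi x)).
    by apply: eq_Rintegral => x _; rewrite mulrDl.
  rewrite IntD; [|exact: iwD|exact: L2_integM (L2_reflect Lw) DL].
  rewrite (reflw w _ Lw DL) -IntD; [|exact: iwD|exact: L2_integM Lw (L2_reflect DL)].
  by apply: eq_Rintegral => x _; rewrite mulrDr.
rewrite lhs; have [kk|kk] := eqVneq k k0.
  have NI := normal_IBP Lw (Lk k0) sw (sk k0) (dw k0) Tt L20 tB.
  transitivity (\int[mu]_x (w x * 'D_(basis k0) theta x)).
    apply: eq_Rintegral => x _; rewrite Dt Dpsi kk eqxx invD0 /=; congr (_ * _).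
    by move: ('D_(basis k0) phi x) ('D_(basis k0) phi (refl x)) => a e; ring.
  rewrite NI; congr (- _).
  transitivity (\int[mu]_x (wk k0 x * phi x - wk k0 (refl x) * phi x)); last first.
    by apply: eq_Rintegral => x _; rewrite mulrBl.
  rewrite IntB; [|exact: L2_integM|exact: L2_integM (L2_reflect (Lk k0)) L2phi].
  rewrite (reflw _ _ (Lk k0) L2phi) -IntB; [|exact: L2_integM|exact: L2_integM (Lk k0) L2psi].
  by apply: eq_Rintegral => x _; rewrite -mulrBr.
have Tct : TC 1 setT (fun x => c k x * theta x) by apply: TC_Ml => //; exact: Ck_le (Cc k).
have [chi schi [chi1 chiD]] := @local_test R n x0 r r1 r1r.
(* [c k] may be unbounded on the whole space; multiplied by [chi] it is bounded, without change on
   the support of [w]. *)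
have [M' M0' cM'] : exists2 M', 0 <= M' & forall x, `|chi x * c k x| <= M'.
  have Tc : TC 0 setT (fun x => chi x * c k x).
    have := TC_Ml (schi 0) (CkW (CkW (Cc k))); move=> [C1 C2]; split.
      by move: C1; congr Ck; apply/funext => x; exact: mulrC.
    by case: C2 => K [cK _ K0]; exists K; split => // x /K0; rewrite mulrC.
  exact: TC_bounded Tc.
pose ct x := chi x * (c k x * theta x).
have Tct' : TC 1 setT ct.
  by apply: TC_Ml => //; exact: (schi 1).1.
have ctB x : `|ct x| <= M' * (2 * L) * `|H x|.
  by rewrite /ct mulrA normrM -mulrA; apply: ler_pM.
have NI := normal_IBP Lw (Lk k0) sw (sk k0) (dw k0) Tct' (mulr_ge0 M0' L20) ctB.
have Dct x : `|x - x0| <= r1 -> 'D_(basis k0) ct x = c k x * 'D_(basis k0) theta x.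
  move=> xr; rewrite (chiD _ k0 x Tct.1 xr).
  have dc : derivable (c k) x (basis k0) by exact: (Ck_derivable (Cc k)).
  have dt : derivable theta x (basis k0) by exact: TC_derivable Tt.
  rewrite (deriveM dc dt).
  have -> : 'D_(basis k0) (c k) x = 0 by exact: (invariant_D ((invariant_D GI).2 k)).1.
  by rewrite scaler0 addr0.
pose sigma x := phi x + psi x.
have Ts : TC 1 setT sigma by exact: TC_add.
have TI := tipp kk Lw (Lk k) (Lk k0) sw (sk k) (sk k0) (dw k) (dw k0) Ts.
have I1 : integ mu (fun x => w x * ('D_(basis k) sigma x + c k x * 'D_(basis k0) sigma x)).
  have TX : TC 0 setT (fun x => 'D_(basis k) sigma x + c k x * 'D_(basis k0) sigma x).
    apply: TC_add; first exact: TC_D.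
    by apply: TC_Ml; [exact: TC_D|exact: Ck_le (Cc k)].
  exact: L2_integM (TC_L2 TX).
have I2 : integ mu (fun x => w x * 'D_(basis k0) ct x) by exact: iwD.
have Ds j x : 'D_(basis j) sigma x = 'D_(basis j) phi x + 'D_(basis j) psi x.
  exact: (deriveD (dphi j x) (dpsi j x)).
(* On the support of [w], the sum of [D_k phi] and its reflection is the tangential derivative of
   [sigma] minus [c k] times the normal derivative of [theta]. *)
transitivity (\int[mu]_x (w x * ('D_(basis k) sigma x + c k x * 'D_(basis k0) sigma x) -
    w x * 'D_(basis k0) ct x)).
  apply: eq_Rintegral => x _; have [xr|xr] := leP `|x - x0| r1; last first.
    by rewrite sw ?mul0r ?subr0// => -[]; rewrite leNgt xr.
  rewrite (Dct x xr) !Ds Dt !Dpsi eqxx (negbTE kk) invD0 /=.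
  move: ('D_(basis k) phi x) ('D_(basis k) phi (refl x)) ('D_(basis k0) phi x)
    ('D_(basis k0) phi (refl x)) (c k x) (w x) => a1 a2 a3 a4 a5 a6; ring.
rewrite (IntB I1 I2) TI NI opprK.
have I3 : integ mu (fun x => (wk k x + c k x * wk k0 x) * sigma x).
  by apply: L2_integM (TC_L2 Ts); apply: L2D => //; exact: Lcw.
have I4 : integ mu (fun x => wk k0 x * ct x) by exact: L2_integM (TC_L2 Tct').
have I5 : integ mu (fun x => wk k x * phi x) by exact: L2_integM.
have I6 : integ mu (fun x => (wk k x + 2 * cw k x) * psi x).
  by apply: L2_integM => //; apply: L2D => //; exact: L2Z.
have L6 : L2 mu (fun x => wk k x + 2 * cw k x) by apply: L2D => //; exact: L2Z.
have I7 : integ mu (fun x => (wk k (refl x) + 2 * cw k (refl x)) * phi x).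
  exact: L2_integM (L2_reflect L6) L2phi.
rewrite addrC -opprB -(IntB I3 I4); congr (- _).
transitivity (\int[mu]_x (wk k x * phi x + (wk k x + 2 * cw k x) * psi x)).
  apply: eq_Rintegral => x _; have [xr|xr] := leP `|x - x0| r1; last first.
    have nx : ~ (`|x - x0| <= r1 /\ Omega x) by move=> []; rewrite leNgt xr.
    by rewrite /ct /cw (sk k _ nx) (sk k0 _ nx); ring.
  rewrite /ct chi1// mul1r /sigma /theta /cw.
  move: (phi x) (psi x) (wk k x) (wk k0 x) (c k x) => a1 a2 a3 a4 a5; ring.
rewrite (IntD I5 I6) -(reflw _ _ L6 L2phi) -(IntD I5 I7).
by apply: eq_Rintegral => x _; rewrite -mulrDl.
Qed.

(** [w] and [w o refl] are never both nonzero, since heights are positive on the support of [w] and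
    reflection reverses them; hence the sixth power of the sum dominates that of [w]. *)
Lemma local_sobolev6 w (wk : 'I_n -> V -> R) : (m < 3)%N -> L2 mu w -> (forall k, L2 mu (wk k)) ->
  lsup w -> (forall k, lsup (wk k)) -> (forall k, wder Omega k w (wk k)) ->
  integ mu (fun x => w x ^+ 6).
Proof.
move=> m3 Lw Lk sw sk dw; have [gk [Lg cg dg]] := reflect_wder Lw Lk sw sk dw.
have LW : L2 mu (fun x => w x + w (refl x)) by apply: L2D => //; exact: L2_reflect.
have cw := lsup_cpt sw.
have i6 := sobolev6 m3 LW (cptinD cw (cptin_reflect cw)) Lg cg dg.
apply: integ_le i6; first by apply: measurable_funX; exact: Lw.1.
have e6 (a : R) : 0 <= a ^+ 6 by exact: (cp_ge0 (convex_power6 R)).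
move=> x; rewrite ger0_norm//; have [w0|wx] := eqVneq (w x) 0.
  by rewrite {1}w0 expr0n.
have Hx := hgt sw wx; have [w0|wx'] := eqVneq (w (refl x)) 0; first by rewrite w0 addr0.
by have := hgt sw wx'; rewrite refl_height oppr_gt0 ltNge (ltW Hx).
Qed.

End reflection.

Transparent derive basis.

(** * Global estimates *)
Section chart_existence.
Context (R : realType) (m : nat).
Local Notation n := m.+1.
Local Notation V := 'rV[R]_n.
Local Notation mu := (@lebesgue_rV R n).

Lemma col'_nonexpansive (i : 'I_n) (x y : V) : `|(col' i x : 'rV[R]_m) - col' i y| <= `|x - y|.
Proof.
apply/norm_rV_leP => // j; rewrite !mxE.
by have := coord_le_norm (x - y) (lift i j); rewrite !mxE.
Qed.

Lemma col'_quot (i : 'I_n) (f : 'rV[R]_m -> R) (x : V) (v : V) :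
  (fun h : R => h^-1 *: (((fun y : V => f (col' i y)) \o shift x) (h *: v) - f (col' i x))) =
  (fun h : R => h^-1 *: ((f \o shift (col' i x)) (h *: col' i v) - f (col' i x))).
Proof.
apply/funext => h; congr (_ *: (f _ - _)).
by apply/rowP => k; rewrite !mxE.
Qed.

Lemma col'_basis (i : 'I_n) j : col' i (basis (lift i j) : V) = basis j.
Proof. by apply/rowP => k; rewrite /basis !mxE !eqxx (inj_eq lift_inj). Qed.

Lemma col'_basis0 (i : 'I_n) : col' i (basis i : V) = 0.
Proof.
apply/rowP => k; rewrite /basis !mxE !eqxx /= [_ == i]eq_sym.
by rewrite (negbTE (neq_lift i k)).
Qed.

Lemma Ck_col' (i : 'I_n) k (f : 'rV[R]_m -> R) : Ck setT k f ->
  Ck setT k (fun x : V => f (col' i x)).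
Proof.
have cs (h : 'rV[R]_m -> R) : continuous h -> continuous (fun x : V => h (col' i x)).
  move=> ch; apply: continuousT_comp ch; apply: nonexpansive_continuous.
  exact: col'_nonexpansive.
elim: k f => [|k IH] f Cf; first by apply/Ck0P => y _; apply: cs; exact: CkT_cont Cf.
have zero (x : V) : (fun h : R => h^-1 *: ((f \o shift (col' i x)) (h *: col' i (basis i : V)) - f (col' i x))) = cst 0.
  by apply/funext => h; rewrite /= col'_basis0 scaler0 add0r subrr scaler0.
apply/CkSP; split.
- by move=> y _; apply: cs; exact: CkT_cont Cf.
- move=> j y _; rewrite /derivable col'_quot; case: (unliftP i j) => [l|] ->.
    rewrite col'_basis; exact: (Ck_derivable Cf).
  by rewrite zero; exact: is_cvg_cst.
- move=> j; case: (unliftP i j) => [l|] ->.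
    rewrite (_ : 'D_(basis (lift i l)) _ = fun y : V => 'D_(basis l) f (col' i y)).
      exact: (IH _ (Ck_D l Cf)).
    by apply/funext => z; rewrite /derive col'_quot col'_basis.
  rewrite (_ : 'D_(basis i) _ = fun=> 0); first exact: Ck_cst.
  by apply/funext => z; rewrite /derive col'_quot zero lim_cst.
Qed.

Opaque derive basis.

(** Makes a chart function known only on a ball into a global one: the open set [A] and the
    complement of the support of [chi] cover the space. *)
Lemma Ck_plateau n' (A : set 'rV[R]_n') k (chi f : 'rV[R]_n' -> R) : open A ->
  smooth A chi -> Ck A k f -> Ck setT k (fun x => chi x * f x).
Proof.
move=> oA schi Cf; have [_ [K [cK KA K0]]] := schi 0.
have cl : closed K by exact: (compact_closed (@rV_hausdorff R n')).
rewrite (_ : setT = A `|` ~` K); last first.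
  apply/esym; rewrite -subTset => x _; have [Kx|nK] := pselect (K x); last by right.
  by left; exact: KA.
apply: Ck_setU; first by apply: CkM => //; exact: Ck_sub (schi k).1.
apply: (@eq_in_Ck _ _ _ _ (fun=> 0)); [exact: closed_openC| |exact: Ck_cst].
by move=> x nK; rewrite K0// mul0r.
Qed.

Context (Omega : set V).
Context (oO : open Omega).

(** Points inside the domain receive a chart too, so that interior and boundary estimates need no
    separate treatment. *)
Lemma chart_exists (e : R) : boundary_of_class Omega 4 e -> forall x0, closure Omega x0 ->
  exists (r : R) (k0 : 'I_n) (b : bool) (G : V -> R),
    [/\ 0 < r, Ck setT 3 G, forall x (s : R), G (x + s *: basis k0) = G x &
      forall x, ball x0 r x -> (Omega x <-> 0 < height k0 b G x)].
Proof.
move=> hbd x0 cx; have [Ox|nOx] := pselect (Omega x0).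
  have : nbhs x0 Omega by exact: open_nbhs_nbhs.
  move=> /nbhs_ballP[r /= r0 rO].
  (* A half-space containing the whole ball: a chart whose boundary is not met. *)
  exists r, ord0, false, (fun=> x0 ord0 ord0 - r); split => //; first exact: Ck_cst.
  move=> x bx; split=> [_|_]; last exact: rO.
  rewrite /height expr0 mul1r.
  have : `|(x0 - x) ord0 ord0| <= `|x0 - x| := coord_le_norm _ _.
  have : `|x0 - x| < r by move: bx; rewrite -ball_normE.
  rewrite !mxE => h1 h2; have := le_lt_trans h2 h1; rewrite ltr_norml => /andP[_]; lra.
have [|r [i [b [gam [r0 [Cg _] gP]]]]] := hbd x0.
  by split => //; move=> /interior_subset.
(* The graph function is cut off, and the chart radius halved so that the cutoff equals 1 on it. *)
have [|chi [schi chi1]] := @plateau R m (col' i x0) (r / 2) r; first by apply/andP; split; lra.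
pose f y := chi y * gam y.
have Cf : Ck setT 3 f.
  apply: (@Ck_plateau m (ball (col' i x0 : 'rV[R]_m) r)) => //; first exact: ball_open.
  exact: CkW Cg.
exists (r / 2), i, b, (fun x => f (col' i x)); split.
- by rewrite divr_gt0.
- exact: Ck_col'.
- move=> x s; congr f; apply/rowP => k; rewrite !mxE [_ == i]eq_sym.
  by rewrite (negbTE (neq_lift i k)) andbF mulr0 addr0.
- move=> x; rewrite -ball_normE/= => bx.
  have bx' : ball x0 r x by rewrite -ball_normE/=; lra.
  rewrite (gP x bx') /height /f chi1 ?mul1r//.
  apply: le_trans (col'_nonexpansive _ _ _) _; rewrite distrC; exact: ltW.
Qed.

(** Records the two local conclusions and forgets the chart that produced them, which is all that
    the covering argument uses. *)
Definition chart_at (x0 : V) (r1 : R) :=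
  (exists2 CF : R, 0 <= CF &
    forall (v : V -> R) (g : 'I_n -> V -> R) (h : 'I_n -> 'I_n -> V -> R),
    L2 mu v -> (forall i, L2 mu (g i)) -> (forall i k, L2 mu (h i k)) ->
    lsup Omega x0 r1 v -> (forall i, lsup Omega x0 r1 (g i)) ->
    (forall i k, lsup Omega x0 r1 (h i k)) ->
    (forall i, wder setT i v (g i)) -> (forall i k, wder Omega k (g i) (h i k)) ->
    (forall i k, h i k = h k i) ->
    forall i k, \int[mu]_x (h i k x ^+ 2) <=
      CF * (\int[mu]_x ((\sum_l h l l x) ^+ 2) + \sum_l \int[mu]_x (g l x ^+ 2))) /\
  ((m < 3)%N -> forall w (wk : 'I_n -> V -> R), L2 mu w -> (forall k, L2 mu (wk k)) ->
    lsup Omega x0 r1 w -> (forall k, lsup Omega x0 r1 (wk k)) ->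
    (forall k, wder Omega k w (wk k)) -> integ mu (fun x => w x ^+ 6)).

Lemma chart_at_exists (e : R) : boundary_of_class Omega 4 e -> forall x0, closure Omega x0 ->
  exists2 r1 : R, 0 < r1 & chart_at x0 r1.
Proof.
move=> hbd x0 cx; have [r [k0 [b [G [r0 CG GI chartP]]]]] := chart_exists hbd cx.
have r1r : 0 < r / 2 < r by apply/andP; split; lra.
exists (r / 2); first by case/andP: r1r.
split; first exact: (local_H2_estimate oO r1r CG GI chartP).
by move=> m3 w wk; exact: (local_sobolev6 oO r1r CG GI chartP m3).
Qed.

(** Not a partition of unity: it suffices that at each point of the domain some cutoff equals 1,
    because integrals of even powers are then bounded by the sum over the pieces. *)
Lemma cutoff_cover (e : R) : boundary_of_class Omega 4 e -> bounded_set Omega ->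
  exists (K : nat) (a : 'I_K -> V) (r : 'I_K -> R) (z : 'I_K -> V -> R),
   (forall p, [/\ 0 < r p, chart_at (a p) (r p) & smooth (ball (a p) (r p)) (z p)]) /\
   (forall x, Omega x -> exists p, z p x = 1).
Proof.
move=> hbd [M [Mr HM]].
have cO : compact (closure Omega).
  have M1 : M < `|M| + 1 by have := ler_norm M; lra.
  apply: (@subclosed_compact _ _ (box (`|M| + 1))); [exact: closed_closure|exact: box_compact|].
  rewrite ((closure_id (box (`|M| + 1))).1 (@box_closed R n _)).
  by apply: closure_subset => x Ox; exact: HM.
have /choice[F HF] : forall x0 : V, exists p : R * (V -> R), closure Omega x0 ->
    [/\ 0 < p.1, chart_at x0 p.1, smooth (ball x0 p.1) p.2 &
      forall x, `|x - x0| <= p.1 / 2 -> p.2 x = 1].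
  move=> x0; have [cx|nx] := pselect (closure Omega x0); last by exists (0, fun=> 0).
  have [r1 r10 ch] := chart_at_exists hbd cx.
  have [|chi [schi chi1]] := @plateau R n x0 (r1 / 2) r1; first by apply/andP; split; lra.
  by exists (r1, chi).
move: cO; rewrite compact_cover.
move=> /(_ V (closure Omega) (fun a => ball a ((F a).1 / 2)) (fun a _ => ball_open _ _)).
have cov : closure Omega `<=` cover (closure Omega) (fun a => ball a ((F a).1 / 2)).
  move=> x cx; exists x => //; apply: ballxx.
  by have [h _ _ _] := HF x cx; rewrite divr_gt0.
move=> /(_ cov)[D DO Dc].
pose s := finmap.enum_fset D.
have sD (p : 'I_(size s)) : closure Omega (nth 0 s p).
  by have /set_mem := DO _ (mem_nth 0 (ltn_ord p)).
exists (size s), (fun p => nth 0 s p), (fun p => (F (nth 0 s p)).1), (fun p => (F (nth 0 s p)).2).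
split=> [p|x Ox]; first by have [] := HF _ (sD p).
have [b /= bD bx] := Dc x (@subset_closure _ _ _ Ox).
have bs : (index b s < size s)%N by rewrite index_mem.
exists (Ordinal bs) => /=; rewrite nth_index//.
have [_ _ _] := HF b (set_mem (DO _ bD)); apply.
by move: bx; rewrite -ball_normE/= distrC => /ltW.
Qed.

Implicit Types (x y : V) (f z : V -> R) (A : set V) (i k l : 'I_n).

Lemma smooth_ball_eq0 x0 r1 f : smooth (ball x0 r1) f ->
  forall x, ~ (`|x - x0| <= r1) -> f x = 0.
Proof.
move=> sf x nx; have [_ [K [cK KA K0]]] := sf 0; apply: K0 => Kx; apply: nx.
by have := KA _ Kx; rewrite -ball_normE/= distrC => /ltW.
Qed.

Lemma smooth_D A f i : smooth A f -> smooth A ('D_(basis i) f).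
Proof. by move=> sf k; exact: TC_D (sf k.+1). Qed.

Lemma smooth_bound_fam (J : finType) (f : J -> V -> R) A : (forall j, smooth A (f j)) ->
  exists2 B : R, 0 <= B & forall j x, `|f j x| <= B.
Proof.
move=> sf.
have /choice[D HD] : forall c, exists D : R, 0 <= D /\ forall x, `|f c x| <= D.
  by move=> c; have [D D0 H] := TC_bounded (sf c 0); exists D.
exists (\sum_c D c); first by apply: sumr_ge0 => c _; case: (HD c).
move=> c x; apply: le_trans ((HD c).2 x) _.
by rewrite (bigD1 c)//= lerDl; apply: sumr_ge0 => e _; case: (HD e).
Qed.

Lemma sqr_le_of_norm (a B s E : R) : 0 <= B -> 0 <= s -> s ^+ 2 = E -> `|a| <= B * s -> a ^+ 2 <= B ^+ 2 * E.
Proof.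
move=> B0 s0 <- H; rewrite -exprMn -[a ^+ 2]real_normK ?num_real// lerXn2r// nnegrE//.
exact: mulr_ge0.
Qed.

Lemma norm_le_sqrt (a E : R) : a ^+ 2 <= E -> `|a| <= Num.sqrt E.
Proof. by move=> H; rewrite -sqrtr_sqr ler_wsqrtr. Qed.

Definition lower_energy (v : V -> R) (g : 'I_n -> V -> R) (h : 'I_n -> 'I_n -> V -> R) x :=
  (\sum_l h l l x) ^+ 2 + \sum_l g l x ^+ 2 + v x ^+ 2.

Lemma loc_arith (CF K1 K2 K3 E a1 a2 H' Rr Z : R) : 0 <= CF -> H' <= CF * (a1 + a2) ->
  a1 <= K1 * E -> a2 <= K2 * E -> Rr <= K3 * E -> Z <= 2 * H' + 2 * Rr ->
  Z <= (2 * (CF * (K1 + K2)) + 2 * K3) * E.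
Proof.
move=> CF0 h1 h2 h3 h4 h5.
have h6 : CF * (a1 + a2) <= CF * (K1 * E + K2 * E) by apply: ler_wpM2l => //; exact: lerD.
have -> : (2 * (CF * (K1 + K2)) + 2 * K3) * E = 2 * (CF * (K1 * E + K2 * E)) + 2 * (K3 * E) by ring.
move: h1 h4 h5 h6; set u := CF * _; set w := CF * (_ + _); set t := K3 * E; lra.
Qed.

(** The local estimate is applied to [z v], which has a zero trace like [v]. Its second derivatives
    differ from [z h] by [rest], which only involves [v] and its gradient. *)
Lemma localized_bound x0 r1 z : smooth (ball x0 r1) z -> chart_at x0 r1 ->
  exists2 C : R, 0 <= C &
    forall (v : V -> R) (g : 'I_n -> V -> R) (h : 'I_n -> 'I_n -> V -> R),
    L2 mu v -> (forall i, L2 mu (g i)) -> (forall i k, L2 mu (h i k)) ->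
    cptin setT v -> (forall i, cptin setT (g i)) -> (forall i k, cptin setT (h i k)) ->
    (forall x, ~ Omega x -> v x = 0) -> (forall i x, ~ Omega x -> g i x = 0) ->
    (forall i k x, ~ Omega x -> h i k x = 0) ->
    (forall i, wder setT i v (g i)) -> (forall i k, wder Omega k (g i) (h i k)) ->
    (forall i k, h i k = h k i) ->
    forall i k, \int[mu]_x ((z x * h i k x) ^+ 2) <= C * \int[mu]_x lower_energy v g h x.
Proof.
move=> sz [[CF CF0 HCF] _].
pose z1 i := 'D_(basis i) z; pose z2 i k := 'D_(basis k) (z1 i).
have sz1 i : smooth (ball x0 r1) (z1 i) by exact: smooth_D.
have sz2 i k : smooth (ball x0 r1) (z2 i k) by exact: smooth_D.
have [B0 B00 zB] := TC_bounded (sz 0).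
have [B1 B10 z1B] := smooth_bound_fam sz1.
have [B2 B20 z2B'] := smooth_bound_fam (fun p : 'I_n * 'I_n => sz2 p.1 p.2).
have z2B i k x : `|z2 i k x| <= B2 by exact: (z2B' (i, k)).
pose B := B0 + B1 + B2.
have BB0 : 0 <= B by rewrite !addr_ge0.
have zb x : `|z x| <= B by apply: le_trans (zB x) _; rewrite /B; lra.
have z1b i x : `|z1 i x| <= B by apply: le_trans (z1B i x) _; rewrite /B; lra.
have z2b i k x : `|z2 i k x| <= B by apply: le_trans (z2B i k x) _; rewrite /B; lra.
have cz := TC_cont (sz 0).
have cz1 i := TC_cont (sz1 i 0).
have cz2 i k := TC_cont (sz2 i k 0).
pose N : R := n%:R; have N0 : 0 <= N by exact: ler0n.
pose K1 := (B * (1 + 3 * N)) ^+ 2; pose K2 := N * (2 * B) ^+ 2; pose K3 := (3 * B) ^+ 2.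
exists (2 * (CF * (K1 + K2)) + 2 * K3).
  have K10 : 0 <= K1 by exact: sqr_ge0.
  have K20 : 0 <= K2 by rewrite mulr_ge0// sqr_ge0.
  have K30 : 0 <= K3 by exact: sqr_ge0.
  by rewrite addr_ge0// mulr_ge0// mulr_ge0// addr_ge0.
move=> v g h Lv Lg Lh cv cg ch v0 g0 h0 dv dg hs i k.
pose v' x := z x * v x.
pose g' l x := z x * g l x + z1 l x * v x.
pose rest i k x := z1 k x * g i x + (z1 i x * g k x + z2 i k x * v x).
pose h' i k x := (z x * h i k x + z1 k x * g i x) + (z1 i x * g k x + z2 i k x * v x).
have Lzv : L2 mu v' by exact: L2_Mc cz Lv cv.
have Lz1v l : L2 mu (fun x => z1 l x * v x) by exact: L2_Mc (cz1 l) Lv cv.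
have Lzg l : L2 mu (fun x => z x * g l x) by exact: L2_Mc cz (Lg l) (cg l).
have Lz1g j l : L2 mu (fun x => z1 j x * g l x) by exact: L2_Mc (cz1 j) (Lg l) (cg l).
have Lz2v j l : L2 mu (fun x => z2 j l x * v x) by exact: L2_Mc (cz2 j l) Lv cv.
have Lzh j l : L2 mu (fun x => z x * h j l x) by exact: L2_Mc cz (Lh j l) (ch j l).
have Lg' l : L2 mu (g' l) by exact: L2D.
have La j l : L2 mu (fun x => z x * h j l x + z1 l x * g j x) by exact: L2D.
have Lb j l : L2 mu (fun x => z1 j x * g l x + z2 j l x * v x) by exact: L2D.
have Lh' j l : L2 mu (h' j l) by exact: L2D.
have Lr j l : L2 mu (rest j l) by exact: L2D.
have off f u : smooth (ball x0 r1) f -> (forall x, ~ Omega x -> u x = 0) ->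
    forall x, ~ (`|x - x0| <= r1 /\ Omega x) -> f x * u x = 0.
  move=> sf u0 x nx; have [Ox|nO] := pselect (Omega x); last by rewrite u0 ?mulr0.
  by rewrite (smooth_ball_eq0 sf) ?mul0r// => xr; exact: nx.
have dv' l : wder setT l v' (g' l).
  exact: (wderM openT Lv (Lg l) cv (cg l) (dv l) (sz 1).1).
have dg' j l : wder Omega l (g' j) (h' j l).
  apply: wderD => //.
    exact: (wderM oO (Lg j) (Lh j l) (cg j) (ch j l) (dg j l) (sz 1).1).
  exact: (wderM oO Lv (Lg l) cv (cg l) (wder_sub (@subsetT _ Omega) (dv l)) (sz1 j 1).1).
have hs' j l : h' j l = h' l j.
  apply/funext => x; rewrite /h' (hs j l).
  have -> : z2 j l x = z2 l j x by rewrite /z2 /z1 (derive2C _ _ _ (sz 2).1).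
  move: (z x * _) (z1 l x * _) (z1 j x * _) (z2 l j x * _) => a1 a2 a3 a4; ring.
have H := HCF v' g' h' Lzv Lg' Lh'.
have {}H := H (off z v sz v0).
have sg' l : lsup Omega x0 r1 (g' l).
  by move=> x nx; rewrite /g' (off z (g l) sz (g0 l) x nx) (off (z1 l) v (sz1 l) v0 x nx) addr0.
have sh' j l : lsup Omega x0 r1 (h' j l).
  move=> x nx; rewrite /h' (off z (h j l) sz (h0 j l) x nx) (off (z1 l) (g j) (sz1 l) (g0 j) x nx).
  by rewrite (off (z1 j) (g l) (sz1 j) (g0 l) x nx) (off (z2 j l) v (sz2 j l) v0 x nx) !addr0.
have {}H := H sg' sh' dv' dg' hs' i k.
pose e := lower_energy v g h.
have Lsum : L2 mu (fun x => \sum_l h l l x) by apply: L2_sum => l.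
have ie : integ mu e.
  apply: integD; last exact: Lv.2.
  apply: integD; first exact: Lsum.2.
  by apply: integ_sum => l; exact: (Lg l).2.
have e0 x : 0 <= e x by rewrite !addr_ge0 ?sqr_ge0// sumr_ge0// => l _; exact: sqr_ge0.
pose s x := Num.sqrt (e x).
have s0 x : 0 <= s x by exact: sqrtr_ge0.
have ss x : s x ^+ 2 = e x by exact: sqr_sqrtr.
have gS x : 0 <= \sum_l g l x ^+ 2 by apply: sumr_ge0 => l _; exact: sqr_ge0.
have vs x : `|v x| <= s x.
  by apply: norm_le_sqrt; rewrite /e /lower_energy lerDr addr_ge0// sqr_ge0.
have gs l x : `|g l x| <= s x.
  apply: norm_le_sqrt; apply: (@le_trans _ _ (\sum_l g l x ^+ 2)).
    by rewrite (bigD1 l)//= lerDl; apply: sumr_ge0 => j _; exact: sqr_ge0.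
  by rewrite /e /lower_energy addrAC lerDr addr_ge0// sqr_ge0.
have Ss x : `|\sum_l h l l x| <= s x.
  by apply: norm_le_sqrt; rewrite /e /lower_energy -addrA lerDl addr_ge0// sqr_ge0.
have pr a c x : `|a| <= B -> `|c| <= s x -> `|a * c| <= B * s x.
  by move=> h1 h2; rewrite normrM; apply: ler_pM.
have bg l x : g' l x ^+ 2 <= (2 * B) ^+ 2 * e x.
  apply: (sqr_le_of_norm _ (s0 x) (ss x)); first by rewrite mulr_ge0.
  apply: le_trans (ler_normD _ _) _.
  have := pr _ _ x (zb x) (gs l x); have := pr _ _ x (z1b l x) (vs x); rewrite -mulrA; lra.
have brest j l x : `|rest j l x| <= 3 * B * s x.
  apply: le_trans (ler_normD _ _) _.
  have h1 := pr _ _ x (z1b l x) (gs j x); have h2 := pr _ _ x (z1b j x) (gs l x).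
  have h3 := pr _ _ x (z2b j l x) (vs x).
  have h4 := ler_normD (z1 j x * g l x) (z2 j l x * v x).
  by rewrite -mulrA; move: h1 h2 h3 h4; lra.
have bS x : (\sum_l h' l l x) ^+ 2 <= K1 * e x.
  apply: (sqr_le_of_norm _ (s0 x) (ss x)); first by rewrite mulr_ge0// addr_ge0// mulr_ge0.
  have -> : \sum_l h' l l x = z x * (\sum_l h l l x) + \sum_l rest l l x.
    rewrite mulr_sumr -big_split /=; apply: eq_bigr => l _; rewrite /h' /rest. exact: (esym (addrA (z x * h l l x) _ _)).
  apply: le_trans (ler_normD _ _) _.
  have h1 := pr _ _ x (zb x) (Ss x).
  have h2 : `|\sum_l rest l l x| <= N * (3 * B * s x).
    apply: le_trans (ler_norm_sum _ _ _) _.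
    apply: le_trans (ler_sum _ (fun l _ => brest l l x)) _.
    by rewrite sumr_const card_ord /N -[leLHS]mulr_natl.
  apply: le_trans (lerD h1 h2) _; rewrite le_eqVlt; apply/orP; left; apply/eqP; ring.
have br j l x : rest j l x ^+ 2 <= K3 * e x.
  by apply: (sqr_le_of_norm _ (s0 x) (ss x)) => //; rewrite mulr_ge0.
have I1 : \int[mu]_x ((\sum_l h' l l x) ^+ 2) <= K1 * \int[mu]_x e x.
  rewrite -(IntZ K1 ie); apply: Int_le => //; last exact: integZ.
  have LS : L2 mu (fun x => \sum_l h' l l x) by apply: L2_sum => l; exact: Lh'.
  exact: LS.2.
have I2 : \sum_l \int[mu]_x (g' l x ^+ 2) <= K2 * \int[mu]_x e x.
  rewrite /K2 -mulrA.
  apply: (@le_trans _ _ (\sum_(l < n) ((2 * B) ^+ 2 * \int[mu]_x e x))).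
    apply: ler_sum => l _; rewrite -(IntZ _ ie); apply: Int_le => //; last exact: integZ.
    exact: (Lg' l).2.
  by rewrite sumr_const card_ord /N -[leLHS]mulr_natl.
have I3 : \int[mu]_x (rest i k x ^+ 2) <= K3 * \int[mu]_x e x.
  rewrite -(IntZ K3 ie); apply: Int_le => //; last exact: integZ.
  exact: (Lr i k).2.
have I4 : \int[mu]_x ((z x * h i k x) ^+ 2) <= 2 * \int[mu]_x (h' i k x ^+ 2) + 2 * \int[mu]_x (rest i k x ^+ 2).
  rewrite -(IntZ 2 (Lh' i k).2) -(IntZ 2 (Lr i k).2) -IntD; [|exact: integZ (Lh' i k).2|exact: integZ (Lr i k).2].
  apply: Int_le; first exact: (Lzh i k).2.
    by apply: integD; [exact: integZ (Lh' i k).2|exact: integZ (Lr i k).2].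
  move=> x; have -> : h' i k x = z x * h i k x + rest i k x.
    exact: (esym (addrA (z x * h i k x) _ _)).
  move: (z x * h i k x) (rest i k x) => a c; have := sqr_ge0 (a + 2 * c); nra.
exact: (loc_arith CF0 H I1 I2 I3 I4).
Qed.

(** The two kinds of test functions carry the boundary condition: the gradient is weak on the whole
    space, so [v] has zero trace, while second derivatives are tested inside [Omega] only and the
    gradient keeps a free trace. *)
Record H2_data (v : V -> R) (g : 'I_n -> V -> R) (h : 'I_n -> 'I_n -> V -> R) : Prop := H2Data {
  data_Lv : L2 mu v;
  data_Lg : forall i, L2 mu (g i);
  data_Lh : forall i k, L2 mu (h i k);
  data_v0 : forall x, ~ Omega x -> v x = 0;
  data_g0 : forall i x, ~ Omega x -> g i x = 0;
  data_h0 : forall i k x, ~ Omega x -> h i k x = 0;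
  data_dv : forall i, wder setT i v (g i);
  data_dg : forall i k, wder Omega k (g i) (h i k);
  data_sym : forall i k, h i k = h k i }.

Lemma bounded_box : bounded_set Omega -> exists2 M : R, 0 <= M & forall x, Omega x -> `|x| <= M.
Proof.
move=> [M [Mr HM]]; exists (`|M| + 1); first by rewrite addr_ge0.
by move=> x Ox; apply: HM => //; have := ler_norm M; lra.
Qed.

Lemma off_cptin f : bounded_set Omega -> (forall x, ~ Omega x -> f x = 0) -> cptin setT f.
Proof.
move=> /bounded_box[M M0 HM] f0; apply: (@box_cptin _ _ _ M) => x xM; apply: f0 => /HM.
by rewrite leNgt xM.
Qed.

Lemma cover_Int_le (K : nat) (z : 'I_K -> V -> R) f :
  (forall p, L2 mu (fun x => z p x * f x)) -> L2 mu f ->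
  (forall x, f x != 0 -> exists p, z p x = 1) ->
  \int[mu]_x (f x ^+ 2) <= \sum_p \int[mu]_x ((z p x * f x) ^+ 2).
Proof.
move=> Lz Lf H; rewrite -Int_sum; last by move=> p; exact: (Lz p).2.
apply: Int_le; [exact: Lf.2|by apply: integ_sum => p; exact: (Lz p).2|].
move=> x; have S0 (P : pred 'I_K) : 0 <= \sum_(p | P p) (z p x * f x) ^+ 2.
  by apply: sumr_ge0 => p _; exact: sqr_ge0.
have [f0|fx] := eqVneq (f x) 0; first by rewrite {1}f0 expr0n; exact: S0.
by have [p zp] := H x fx; rewrite (bigD1 p)//= zp mul1r lerDl.
Qed.

Lemma global_H2_estimate (e : R) : boundary_of_class Omega 4 e -> bounded_set Omega ->
  exists2 C : R, 0 <= C & forall v g h, H2_data v g h -> forall i k,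
    \int[mu]_x (h i k x ^+ 2) <= C * \int[mu]_x lower_energy v g h x.
Proof.
move=> hbd bO; have [K [a [r [z [Hz cov]]]]] := cutoff_cover hbd bO.
have /choice[C HC] : forall p : 'I_K, exists C : R, 0 <= C /\ forall v g h, H2_data v g h ->
    forall i k, \int[mu]_x ((z p x * h i k x) ^+ 2) <= C * \int[mu]_x lower_energy v g h x.
  move=> p; have [_ ch sz] := Hz p; have [C C0 H] := localized_bound sz ch.
  exists C; split => // v g h D i k; apply: H; try by case: D.
  - by apply: off_cptin => //; exact: data_v0 D.
  - by move=> l; apply: off_cptin => //; exact: data_g0 D l.
  - by move=> l j; apply: off_cptin => //; exact: data_h0 D l j.
exists (\sum_p C p); first by apply: sumr_ge0 => p _; case: (HC p).
move=> v g h D i k.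
have Lz p : L2 mu (fun x => z p x * h i k x).
  have [_ _ sz] := Hz p; apply: L2_Mc (data_Lh D i k) (off_cptin bO (data_h0 D i k)).
  exact: TC_cont (sz 0).
apply: le_trans (cover_Int_le Lz (data_Lh D i k) _) _.
  move=> x hx; apply: cov; apply: contrapT => nO.
  by move/eqP : hx; apply; exact: data_h0 D i k x nO.
by rewrite mulr_suml; apply: ler_sum => p _; exact: (HC p).2.
Qed.

(** Applied to each localized component of the gradient. Such a component has no boundary condition,
    which is why the local statement rests on reflection rather than on extension by zero. *)
Lemma global_L6 (e : R) v g h : boundary_of_class Omega 4 e -> bounded_set Omega ->
  (m < 3)%N -> H2_data v g h -> forall i, integ mu (fun x => g i x ^+ 6).
Proof.
move=> hbd bO m3 D i; have [K [a [r [z [Hz cov]]]]] := cutoff_cover hbd bO.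
have e6 (t : R) : 0 <= t ^+ 6 by exact: (cp_ge0 (convex_power6 R)).
have Z6 p : integ mu (fun x => (z p x * g i x) ^+ 6).
  have [_ [_ H] sz] := Hz p.
  have cz := TC_cont (sz 0); have cz1 k := TC_cont (smooth_D k sz 0).
  have cg := off_cptin bO (data_g0 D i); have ch k := off_cptin bO (data_h0 D i k).
  have Lzh k : L2 mu (fun x => z p x * h i k x) by exact: L2_Mc cz (data_Lh D i k) (ch k).
  have Lzg k : L2 mu (fun x => 'D_(basis k) (z p) x * g i x).
    exact: L2_Mc (cz1 k) (data_Lg D i) cg.
  have off f u : smooth (ball (a p) (r p)) f -> (forall x, ~ Omega x -> u x = 0) ->
      forall x, ~ (`|x - a p| <= r p /\ Omega x) -> f x * u x = 0.
    move=> sf u0 x nx; have [Ox|nO] := pselect (Omega x); last by rewrite u0 ?mulr0.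
    by rewrite (smooth_ball_eq0 sf) ?mul0r// => xr; exact: nx.
  apply: (H m3 _ (fun k x => z p x * h i k x + 'D_(basis k) (z p) x * g i x)).
  - exact: L2_Mc cz (data_Lg D i) cg.
  - by move=> k; exact: L2D.
  - exact: off sz (data_g0 D i).
  - move=> k x nx; rewrite (off _ _ sz (data_h0 D i k) x nx).
    by rewrite (off _ _ (smooth_D k sz) (data_g0 D i) x nx) addr0.
  - by move=> k; exact: (wderM oO (data_Lg D i) (data_Lh D i k) cg (ch k) (data_dg D i k) (sz 1).1).
apply: (integ_le _ _ (integ_sum (index_enum 'I_K) Z6)).
  by apply: measurable_funX; exact: (data_Lg D i).1.
move=> x; rewrite ger0_norm//; have S0 (P : pred 'I_K) : 0 <= \sum_(p | P p) (z p x * g i x) ^+ 6.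
  by apply: sumr_ge0.
have [g0|gx] := eqVneq (g i x) 0; first by rewrite {1}g0 expr0n; exact: S0.
have [|p zp] := cov x.
  by apply: contrapT => nO; move/eqP : gx; apply; exact: data_g0 D i x nO.
by rewrite (bigD1 p)//= zp mul1r lerDl.
Qed.

End chart_existence.

(** * The energy and its minimizer *)
Section vector_inequality.
Context (R : realType) (J : finType).
Implicit Types (c d : J -> R).

Lemma sum_CS c d : (\sum_i c i * d i) ^+ 2 <= (\sum_i c i ^+ 2) * (\sum_i d i ^+ 2).
Proof.
set t := \sum_i _; set M := \sum_i c i ^+ 2; set D := \sum_i d i ^+ 2.
have M0 : 0 <= M by apply: sumr_ge0 => i _; exact: sqr_ge0.
have D0 : 0 <= D by apply: sumr_ge0 => i _; exact: sqr_ge0.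
have H l : 0 <= M - 2 * l * t + l ^+ 2 * D.
  have -> : M - 2 * l * t + l ^+ 2 * D = \sum_i (c i - l * d i) ^+ 2.
    rewrite !mulr_sumr -sumrB -big_split /=; apply: eq_bigr => i _.
    by move: (c i) (d i) => a b; ring.
  by apply: sumr_ge0 => i _; exact: sqr_ge0.
have [D1|D1] := eqVneq D 0.
  have t0 : t = 0.
    apply: big1 => i _; have /eqP := D1; rewrite psumr_eq0; last by move=> j _; exact: sqr_ge0.
    move=> /allP /(_ i (mem_index_enum i)); rewrite sqrf_eq0 => /eqP ->; exact: mulr0.
  by rewrite t0 expr0n /= mulr_ge0.
have Dp : 0 < D by rewrite lt0r D1.
have := H (t / D); have -> : M - 2 * (t / D) * t + (t / D) ^+ 2 * D = M - t ^+ 2 / D by field.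
by rewrite subr_ge0 ler_pdivrMr.
Qed.

Lemma sqr_sum_split c d : \sum_i (c i + d i) ^+ 2 =
  \sum_i c i ^+ 2 + \sum_i d i ^+ 2 + 2 * \sum_i c i * d i.
Proof.
rewrite mulr_sumr -!big_split /=; apply: eq_bigr => i _.
by move: (c i) (d i) => a b; ring.
Qed.

Lemma sqr_sum_splitB c d : \sum_i (c i - d i) ^+ 2 =
  \sum_i c i ^+ 2 + \sum_i d i ^+ 2 - 2 * \sum_i c i * d i.
Proof.
rewrite mulr_sumr -big_split -sumrB /=; apply: eq_bigr => i _.
by move: (c i) (d i) => a b; ring.
Qed.

(** At [s = |grad u|^2], [kappa] times this is the quartic and sextic part of the energy density. *)
Definition well (s : R) := s ^+ 3 / 12 - s ^+ 2 / 4.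

(** [M] and [D] are the squared norms of the midpoint and of the half difference, [t] their inner
    product. Only [q (M + D - 1)] can be negative; then [M + D < 1], and Cauchy-Schwarz bounds it
    below by [- M D >= - D]. *)
Lemma well_midpoint_arith (M D t : R) : 0 <= M -> 0 <= D -> t ^+ 2 <= M * D ->
  well M <= 2^-1 * (well (M + D + 2 * t) + well (M + D - 2 * t)) + 2 * D.
Proof.
move=> M0 D0 tMD; rewrite /well.
set q := t ^+ 2; have q0 : 0 <= q by exact: sqr_ge0.
have -> : 2^-1 * ((M + D + 2 * t) ^+ 3 / 12 - (M + D + 2 * t) ^+ 2 / 4 +
    ((M + D - 2 * t) ^+ 3 / 12 - (M + D - 2 * t) ^+ 2 / 4)) =
    (M + D) ^+ 3 / 12 - (M + D) ^+ 2 / 4 + q * (M + D - 1).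
  by rewrite /q; field.
(* Completing squares leaves at least [25/16 D], more than the possible loss [D]. *)
have -> : (M + D) ^+ 3 / 12 - (M + D) ^+ 2 / 4 + q * (M + D - 1) + 2 * D =
   (M ^+ 3 / 12 - M ^+ 2 / 4) + (D * ((M - 1) ^+ 2 / 4 + M * D / 4 + (D - 3 / 2) ^+ 2 / 12 + 25 / 16)
     + q * (M + D - 1)) by field.
rewrite lerDl.
have h0 : 0 <= (M - 1) ^+ 2 / 4 + M * D / 4 + (D - 3 / 2) ^+ 2 / 12.
  by rewrite !addr_ge0// divr_ge0 ?sqr_ge0 ?mulr_ge0.
have h1 : D * (25 / 16) <= D * ((M - 1) ^+ 2 / 4 + M * D / 4 + (D - 3 / 2) ^+ 2 / 12 + 25 / 16).
  by apply: ler_wpM2l => //; rewrite lerDr.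
have [h|h] := leP 1 (M + D).
  have : 0 <= q * (M + D - 1) by rewrite mulr_ge0// subr_ge0.
  by move: h1; set A := D * (_ + _); set B := q * _; lra.
have h2 : q * (1 - (M + D)) <= (M * D) * 1.
  by apply: ler_pM => //; [rewrite subr_ge0 ltW|lra].
have h3 : M * D <= 1 * D by apply: ler_wpM2r => //; lra.
move: h1 h2 h3; have -> : q * (M + D - 1) = - (q * (1 - (M + D))) by ring.
by set A := D * (_ + _); set B := q * _; set E := M * D; lra.
Qed.

Lemma well_midpoint c d :
  well (\sum_i c i ^+ 2) <= 2^-1 * (well (\sum_i (c i + d i) ^+ 2) + well (\sum_i (c i - d i) ^+ 2)) +
    2 * \sum_i d i ^+ 2.
Proof.
rewrite sqr_sum_split sqr_sum_splitB; apply: well_midpoint_arith; last exact: sum_CS.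
  by apply: sumr_ge0 => i _; exact: sqr_ge0.
by apply: sumr_ge0 => i _; exact: sqr_ge0.
Qed.

(** The minimum over nonnegative [s] is attained at the double root [s = 2]. *)
Lemma well_ge (s : R) : 0 <= s -> - 3^-1 <= well s.
Proof.
move=> s0; rewrite /well -subr_ge0.
have -> : s ^+ 3 / 12 - s ^+ 2 / 4 - - 3^-1 = (s - 2) ^+ 2 * (s + 1) / 12 by field.
by rewrite divr_ge0// mulr_ge0 ?sqr_ge0// addr_ge0.
Qed.

(** Coercivity: a bound on the integral of the well bounds that of [|grad u|^6], which puts the
    gradient of a limit in L^6. *)
Lemma cube_le_well (s : R) : 0 <= s -> s ^+ 3 / 24 <= well s + 4.
Proof.
move=> s0; rewrite /well -subr_ge0.
have -> : s ^+ 3 / 12 - s ^+ 2 / 4 + 4 - s ^+ 3 / 24 = (s - 4) ^+ 2 * (s + 2) / 24 + 8 / 3.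
  by field.
by rewrite addr_ge0// divr_ge0// mulr_ge0 ?sqr_ge0// addr_ge0.
Qed.

Lemma continuous_well : continuous well.
Proof.
move=> s; apply: cvgB; apply: cvgMr_tmp; exact: exprn_continuous.
Qed.

End vector_inequality.

Lemma midpoint_arith (R : realType) (kappa p q A B C D a b c d : R) :
  kappa * well c <= kappa * (2^-1 * (well a + well b) + 2 * d) -> 0 <= D -> C + D = 2^-1 * (A + B) ->
  2^-1 * p ^+ 2 + C + kappa * well c <=
  2^-1 * (2^-1 * (p + q) ^+ 2 + A + kappa * well a +
    (2^-1 * (p - q) ^+ 2 + B + kappa * well b)) - 2^-1 * q ^+ 2 + 2 * kappa * d.
Proof.
move: (well a) (well b) (well c) => wa wb wc h1 h2 h3.
have -> : 2^-1 * (2^-1 * (p + q) ^+ 2 + A + kappa * wa + (2^-1 * (p - q) ^+ 2 + B + kappa * wb)) -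
    2^-1 * q ^+ 2 + 2 * kappa * d =
    2^-1 * p ^+ 2 + 2^-1 * (A + B) + kappa * (2^-1 * (wa + wb) + 2 * d) by field.
by rewrite -h3; apply: lerD => //; rewrite lerD2l lerDl.
Qed.

(** * Jets and the energy in terms of jets *)

Section jets.
Context (R : realType) (m : nat).
Local Notation n := m.+1.
Local Notation V := 'rV[R]_n.
Local Notation mu := (@lebesgue_rV R n).
Context (Omega : set V).
Context (oO : open Omega).
Context (bO : bounded_set Omega).

(* Value, first and second derivatives; [c2 i k] stands for [D_k D_i]. *)
Definition idx := (unit + 'I_n + 'I_n * 'I_n)%type.
Definition c0 : idx := inl (inl tt).
Definition c1 i : idx := inl (inr i).
Definition c2 i k : idx := inr (i, k).
Definition jet := idx -> V -> R.
Implicit Types (u w : jet) (c : idx) (i k l : 'I_n) (x : V).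

Definition Jet (phi : V -> R) : jet := fun c =>
  match c with
  | inl (inl _) => phi
  | inl (inr i) => 'D_(basis i) phi
  | inr ik => 'D_(basis ik.2) ('D_(basis ik.1) phi)
  end.

Definition jdata u := H2_data Omega (u c0) (fun i => u (c1 i)) (fun i k => u (c2 i k)).

(** The components that test functions must approximate: the full jet for W^{2,2}_0, only the value
    and gradient for the Navier space, whose zero condition is that of W^{1,2}_0. *)
Definition graded (bc : boundary_condition) c :=
  match bc, c with Navier, inr _ => false | _, _ => true end.

Definition approx bc u := forall d : R, 0 < d -> exists2 phi, smooth Omega phi &
  forall c, graded bc c -> \int[mu]_x ((Jet phi c x - u c x) ^+ 2) <= d.

Definition grad2 u x := \sum_i u (c1 i) x ^+ 2.
Definition lap u x := \sum_i u (c2 i i) x.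

(** The image of [Y] among jets. Integrability of the cube says that the gradient is in L^6, in
    every dimension; in dimension at most three this will follow from the first two conditions and
    the regularity of the boundary. *)
Definition adm bc u := [/\ jdata u, approx bc u & integ mu (fun x => grad2 u x ^+ 3)].

Definition jlin (a b : R) u w : jet := fun c x => a * u c x + b * w c x.

Lemma jdata_L2 u c : jdata u -> L2 mu (u c).
Proof.
move=> D; case: c => [[[]|i]|[i k]]; [exact: data_Lv D|exact: (data_Lg D i)|exact: (data_Lh D i k)].
Qed.

Lemma jdata_off u c x : jdata u -> ~ Omega x -> u c x = 0.
Proof.
move=> D; case: c => [[[]|i]|[i k]].
- exact: (data_v0 D).
- exact: (data_g0 D i).
- exact: (data_h0 D i k).
Qed.

Lemma Jet_smooth phi c : smooth Omega phi -> smooth Omega (Jet phi c).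
Proof.
move=> sp; case: c => [[[]|i]|[i k]] //=; first exact: smooth_D.
by do 2 apply: smooth_D.
Qed.

Lemma Jet_lin a b phi psi : smooth Omega phi -> smooth Omega psi ->
  Jet (fun x => a * phi x + b * psi x) = jlin a b (Jet phi) (Jet psi).
Proof.
have D f g i : smooth Omega f -> smooth Omega g ->
    'D_(basis i) (fun x => a * f x + b * g x) = fun x => a * 'D_(basis i) f x + b * 'D_(basis i) g x.
  move=> sf sg; apply/funext => x.
  have df : derivable f x (basis i) by exact: TC_derivable (sf 1).
  have dg : derivable g x (basis i) by exact: TC_derivable (sg 1).
  have daf : derivable (fun x => a * f x) x (basis i) by exact: derivableZ.
  have dbg : derivable (fun x => b * g x) x (basis i) by exact: derivableZ.
  by rewrite (deriveD daf dbg) (deriveZ _ df) (deriveZ _ dg).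
move=> sp ss; apply/funext => -[[[]|i]|[i k]]; rewrite /jlin/=; first by [].
  exact: D.
by rewrite (D phi psi i sp ss) (D _ _ k (smooth_D i sp) (smooth_D i ss)).
Qed.

Lemma smooth_lin a b phi psi : smooth Omega phi -> smooth Omega psi ->
  smooth Omega (fun x => a * phi x + b * psi x).
Proof. by move=> sp ss k; apply: TC_add; exact: TC_Z. Qed.

Lemma jdata_lin a b u w : jdata u -> jdata w -> jdata (jlin a b u w).
Proof.
move=> Du Dw; have Lu c := jdata_L2 c Du; have Lw c := jdata_L2 c Dw.
have L c : L2 mu (jlin a b u w c) by apply: L2D; exact: L2Z.
have off c x : ~ Omega x -> jlin a b u w c x = 0.
  by move=> nO; rewrite /jlin (jdata_off c Du nO) (jdata_off c Dw nO) !mulr0 addr0.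
split; rewrite /= => //.
- by move=> x; exact: off.
- by move=> i x; exact: off.
- by move=> i k x; exact: off.
- by move=> i; apply: wderD; try exact: L2Z;
    apply: wderZ => //; [exact: (data_dv Du i)|exact: (data_dv Dw i)].
- by move=> i k; apply: wderD; try exact: L2Z;
    apply: wderZ => //; [exact: (data_dg Du i k)|exact: (data_dg Dw i k)].
- move=> i k; apply/funext => x; rewrite /jlin.
  by rewrite (congr1 (fun f : V -> R => f x) (data_sym Du i k)) (congr1 (fun f : V -> R => f x) (data_sym Dw i k)).
Qed.

Lemma Int_sqr_lin a b f g : L2 mu f -> L2 mu g ->
  \int[mu]_x ((a * f x + b * g x) ^+ 2) <=
  2 * a ^+ 2 * \int[mu]_x (f x ^+ 2) + 2 * b ^+ 2 * \int[mu]_x (g x ^+ 2).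
Proof.
move=> Lf Lg; apply: le_trans (Int_sqrD (L2Z a Lf) (L2Z b Lg)) _.
have E (r : R) (h : V -> R) : L2 mu h -> \int[mu]_x ((r * h x) ^+ 2) = r ^+ 2 * \int[mu]_x (h x ^+ 2).
  by move=> Lh; rewrite -(IntZ _ Lh.2); apply: eq_Rintegral => x _; rewrite exprMn.
by rewrite (E a f Lf) (E b g Lg) !mulrA.
Qed.

Lemma lin_diff (a b p q r s : R) : a * (p - r) + b * (q - s) = a * p + b * q - (a * r + b * s).
Proof. ring. Qed.

Lemma approx_lin bc a b u w : jdata u -> jdata w -> approx bc u -> approx bc w ->
  approx bc (jlin a b u w).
Proof.
move=> Du Dw Au Aw d d0; pose K := 2 * a ^+ 2 + 2 * b ^+ 2 + 1.
have a0 := sqr_ge0 a; have b0 := sqr_ge0 b.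
have K0 : 0 < K by rewrite /K; lra.
have dK : 0 < d / K by rewrite divr_gt0.
have [phi sp Hp] := Au _ dK; have [psi ss Hs] := Aw _ dK.
exists (fun x => a * phi x + b * psi x); first exact: smooth_lin.
move=> c gc; rewrite (Jet_lin a b sp ss).
have LJ f : smooth Omega f -> L2 mu (Jet f c) by move=> sf; exact: TC_L2 (Jet_smooth c sf 0).
have L1 : L2 mu (fun x => Jet phi c x - u c x) by apply: L2B; [exact: LJ|exact: jdata_L2].
have L2' : L2 mu (fun x => Jet psi c x - w c x) by apply: L2B; [exact: LJ|exact: jdata_L2].
have := Int_sqr_lin a b L1 L2'.
rewrite (_ : \int[mu]_x _ = \int[mu]_x ((jlin a b (Jet phi) (Jet psi) c x - jlin a b u w c x) ^+ 2)); last first.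
  by apply: eq_Rintegral => x _; exact: (congr1 (fun t => t ^+ 2) (lin_diff _ _ _ _ _ _)).
move=> /le_trans; apply.
have h1 := ler_wpM2l (mulr_ge0 (ler0n R 2) a0) (Hp c gc).
have h2 := ler_wpM2l (mulr_ge0 (ler0n R 2) b0) (Hs c gc).
apply: le_trans (lerD h1 h2) _; rewrite -mulrDl mulrCA ler_piMr ?(ltW d0)//.
by rewrite ler_pdivrMr// mul1r /K lerDl.
Qed.

Lemma grad2_ge0 u x : 0 <= grad2 u x.
Proof. by apply: sumr_ge0 => i _; exact: sqr_ge0. Qed.

Lemma grad2_meas u : jdata u -> measurable_fun setT (grad2 u).
Proof.
move=> D; apply: measurable_sum => i; apply: measurable_funX.
by have [] := jdata_L2 (c1 i) D.
Qed.

Lemma integ_grad2 u : jdata u -> integ mu (grad2 u).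
Proof. by move=> D; apply: integ_sum => i; exact: (jdata_L2 (c1 i) D).2. Qed.

Lemma L2_lap u : jdata u -> L2 mu (lap u).
Proof. by move=> D; apply: L2_sum => i; exact: jdata_L2 (c2 i i) D. Qed.

Lemma integ_grad2_sqr u : jdata u -> integ mu (fun x => grad2 u x ^+ 3) ->
  integ mu (fun x => grad2 u x ^+ 2).
Proof.
move=> D i3; apply: integ_le (integD (integ_grad2 D) i3).
  by apply: measurable_funX; exact: grad2_meas.
move=> x; rewrite ger0_norm ?sqr_ge0//; move: (grad2 u x) (grad2_ge0 u x) => s s0.
have : 0 <= s * ((s - 1) ^+ 2 + s) by rewrite mulr_ge0// addr_ge0// sqr_ge0.
by move=> h; rewrite -subr_ge0; have <- : s * ((s - 1) ^+ 2 + s) = s + s ^+ 3 - s ^+ 2 by ring.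
Qed.

Lemma integ_cube_sum (J : Type) (r : seq J) (f : J -> V -> R) :
  (forall j, measurable_fun setT (f j)) -> (forall j x, 0 <= f j x) ->
  (forall j, integ mu (fun x => f j x ^+ 3)) ->
  integ mu (fun x => (\sum_(j <- r) f j x) ^+ 3).
Proof.
move=> mf f0 i3; elim: r => [|j r IH].
  by apply: integ_eq (@integ0 _ _ _ mu) => x; rewrite big_nil expr0n.
apply: integ_le (integZ 4 (integD (i3 j) IH)).
  by apply: measurable_funX; apply: measurable_sum.
move=> x; rewrite big_cons; have : 0 <= \sum_(j <- r) f j x by apply: sumr_ge0.
move: (f j x) (f0 j x) (\sum_(j <- r) f j x) => a a0 b b0.
rewrite ger0_norm; last by rewrite exprn_ge0// addr_ge0.
have : 0 <= (a + b) * (a - b) ^+ 2 by rewrite mulr_ge0 ?sqr_ge0 ?addr_ge0.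
move=> h; rewrite -subr_ge0.
have -> : 4 * (a ^+ 3 + b ^+ 3) - (a + b) ^+ 3 = 3 * ((a + b) * (a - b) ^+ 2) by ring.
by rewrite mulr_ge0.
Qed.

Lemma grad2_cubeP u : jdata u -> integ mu (fun x => grad2 u x ^+ 3) <->
  forall i, integ mu (fun x => u (c1 i) x ^+ 6).
Proof.
move=> D; split=> [i3 i|i6].
  apply: integ_le i3; first by apply: measurable_funX; exact: (jdata_L2 (c1 i) D).1.
  move=> x; rewrite (exprM _ 2 3) ger0_norm; last by apply: exprn_ge0; exact: sqr_ge0.
  rewrite lerXn2r ?nnegrE ?sqr_ge0 ?grad2_ge0// /grad2 (bigD1 i)//= lerDl.
  by apply: sumr_ge0 => j _; exact: sqr_ge0.
apply: (@integ_cube_sum _ _ (fun i x => u (c1 i) x ^+ 2)).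
- by move=> i; apply: measurable_funX; exact: (jdata_L2 (c1 i) D).1.
- by move=> i x; exact: sqr_ge0.
- by move=> i; apply: integ_eq (i6 i) => x; rewrite (exprM _ 2 3).
Qed.

Lemma grad2_lin_le a b u w x :
  grad2 (jlin a b u w) x <= 2 * a ^+ 2 * grad2 u x + 2 * b ^+ 2 * grad2 w x.
Proof.
rewrite /grad2 !mulr_sumr -big_split /=; apply: ler_sum => i _; rewrite /jlin.
move: (u (c1 i) x) (w (c1 i) x) => p q; rewrite -subr_ge0.
have -> : 2 * a ^+ 2 * p ^+ 2 + 2 * b ^+ 2 * q ^+ 2 - (a * p + b * q) ^+ 2 = (a * p - b * q) ^+ 2.
  by ring.
exact: sqr_ge0.
Qed.

Lemma adm_lin bc a b u w : adm bc u -> adm bc w -> adm bc (jlin a b u w).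
Proof.
move=> [Du Au iu] [Dw Aw iw]; split; [exact: jdata_lin|exact: approx_lin|].
pose f (t : bool) x := if t then 2 * a ^+ 2 * grad2 u x else 2 * b ^+ 2 * grad2 w x.
have i3 : integ mu (fun x => (\sum_(t <- [:: true; false]) f t x) ^+ 3).
  apply: integ_cube_sum.
  - by case; apply: measurable_funM => //; exact: grad2_meas.
  - by case=> x; apply: mulr_ge0; rewrite ?grad2_ge0// mulr_ge0// sqr_ge0.
  - case.
      by apply: integ_eq (integZ ((2 * a ^+ 2) ^+ 3) iu) => x; rewrite /f [RHS]exprMn.
    by apply: integ_eq (integZ ((2 * b ^+ 2) ^+ 3) iw) => x; rewrite /f [RHS]exprMn.
apply: integ_le i3; first by apply: measurable_funX; apply: grad2_meas; exact: jdata_lin.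
move=> x; rewrite big_cons big_seq1 /f ger0_norm ?exprn_ge0 ?grad2_ge0//.
rewrite lerXn2r ?nnegrE ?grad2_ge0//; last exact: grad2_lin_le.
by apply: addr_ge0; apply: mulr_ge0; rewrite ?grad2_ge0// mulr_ge0// sqr_ge0.
Qed.

Context (omega kappa : R).
Context (kappa0 : 0 < kappa).

Definition dens u x := 2^-1 * lap u x ^+ 2 + omega ^+ 2 / 2 * grad2 u x + kappa * well (grad2 u x).
Definition Jen u := \int[mu]_x dens u x.

Lemma integ_well bc u : adm bc u -> integ mu (fun x => well (grad2 u x)).
Proof.
move=> [D _ i3]; have i2 := integ_grad2_sqr D i3.
by apply: integ_eq (integB (integZ 12^-1 i3) (integZ 4^-1 i2)) => x; rewrite /well !(mulrC _^-1).
Qed.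

Lemma integ_dens bc u : adm bc u -> integ mu (dens u).
Proof.
move=> A; have [D _ _] := A; apply: integD; last exact: integZ (integ_well A).
by apply: integD; [exact: integZ (L2_lap D).2|exact: integZ (integ_grad2 D)].
Qed.

Lemma JenE bc u : adm bc u -> Jen u = 2^-1 * \int[mu]_x (lap u x ^+ 2) +
  omega ^+ 2 / 2 * \int[mu]_x grad2 u x + kappa * \int[mu]_x well (grad2 u x).
Proof.
move=> A; have [D _ _] := A.
have I1 := (L2_lap D).2; have I2 := integ_grad2 D; have I3 := integ_well A.
rewrite -(IntZ _ I1) -(IntZ _ I2) -(IntZ _ I3) -(IntD (integZ _ I1) (integZ _ I2)).
by rewrite -(IntD (integD (integZ _ I1) (integZ _ I2)) (integZ _ I3)).
Qed.

Lemma lap_off u x : jdata u -> ~ Omega x -> lap u x = 0.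
Proof. by move=> D nO; apply: big1 => i _; exact: jdata_off. Qed.

Lemma grad2_off u x : jdata u -> ~ Omega x -> grad2 u x = 0.
Proof. by move=> D nO; apply: big1 => i _; rewrite (jdata_off _ D nO) expr0n. Qed.

Lemma well0 : well (0 : R) = 0.
Proof. by rewrite /well !expr0n !mul0r subr0. Qed.

(** Adding the constant [1/3] on the domain makes the integrand nonnegative, as Fatou's lemma
    requires; boundedness of the domain keeps it integrable. *)
Lemma well_indic_ge0 u x : jdata u -> 0 <= well (grad2 u x) + 3^-1 * \1_Omega x.
Proof.
move=> D; rewrite indicE; have [Ox|nO] := pselect (Omega x).
  by rewrite mem_set// mulr1; have := well_ge (grad2_ge0 u x); rewrite -subr_ge0 opprK.
by rewrite memNset// mulr0 addr0 (grad2_off D nO) well0.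
Qed.

Lemma integ_Omega : integ mu (\1_Omega : V -> R).
Proof.
have [M M0 HM] := bounded_box bO.
have mO : measurable Omega by rewrite measurable_rV_open; exact: sub_sigma_algebra.
apply: integ_le (integ_box n M); first exact: measurable_indic.
move=> x; rewrite !indicE; have [Ox|nO] := pselect (Omega x); last first.
  by rewrite (memNset nO) normr0.
by rewrite !mem_set//= ?normr1//; exact: HM.
Qed.

(** The parallelogram identity gains the square of the Laplacian of the half difference, and the
    convexity defect of the well loses [2 kappa] times the square of its gradient. *)
Lemma dens_midpoint u w x : dens (jlin 2^-1 2^-1 u w) x <=
  2^-1 * (dens u x + dens w x) - 2^-1 * lap (jlin 2^-1 (- 2^-1) u w) x ^+ 2 +
  2 * kappa * grad2 (jlin 2^-1 (- 2^-1) u w) x.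
Proof.
set c := jlin _ _ _ _; set d := jlin _ (- _) _ _.
have uE (k : idx) : u k x = c k x + d k x by rewrite /c /d /jlin; field.
have wE (k : idx) : w k x = c k x - d k x by rewrite /c /d /jlin; field.
have lu : lap u x = lap c x + lap d x.
  by rewrite /lap -big_split; apply: eq_bigr => i _; exact: uE.
have lw : lap w x = lap c x - lap d x.
  by rewrite /lap -sumrB; apply: eq_bigr => i _; exact: wE.
have W := well_midpoint (fun i => c (c1 i) x) (fun i => d (c1 i) x).
have gu : grad2 u x = \sum_i (c (c1 i) x + d (c1 i) x) ^+ 2.
  by apply: eq_bigr => i _; rewrite uE.
have gw : grad2 w x = \sum_i (c (c1 i) x - d (c1 i) x) ^+ 2.
  by apply: eq_bigr => i _; rewrite wE.
have S : 2^-1 * (grad2 u x + grad2 w x) = grad2 c x + grad2 d x.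
  rewrite gu gw sqr_sum_split sqr_sum_splitB /grad2.
  by move: (\sum_i _) (\sum_i _) (\sum_i _) => p q r; field.
rewrite -gu -gw in W; have g0 := grad2_ge0 d x.
rewrite /dens lu lw; move: (lap c x) (lap d x) => p q.
have W' := ler_wpM2l (ltW kappa0) W.
have om : 0 <= omega ^+ 2 / 2 * grad2 d x by rewrite mulr_ge0// divr_ge0// sqr_ge0.
have E1 : omega ^+ 2 / 2 * grad2 c x + omega ^+ 2 / 2 * grad2 d x =
    2^-1 * (omega ^+ 2 / 2 * grad2 u x + omega ^+ 2 / 2 * grad2 w x).
  by rewrite -mulrDr -S; field.
move: W' om E1; rewrite -/(grad2 c x) -/(grad2 d x).
exact: midpoint_arith.
Qed.

End jets.

Lemma jet_arith (R : realType) (C a l g : R) : 0 <= C -> 0 <= a -> 0 <= l -> g <= a + l ->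
  C * (a + l + g) <= (2 * C + 1) * (a + l).
Proof.
move=> C0 a0 l0 h; have h1 : C * g <= C * (a + l) by exact: ler_wpM2l.
have -> : C * (a + l + g) = C * (a + l) + C * g by ring.
have -> : (2 * C + 1) * (a + l) = C * (a + l) + C * (a + l) + (a + l) by ring.
by move: h1; set p := C * g; set q := C * (a + l); lra.
Qed.

Lemma gap_arith (R : realType) (K k d p l h : R) : 0 <= K -> 0 <= k -> 0 <= d -> 0 <= p ->
  4 * p <= d -> h <= K * (p + l) -> l <= 4 * d + k * p ->
  4 * h <= (4 * (K * (1 + (4 + k))) + 1) * d.
Proof.
move=> K0 k0 d0 p0 pd hK lk; have pd' : p <= d by lra.
have h1 : k * p <= k * d by exact: ler_wpM2l.
have h2 : K * (p + l) <= K * (d + (4 * d + k * d)).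
  by apply: ler_wpM2l => //; move: h1 lk pd'; set a := k * p; set b := k * d; lra.
have -> : (4 * (K * (1 + (4 + k))) + 1) * d = 4 * (K * (d + (4 * d + k * d))) + d by ring.
by move: h2 hK; set a := K * _; set b := K * _; lra.
Qed.

(** The gradient term is at most [4 kappa^2 p + 4^-1 l], so a quarter of [l] survives from the gain
    [2^-1 l]. *)
Lemma gap_arith0 (R : realType) (kappa I d a1 a2 a3 l g p : R) : 0 < kappa ->
  a1 <= 2^-1 * (a2 + a3) - 2^-1 * l + 2 * kappa * g -> I <= a1 -> a2 <= I + d -> a3 <= I + d ->
  2 * kappa * g <= 2 * kappa * (2 * kappa * p + (4 * (2 * kappa))^-1 * l) ->
  l <= 4 * d + 16 * kappa ^+ 2 * p.
Proof.
move=> k0 h1 h2 h3 h4; have -> : 2 * kappa * (2 * kappa * p + (4 * (2 * kappa))^-1 * l) =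
  4 * (kappa ^+ 2 * p) + 4^-1 * l by field; rewrite gt_eqF.
have -> : 16 * kappa ^+ 2 * p = 16 * (kappa ^+ 2 * p) by ring.
by move: h1; set a := kappa ^+ 2 * p; set b := 2 * kappa * g; lra.
Qed.

(** Young's parameter is [1 / (2 P)]: Poincare's inequality then returns half of [G], which is
    absorbed. *)
Lemma green_arith (R : realType) (P G V L B : R) : 0 < P ->
  G <= (2 * P)^-1 * V + (4 * (2 * P)^-1)^-1 * L -> V <= P * G -> L <= B -> G <= P * B.
Proof.
move=> P0 h1 h2 h3; have i0 : 0 <= (2 * P)^-1 by rewrite invr_ge0 mulr_ge0// ltW.
have h4 := ler_wpM2l i0 h2; have h5 := ler_wpM2l (ltW P0) h3.
move: h1 h4; have -> : (2 * P)^-1 * (P * G) = 2^-1 * G by field; rewrite gt_eqF.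
have -> : (4 * (2 * P)^-1)^-1 * L = 2^-1 * (P * L) by field; rewrite gt_eqF.
by move: h5; set a := P * L; set b := P * B; set c := _^-1 * V; lra.
Qed.

(** * Green's identity and the gap between almost minimizers *)

Section minimizer.
Context (R : realType) (m : nat).
Local Notation n := m.+1.
Local Notation V := 'rV[R]_n.
Local Notation mu := (@lebesgue_rV R n).
Context (Omega : set V).
Context (oO : open Omega).
Context (bO : bounded_set Omega).
Implicit Types (u w : jet R m) (c : idx m) (i k l : 'I_n) (x : V).
Local Notation jdata := (jdata Omega).
Local Notation approx := (approx Omega).
Local Notation adm := (adm Omega).
Local Notation c0 := (c0 m).

Lemma approx_seq bc u : approx bc u -> exists phi : nat -> V -> R,
  (forall j, smooth Omega (phi j)) /\
  forall c, graded bc c -> L2cvg (fun j => Jet (phi j) c) (u c).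
Proof.
move=> A; have /choice[phi H] : forall j : nat, exists phi, smooth Omega phi /\
    forall c, graded bc c -> \int[mu]_x ((Jet phi c x - u c x) ^+ 2) <= j.+1%:R^-1.
  by move=> j; have [phi s h] := A j.+1%:R^-1 (ltac:(by rewrite invr_gt0)); exists phi.
exists phi; split=> [j|c gc]; first exact: (H j).1.
apply: L2cvg_le => d d0; have [N _ HN] := near_infty_natSinv_lt (PosNum d0).
exists N => j Nj; apply: le_trans ((H j).2 c gc) _; exact: ltW (HN j Nj).
Qed.

Lemma graded0 bc : graded bc c0. Proof. by case: bc. Qed.
Lemma graded1 bc i : graded bc (c1 i). Proof. by case: bc. Qed.

(** The derivatives of [u] are tested with the functions approximating it. Only values and gradients
    have to converge, so both boundary conditions are covered. *)
Lemma green bc u : jdata u -> approx bc u ->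
  \int[mu]_x grad2 u x = - \int[mu]_x (u c0 x * lap u x).
Proof.
move=> D /approx_seq[phi [sp C]].
have Lu c := jdata_L2 c D.
have LJ c j : L2 mu (Jet (phi j) c) by exact: TC_L2 (Jet_smooth c (sp j) 0).
have E j : \sum_i \int[mu]_x (u (c1 i) x * 'D_(basis i) (phi j) x) =
    - \int[mu]_x (lap u x * phi j x).
  transitivity (\sum_i - (\int[mu]_x (u (c2 i i) x * phi j x))).
    by apply: eq_bigr => i _; exact: (data_dg D i i (sp j)).
  rewrite sumrN -Int_sum; last by move=> i; exact: L2_integM (Lu _) (LJ c0 j).
  by congr (- _); apply: eq_Rintegral => x _; rewrite /lap mulr_suml.
have C1 : (fun j => \sum_i \int[mu]_x (u (c1 i) x * 'D_(basis i) (phi j) x)) @ \oo -->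
    \sum_i \int[mu]_x (u (c1 i) x * u (c1 i) x).
  apply: cvg_sumr => i; exact: (L2cvg_pair (LJ (c1 i)) (Lu (c1 i)) (Lu (c1 i)) (C _ (graded1 bc i))).
have C2 : (fun j => - (\int[mu]_x (lap u x * phi j x))) @ \oo -->
    - (\int[mu]_x (lap u x * u c0 x)).
  by apply: cvgN; exact: (L2cvg_pair (LJ c0) (Lu c0) (L2_lap D) (C _ (graded0 bc))).
rewrite -(funext E) in C2; have H : \sum_i \int[mu]_x (u (c1 i) x * u (c1 i) x) = - (\int[mu]_x (lap u x * u c0 x)).
  exact: cvg_unique C1 C2.
transitivity (\sum_i \int[mu]_x (u (c1 i) x * u (c1 i) x)).
  rewrite -Int_sum; last by move=> i; exact: L2_integM.
  by apply: eq_Rintegral => x _; apply: eq_bigr => i _; rewrite expr2.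
by rewrite H; congr (- _); apply: eq_Rintegral => x _; rewrite mulrC.
Qed.

Lemma green_young bc u s : jdata u -> approx bc u -> 0 < s ->
  \int[mu]_x grad2 u x <= s * \int[mu]_x (u c0 x ^+ 2) + (4 * s)^-1 * \int[mu]_x (lap u x ^+ 2).
Proof.
move=> D A s0; have Lu := jdata_L2 c0 D; have Ll := L2_lap D.
rewrite (green D A) -(IntN (L2_integM Lu Ll)) -(IntZ _ Lu.2) -(IntZ _ Ll.2).
rewrite -(IntD (integZ _ Lu.2) (integZ _ Ll.2)); apply: Int_le.
- by apply: integN; exact: L2_integM.
- by apply: integD; [exact: integZ Lu.2|exact: integZ Ll.2].
move=> x; move: (u c0 x) (lap u x) => a b; rewrite -subr_ge0.
have -> : s * a ^+ 2 + (4 * s)^-1 * b ^+ 2 - - (a * b) = (4 * s)^-1 * (2 * s * a + b) ^+ 2.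
  by field; rewrite gt_eqF.
by rewrite mulr_ge0 ?sqr_ge0// invr_ge0 mulr_ge0// ltW.
Qed.

Lemma sum_grad2 u : jdata u -> \sum_i \int[mu]_x (u (c1 i) x ^+ 2) = \int[mu]_x grad2 u x.
Proof. by move=> D; rewrite -Int_sum// => i; exact: (jdata_L2 (c1 i) D).2. Qed.

Lemma poincare_jet : exists2 P : R, 0 < P & forall u, jdata u ->
  \int[mu]_x (u c0 x ^+ 2) <= P * \int[mu]_x grad2 u x.
Proof.
have [M M0 HM] := bounded_box bO; pose P : R := 2 * (4 * (M + 1)) ^+ 2.
have P0 : 0 < P by rewrite mulr_gt0// exprn_gt0// mulr_gt0// ltr_wpDl.
exists P => // u D.
have uM x : M < `|x| -> u c0 x = 0.
  move=> xM; apply: (jdata_off c0 D) => /HM; by rewrite leNgt xM.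
have Lg j : L2 mu (u (c1 j)) by exact: jdata_L2 (c1 j) D.
have cg j : cptin setT (u (c1 j)) := off_cptin bO (fun x nO => jdata_off (c1 j) D nO).
apply: le_trans (poincare_weak ord0 M0 (jdata_L2 c0 D) uM Lg cg (data_dv D)) _.
rewrite ler_pM2l// -sum_grad2// (bigD1 ord0)//= lerDl.
by apply: sumr_ge0 => i _; apply: Int_ge0 => x; exact: sqr_ge0.
Qed.

Context (e : R).
Context (hbd : boundary_of_class Omega 4 e).

(** Young's form of Green's identity bounds the gradient by the value and the Laplacian, and the
    global second-order estimate then bounds the Hessian by the same two. *)
Lemma jet_bound bc : exists2 K : R, 0 <= K & forall u, jdata u -> approx bc u -> forall c,
  \int[mu]_x (u c x ^+ 2) <= K * (\int[mu]_x (u c0 x ^+ 2) + \int[mu]_x (lap u x ^+ 2)).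
Proof.
have [C C0 HC] := global_H2_estimate oO hbd bO.
exists (2 * C + 1); first by rewrite addr_ge0// mulr_ge0.
move=> u D A c; set S := \int[mu]_x (u c0 x ^+ 2) + _.
have a0 : 0 <= \int[mu]_x (u c0 x ^+ 2) by apply: Int_ge0 => x; exact: sqr_ge0.
have l0 : 0 <= \int[mu]_x (lap u x ^+ 2) by apply: Int_ge0 => x; exact: sqr_ge0.
have S0 : 0 <= S by exact: addr_ge0.
have G : \int[mu]_x grad2 u x <= S.
  apply: le_trans (green_young D A ltr01) _; rewrite mul1r lerD2l ler_piMl// mulr1.
  by rewrite invf_le1// ler1n.
have CS : S <= (2 * C + 1) * S by rewrite mulrDl mul1r lerDr mulr_ge0// mulr_ge0.
case: c => [[[]|i]|[i k]].
- by apply: le_trans CS; rewrite lerDl.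
- apply: le_trans CS; apply: le_trans G; rewrite -sum_grad2// (bigD1 i)//= lerDl.
  by apply: sumr_ge0 => j _; apply: Int_ge0 => x; exact: sqr_ge0.
- apply: le_trans (HC _ _ _ D i k) _.
  have i1 := (L2_lap D).2; have i2 := integ_grad2 D; have i3 := (jdata_L2 c0 D).2.
  have E : \int[mu]_x lower_energy (u c0) (fun i => u (c1 i)) (fun i k => u (c2 i k)) x =
      \int[mu]_x (lap u x ^+ 2) + \int[mu]_x grad2 u x + \int[mu]_x (u c0 x ^+ 2).
    exact: (etrans (IntD (integD i1 i2) i3) (congr1 (fun t => t + _) (IntD i1 i2))).
  have E2 (p q r : R) : p + q + r = r + p + q by ring.
  rewrite E E2.
  exact: jet_arith.
Qed.

(** A diagonal choice: finite intersections of sets of [U] are nonempty. *)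
Lemma extract (U : set_system nat) (A : nat -> set nat) : ProperFilter U ->
  (forall j, U (A j)) -> exists k : nat -> nat, forall i j : nat, (i <= j)%N -> A i (k j).
Proof.
move=> UU UA; have UB j : U [set k : nat | forall i : nat, (i <= j)%N -> A i k].
  elim: j => [|j IH].
    by apply: filterS (UA 0) => k Ak i; rewrite leqn0 => /eqP ->.
  apply: filterS2 IH (UA j.+1) => k H1 H2 i; rewrite leq_eqVlt => /predU1P[->//|].
  by rewrite ltnS; exact: H1.
have /choice[k Hk] : forall j, exists k : nat, forall i : nat, (i <= j)%N -> A i k.
  by move=> j; exact: (filter_ex (UB j)).
by exists k => i j ij; exact: Hk.
Qed.

Context (omega kappa : R).
Context (kappa0 : 0 < kappa).
Local Notation Jen := (Jen omega kappa).
Local Notation dens := (dens omega kappa).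
Implicit Types (bc : boundary_condition).

Lemma Jen_ge bc u : adm bc u -> 2^-1 * \int[mu]_x (lap u x ^+ 2) <=
  Jen u + kappa / 3 * \int[mu]_x (\1_Omega x : R).
Proof.
move=> A; have [D _ _] := A; have iO := integ_Omega oO bO.
rewrite (JenE omega kappa A).
have g0 : 0 <= omega ^+ 2 / 2 * \int[mu]_x grad2 u x.
  by rewrite mulr_ge0 ?divr_ge0 ?sqr_ge0//; apply: Int_ge0 => x; exact: grad2_ge0.
have w0 : 0 <= kappa * \int[mu]_x well (grad2 u x) + kappa / 3 * \int[mu]_x (\1_Omega x : R).
  rewrite -mulrA -mulrDr mulr_ge0 ?(ltW kappa0)// -(IntZ _ iO).
  rewrite -(IntD (integ_well A) (integZ _ iO)); apply: Int_ge0 => x; exact: well_indic_ge0.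
by move: g0 w0; set a := omega ^+ 2 / 2 * _; set b := kappa * _; set c := kappa / 3 * _; lra.
Qed.

(** The energy of the midpoint is at least [I], so almost minimality bounds the gain of
    [dens_midpoint] by [d] plus the gradient loss. Young with parameter [2 kappa] trades that loss
    for part of the gain and the L^2 norm of the value. *)
Lemma energy_gap bc u w I d : adm bc u -> adm bc w ->
  (forall v, adm bc v -> I <= Jen v) -> Jen u <= I + d -> Jen w <= I + d ->
  \int[mu]_x (lap (jlin 2^-1 (- 2^-1) u w) x ^+ 2) <=
  4 * d + 16 * kappa ^+ 2 * \int[mu]_x (jlin 2^-1 (- 2^-1) u w c0 x ^+ 2).
Proof.
move=> Au Aw HI Ju Jw; set v := jlin 2^-1 (- 2^-1) u w; set c := jlin 2^-1 2^-1 u w.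
have Av : adm bc v by exact: adm_lin.
have Ac : adm bc c by exact: adm_lin.
have [Dv Pv _] := Av; have Jc := HI c Ac.
have iu := integ_dens omega kappa Au; have iw := integ_dens omega kappa Aw.
have il := (L2_lap Dv).2; have ig := integ_grad2 Dv.
have M : Jen c <= 2^-1 * (Jen u + Jen w) - 2^-1 * \int[mu]_x (lap v x ^+ 2) +
    2 * kappa * \int[mu]_x grad2 v x.
  rewrite -(IntD iu iw) -(IntZ _ (integD iu iw)) -(IntZ _ il) -(IntZ _ ig).
  rewrite -(IntB (integZ _ (integD iu iw)) (integZ _ il)).
  rewrite -(IntD (integB (integZ _ (integD iu iw)) (integZ _ il)) (integZ _ ig)).
  apply: Int_le; first exact: integ_dens Ac.
    apply: integD; last exact: integZ.
    by apply: integB; [apply: integZ; exact: integD|exact: integZ].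
  by move=> x; exact: dens_midpoint.
have k2 : 0 < 2 * kappa by rewrite mulr_gt0.
have G := ler_wpM2l (ltW k2) (green_young Dv Pv k2).
exact: (gap_arith0 kappa0 M Jc Ju Jw G).
Qed.

Lemma jet_gap bc : exists2 K : R, 0 < K & forall u w I d, adm bc u -> adm bc w ->
  (forall v, adm bc v -> I <= Jen v) -> Jen u <= I + d -> Jen w <= I + d ->
  \int[mu]_x ((u c0 x - w c0 x) ^+ 2) <= d -> 0 <= d ->
  forall c, \int[mu]_x ((u c x - w c x) ^+ 2) <= K * d.
Proof.
have [K0 K00 HK] := jet_bound bc.
have kk : 0 <= 16 * kappa ^+ 2 by rewrite mulr_ge0// sqr_ge0.
exists (4 * (K0 * (1 + (4 + 16 * kappa ^+ 2))) + 1).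
  by rewrite ltr_wpDl// mulr_ge0// mulr_ge0// addr_ge0// addr_ge0.
move=> u w I d Au Aw HI Ju Jw V d0 c.
pose v := jlin 2^-1 (- 2^-1) u w.
have Av : adm bc v by exact: adm_lin.
have [Dv Pv _] := Av; have Lv c' := jdata_L2 c' Dv.
have E c' : \int[mu]_x ((u c' x - w c' x) ^+ 2) = 4 * \int[mu]_x (v c' x ^+ 2).
  rewrite -(IntZ _ (Lv c').2); apply: eq_Rintegral => x _; rewrite /v /jlin.
  by move: (u c' x) (w c' x) => a b; field.
rewrite E in V; rewrite E.
have H1 := HK v Dv Pv c; have H2 := energy_gap Au Aw HI Ju Jw.
have p0 : 0 <= \int[mu]_x (v c0 x ^+ 2) by apply: Int_ge0 => x; exact: sqr_ge0.
exact: (gap_arith K00 kk d0 p0 V H1 H2).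
Qed.

End minimizer.

Lemma lap_arith (R : realType) (I s J p q : R) :
  J <= I + s -> s <= 1 -> 2^-1 * q <= J + p -> q <= 2 * (I + 1 + p).
Proof. lra. Qed.

(** * Existence of a minimizer *)

Section existence.
Context (R : realType) (m : nat).
Local Notation n := m.+1.
Local Notation V := 'rV[R]_n.
Local Notation mu := (@lebesgue_rV R n).
Context (Omega : set V).
Context (oO : open Omega).
Context (bO : bounded_set Omega).
Context (e : R).
Context (hbd : boundary_of_class Omega 4 e).
Context (omega kappa : R).
Context (kappa0 : 0 < kappa).
Implicit Types (u w : jet R m) (c : idx m) (x : V) (bc : boundary_condition).
Local Notation jdata := (jdata Omega).
Local Notation approx := (approx Omega).
Local Notation adm := (adm Omega).
Local Notation c0 := (c0 m).
Local Notation Jen := (Jen omega kappa).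
Local Notation dens := (dens omega kappa).

Lemma L2cvg_lap (w : nat -> jet R m) u : (forall j, jdata (w j)) -> jdata u ->
  (forall c, L2cvg (fun j => w j c) (u c)) -> L2cvg (fun j => lap (w j)) (lap u).
Proof.
move=> Dw Du C.
have Ld j (i : 'I_n) : L2 mu (fun x => w j (c2 i i) x - u (c2 i i) x).
  exact: (L2B (jdata_L2 _ (Dw j)) (jdata_L2 _ Du)).
have H : (fun j => n%:R * \sum_(i < n) \int[mu]_x ((w j (c2 i i) x - u (c2 i i) x) ^+ 2)) @ \oo -->
    n%:R * \sum_(i < n) (0 : R).
  by apply: cvgMl_tmp; apply: cvg_sumr => i; exact: C.
rewrite big1 ?mulr0// in H.
apply: (@squeeze_cvgr _ _ _ _ (cst 0) _ _ _ _ _ H); last exact: cvg_cst.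
apply: nearW => j; rewrite Int_sqr_ge0 /=.
rewrite -Int_sum; last by move=> i; exact: (Ld j i).2.
rewrite -IntZ; last by apply: integ_sum => i; exact: (Ld j i).2.
apply: Int_le.
- by apply: (L2B (L2_lap (Dw j)) (L2_lap Du)).2.
- by apply: integZ; apply: integ_sum => i; exact: (Ld j i).2.
move=> x; rewrite /lap -sumrB.
have := sqr_sum_le (index_enum 'I_n) (fun i => w j (c2 i i) x - u (c2 i i) x).
by rewrite size_ord.
Qed.

(** Weak derivatives are stable under L^2 convergence, and approximation by test functions is a
    closed condition. The speed [16^-j] also yields convergence almost everywhere, needed for the
    nonquadratic terms. *)
Lemma jet_limit bc (w : nat -> jet R m) : (forall j, jdata (w j)) -> (forall j, approx bc (w j)) ->
  (forall j c, \int[mu]_x ((w j.+1 c x - w j c x) ^+ 2) <= 16^-1 ^+ j) ->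
  exists u, [/\ jdata u, approx bc u, forall c, L2cvg (fun j => w j c) (u c) &
    {ae mu, forall x c, (fun j => w j c x) @ \oo --> u c x}].
Proof.
move=> Dw Aw Hw.
(* One choice function on sequences: equal sequences have the same limit function, so the symmetry
   of second derivatives is inherited literally. *)
have /choice[lim Hl] : forall F : nat -> V -> R, exists f : V -> R, (forall j, L2 mu (F j)) ->
    (forall j, \int[mu]_x ((F j.+1 x - F j x) ^+ 2) <= 16^-1 ^+ j) ->
    [/\ L2 mu f, L2cvg F f, {ae mu, forall x, F ^~ x @ \oo --> f x} &
      forall x, (forall j, F j x = 0) -> f x = 0].
  move=> F; have [H|H] := pselect ((forall j, L2 mu (F j)) /\
      (forall j, \int[mu]_x ((F j.+1 x - F j x) ^+ 2) <= 16^-1 ^+ j)); last first.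
    by exists (fun=> 0) => h1 h2; exfalso; apply: H.
  by have [f Hf] := L2_complete H.1 H.2; exists f.
pose u : jet R m := fun c => lim (fun j => w j c).
have Lw j c : L2 mu (w j c) := jdata_L2 c (Dw j).
have P c := Hl _ (fun j => Lw j c) (fun j => Hw j c).
have Lu c : L2 mu (u c) by case: (P c).
have Cu c : L2cvg (fun j => w j c) (u c) by case: (P c).
have Ou c x : ~ Omega x -> u c x = 0.
  move=> nO; have [_ _ _] := P c; apply => j; exact: (jdata_off c (Dw j) nO).
have Du : jdata u.
  split => //.
  - by move=> x; exact: Ou.
  - by move=> i x; exact: Ou.
  - by move=> i k x; exact: Ou.
  - move=> i; apply: (@wder_lim _ _ setT i (fun j => w j c0) (fun j => w j (c1 i))) => //.
    by move=> j; exact: (data_dv (Dw j) i).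
  - move=> i k; apply: (@wder_lim _ _ Omega k (fun j => w j (c1 i)) (fun j => w j (c2 i k))) => //.
    by move=> j; exact: (data_dg (Dw j) i k).
  - move=> i k; rewrite /u; congr lim; apply/funext => j; exact: (data_sym (Dw j) i k).
exists u; split => //.
- move=> d d0; have d4 : 0 < d / 4 by rewrite divr_gt0.
  have : \forall j \near \oo, forall c, \int[mu]_x ((w j c x - u c x) ^+ 2) <= d / 4.
    apply: filter_forall => c; have [N HN] := L2cvgP (Cu c) d4.
    by exists N => // j /= /HN.
  move=> [N _ HN]; have HN' := HN N (leqnn N).
  have [phi sp Hp] := Aw N _ d4; exists phi => // c gc.
  have LJ : L2 mu (Jet phi c) by exact: TC_L2 (Jet_smooth c sp 0).
  have := Int_sqrD (L2B LJ (Lw N c)) (L2B (Lw N c) (Lu c)).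
  under eq_Rintegral do rewrite addrA subrK.
  move=> /le_trans; apply; have := Hp c gc; have := HN' c.
  by set a := \int[_]_x _; set b := \int[_]_x _; lra.
- have : {ae mu, forall x, forall c, c \in index_enum (idx m) -> (fun j => w j c x) @ \oo --> u c x}.
    elim: (index_enum (idx m)) => [|c s IH]; first by apply: aeW.
    have [_ _ Pc _] := P c.
    apply: filterS2 IH Pc => x h1 h2 d; rewrite inE => /predU1P[->|]; [exact: h2|exact: h1].
  by apply: filterS => x Hx c; apply: Hx; rewrite mem_index_enum.
Qed.

Lemma adm0 bc : adm bc (fun _ _ => 0).
Proof.
have L0 : L2 mu (fun=> 0) by exact: L2_0.
have w0 A i : wder A i (fun _ : V => 0) (fun=> 0).
  move=> phi _; under eq_Rintegral do rewrite mul0r.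
  by under [in RHS]eq_Rintegral do rewrite mul0r; rewrite Int0 oppr0.
split; first by split.
  move=> d d0; exists (fun=> 0).
    by move=> k; split; [exact: Ck_cst|exists set0; split => //; exact: compact0].
  move=> c _; have J0 : Jet (fun=> 0) c = (fun _ : V => 0).
    have D0 i : 'D_(basis i) (fun _ : V => 0 : R) = fun=> 0.
      by apply/funext => x; exact: derive_cst.
    by case: c => [[[]|i]|[i k]] //=; rewrite !D0.
  rewrite J0; under eq_Rintegral do rewrite subrr expr0n.
  by rewrite Int0 ltW.
apply: integ_eq (@integ0 _ _ _ mu) => x.
by rewrite /grad2 big1 ?expr0n// => i _; rewrite expr0n.
Qed.

(** The quadratic terms converge by strong L^2 convergence, so the integrals of the shifted well
    converge too, and Fatou's lemma is applied to them. *)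
Lemma lower_semicontinuity bc (w : nat -> jet R m) u I : (forall j, adm bc (w j)) ->
  jdata u -> approx bc u -> (forall c, L2cvg (fun j => w j c) (u c)) ->
  {ae mu, forall x c, (fun j => w j c x) @ \oo --> u c x} ->
  (fun j => Jen (w j)) @ \oo --> I -> adm bc u /\ Jen u <= I.
Proof.
move=> Aw Du Au C Cae JI.
have Dw j : jdata (w j) by case: (Aw j).
have Lw j c : L2 mu (w j c) := jdata_L2 c (Dw j).
have Lu c : L2 mu (u c) := jdata_L2 c Du.
have iO := integ_Omega oO bO; set vol := \int[mu]_x (\1_Omega x : R).
pose G (v : jet R m) x := kappa * (well (grad2 v x) + 3^-1 * \1_Omega x).
have G0 v x : jdata v -> 0 <= G v x.
  by move=> Dv; rewrite mulr_ge0 ?(ltW kappa0)//; exact: well_indic_ge0.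
have iG j : integ mu (G (w j)).
  by apply: integZ; apply: integD (integ_well (Aw j)) _; exact: integZ.
have IG v : integ mu (fun x => well (grad2 v x)) ->
    \int[mu]_x G v x = kappa * \int[mu]_x well (grad2 v x) + kappa / 3 * vol.
  by move=> iv; rewrite IntZ; [rewrite IntD ?IntZ ?mulrDr ?mulrA//; exact: integZ|
    apply: integD => //; exact: integZ].
pose a v := 2^-1 * \int[mu]_x (lap v x ^+ 2) + omega ^+ 2 / 2 * \int[mu]_x grad2 v x.
have Ca : (fun j => a (w j)) @ \oo --> a u.
  apply: cvgD.
    apply: cvgMl_tmp; exact: (@L2cvg_norm _ _ (fun j => lap (w j)) (lap u) (fun j => L2_lap (Dw j)) (L2_lap Du) (L2cvg_lap Dw Du C)).
  apply: cvgMl_tmp; rewrite -(sum_grad2 Du).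
  under eq_fun => j do rewrite -(sum_grad2 (Dw j)).
  by apply: cvg_sumr => i; apply: (@L2cvg_norm _ _ (fun j => w j (c1 i))).
pose L := I - a u + kappa / 3 * vol.
have CG : (fun j => \int[mu]_x G (w j) x) @ \oo --> L.
  rewrite (_ : (fun j => _) = fun j => Jen (w j) - a (w j) + kappa / 3 * vol); last first.
    apply/funext => j; rewrite IG; last exact: integ_well (Aw j).
    by rewrite (JenE omega kappa (Aw j)) /a [X in _ = X + _]addrAC subrr add0r.
  by apply: cvgD; [exact: cvgB|exact: cvg_cst].
have mG : measurable_fun setT (G u).
  apply: measurable_funM => //; apply: measurable_funD; last first.
    by apply: measurable_funM => //; exact: integ_meas iO.
  have mg := grad2_meas Du.
  by apply: measurable_funB; apply: measurable_funM => //; apply: measurable_funX.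
have Gae : {ae mu, forall x, (fun j => G (w j) x) @ \oo --> G u x}.
  apply: filterS Cae => x Hx; apply: cvgMl_tmp; apply: cvgD; last exact: cvg_cst.
  have S : (fun j => grad2 (w j) x) @ \oo --> grad2 u x.
    apply: (@cvg_sumr _ _ _ (fun i j => w j (c1 i) x ^+ 2)) => i.
    exact: (cvg_comp _ _ (Hx (c1 i)) (@exprn_continuous _ 2 _)).
  exact: (cvg_comp _ _ S (@continuous_well R (grad2 u x))).
(* The integrals are at most [L + d] along a tail of the sequence, which is what Fatou's lemma
   receives; then [d] tends to 0. *)
have fat d : 0 < d -> integ mu (fun x => `|G u x|) /\ \int[mu]_x `|G u x| <= L + d.
  move=> d0; have /cvgrPdist_le/(_ _ d0)[N _ HN] := CG.
  apply: (@Int_fatou _ _ _ mu (fun j => G (w (j + N)%N))) => //.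
  - by move=> j x; exact: G0.
  - move=> j; have := HN (j + N)%N (leq_addl _ _); rewrite /= distrC => h.
    by rewrite -lerBlDl; exact: le_trans (ler_norm _) h.
  - apply: filterS Gae => x Hx; have E := cvg_shiftn N (fun j => (G (w j) x : R)) (nbhs (G u x : R)).
    by move: Hx; rewrite -E.
have iGu : integ mu (G u).
  have [H _] := fat 1 ltr01; by apply: integ_eq H => x; rewrite ger0_norm//; exact: G0.
have GL : \int[mu]_x G u x <= L.
  apply/ler_addgt0Pr => d d0; have [_] := fat d d0.
  by under eq_Rintegral do rewrite ger0_norm ?G0//.
have adu : adm bc u.
  (* By [cube_le_well] the cube is at most [24 (well + 4)]; the factor and the added indicator
     reconstruct this from [G u]. *)
  split => //; apply: (integ_le _ _ (integZ (24 / kappa) (integD iGu (integZ (4 * kappa) iO)))).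
    by apply: measurable_funX; exact: grad2_meas Du.
  move=> x; rewrite ger0_norm ?exprn_ge0 ?grad2_ge0// /G indicE.
  have [Ox|nO] := pselect (Omega x).
    rewrite mem_set// !mulr1; have := cube_le_well (grad2_ge0 u x).
    move: (well _) (grad2 u x ^+ 3) => a1 a2 h.
    have -> : 24 / kappa * (kappa * (a1 + 3^-1) + 4 * kappa) = 24 * (a1 + 4) + 8.
      by field; rewrite gt_eqF.
    lra.
  by rewrite memNset// !mulr0 !addr0 (grad2_off Du nO) well0 expr0n !mulr0.
split => //; rewrite (JenE omega kappa adu) -/(a u).
move: GL; rewrite (IG _ (integ_well adu)) /L.
by set p := kappa * _; set q := kappa / 3 * _; lra.
Qed.

Theorem minimizer_exists bc : exists2 u, adm bc u & forall w, adm bc w -> Jen u <= Jen w.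
Proof.
pose S := [set Jen u | u in [set u | adm bc u]].
have S0 : S !=set0 by exists (Jen ((fun _ _ => 0) : jet R m)), (fun _ _ => 0) => //; exact: adm0.
pose vol := \int[mu]_x (\1_Omega x : R).
have lbS : has_lbound S.
  exists (- (kappa / 3 * vol)) => _ [u Au <-]; have := Jen_ge oO bO omega kappa0 Au.
  have : 0 <= 2^-1 * \int[mu]_x (lap u x ^+ 2) by rewrite mulr_ge0// Int_sqr_ge0.
  by rewrite -/vol; set p := kappa / 3 * vol; set q := 2^-1 * _; lra.
pose I := inf S.
have HI u : adm bc u -> I <= Jen u by move=> Au; apply: ge_inf => //; exists u.
have ex (d : R) : 0 < d -> exists2 u, adm bc u & Jen u <= I + d.
  by move=> d0; have [_ [u Au <-] H] := inf_adherent d0 (conj S0 lbS); exists u => //; exact: ltW.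
have /choice[u Hu] : forall j : nat, exists u, adm bc u /\ Jen u <= I + j.+1%:R^-1.
  by move=> j; have [u Au Ju] := ex j.+1%:R^-1 (ltac:(by rewrite invr_gt0)); exists u.
have [P P0 HP] := poincare_jet bO.
have [M M0 HM] := bounded_box bO.
have v0 : 0 <= vol by apply: Int_ge0 => x; rewrite indicE.
pose B := 2 * (I + 1 + kappa / 3 * vol).
have LB j : \int[mu]_x (lap (u j) x ^+ 2) <= B.
  have [Au Ju] := Hu j; have := Jen_ge oO bO omega kappa0 Au; rewrite -/vol.
  have j1 : j.+1%:R^-1 <= 1 :> R by rewrite invf_le1// ler1n.
  exact: lap_arith Ju j1.
have GB j : \int[mu]_x grad2 (u j) x <= P * B.
  have [[D A _] _] := Hu j; have s0 : 0 < (2 * P)^-1 by rewrite invr_gt0 mulr_gt0.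
  have h1 := green_young D A s0; have h2 := HP _ D.
  exact: (green_arith P0 h1 h2 (LB j)).
(* One constant for both requirements of Rellich's theorem, the L^2 bound and the translation
   estimate. *)
pose C := n%:R * (P * B) + P * (P * B).
have gp j : 0 <= \int[mu]_x grad2 (u j) x by apply: Int_ge0 => x; exact: grad2_ge0.
have PB0 : 0 <= P * B by exact: le_trans (gp 0%N) (GB 0%N).
have C0' : 0 <= C by rewrite addr_ge0// mulr_ge0// ltW.
have Du j : jdata (u j) by case: (Hu j) => -[].
(* An ultrafilter finer than convergence to infinity, so that energies still tend to the infimum
   along it. *)
have [U [UU Uoo]] := ultraFilterLemma (@eventually_filter).
have PU := @ultra_proper _ _ UU.
have rel d : 0 < d -> \forall p \near filter_prod U U, \int[mu]_x ((u p.1 c0 x - u p.2 c0 x) ^+ 2) <= d.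
  move=> dp; apply: (rellich (u := fun k => u k c0) UU M0 C0' _ _ _ _ dp).
  - by move=> k; exact: jdata_L2 c0 (Du k).
  - move=> k x xM; apply: (jdata_off c0 (Du k)) => /HM; by rewrite leNgt xM.
  - move=> k; apply: le_trans (HP _ (Du k)) _; apply: (@le_trans _ _ (P * (P * B))).
      by rewrite ler_pM2l.
    by rewrite /C lerDr mulr_ge0.
  - move=> k h; have Lg i : L2 mu (u k (c1 i)) := jdata_L2 (c1 i) (Du k).
    have cg i : cptin setT (u k (c1 i)) := off_cptin bO (fun x nO => jdata_off (c1 i) (Du k) nO).
    have cv : cptin setT (u k c0) := off_cptin bO (fun x nO => jdata_off c0 (Du k) nO).
    apply: le_trans (translation_weak h (jdata_L2 c0 (Du k)) cv Lg cg (data_dv (Du k))) _.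
    rewrite (sum_grad2 (Du k)) mulrAC ler_wpM2r ?sqr_ge0//.
    apply: (@le_trans _ _ (n%:R * (P * B))); first by rewrite ler_wpM2l.
    by rewrite /C lerDl mulr_ge0// ltW.
have [K K0 HK] := jet_gap oO bO hbd omega kappa0 bc.
(* The tolerance for which [jet_gap] delivers consecutive differences at most [16^-j]; adding 1 to
   [K] makes the division harmless. *)
pose d (j : nat) : R := 16^-1 ^+ j / (K + 1).
have K1 : 0 < K + 1 by rewrite addr_gt0.
have d0 j : 0 < d j by rewrite divr_gt0// exprn_gt0// invr_gt0.
have Kd j : K * d j <= 16^-1 ^+ j.
  rewrite /d mulrA ler_pdivrMr// mulrC ler_wpM2l ?exprn_ge0 ?invr_ge0// lerDl//.
have close (j : nat) : exists A : set nat, U A /\ forall k l, A k -> A l ->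
    (\int[mu]_x ((u k c0 x - u l c0 x) ^+ 2) <= d j /\ Jen (u k) <= I + d j).
  have [[A1 A2] /= [UA1 UA2] H] := rel (d j) (d0 j).
  have UJ : U [set k | Jen (u k) <= I + d j].
    apply: Uoo; have [N _ HN] := near_infty_natSinv_lt (PosNum (d0 j)).
    exists N => // k /= Nk; have [_ Jk] := Hu k; apply: le_trans Jk _.
    by rewrite lerD2l ltW//; exact: (HN k Nk).
  exists (A1 `&` A2 `&` [set k | Jen (u k) <= I + d j]); split.
    by apply: filterI => //; exact: filterI.
  by move=> k l [[A1k _] Jk] [[_ A2l] _]; split => //; exact: (H (k, l)).
have /choice[A HA] := close.
have [k Hk] := extract PU (fun j => (HA j).1).
pose w j := u (k j).
have Aw j : adm bc (w j) by case: (Hu (k j)).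
have Jw j : Jen (w j) <= I + d j := ((HA j).2 _ _ (Hk j j (leqnn j)) (Hk j j (leqnn j))).2.
have ww j c : \int[mu]_x ((w j.+1 c x - w j c x) ^+ 2) <= 16^-1 ^+ j.
  have [h1 h2] := (HA j).2 _ _ (Hk j j.+1 (leqnSn j)) (Hk j j (leqnn j)).
  apply: le_trans (Kd j).
  exact: (HK _ _ _ _ (Aw j.+1) (Aw j) HI h2 (Jw j) h1 (ltW (d0 j)) c).
have [v [Dv Av Cv Caev]] := @jet_limit bc w (fun j => let: And3 D _ _ := Aw j in D)
  (fun j => let: And3 _ D _ := Aw j in D) ww.
have dcv : d @ \oo --> (0 : R).
  have h : (fun j => 16^-1 ^+ j * (K + 1)^-1 : R) @ \oo --> 0 * (K + 1)^-1.
    apply: cvgMr_tmp; apply: cvg_expr; rewrite ger0_norm ?invr_ge0//.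
    by rewrite invf_lt1// ltr1n.
  rewrite mul0r in h; exact: h.
have JI : (fun j => Jen (w j)) @ \oo --> I.
  apply: (@squeeze_cvgr _ _ _ _ (cst I) (fun j => I + d j)).
  - by apply: nearW => j; rewrite Jw HI.
  - exact: cvg_cst.
  - have h : (fun j => I + d j) @ \oo --> I + 0 by apply: cvgD => //; exact: cvg_cst.
    rewrite addr0 in h; exact: h.
have [av Jv] := lower_semicontinuity Aw Dv Av Cv Caev JI.
by exists v => // w' Aw'; apply: le_trans Jv _; exact: HI.
Qed.

End existence.

(** * A competitor of negative energy *)

Section test_energy.
Context (R : realType) (m : nat).
Local Notation n := m.+1.
Local Notation V := 'rV[R]_n.
Local Notation mu := (@lebesgue_rV R n).
Context (Omega : set V).
Context (oO : open Omega).
Context (bO : bounded_set Omega).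
Implicit Types (u w : jet R m) (c : idx m) (x : V) (bc : boundary_condition).
Local Notation jdata := (jdata Omega).
Local Notation adm := (adm Omega).
Local Notation c0 := (c0 m).

Lemma smooth_off f x : smooth Omega f -> ~ Omega x -> f x = 0.
Proof. by move=> sf nO; have [_ [K [_ KO K0]]] := sf 0; apply: K0 => /KO. Qed.

Lemma adm_Jet bc phi : smooth Omega phi -> adm bc (Jet phi).
Proof.
move=> sp; have sJ c := Jet_smooth c sp.
have D : jdata (Jet phi).
  split.
  - exact: TC_L2 (sJ c0 0).
  - by move=> i; exact: TC_L2 (sJ (c1 i) 0).
  - by move=> i k; exact: TC_L2 (sJ (c2 i k) 0).
  - by move=> x; exact: smooth_off (sJ c0).
  - by move=> i x; exact: smooth_off (sJ (c1 i)).
  - by move=> i k x; exact: smooth_off (sJ (c2 i k)).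
  - by move=> i; exact: TC_wder (sp 1).
  - by move=> i k; exact: (wder_sub (@subsetT _ Omega) (TC_wder k (sJ (c1 i) 1))).
  - by move=> i k; apply/funext => x; exact: derive2C (sp 2).1.
split => //.
  move=> d d0; exists phi => // c _; under eq_Rintegral do rewrite subrr expr0n.
  by rewrite Int0 ltW.
apply/(grad2_cubeP D) => i; apply: Int_TC_X 5 _.
exact: TC_S (@subsetT _ Omega) (sJ (c1 i) 0).
Qed.

(** Scaling by [t], written as a linear combination so that admissibility comes from [adm_lin]; the
    terms are homogeneous of degrees 2, 6 and 4. *)
Lemma Jen_lin0 omega kappa bc t u w : adm bc u -> adm bc w -> Jen omega kappa (jlin t 0 u w) =
  t ^+ 2 * (2^-1 * \int[mu]_x (lap u x ^+ 2) + omega ^+ 2 / 2 * \int[mu]_x grad2 u x) +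
  kappa * (t ^+ 6 * \int[mu]_x (grad2 u x ^+ 3) / 12 - t ^+ 4 * \int[mu]_x (grad2 u x ^+ 2) / 4).
Proof.
move=> Au Aw; have [D _ i3] := Au; have i2 := integ_grad2_sqr D i3.
have il := (L2_lap D).2; have ig := integ_grad2 D.
rewrite (JenE omega kappa (adm_lin t 0 Au Aw)).
have L x : lap (jlin t 0 u w) x = t * lap u x.
  by rewrite /lap mulr_sumr; apply: eq_bigr => i _; rewrite /jlin mul0r addr0.
have G x : grad2 (jlin t 0 u w) x = t ^+ 2 * grad2 u x.
  by rewrite /grad2 mulr_sumr; apply: eq_bigr => i _; rewrite /jlin mul0r addr0 exprMn.
have E1 : \int[mu]_x (lap (jlin t 0 u w) x ^+ 2) = t ^+ 2 * \int[mu]_x (lap u x ^+ 2).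
  by rewrite -(IntZ _ il); apply: eq_Rintegral => x _; rewrite L exprMn.
have E2 : \int[mu]_x grad2 (jlin t 0 u w) x = t ^+ 2 * \int[mu]_x grad2 u x.
  by rewrite -(IntZ _ ig); apply: eq_Rintegral => x _; rewrite G.
have E3 : \int[mu]_x well (grad2 (jlin t 0 u w) x) =
    t ^+ 6 / 12 * \int[mu]_x (grad2 u x ^+ 3) - t ^+ 4 / 4 * \int[mu]_x (grad2 u x ^+ 2).
  rewrite -(IntZ _ i3) -(IntZ _ i2) -(IntB (integZ _ i3) (integZ _ i2)).
  by apply: eq_Rintegral => x _; rewrite G /well; field.
by rewrite E1 E2 E3; field.
Qed.

(** The choice of [t] gives [t <= 1] and [t^2 P6 <= P4], so the bracket is at most [- t^4 P4 / 6];
    this beats [t^2 A] once [kappa] exceeds [6 A / (t^2 P4)]. *)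
Lemma negative_arith (A P4 P6 : R) : 0 <= A -> 0 < P4 -> 0 <= P6 -> exists2 t : R, 0 < t &
  exists2 kappa0 : R, 0 < kappa0 & forall kappa, kappa0 <= kappa ->
    t ^+ 2 * A + kappa * (t ^+ 6 * P6 / 12 - t ^+ 4 * P4 / 4) < 0.
Proof.
move=> A0 P40 P60; pose t := P4 / (P4 + P6 + 1).
have d0 : 0 < P4 + P6 + 1 by lra.
have t0 : 0 < t by rewrite divr_gt0.
have t1 : t <= 1 by rewrite ler_pdivrMr// mul1r; lra.
have tP : t ^+ 2 * P6 <= P4.
  apply: (@le_trans _ _ (1 * (t * P6))).
    by rewrite expr2 -mulrA ler_wpM2r// mulr_ge0// ltW.
  rewrite mul1r /t mulrAC ler_pdivrMr// ler_wpM2l//; [exact: ltW|lra].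
have t2 : 0 < t ^+ 2 by exact: exprn_gt0.
have q0 : 0 < t ^+ 2 * P4 by exact: mulr_gt0.
exists t => //; exists (6 * A / (t ^+ 2 * P4) + 1).
  by rewrite ltr_wpDl//; apply: divr_ge0; [rewrite mulr_ge0|exact: ltW].
move=> kappa kk; have k0 : 0 <= 6 * A / (t ^+ 2 * P4) by apply: divr_ge0; [rewrite mulr_ge0|exact: ltW].
have kp : 0 < kappa by lra.
have h1 : kappa * (t ^+ 4 * (t ^+ 2 * P6)) <= kappa * (t ^+ 4 * P4).
  by rewrite ler_pM2l// ler_pM2l// exprn_gt0.
have h2 : 6 * A < kappa * (t ^+ 2 * P4).
  by rewrite -ltr_pdivrMr//; lra.
have h3 : t ^+ 2 * (6 * A) < t ^+ 2 * (kappa * (t ^+ 2 * P4)) by rewrite ltr_pM2l.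
have -> : t ^+ 2 * A + kappa * (t ^+ 6 * P6 / 12 - t ^+ 4 * P4 / 4) =
  6^-1 * (t ^+ 2 * (6 * A)) + (12^-1 * (kappa * (t ^+ 4 * (t ^+ 2 * P6))) - 4^-1 * (kappa * (t ^+ 4 * P4))).
  by field.
have E : t ^+ 2 * (kappa * (t ^+ 2 * P4)) = kappa * (t ^+ 4 * P4) by ring.
rewrite E in h3; move: h1 h3; set a := kappa * _; set b := kappa * (_ * P4); set d := t ^+ 2 * _; lra.
Qed.

Lemma negative_energy omega : Omega !=set0 -> exists2 kappa0 : R, 0 < kappa0 &
  forall bc kappa, kappa0 <= kappa -> exists2 u, adm bc u & Jen omega kappa u < 0.
Proof.
move=> [x0 Ox0].
have [r r0 rO] : exists2 r : R, 0 < r & ball x0 r `<=` Omega.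
  have nO : nbhs x0 Omega by exact: open_nbhs_nbhs.
  by move: nO => /nbhs_ballP[r /= r0 rO]; exists r.
pose phi x := ker (r / 2) (x - x0) : R.
have r2 : 0 < r / 2 by rewrite divr_gt0.
have sp : smooth Omega phi.
  move=> k; split; first by apply: (@Ck_shiftV _ _ k (ker (r / 2)) (- x0)); exact: ker_Ck.
  exists [set x | `|x - x0| <= r / 2]; split; first exact: cball_compact.
    by move=> x /= xr; apply: rO; rewrite -ball_normE/= distrC; lra.
  by move=> x /negP; rewrite -ltNge => /ltW; exact: ker_eq0.
have Aphi bc : adm bc (Jet phi) by exact: adm_Jet.
have [D _ i3] := Aphi Navier; have i2 := integ_grad2_sqr D i3.
have [P P0 HP] := poincare_jet bO.
have Lphi := jdata_L2 c0 D.
have phi2 : 0 < \int[mu]_x (phi x ^+ 2).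
  rewrite lt0r Int_sqr_ge0 andbT; apply/negP => /eqP E.
  have ae0 := Int_eq0_ae Lphi.2 (fun x => sqr_ge0 _) E.
  have : \int[mu]_x phi x = \int[mu]_x (0 : R).
    apply: Int_ae; [exact: Lphi.1|exact: measurable_cst|].
    by apply: filterS ae0 => x /eqP; rewrite sqrf_eq0 => /eqP.
  rewrite Int0 /phi (Int_shift (f := ker (r / 2)) (- x0)); last first.
    by apply: continuous_measurable_rV; apply: (@CkT_cont _ _ 0); exact: ker_Ck.
  by rewrite Int_ker// => /eqP; rewrite oner_eq0.
(* Poincare's inequality excludes a vanishing gradient, since the kernel has integral 1 and is not
   zero. *)
have G0 : 0 < \int[mu]_x grad2 (Jet phi) x.
  by rewrite -(pmulr_rgt0 _ P0); exact: lt_le_trans phi2 (HP _ D).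
have P40 : 0 < \int[mu]_x (grad2 (Jet phi) x ^+ 2).
  rewrite lt0r Int_sqr_ge0 andbT; apply/negP => /eqP E.
  have ae0 := Int_eq0_ae i2 (fun x => sqr_ge0 _) E.
  have : \int[mu]_x grad2 (Jet phi) x = \int[mu]_x (0 : R).
    apply: Int_ae; [exact: grad2_meas D|exact: measurable_cst|].
    by apply: filterS ae0 => x /eqP; rewrite sqrf_eq0 => /eqP.
  by move=> E0; rewrite E0 Int0 ltxx in G0.
have P60 : 0 <= \int[mu]_x (grad2 (Jet phi) x ^+ 3).
  by apply: Int_ge0 => x; rewrite exprn_ge0// grad2_ge0.
pose A := 2^-1 * \int[mu]_x (lap (Jet phi) x ^+ 2) + omega ^+ 2 / 2 * \int[mu]_x grad2 (Jet phi) x.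
have A0 : 0 <= A.
  rewrite /A addr_ge0// mulr_ge0 ?Int_sqr_ge0 ?divr_ge0 ?sqr_ge0//; exact: ltW.
have [t t0 [kappa0 k0 Hk]] := negative_arith A0 P40 P60.
exists kappa0 => // bc kappa kk; exists (jlin t 0 (Jet phi) (Jet phi)); first exact: adm_lin.
by rewrite (Jen_lin0 omega kappa t (Aphi bc) (Aphi bc)); exact: Hk.
Qed.

End test_energy.

Lemma wd_arith (R : realType) (a1 a2 b c : R) : a1 = - b -> a2 = c -> a1 = a2 -> b = - c.
Proof. by move=> -> -> <-; rewrite opprK. Qed.

(** * Sobolev spaces and jets *)
Section conversion.
Context (R : realType) (m : nat).
Local Notation n := m.+1.
Local Notation V := 'rV[R]_n.
Local Notation mu := (@lebesgue_rV R n).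
Context (Omega : set V).
Context (oO : open Omega).
Context (bO : bounded_set Omega).
Implicit Types (u w g phi : V -> R) (c : idx m) (x : V) (bc : boundary_condition) (s : seq 'I_n).
Local Notation c0 := (c0 m).

Lemma restr_in u x : Omega x -> (u \_ Omega) x = u x.
Proof. by move=> Ox; rewrite patchE mem_set. Qed.

Lemma restr_off u x : ~ Omega x -> (u \_ Omega) x = 0.
Proof. by move=> Ox; rewrite patchE memNset. Qed.

Lemma restr_id u : (forall x, ~ Omega x -> u x = 0) -> u \_ Omega = u.
Proof.
move=> u0; apply/funext => x; have [Ox|nO] := pselect (Omega x); first exact: restr_in.
by rewrite restr_off// u0.
Qed.

Lemma mOmega : measurable Omega.
Proof. by rewrite measurable_rV_open; exact: sub_sigma_algebra. Qed.

Lemma restr_meas u : measurable_fun Omega u <-> measurable_fun setT (u \_ Omega).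
Proof. exact: measurable_restrictT mOmega. Qed.

Lemma Lp_norm_pow (p : nat) u : (0 < p)%N ->
  (Lp_norm Omega p%:R u `^ p%:R = \int[mu]_x (`|(u \_ Omega) x| ^+ p)%:E)%E.
Proof.
move=> p0; rewrite /Lp_norm poweR_Lnorm ?pnatr_eq0 -?lt0n//; apply: eq_integral => x _.
transitivity (`|(u \_ Omega) x|%:E `^ p%:R)%E => //.
by rewrite poweR_EFin powR_mulrn.
Qed.

Lemma Lp_norm_ge0 p u : (0 <= Lp_norm Omega p u)%E.
Proof. exact: Lnorm_ge0. Qed.

Lemma Lp_funP (p : nat) u : (0 < p)%N -> Lp_fun Omega p%:R u <->
  measurable_fun setT (u \_ Omega) /\ integ mu (fun x => `|(u \_ Omega) x| ^+ p).
Proof.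
move=> p0; have pn0 : p%:R != 0 :> R by rewrite pnatr_eq0 -lt0n.
have mp : measurable_fun setT (u \_ Omega) -> measurable_fun setT (fun x => `|(u \_ Omega) x| ^+ p).
  by move=> mu'; apply: measurable_funX; exact: measurableT_comp.
have pf x : 0 <= `|(u \_ Omega) x| ^+ p by exact: exprn_ge0.
split=> [[/restr_meas mu' fin]|[mu' iu]]; split => //.
- have H := (integ_ge0P mu (mp mu') pf).2; apply: H.
  by rewrite -Lp_norm_pow//; exact: poweR_lty.
- exact/restr_meas.
- by apply: (lty_poweRy pn0); rewrite Lp_norm_pow//; apply: (integ_ge0P mu (mp mu') pf).1.
Qed.

Lemma Lp_fun2 u : Lp_fun Omega 2 u <-> L2 mu (u \_ Omega).
Proof.
rewrite (Lp_funP u (ltn0Sn 1)); split=> -[h1 h2]; split => //; apply: integ_eq h2 => x.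
  by rewrite real_normK// num_real.
by rewrite real_normK// num_real.
Qed.

Lemma Lp_fun6 u : Lp_fun Omega 6 u <->
  measurable_fun setT (u \_ Omega) /\ integ mu (fun x => (u \_ Omega) x ^+ 6).
Proof.
have E (a : R) : `|a| ^+ 6 = a ^+ 6 by rewrite (exprM _ 2 3) real_normK ?num_real// -exprM.
by rewrite (Lp_funP u (ltn0Sn 5)); split=> -[h1 h2]; split => //; apply: integ_eq h2 => x; rewrite E.
Qed.

Lemma Lp_norm2 u : L2 mu (u \_ Omega) ->
  Lp_norm Omega 2 u = (Num.sqrt (\int[mu]_x ((u \_ Omega) x ^+ 2)))%:E.
Proof.
move=> Lu; have [_ fin] := (Lp_fun2 u).2 Lu; have N0 := Lp_norm_ge0 2 u.
have := Lp_norm_pow u (ltn0Sn 1).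
move: fin N0; case: (Lp_norm Omega 2 u) => [a _ a0| |] //.
rewrite poweR_EFin powR_mulrn ?lee_fin//.
under eq_integral do rewrite real_normK ?num_real//.
rewrite Int_EFin; last exact: Lu.2.
by move=> [<-]; rewrite sqrtr_sqr ger0_norm.
Qed.

Lemma Int_restr u f : \int[mu]_(x in Omega) (u x * f x) = \int[mu]_x ((u \_ Omega) x * f x).
Proof.
rewrite Rintegral_mkcond; apply: eq_Rintegral => x _; have [Ox|nO] := pselect (Omega x).
  by rewrite !restr_in.
by rewrite !restr_off// mul0r.
Qed.

Lemma patch_indic u K x : K `<=` Omega ->
  ((EFin \o u) \_ K) x = ((u \_ Omega) x * \1_K x)%:E.
Proof.
move=> KO; rewrite patchE indicE; have [Kx|nK] := pselect (K x).
  by rewrite !mem_set// mulr1 restr_in//; exact: KO.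
by rewrite !memNset// mulr0.
Qed.

Lemma loc_integrableP u : loc_integrable Omega u <-> measurable_fun setT (u \_ Omega) /\
  (forall K, compact K -> K `<=` Omega -> integ mu (fun x => (u \_ Omega) x * \1_K x)).
Proof.
have key K : compact K -> K `<=` Omega -> mu.-integrable K (EFin \o u) <->
    integ mu (fun x => (u \_ Omega) x * \1_K x).
  move=> cK KO; have mK := compact_measurable_rV cK.
  have E : (EFin \o u) \_ K = EFin \o (fun x => (u \_ Omega) x * \1_K x).
    by apply/funext => x; rewrite patch_indic.
  by rewrite /integ -E -(integrable_restrict mu mK measurableT) setTI.
split=> -[/restr_meas h1 h2]; split => //.
- by move=> K cK KO; apply/(key K cK KO); exact: h2.
- by move=> K cK KO; apply/(key K cK KO); exact: h2.
Qed.

Lemma loc_integrable_L2 u : L2 mu (u \_ Omega) -> loc_integrable Omega u.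
Proof.
move=> Lu; apply/loc_integrableP; split; first exact: Lu.1.
move=> K cK _; apply: L2_integM => //; apply: L2_indic; first exact: compact_measurable_rV.
have [M M0 KM] := compact_norm_bounded cK.
have bf := @box_finite R n M.
apply: le_lt_trans bf; apply: le_measure; rewrite ?inE.
- exact: compact_measurable_rV.
- exact: box_meas.
- by move=> x /KM.
Qed.

Lemma integ_loc_smooth u phi : loc_integrable Omega u -> smooth Omega phi ->
  integ mu (fun x => (u \_ Omega) x * phi x).
Proof.
move=> /loc_integrableP[mu' iu] sp; have [_ [K [cK KO K0]]] := sp 0.
have [B B0 pB] := TC_bounded (sp 0); have iK := iu K cK KO.
apply: integ_le (integZ B (integ_abs iK)).
  by apply: measurable_funM => //; exact: continuous_measurable_rV (TC_cont (sp 0)).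
move=> x; rewrite indicE; have [Kx|nK] := pselect (K x).
  by rewrite mem_set// mulr1 normrM mulrC ler_wpM2r.
by rewrite (K0 x nK) memNset// !mulr0 normr0 mulr0.
Qed.

(** The difference is locally integrable and annihilates all test functions, so the fundamental
    lemma applies. *)
Lemma wd_uniq s u g g' : is_weak_deriv Omega s u g -> is_weak_deriv Omega s u g' ->
  {ae mu, forall x, (g \_ Omega) x = (g' \_ Omega) x}.
Proof.
move=> [_ lg Hg] [_ lg' Hg'].
have [mg ig] := (loc_integrableP g).1 lg; have [mg' ig'] := (loc_integrableP g').1 lg'.
have : {ae mu, forall x, Omega x -> (g \_ Omega) x - (g' \_ Omega) x = 0}.
  apply: fundamental_lemma => //; first exact: measurable_funB.
    move=> K cK KO; apply: integ_eq (integB (ig K cK KO) (ig' K cK KO)) => x.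
    by rewrite mulrBl.
  move=> phi tphi; have sp := (test_functionE Omega phi).1 tphi.
  have i1 := integ_loc_smooth lg sp; have i2 := integ_loc_smooth lg' sp.
  transitivity (\int[mu]_x ((g \_ Omega) x * phi x - (g' \_ Omega) x * phi x)).
    by apply: eq_Rintegral => x _; rewrite mulrBl.
  rewrite (IntB i1 i2) -!Int_restr; apply/eqP; rewrite subr_eq0; apply/eqP.
  have h := Hg phi tphi; rewrite (Hg' phi tphi) in h.
  by apply: mulfI (esym h); rewrite signr_eq0.
apply: filterS => x H; have [Ox|nO] := pselect (Omega x).
  by apply/eqP; rewrite -subr_eq0 H.
by rewrite !restr_off.
Qed.

Lemma smooth_restr phi : smooth Omega phi -> phi \_ Omega = phi.
Proof. by move=> sp; apply: restr_id => x; exact: smooth_off. Qed.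

(** The head of a list is the derivative applied last, hence the reversed order for [c2 i k], which
    stands for [D_k D_i]. *)
Definition sc c : seq 'I_n :=
  match c with inl (inl _) => [::] | inl (inr i) => [:: i] | inr ik => [:: ik.2; ik.1] end.

Lemma pderiv_sc phi c : pderiv (sc c) phi = Jet phi c.
Proof. by case: c => [[[]|i]|[i k]]. Qed.

Lemma sc_size c : (size (sc c) <= 2)%N.
Proof. by case: c => [[[]|i]|[i k]]. Qed.

Lemma sc_surj s : (size s <= 2)%N -> exists c, sc c = s.
Proof.
case: s => [|k [|i [|//]]] _; first by exists c0.
  by exists (c1 k).
by exists (c2 i k).
Qed.

Lemma is_weak_deriv_L2 c u g : L2 mu (u \_ Omega) -> L2 mu (g \_ Omega) ->
  is_weak_deriv Omega (sc c) u g <-> forall phi, smooth Omega phi ->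
    \int[mu]_x ((u \_ Omega) x * Jet phi c x) =
    (-1) ^+ size (sc c) * \int[mu]_x ((g \_ Omega) x * phi x).
Proof.
move=> Lu Lg; split=> [[_ _ H] phi sp|H].
  by have := H phi ((test_functionE Omega phi).2 sp); rewrite !Int_restr pderiv_sc.
split; [exact: loc_integrable_L2|exact: loc_integrable_L2|].
move=> phi /(test_functionE Omega phi).1 sp; rewrite !Int_restr pderiv_sc; exact: H.
Qed.

Lemma Jet_IBP c phi psi : smooth Omega phi -> smooth Omega psi ->
  \int[mu]_x (phi x * Jet psi c x) = (-1) ^+ size (sc c) * \int[mu]_x (Jet phi c x * psi x).
Proof.
move=> sp ss; have W i f : smooth Omega f -> wder setT i f ('D_(basis i) f).
  by move=> sf; exact: TC_wder (sf 1).
have T f : smooth Omega f -> smooth setT f by move=> sf k; exact: TC_S (@subsetT _ Omega) (sf k).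
case: c => [[[]|i]|[i k]] /=; first by rewrite expr0 mul1r.
  by rewrite expr1 mulN1r; exact: (W i phi sp psi (T psi ss)).
rewrite sqrrN expr1n mul1r.
rewrite (W k phi sp _ (T _ (smooth_D i ss))) (W i _ (smooth_D k sp) psi (T psi ss)) opprK.
by apply: eq_Rintegral => x _; rewrite (derive2C i k x (sp 2).1).
Qed.

Lemma wd_sub_smooth c u g phi : L2 mu (u \_ Omega) -> L2 mu (g \_ Omega) -> smooth Omega phi ->
  is_weak_deriv Omega (sc c) u g ->
  is_weak_deriv Omega (sc c) (fun x => u x - phi x) (fun x => g x - Jet phi c x).
Proof.
move=> Lu Lg sp /(is_weak_deriv_L2 c Lu Lg) H.
have E (f h : V -> R) : (fun x => f x - h x) \_ Omega = fun x => (f \_ Omega) x - (h \_ Omega) x.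
  apply/funext => x; have [Ox|nO] := pselect (Omega x); first by rewrite !restr_in.
  by rewrite !restr_off// subrr.
have sJ := Jet_smooth c sp.
have Lp := TC_L2 (sp 0); have LJ := TC_L2 (sJ 0).
have E1 : (fun x => u x - phi x) \_ Omega = fun x => (u \_ Omega) x - phi x.
  by rewrite E (smooth_restr sp).
have E2 : (fun x => g x - Jet phi c x) \_ Omega = fun x => (g \_ Omega) x - Jet phi c x.
  by rewrite E (smooth_restr sJ).
have L1 : L2 mu ((fun x => u x - phi x) \_ Omega) by rewrite E1; exact: L2B.
have L2' : L2 mu ((fun x => g x - Jet phi c x) \_ Omega) by rewrite E2; exact: L2B.
apply/(is_weak_deriv_L2 c L1 L2') => psi ss; rewrite E1 E2.
have LJs := TC_L2 (Jet_smooth c ss 0); have Ls := TC_L2 (ss 0).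
transitivity (\int[mu]_x ((u \_ Omega) x * Jet psi c x - phi x * Jet psi c x)).
  by apply: eq_Rintegral => x _; rewrite mulrBl.
rewrite (IntB (L2_integM Lu LJs) (L2_integM Lp LJs)) (H psi ss) (Jet_IBP c sp ss) -mulrBr.
rewrite -(IntB (L2_integM Lg Ls) (L2_integM LJ Ls)); congr (_ * _).
by apply: eq_Rintegral => x _; rewrite mulrBl.
Qed.

Lemma weak_derivP s u g : is_weak_deriv Omega s u g -> is_weak_deriv Omega s u (weak_deriv Omega s u).
Proof. by move=> H; apply: getPex; exists g. Qed.

Lemma weak_deriv_ae s u g : is_weak_deriv Omega s u g ->
  {ae mu, forall x, (g \_ Omega) x = (weak_deriv Omega s u \_ Omega) x}.
Proof. by move=> H; exact: wd_uniq H (weak_derivP H). Qed.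

Lemma weak_deriv_L2 s u g : is_weak_deriv Omega s u g -> L2 mu (g \_ Omega) ->
  L2 mu (weak_deriv Omega s u \_ Omega).
Proof.
move=> H Lg; have [_ /loc_integrableP[mw _] _] := weak_derivP H.
exact: L2_ae mw (weak_deriv_ae H) Lg.
Qed.

Lemma Int_sqr_ae (f g : V -> R) : L2 mu f -> L2 mu g -> {ae mu, forall x, f x = g x} ->
  \int[mu]_x (f x ^+ 2) = \int[mu]_x (g x ^+ 2).
Proof.
move=> [mf _] [mg _] H; apply: Int_ae; try exact: measurable_funX.
by apply: filterS H => x ->.
Qed.

(** The value component is [u] itself, since the chosen weak derivative of order zero agrees with it
    only almost everywhere. *)
Definition jof u : jet R m := fun c => match c with
  | inl (inl _) => u \_ Omega
  | _ => weak_deriv Omega (sc c) u \_ Omega end.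

Lemma weak_deriv_id u : loc_integrable Omega u -> is_weak_deriv Omega [::] u u.
Proof. by move=> lu; split => // phi _; rewrite /= expr0 mul1r. Qed.

Lemma sobolev2_weak u : sobolev Omega 2 2 u -> forall c,
  is_weak_deriv Omega (sc c) u (weak_deriv Omega (sc c) u) /\
  L2 mu (weak_deriv Omega (sc c) u \_ Omega).
Proof.
move=> [_ H] c; have [g [wg /Lp_fun2 Lg]] := H (sc c) (sc_size c).
by split; [exact: weak_derivP wg|exact: weak_deriv_L2 wg Lg].
Qed.

Lemma jof_ae u : sobolev Omega 2 2 u -> forall c,
  {ae mu, forall x, jof u c x = (weak_deriv Omega (sc c) u \_ Omega) x}.
Proof.
move=> su [[[]|i]|[i k]]; [|exact: aeW|exact: aeW].
apply: weak_deriv_ae; apply: weak_deriv_id; apply: loc_integrable_L2; apply/Lp_fun2; exact: su.1.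
Qed.

Lemma jof_L2 u : sobolev Omega 2 2 u -> forall c, L2 mu (jof u c).
Proof.
move=> su c; have [_ L] := sobolev2_weak su c.
case: c L => [[[]|i]|[i k]] L //=; apply/Lp_fun2; exact: su.1.
Qed.

Lemma Lp_norm_le_sobolev k p u c : (size (sc c) <= k)%N ->
  (Lp_norm Omega p (weak_deriv Omega (sc c) u) <= sobolev_norm Omega k p u)%E.
Proof.
move=> sk; pose j : 'I_k.+1 := Ordinal (sk : (size (sc c) < k.+1)%N).
rewrite /sobolev_norm (bigD1 j)//= (bigD1 (in_tuple (sc c)))//=.
rewrite -addeA leeDl// adde_ge0// sume_ge0// => i _; first exact: Lp_norm_ge0.
by rewrite sume_ge0// => t _; exact: Lp_norm_ge0.
Qed.

Definition order bc : nat := if bc is Dirichlet then 2 else 1.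

Lemma graded_size bc c : graded bc c = (size (sc c) <= order bc)%N.
Proof. by case: bc c => -[[[]|i]|[i k]]. Qed.

(** Smallness of the Sobolev norm bounds each graded component of [u - phi]; these chosen
    derivatives agree almost everywhere with differences of jet components. The square root of [d]
    accounts for squared norms. *)
Lemma jof_approx bc u : sobolev Omega 2 2 u -> sobolev0 Omega (order bc) 2 u ->
  approx Omega bc (jof u).
Proof.
move=> su [_ H] d d0; have sd : 0 < Num.sqrt d by rewrite sqrtr_gt0.
have [phi [/test_functionE sp Hphi]] := H _ sd.
exists phi => // c; rewrite graded_size => sz.
have [W Lw] := sobolev2_weak su c; have Lu : L2 mu (u \_ Omega) by apply/Lp_fun2; exact: su.1.
have Wd := wd_sub_smooth Lu Lw sp W.
have LJ := TC_L2 (Jet_smooth c sp 0).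
have E2 : (fun x => weak_deriv Omega (sc c) u x - Jet phi c x) \_ Omega =
    fun x => (weak_deriv Omega (sc c) u \_ Omega) x - Jet phi c x.
  apply/funext => x; have [Ox|nO] := pselect (Omega x); first by rewrite !restr_in.
  by rewrite !restr_off// (smooth_off (Jet_smooth c sp) nO) subrr.
have Ld : L2 mu ((fun x => weak_deriv Omega (sc c) u x - Jet phi c x) \_ Omega).
  by rewrite E2; exact: L2B.
have Lw' := weak_deriv_L2 Wd Ld.
have := le_lt_trans (Lp_norm_le_sobolev 2 _ sz) Hphi; rewrite Lp_norm2// lte_fin.
move=> /ltW; rewrite ler_sqrt ?(ltW d0)//.
rewrite -(Int_sqr_ae Ld Lw' (weak_deriv_ae Wd)) E2 => /(le_trans _); apply.
rewrite le_eqVlt; apply/orP; left; apply/eqP; rewrite Int_sqrBC.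
apply: Int_sqr_ae; [exact: L2B (jof_L2 su c) LJ|exact: L2B|].
by apply: filterS (jof_ae su c) => x ->.
Qed.

(** Test functions have symmetric derivatives, so both orders define the same predicate, and the
    choice made by [get] is literally the same function. *)
Lemma weak_deriv_sym u i k : weak_deriv Omega [:: i; k] u = weak_deriv Omega [:: k; i] u.
Proof.
have E phi : test_function Omega phi -> pderiv [:: i; k] phi = pderiv [:: k; i] phi.
  by move=> /test_functionE sp; apply/funext => x; exact: derive2C (sp 2).1.
have P : is_weak_deriv Omega [:: i; k] u = is_weak_deriv Omega [:: k; i] u.
  apply/funext => g; apply/propext; split=> -[lu lg H]; (split; [exact: lu|exact: lg|]).
    by move=> phi tp; rewrite -(E phi tp); exact: H.
  by move=> phi tp; rewrite (E phi tp); exact: H.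
exact: (congr1 (fun P => get P) P).
Qed.

(** The Sobolev conditions only give derivatives tested inside [Omega]. That the gradient is weak on
    the whole space comes from the approximating test functions, for which it is integration by
    parts. *)
Lemma jof_jdata bc u : sobolev Omega 2 2 u -> approx Omega bc (jof u) -> jdata Omega (jof u).
Proof.
move=> su A; have L := jof_L2 su; have Lu := L c0.
have off c x : ~ Omega x -> jof u c x = 0.
  by move=> nO; case: c => [[[]|i]|[i k]]; exact: restr_off.
have W c := (is_weak_deriv_L2 c Lu (sobolev2_weak su c).2).1 (sobolev2_weak su c).1.
have [phi [sp C]] := approx_seq A.
split.
- exact: Lu.
- by move=> i; exact: (L (c1 i)).
- by move=> i k; exact: (L (c2 i k)).
- by move=> x; exact: off.
- by move=> i x; exact: off.
- by move=> i k x; exact: off.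
- move=> i; apply: (@wder_lim _ _ setT i phi (fun j => 'D_(basis i) (phi j))).
  + by move=> j; exact: TC_L2 (sp j 0).
  + by move=> j; exact: TC_L2 (smooth_D i (sp j) 0).
  + exact: Lu.
  + exact: (L (c1 i)).
  + exact: (C c0 (graded0 m bc)).
  + exact: (C (c1 i) (graded1 bc i)).
  + by move=> j; exact: TC_wder (sp j 1).
- move=> i k psi ss.
  have h1 := W (c1 i) _ (smooth_D k ss); have h2 := W (c2 i k) _ ss.
  have e1 : (-1) ^+ size (sc (c1 i)) = -1 :> R by exact: expr1.
  have e2 : (-1) ^+ size (sc (c2 i k)) = 1 :> R by exact: (etrans (sqrrN 1) (expr1n R 2)).
  rewrite e1 mulN1r in h1; rewrite e2 mul1r in h2; apply: (wd_arith h1 h2).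
  by apply: eq_Rintegral => x _; exact: (congr1 (fun t => _ * t) (derive2C i k x (ss 2).1)).
- by move=> i k; exact: (congr1 (fun f => f \_ Omega) (weak_deriv_sym u k i)).
Qed.

End conversion.

(** * Translation between [Y] and admissible jets *)

Section admissible_jets.
Context (R : realType) (m : nat).
Local Notation n := m.+1.
Local Notation V := 'rV[R]_n.
Local Notation mu := (@lebesgue_rV R n).
Context (Omega : set V).
Context (oO : open Omega).
Context (bO : bounded_set Omega).
Context (e : R).
Context (hbd : boundary_of_class Omega 4 e).
Implicit Types (c : idx m) (x : V) (bc : boundary_condition) (s : seq 'I_n).
Local Notation c0 := (c0 m).

Lemma Xspace_sobolev bc v : Xspace Omega bc v ->
  sobolev Omega 2 2 v /\ sobolev0 Omega (order bc) 2 v.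
Proof. by case: bc => [H|//]; split => //; exact: H.1. Qed.

(** The gradient is in L^6 by the Sobolev embedding in dimension at most three, and by the
    definition of [Y] above. *)
Lemma jof_adm bc v : Yspace Omega bc v -> adm Omega bc (jof Omega v).
Proof.
move=> Y; have X : Xspace Omega bc v by move: Y; rewrite /Yspace; case: ifP => // _ [].
have [sv sv0] := Xspace_sobolev X.
have A := jof_approx oO sv sv0; have D := jof_jdata oO sv A.
split => //; apply/(grad2_cubeP D) => i.
move: Y; rewrite /Yspace; case: ifPn => [n3 _|_ [_ [_ H]]].
  exact: (global_L6 oO hbd bO n3 D i).
have [g [wg /(Lp_fun6 oO) [_ g6]]] := H [:: i] (leqnn 1).
apply: integ_ae g6.
  by apply: measurable_funX; exact: (jdata_L2 (c1 i) D).1.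
by apply: filterS (weak_deriv_ae oO wg) => x ->.
Qed.

Lemma Int_restr_eq (f h : V -> R) : (forall x, Omega x -> f x = h x) ->
  (forall x, ~ Omega x -> h x = 0) -> \int[mu]_(x in Omega) f x = \int[mu]_x h x.
Proof.
move=> fh h0; rewrite Rintegral_mkcond; apply: eq_Rintegral => x _.
have [Ox|nO] := pselect (Omega x); first by rewrite restr_in// fh.
by rewrite restr_off// h0.
Qed.

Lemma energy_arith (omega kappa A B C E : R) :
  2^-1 * A + omega ^+ 2 / 2 * B - kappa / 4 * C + kappa / 12 * E =
  2^-1 * A + omega ^+ 2 / 2 * B + kappa * (12^-1 * E - 4^-1 * C).
Proof. by field. Qed.

Lemma energy2E omega kappa bc v : adm Omega bc (jof Omega v) ->
  energy2 Omega omega kappa v = Jen omega kappa (jof Omega v).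
Proof.
move=> A; have [D _ i3] := A; have i2 := integ_grad2_sqr D i3.
rewrite (JenE omega kappa A).
have E1 : \int[mu]_(x in Omega) (weak_laplacian Omega v x ^+ 2) = \int[mu]_x (lap (jof Omega v) x ^+ 2).
  apply: Int_restr_eq => x Ox; last by rewrite (lap_off D Ox) expr0n.
  by congr (_ ^+ 2); apply: eq_bigr => i _; exact: (esym (restr_in _ Ox)).
have en x : enorm (weak_grad Omega v x) ^+ 2 = \sum_i weak_deriv Omega [:: i] v x ^+ 2.
  rewrite /enorm sqr_sqrtr; last by apply: sumr_ge0 => i _; exact: sqr_ge0.
  by apply: eq_bigr => i _; rewrite mxE.
have gE x : Omega x -> grad2 (jof Omega v) x = enorm (weak_grad Omega v x) ^+ 2.
  move=> Ox; rewrite en; apply: eq_bigr => i _.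
  exact: (congr1 (fun t => t ^+ 2) (restr_in _ Ox)).
have E2 : \int[mu]_(x in Omega) (enorm (weak_grad Omega v x) ^+ 2) = \int[mu]_x grad2 (jof Omega v) x.
  by apply: Int_restr_eq => x Ox; [rewrite gE|exact: (grad2_off D Ox)].
have E4 : \int[mu]_(x in Omega) (enorm (weak_grad Omega v x) ^+ 4) = \int[mu]_x (grad2 (jof Omega v) x ^+ 2).
  apply: Int_restr_eq => x Ox; first by rewrite gE// -exprM.
  by rewrite (grad2_off D Ox) expr0n.
have E6 : \int[mu]_(x in Omega) (enorm (weak_grad Omega v x) ^+ 6) = \int[mu]_x (grad2 (jof Omega v) x ^+ 3).
  apply: Int_restr_eq => x Ox; first by rewrite gE// -exprM.
  by rewrite (grad2_off D Ox) expr0n.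
have W : \int[mu]_x well (grad2 (jof Omega v) x) = 12^-1 * \int[mu]_x (grad2 (jof Omega v) x ^+ 3) -
    4^-1 * \int[mu]_x (grad2 (jof Omega v) x ^+ 2).
  rewrite -(IntZ _ i3) -(IntZ _ i2) -(IntB (integZ _ i3) (integZ _ i2)).
  by apply: eq_Rintegral => x _; rewrite /well !(mulrC _^-1).
by rewrite W -energy_arith -E1 -E2 -E4 -E6.
Qed.

Lemma ae_family (f h : jet R m) : (forall c, {ae mu, forall x, f c x = h c x}) ->
  {ae mu, forall x c, f c x = h c x}.
Proof.
move=> H; have : {ae mu, forall x, forall c, c \in index_enum (idx m) -> f c x = h c x}.
  elim: (index_enum (idx m)) => [|c s IH]; first by apply: aeW.
  apply: filterS2 IH (H c) => x h1 h2 d; rewrite inE => /predU1P[->|]; [exact: h2|exact: h1].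
by apply: filterS => x Hx c; apply: Hx; rewrite mem_index_enum.
Qed.

Lemma Jen_ae omega kappa bc (f h : jet R m) : adm Omega bc f -> adm Omega bc h ->
  (forall c, {ae mu, forall x, f c x = h c x}) -> Jen omega kappa f = Jen omega kappa h.
Proof.
move=> Af Ah H; apply: Int_ae; [exact: integ_meas (integ_dens omega kappa Af)|
  exact: integ_meas (integ_dens omega kappa Ah)|].
apply: filterS (ae_family H) => x Hx; rewrite /dens.
have -> : lap f x = lap h x by apply: eq_bigr => i _; exact: Hx.
by have -> : grad2 f x = grad2 h x by apply: eq_bigr => i _; rewrite Hx.
Qed.

Section from_jet.
Context (bc : boundary_condition) (u : jet R m).
Context (Au : adm Omega bc u).
Let Du : jdata Omega u := let: And3 D _ _ := Au in D.
Let U := u c0.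

Let ur c : u c \_ Omega = u c.
Proof. exact: (restr_id (fun x nO => jdata_off c Du nO)). Qed.

Let Lu c : L2 mu (u c \_ Omega).
Proof. by rewrite ur; exact: jdata_L2 c Du. Qed.

Lemma jet_weak_deriv c : is_weak_deriv Omega (sc c) U (u c).
Proof.
apply/(is_weak_deriv_L2 oO c (Lu c0) (Lu c)) => phi sp; rewrite !ur.
have T f : smooth Omega f -> smooth setT f by move=> sf k; exact: TC_S (@subsetT _ Omega) (sf k).
case: c => [[[]|i]|[i k]].
- by rewrite [_ ^+ _]expr0 mul1r.
- have e1 : (-1) ^+ size (sc (c1 i)) = -1 :> R by exact: expr1.
  by rewrite e1 mulN1r; exact: (data_dv Du i (T _ sp)).
- have e2 : (-1) ^+ size (sc (c2 i k)) = 1 :> R by exact: (etrans (sqrrN 1) (expr1n R 2)).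
  rewrite e2 mul1r.
  have h1 := data_dv Du i (T _ (smooth_D k sp)); have h2 := data_dg Du i k sp.
  rewrite h2 opprK in h1; rewrite -h1.
  by apply: eq_Rintegral => x _; exact: (congr1 (fun t => _ * t) (derive2C k i x (sp 2).1)).
Qed.

(** Returning from a jet to a function and back replaces each component by a chosen representative;
    agreement almost everywhere suffices for the energy. *)
Lemma jet_jof_ae c : {ae mu, forall x, jof Omega U c x = u c x}.
Proof.
have H := weak_deriv_ae oO (jet_weak_deriv c); rewrite ur in H.
case: c H => [[[]|i]|[i k]] H; first by apply: aeW => x; exact: (congr1 (fun f => f x) (ur c0)).
  by apply: filterS H => x ->.
by apply: filterS H => x ->.
Qed.

Lemma jet_sobolev k : (k <= 2)%N -> sobolev Omega k 2 U.
Proof.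
move=> k2; split; first by apply/(Lp_fun2 oO); exact: Lu c0.
move=> s sk; have [c <-] := sc_surj (leq_trans sk k2).
by exists (u c); split; [exact: jet_weak_deriv|apply/(Lp_fun2 oO); exact: Lu].
Qed.

Lemma jet_sobolev0 : sobolev0 Omega (order bc) 2 U.
Proof.
split; first by apply: jet_sobolev; case: bc.
(* [T] counts the terms of the Sobolev norm with multiplicity, so each may contribute
   [d / (T + 1)]. *)
move=> d d0; pose T : R := \sum_(j < (order bc).+1) \sum_(t : j.-tuple 'I_n) 1.
have T0 : 0 <= T by apply: sumr_ge0 => j _; apply: sumr_ge0.
pose q := d / (T + 1); have T1 : 0 < T + 1 by rewrite ltr_wpDl.
have q0 : 0 < q by rewrite divr_gt0.
have [_ A _] := Au; have [phi sp Hphi] := A _ (exprn_gt0 2 q0).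
exists phi; split; first exact/test_functionE.
have term s : (size s <= order bc)%N ->
    (Lp_norm Omega 2 (weak_deriv Omega s (U \- phi)%R) <= q%:E)%E.
  move=> sz; have [c Ec] := sc_surj (leq_trans sz (ltac:(by case: bc) : (order bc <= 2)%N)).
  rewrite -Ec; have gc : graded bc c by rewrite graded_size Ec.
  have Wd := wd_sub_smooth oO (Lu c0) (Lu c) sp (jet_weak_deriv c).
  have LJ := TC_L2 (Jet_smooth c sp 0).
  have E2 : (fun x => u c x - Jet phi c x) \_ Omega = fun x => u c x - Jet phi c x.
    apply: restr_id => x nO.
    by rewrite (jdata_off c Du nO) (smooth_off (Jet_smooth c sp) nO) subrr.
  have Ld : L2 mu ((fun x => u c x - Jet phi c x) \_ Omega).
    by rewrite E2; apply: L2B LJ; exact: jdata_L2 c Du.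
  have Lw' := weak_deriv_L2 oO Wd Ld.
  rewrite Lp_norm2// lee_fin -[leRHS](ger0_norm (ltW q0)) -sqrtr_sqr ler_sqrt ?sqr_ge0//.
  rewrite -(Int_sqr_ae Ld Lw' (weak_deriv_ae oO Wd)) E2 Int_sqrBC; exact: Hphi.
apply: (@le_lt_trans _ _ (q * T)%:E).
  rewrite /sobolev_norm /T mulr_sumr -sumEFin; apply: lee_sum => j _.
  rewrite mulr_sumr -sumEFin; apply: lee_sum => t _; rewrite mulr1; apply: term.
  by rewrite size_tuple -ltnS.
by rewrite lte_fin /q mulrAC ltr_pdivrMr// ltr_pM2l// ltrDl.
Qed.

Lemma jet_Yspace : Yspace Omega bc U.
Proof.
have X : Xspace Omega bc U.
  case: bc jet_sobolev0 => H; first exact: H.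
  by split => //; exact: jet_sobolev.
rewrite /Yspace; case: ifP => // _; split => //.
have [_ _ i3] := Au; have g6 := (grad2_cubeP Du).1 i3.
have [M M0 HM] := bounded_box bO.
have off c x : M < `|x| -> u c x = 0.
  by move=> xM; apply: (jdata_off c Du) => /HM; rewrite leNgt xM.
(* L^6 integrability of the function itself, from that of one component of its gradient. *)
have u6 := poincare6 M0 (jdata_L2 c0 Du) (off c0) (jdata_L2 (c1 ord0) Du) (off (c1 ord0))
  (data_dv Du ord0) (g6 ord0).
have L6 c : integ mu (fun x => u c x ^+ 6) -> Lp_fun Omega 6 (u c).
  by move=> i6; apply/(Lp_fun6 oO); rewrite ur; split => //; exact: (jdata_L2 c Du).1.
split; first exact: L6.
case=> [|i [|//]] _.
  by exists U; split; [exact: jet_weak_deriv c0|exact: L6].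
by exists (u (c1 i)); split; [exact: jet_weak_deriv (c1 i)|exact: L6].
Qed.

End from_jet.

(** Green's identity annihilates the gradient, hence the well; only the square of the Laplacian is
    left. *)
Lemma Jen_zero_ge0 omega kappa bc u : adm Omega bc u ->
  {ae mu, forall x, Omega x -> u c0 x = 0} -> 0 <= Jen omega kappa u.
Proof.
move=> Au H; have [D A _] := Au; rewrite (JenE omega kappa Au).
have u0 : {ae mu, forall x, u c0 x * lap u x = 0}.
  apply: filterS H => x Hx; have [Ox|nO] := pselect (Omega x); first by rewrite Hx// mul0r.
  by rewrite (jdata_off c0 D nO) mul0r.
have I0 : \int[mu]_x grad2 u x = 0.
  rewrite (green D A) (Int_ae (g := fun=> 0) _ _ u0) ?Int0 ?oppr0//.
  exact: measurable_funM (jdata_L2 c0 D).1 (L2_lap D).1.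
have g0 := Int_eq0_ae (integ_grad2 D) (fun x => grad2_ge0 u x) I0.
have W0 : \int[mu]_x well (grad2 u x) = 0.
  rewrite (Int_ae (g := fun=> 0)) ?Int0//; first exact: integ_meas (integ_well Au).
  by apply: filterS g0 => x ->; exact: well0.
by rewrite I0 W0 !mulr0 !addr0 mulr_ge0// Int_sqr_ge0.
Qed.

End admissible_jets.

(** [kappa0] comes from the competitor alone: a minimizer exists for every positive [kappa], and the
    size of [kappa] only serves to make the minimum negative. *)
Theorem proposition6p5 (R : realType) (N : nat) (hN : (1 <= N)%N)
    (eta : R) (heta : 0 < eta < 1)
    (Omega : set 'rV[R]_N)
    (hOmega : bounded_domain Omega)
    (hbd : boundary_of_class Omega 4 eta)
    (bc : boundary_condition)
    (hball : bc = Navier -> uniform_outer_ball Omega)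
    (omega : R) :
  exists kappa0 : R, 0 < kappa0 /\
    forall kappa : R, kappa0 <= kappa ->
      exists u : 'rV[R]_N -> R,
        [/\ Yspace Omega bc u,
            ~ {ae @lebesgue_rV R N, forall x, Omega x -> u x = 0},
            forall v : 'rV[R]_N -> R, Yspace Omega bc v ->
              energy2 Omega omega kappa u <= energy2 Omega omega kappa v &
            energy2 Omega omega kappa u < 0].
Proof.
case: N hN Omega hOmega hbd hball => [//|m] _ Omega [oO _ On0 bO] hbd _.
have [kappa0 k0 neg] := negative_energy oO bO omega On0.
exists kappa0; split => // kappa kk; have kp : 0 < kappa by exact: lt_le_trans kk.
have [w Aw Jw] := neg bc kappa kk.
have [u Au umin] := minimizer_exists oO bO hbd omega kp bc.
have Ju : Jen omega kappa u < 0 by exact: le_lt_trans (umin w Aw) Jw.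
have YU := jet_Yspace oO bO Au; have AU := jof_adm oO bO hbd YU.
have EU : energy2 Omega omega kappa (u (c0 m)) = Jen omega kappa u.
  rewrite (energy2E omega kappa AU).
  exact: (Jen_ae omega kappa AU Au (fun c => jet_jof_ae oO Au c)).
exists (u (c0 m)); split.
- exact: YU.
- move=> U0; have := Jen_zero_ge0 omega kappa Au U0; by rewrite leNgt Ju.
- move=> v Yv; have Av := jof_adm oO bO hbd Yv.
  by rewrite EU (energy2E omega kappa Av); exact: umin.
- by rewrite EU.
Qed.
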